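(* Let $\Phi$ be an irreducible crystallographic root system in $V=\mathbb{R}^\ell$ with positive system $\Phi^+$ and Coxeter number $h$. Let $\Psi\subset\Phi^+$ be an order ideal such that $\mathcal{A}(\Psi)$ is free with exponents $(e_1',\dots,e_\ell')$. Then for every integer $m\ge0$ the cone $\mathbf{c}\mathcal{A}(\Phi^+,\Psi,m)$ is free with exponents $(1,e_1'+mh,e_2'+mh,\dots,e_\ell'+mh)$.
   Context: For $\alpha\in\Phi^+$, $k\in\mathbb{Z}$, $H_{\alpha,k}=\{v\in V:\alpha(v)=k\}$. For positive roots, $\alpha\le\beta$ means $\beta-\alpha$ is a nonnegative combination of simple roots; $\Psi\subset\Phi^+$ is an order ideal if $\alpha\in\Psi$, $\beta\in\Phi^+$, $\beta\le\alpha$ imply $\beta\in\Psi$. $\mathcal{A}(\Psi)=\{H_{\alpha,0}:\alpha\in\Psi\}$, a central arrangement in $V$ (the empty one has exponents all $0$). $[p,q]=\{k\in\mathbb{Z}:p\le k\le q\}$ (empty if $p>q$), $\mathcal{A}(\Phi^+)^{[p,q]}=\{H_{\alpha,k}:\alpha\in\Phi^+,k\in[p,q]\}$, and $\mathcal{A}(\Phi^+,\Psi,m)=\mathcal{A}(\Phi^+)^{[1-m,m]}\cup\{H_{\alpha,-m}:\alpha\in\Psi\}$. The cone $\mathbf{c}\mathcal{B}$ of an affine arrangement $\mathcal{B}$ in $V$ is the central arrangement in $\mathbb{R}\times V$ (coordinates $(x_0,x_1,\dots,x_\ell)$) consisting of $\{\alpha-kx_0=0\}$ for each $H_{\alpha,k}\in\mathcal{B}$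 together with $\{x_0=0\}$. A central arrangement is free with exponents $(d_i)$ if its module of logarithmic derivations $D=\{\delta\in\mathrm{Der}:\delta(\alpha_H)\in\alpha_HS\ \forall H\}$ is a free module over the polynomial ring $S$ with homogeneous basis of polynomial degrees $d_i$. *)

(* Defs.v *)
From mathcomp Require Import all_boot all_order all_algebra.
From mathcomp Require Import Rstruct.
From mathcomp Require Import mpoly.
Set Implicit Arguments. Unset Strict Implicit. Unset Printing Implicit Defensive.
Import Order.TTheory GRing.Theory Num.Theory.
Local Open Scope ring_scope.

Notation R := Rdefinitions.R.

Definition dotv (l : nat) (u v : 'rV[R]_l) : R := \sum_(i < l) u 0 i * v 0 i.

Definition is_intR (x : R) : Prop := exists z : int, x = z%:~R.

Definition refl (l : nat) (a v : 'rV[R]_l) : 'rV[R]_l :=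
  v - (2 * dotv v a / dotv a a) *: a.

Definition rows_mx (l : nat) (s : seq 'rV[R]_l) : 'M[R]_(size s, l) :=
  \matrix_(i < size s) nth 0 s i.

Definition root_system (l : nat) (Phi : seq 'rV[R]_l) : Prop :=
  [/\ row_full (rows_mx Phi),
      0 \notin Phi,
      (forall a c, a \in Phi -> c *: a \in Phi -> c = 1 \/ c = -1),
      (forall a b, a \in Phi -> b \in Phi -> refl a b \in Phi) &
      (forall a b, a \in Phi -> b \in Phi -> is_intR (2 * dotv b a / dotv a a))].

Definition irreducible_rs (l : nat) (Phi : seq 'rV[R]_l) : Prop :=
  Phi != [::] /\
  ~ (exists P : pred 'rV[R]_l,
        [/\ (exists2 a, a \in Phi & P a),
            (exists2 b, b \in Phi & ~~ P b) &
            (forall a b, a \in Phi -> b \in Phi -> P a -> ~~ P b -> dotv a b = 0)]).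

Definition coords (l : nat) (Delta : 'M[R]_l) (v : 'rV[R]_l) : 'rV[R]_l :=
  v *m invmx Delta.

Definition nonneg_comb (l : nat) (Delta : 'M[R]_l) (v : 'rV[R]_l) : bool :=
  [forall i, 0 <= coords Delta v 0 i].

Definition simple_system (l : nat) (Phi : seq 'rV[R]_l) (Delta : 'M[R]_l) : Prop :=
  [/\ Delta \in unitmx,
      (forall i, row i Delta \in Phi) &
      (forall a, a \in Phi ->
         (forall i, is_intR (coords Delta a 0 i)) /\
         (nonneg_comb Delta a \/ nonneg_comb Delta (- a)))].

Definition positive_roots (l : nat) (Phi : seq 'rV[R]_l) (Delta : 'M[R]_l) :=
  [seq a <- Phi | nonneg_comb Delta a].

Definition root_le (l : nat) (Delta : 'M[R]_l) (a b : 'rV[R]_l) : bool :=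
  nonneg_comb Delta (b - a).

Definition order_ideal (l : nat) (Phiplus : seq 'rV[R]_l) (Delta : 'M[R]_l)
  (Psi : seq 'rV[R]_l) : Prop :=
  {subset Psi <= Phiplus} /\
  (forall a b, a \in Psi -> b \in Phiplus -> root_le Delta b a -> b \in Psi).

(* Matrix of the reflection s_a acting on row vectors: v |-> v *m refl_mx a. *)
Definition refl_mx (l : nat) (a : 'rV[R]_l) : 'M[R]_l :=
  \matrix_(i, j) refl a (delta_mx 0 i) 0 j.

Definition coxeter_elt (l : nat) (Delta : 'M[R]_l) : 'M[R]_l :=
  foldr (fun i M => refl_mx (row i Delta) *m M) 1%:M (enum 'I_l).

Definition is_coxeter_number (l : nat) (Delta : 'M[R]_l) (h : nat) : Prop :=
  [/\ (0 < h)%N,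
      iter h (mulmx (coxeter_elt Delta)) 1%:M = 1%:M &
      (forall k, (0 < k < h)%N -> iter k (mulmx (coxeter_elt Delta)) 1%:M != 1%:M)].

Definition linform (k : nat) (w : 'rV[R]_k) : {mpoly R[k]} :=
  \sum_(i < k) w 0 i *: 'X_i.

(* A derivation sum_i f_i d/dx_i is represented by (f_i)_i. *)
Definition deriv_apply (k : nat) (th : 'I_k -> {mpoly R[k]}) (w : 'rV[R]_k)
  : {mpoly R[k]} := \sum_(i < k) w 0 i *: th i.

Definition mdivides (k : nat) (p q : {mpoly R[k]}) : Prop :=
  exists r, q = p * r.

(* A central arrangement is given by a list of defining linear forms. *)
Definition in_logder (k : nat) (A : seq 'rV[R]_k) (th : 'I_k -> {mpoly R[k]}) : Prop :=
  forall w, w \in A -> mdivides (linform w) (deriv_apply th w).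

Definition mhomog (k : nat) (d : nat) (p : {mpoly R[k]}) : Prop :=
  forall m, m \in msupp p -> mdeg m = d.

Definition homog_deriv (k : nat) (d : nat) (th : 'I_k -> {mpoly R[k]}) : Prop :=
  (exists i, th i != 0) /\ forall i, mhomog d (th i).

Definition free_with_exponents (k : nat) (A : seq 'rV[R]_k) (d : 'I_k -> nat) : Prop :=
  exists B : 'I_k -> 'I_k -> {mpoly R[k]},
    [/\ (forall j, in_logder A (B j)),
        (forall j, homog_deriv (d j) (B j)),
        (forall th, in_logder A th ->
           exists g : 'I_k -> {mpoly R[k]},
             forall i, th i = \sum_(j < k) g j * B j i) &
        (forall g : 'I_k -> {mpoly R[k]},
           (forall i, \sum_(j < k) g j * B j i = 0) -> forall j, g j = 0)].

(* Affine hyperplanes H_{a,c} = {v : (a,v) = c}, encoded as pairs (a, c). *)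
Definition A_Phi_Psi_m (l : nat) (Phiplus Psi : seq 'rV[R]_l) (m : nat)
  : seq ('rV[R]_l * int) :=
  [seq (a, (i%:Z - (m%:Z - 1))%R) | a <- Phiplus, i <- iota 0 (2 * m)%N]
  ++ [seq (a, (- m%:Z)%R) | a <- Psi].

(* Cone: a - c x_0 = 0 for each H_{a,c}, together with x_0 = 0;
   coordinates of R x V are (x_0, x_1, ..., x_l). *)
Definition cone_form (l : nat) (H : 'rV[R]_l * int) : 'rV[R]_(1 + l) :=
  row_mx (const_mx (- (H.2%:~R))) H.1.

Definition x0_form (l : nat) : 'rV[R]_(1 + l) := row_mx (const_mx 1) 0.

Definition cone (l : nat) (B : seq ('rV[R]_l * int)) : seq 'rV[R]_(1 + l) :=
  x0_form l :: map (@cone_form l) B.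

Definition cone_exponents (l : nat) (e : 'I_l -> nat) (m h : nat) : 'I_(1 + l) -> nat :=
  fun j => match split j with inl _ => 1%N | inr i => (e i + m * h)%N end.

(* Main.v *)
(** Let [mu a = 2 m + [a \in Psi]] on the positive roots, and let [D(mu)] be the module of derivations
    [theta] with [a ^ (mu a) | theta(a)] for every positive root [a].

    The flat sections of the connection [d - m * sum_a (da / a) (1 - s_a)] form a frame of
    homogeneous polynomial vector fields of degree [m h], where [h] is the eigenvalue of the Casimir
    operator [v |-> sum_a <v, a^vee> a].  Applying this frame to the derivations of [A(Psi)] gives an
    isomorphism with [D(mu)] raising degrees by [m h]; hence [D(mu)] is free with exponents
    [e_i + m h].  That [h] is the Coxeter number amounts to [2 |Phi^+| = h l]; the two inequalities
    come from counting the sign changes of roots along the orbits of a Coxeter element, and from its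
    action on the Coxeter plane, obtained from a Perron-Frobenius eigenvector.

    A basis of [D(mu)] is lifted to the cone degree by degree in [x_0].  The obstruction to the next
    step vanishes on every rank two flat, because the rank two ideal-Shi arrangements are free: they
    are built by adding one line at a time, counting its intersection points with the previous lines.
    An obstruction supported in codimension three vanishes since [D(mu)] is free.  The lifts and the
    Euler derivation form the required basis, by descent along [x_0]. *)
From HB Require Import structures.
Require Import Defs.
From mathcomp Require Import all_boot all_order all_algebra.
From mathcomp Require Import Rstruct.
From mathcomp Require boolp trigo.
From mathcomp Require Import mpoly ring lra zify.
Set Implicit Arguments. Unset Strict Implicit. Unset Printing Implicit Defensive.
Import Order.TTheory GRing.Theory Num.Theory.
Local Open Scope ring_scope.

(** * Polynomials and linear forms *)

(** The residue of the connection along a root is [m (1 - s_a)], with eigenvalues [0] and [2 m]; the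
    second one is the origin of the multiplicity. A flat section that changes sign under [s_a]
    vanishes to order [2 m] along [a], with leading vector a multiple of [a], so pairing it with a
    derivation [eta] returns [a^(2 m)] times a multiple of [eta(a)] modulo [a]. Since the two
    exponents differ by an integer, logarithms could appear in the flat sections; parity under [s_a]
    rules them out.

    The harder point is that the Weyl group acts on flat sections by the reflection representation.
    Each reflection has a line of odd sections, so what remains are the rank two Cartan products.
    They follow from vanishing orders at flats of codimension two, and the scalings fit together
    because the Dynkin diagram is a forest.

    In the lifting, the order ideal enters through planes, where it leaves a short list of explicit
    arrangements, and the freeness of [A(Psi)] enters through the freeness of [D(mu)], as a depth
    argument. *)

Section DotProduct.
Variable n : nat.
Implicit Types u v w : 'rV[R]_n.

Lemma dotvC u v : dotv u v = dotv v u.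
Proof. by apply: eq_bigr => i _; rewrite mulrC. Qed.

Lemma dotvDl u v w : dotv (u + v) w = dotv u w + dotv v w.
Proof. by rewrite -big_split; apply: eq_bigr => i _; rewrite !mxE mulrDl. Qed.

Lemma dotvDr u v w : dotv w (u + v) = dotv w u + dotv w v.
Proof. by rewrite dotvC dotvDl !(dotvC w). Qed.

Lemma dotvZl c u w : dotv (c *: u) w = c * dotv u w.
Proof. by rewrite mulr_sumr; apply: eq_bigr => i _; rewrite !mxE mulrA. Qed.

Lemma dotvZr c u w : dotv w (c *: u) = c * dotv w u.
Proof. by rewrite dotvC dotvZl dotvC. Qed.

Lemma dotvNl u w : dotv (- u) w = - dotv u w.
Proof. by rewrite -scaleN1r dotvZl mulN1r. Qed.

Lemma dotvNr u w : dotv w (- u) = - dotv w u.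
Proof. by rewrite dotvC dotvNl dotvC. Qed.

Lemma dotvBl u v w : dotv (u - v) w = dotv u w - dotv v w.
Proof. by rewrite dotvDl dotvNl. Qed.

Lemma dotvBr u v w : dotv w (u - v) = dotv w u - dotv w v.
Proof. by rewrite dotvDr dotvNr. Qed.

Lemma dotv0l w : dotv 0 w = 0.
Proof. by rewrite -(scale0r 0) dotvZl mul0r. Qed.

Lemma dotv0r w : dotv w 0 = 0.
Proof. by rewrite dotvC dotv0l. Qed.

Lemma dotv_suml (I : Type) (r : seq I) (P : pred I) F w :
  dotv (\sum_(i <- r | P i) F i) w = \sum_(i <- r | P i) dotv (F i) w.
Proof. by elim/big_rec2: _ => [|i y1 y2 _ <-]; rewrite ?dotv0l ?dotvDl. Qed.

Lemma dotv_sumr (I : Type) (r : seq I) (P : pred I) F w :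
  dotv w (\sum_(i <- r | P i) F i) = \sum_(i <- r | P i) dotv w (F i).
Proof. by rewrite dotvC dotv_suml; apply: eq_bigr => i _; rewrite dotvC. Qed.

Lemma dotv_ge0 u : 0 <= dotv u u.
Proof. by apply: sumr_ge0 => i _; rewrite -expr2 sqr_ge0. Qed.

Lemma dotv_eq0 u : (dotv u u == 0) = (u == 0).
Proof.
apply/idP/eqP => [|->]; last by rewrite dotv0l.
rewrite psumr_eq0 => [|i _]; last by rewrite -expr2 sqr_ge0.
move=> /allP u0; apply/rowP => i; rewrite mxE.
by have := u0 i (mem_index_enum _); rewrite /= mulf_eq0 orbb => /eqP.
Qed.

Lemma dotv_gt0 u : u != 0 -> 0 < dotv u u.
Proof. by move=> u0; rewrite lt_neqAle eq_sym dotv_eq0 u0 dotv_ge0. Qed.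

Lemma dotv_deltar u i : dotv u (delta_mx 0 i) = u 0 i.
Proof.
rewrite /dotv (bigD1 i) //= mxE !eqxx mulr1 big1 ?addr0 // => j ji.
by rewrite mxE eqxx (negPf ji) mulr0.
Qed.

Lemma dotv_mulmx m (a : 'rV[R]_m) (A : 'M[R]_(m, n)) v :
  dotv (a *m A) v = dotv a (v *m A^T).
Proof.
rewrite /dotv; under eq_bigr => i _ do rewrite mxE big_distrl /=.
rewrite exchange_big /=; apply: eq_bigr => j _; rewrite mxE big_distrr /=.
by apply: eq_bigr => i _; rewrite !mxE; ring.
Qed.

Lemma cauchy_schwarz_eq u v : v != 0 ->
  dotv u u * dotv v v - dotv u v ^+ 2 =
  dotv (dotv v v *: u - dotv u v *: v) (dotv v v *: u - dotv u v *: v) / dotv v v.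
Proof.
move=> v0; have := dotv_gt0 v0; rewrite !(dotvBl, dotvBr, dotvZl, dotvZr) (dotvC v u).
move=> vv; field; lra.
Qed.

End DotProduct.

Section LinePoly.
Variable n : nat.
Implicit Types (p q : {mpoly R[n]}) (u v w : 'rV[R]_n).

(** Restriction of [p] to the line [t |-> v + t u], as a polynomial in [t]; vanishing statements are
    reduced to one variable in this way. *)
Definition linep v u p : {poly R} :=
  mmap (@polyC R) (fun i => (v 0 i)%:P + u 0 i *: 'X) p.

HB.instance Definition _ v u := GRing.RMorphism.copy (linep v u)
  (mmap (@polyC R) (fun i => (v 0 i)%:P + u 0 i *: 'X)).

Lemma linepX v u i : linep v u 'X_i = (v 0 i)%:P + u 0 i *: 'X.
Proof. by rewrite /linep mmapX mmap1U. Qed.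

Lemma linepC v u c : linep v u c%:MP = c%:P.
Proof. by rewrite /linep mmapC. Qed.

Lemma linepZ v u c p : linep v u (c *: p) = c *: linep v u p.
Proof. by rewrite -mul_mpolyC rmorphM /= linepC mul_polyC. Qed.

Lemma mpoly_gen_ind (P : {mpoly R[n]} -> Prop) :
  (forall c, P c%:MP) -> (forall i, P 'X_i) ->
  (forall p q, P p -> P q -> P (p + q)) ->
  (forall p q, P p -> P q -> P (p * q)) -> forall p, P p.
Proof.
move=> PC PX PD PM; apply: mpolyind => [|c m p _ _ IHp]; first exact: (PC 0).
apply: (PD) => //; rewrite -mul_mpolyC; apply: (PM) => //.
rewrite mpolyXE_id; apply: (big_ind P) => [||i _]; [exact: (PC 1)|exact: PM|].
elim: (m i) => [|k IHk]; first exact: (PC 1).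
by rewrite exprS; apply: PM.
Qed.

Lemma linep_ev v u p t : (linep v u p).[t] = p.@[(v + t *: u) 0].
Proof.
elim/mpoly_gen_ind: p => [c|i|p q Hp Hq|p q Hp Hq].
- by rewrite linepC hornerC mevalC.
- by rewrite linepX mevalXU !hornerE !mxE mulrC.
- by rewrite rmorphD hornerD mevalD Hp Hq.
- by rewrite rmorphM hornerM mevalM Hp Hq.
Qed.

Lemma linep_deriv v u p :
  (linep v u p)^`() = \sum_i u 0 i *: linep v u p^`M(i).
Proof.
elim/mpoly_gen_ind: p => [c|j|p q Hp Hq|p q Hp Hq].
- by rewrite linepC derivC big1 // => i _; rewrite mderivC rmorph0 scaler0.
- rewrite linepX derivD derivC add0r derivZ derivX (bigD1 j) //= mderivX.
  rewrite mnm1E eqxx scale1r -[(U_(j) - U_(j))%MM]/(U_(j) - U_(j))%MM.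
  have -> : (U_(j) - U_(j) = 0 :> 'X_{1..n})%MM.
    by apply/mnmP => k; rewrite mnmBE mnm0E subnn.
  rewrite mpolyX0 rmorph1 big1 ?addr0 // => i ij.
  by rewrite mderivX mnm1E eq_sym (negPf ij) scale0r rmorph0 scaler0.
- rewrite rmorphD derivD Hp Hq -big_split; apply: eq_bigr => i _ /=.
  by rewrite mderivD rmorphD scalerDr.
- rewrite rmorphM derivM Hp Hq big_distrl big_distrr -big_split.
  apply: eq_bigr => i _ /=; rewrite mderivM rmorphD !rmorphM scalerDr.
  by rewrite scalerAl scalerAr.
Qed.

Lemma poly_fun_eq0 (f : {poly R}) : (forall t, f.[t] = 0) -> f = 0.
Proof.
move=> f0; apply/eqP/negPn/negP => fn0.
have := @max_poly_roots _ f [seq i%:R | i <- iota 0 (size f)] fn0.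
rewrite size_map size_iota ltnn map_inj_uniq ?iota_uniq; last first.
  by move=> i j /eqP; rewrite eqr_nat => /eqP.
move=> H; suff : false by []. 
by apply: H => //; apply/allP => x /mapP[i _ ->]; apply/rootP.
Qed.

Lemma mderiv_eq0_const p : (forall i, p^`M(i) = 0) -> p = (p@_0%MM)%:MP.
Proof.
move=> dp; apply/mpolyP => m; rewrite mcoeffC.
have [->|m0] := eqVneq m 0%MM; first by rewrite mulr1.
have [i mi] : exists i, m i != 0%N.
  apply/existsP; apply: contraNT m0; rewrite negb_exists => /forallP H.
  by apply/eqP/mnmP => i; have := H i; rewrite negbK mnm0E => /eqP.
have := congr1 (fun q => q@_(m - U_(i))) (dp i); rewrite /= mcoeff_deriv mcoeff0.
have -> : (m - U_(i) + U_(i) = m)%MM.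
  apply/mnmP => j; rewrite mnmDE mnmBE mnm1E; have [<-|_] := eqVneq i j; rewrite /=; lia.
by move/eqP; rewrite mulrn_eq0 /= => /eqP ->; rewrite mulr0.
Qed.

Lemma msize_mderiv p i : p != 0 -> (msize p^`M(i) < msize p)%N.
Proof.
move=> p0; have [->|dp0] := eqVneq p^`M(i) 0.
  by rewrite msize0 lt0n msize_poly_eq0.
rewrite -(mlead_deg dp0).
have : mlead p^`M(i) \in msupp p^`M(i) by apply: mlead_supp.
rewrite mcoeff_msupp mcoeff_deriv mulrn_eq0 /= -mcoeff_msupp => /msize_mdeg_lt.
by rewrite mdegD mdeg1 addn1.
Qed.

(** Restricting to coordinate lines shows that the partial derivatives vanish as functions too; they
    have smaller degree, so by induction they are zero and [p] is constant. *)
Lemma mpoly_fun_eq0 p : (forall v : 'rV_n, p.@[v 0] = 0) -> p = 0.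
Proof.
have [k] := ubnP (msize p); elim: k => // k IHk in p *; rewrite ltnS => pk p0.
have [//|pn0] := eqVneq p 0.
have dp i : p^`M(i) = 0.
  apply: IHk => [|v]; first exact: leq_trans (msize_mderiv i pn0) pk.
  have l0 : linep v (delta_mx 0 i) p = 0.
    by apply: poly_fun_eq0 => t; rewrite linep_ev p0.
  have := linep_deriv v (delta_mx 0 i) p; rewrite l0 derivC (bigD1 i) //= mxE !eqxx.
  rewrite scale1r big1 => [|j ji]; last by rewrite mxE eqxx (negPf ji) scale0r.
  by move/(congr1 (horner^~ 0)); rewrite addr0 horner0 linep_ev scale0r addr0.
have pE := mderiv_eq0_const dp; have := p0 0; rewrite pE mevalC => c0.
by rewrite c0 mpolyC0.
Qed.

Lemma mpoly_funP p q : (forall v : 'rV_n, p.@[v 0] = q.@[v 0]) -> p = q.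
Proof.
move=> pq; apply/eqP; rewrite -subr_eq0; apply/eqP/mpoly_fun_eq0 => v.
by rewrite mevalB pq subrr.
Qed.

Lemma mpoly_nonzero_point p : p != 0 -> exists v : 'rV_n, p.@[v 0] != 0.
Proof.
move=> p0; apply: boolp.contrapT => H; case/eqP: p0; apply: mpoly_fun_eq0 => v.
by have [//|pv] := eqVneq (p.@[v 0]) 0; case: H; exists v.
Qed.

Lemma ev_linform w v : (linform w).@[v 0] = dotv w v.
Proof. by rewrite raddf_sum; apply: eq_bigr => i _; rewrite /= mevalZ mevalXU. Qed.

Lemma linform_eq0 w : (linform w == 0) = (w == 0).
Proof.
apply/eqP/eqP => [w0|->]; last first.
  by apply: mpoly_funP => v; rewrite ev_linform dotv0l meval0.
by apply/eqP; rewrite -dotv_eq0 -ev_linform w0 meval0.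
Qed.

Lemma linformD u v : linform (u + v) = linform u + linform v.
Proof. by apply: mpoly_funP => x; rewrite mevalD !ev_linform dotvDl. Qed.

Lemma linformZ c v : linform (c *: v) = c *: linform v.
Proof. by apply: mpoly_funP => x; rewrite mevalZ !ev_linform dotvZl. Qed.

Lemma linformN v : linform (- v) = - linform v.
Proof. by apply: mpoly_funP => x; rewrite mevalN !ev_linform dotvNl. Qed.

Lemma mderiv_linform w i : (linform w)^`M(i) = (w 0 i)%:MP.
Proof.
rewrite /linform raddf_sum (bigD1 i) //= mderivZ mderivX mnm1E eqxx scale1r.
have -> : (U_(i) - U_(i) = 0 :> 'X_{1..n})%MM.
  by apply/mnmP => k; rewrite mnmBE mnm0E subnn.
rewrite mpolyX0 alg_mpolyC big1 ?addr0 // => j ji.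
by rewrite mderivZ mderivX mnm1E (negPf ji) scale0r scaler0.
Qed.

Lemma linep_linform v u w : linep v u (linform w) = (dotv w v)%:P + dotv w u *: 'X.
Proof.
apply/eqP; rewrite -subr_eq0; apply/eqP/poly_fun_eq0 => t.
by rewrite hornerD hornerN linep_ev ev_linform !hornerE dotvDr dotvZr mulrC subrr.
Qed.

Lemma dhomog_linform w : linform w \is 1.-homog.
Proof. by apply: rpred_sum => i _; rewrite rpredZ // dhomogX /= mdeg1. Qed.

End LinePoly.

(** * Divisibility by linear forms, linear substitutions, Euler's formula *)

Section Divisibility.
Variable n : nat.
Implicit Types (p q r : {mpoly R[n]}) (u v w : 'rV[R]_n).

Lemma mdvdr p : mdivides p p. Proof. by exists 1; rewrite mulr1. Qed.
Lemma mdvd0 p : mdivides p 0. Proof. by exists 0; rewrite mulr0. Qed.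
Lemma mdvdD p q r : mdivides p q -> mdivides p r -> mdivides p (q + r).
Proof. by move=> [a ->] [b ->]; exists (a + b); rewrite mulrDr. Qed.
Lemma mdvdN p q : mdivides p q -> mdivides p (- q).
Proof. by move=> [a ->]; exists (- a); rewrite mulrN. Qed.
Lemma mdvdB p q r : mdivides p q -> mdivides p r -> mdivides p (q - r).
Proof. by move=> pq pr; apply: mdvdD => //; apply: mdvdN. Qed.
Lemma mdvdMr p q r : mdivides p q -> mdivides p (q * r).
Proof. by move=> [a ->]; exists (a * r); rewrite mulrA. Qed.
Lemma mdvdMl p q r : mdivides p q -> mdivides p (r * q).
Proof. by rewrite mulrC; apply: mdvdMr. Qed.
Lemma mdvdZ p q c : mdivides p q -> mdivides p (c *: q).
Proof. by rewrite -mul_mpolyC; apply: mdvdMl. Qed.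
Lemma mdvd_trans p q r : mdivides p q -> mdivides q r -> mdivides p r.
Proof. by move=> [a ->] [b ->]; exists (a * b); rewrite mulrA. Qed.
Lemma mdvd_sum (I : Type) (s : seq I) (P : pred I) F p :
  (forall i, P i -> mdivides p (F i)) -> mdivides p (\sum_(i <- s | P i) F i).
Proof. by move=> H; apply: big_ind => //; [exact: mdvd0|exact: mdvdD]. Qed.
Lemma mdvd_mul p q p' q' : mdivides p q -> mdivides p' q' -> mdivides (p * p') (q * q').
Proof. by move=> [a ->] [b ->]; exists (a * b); rewrite mulrACA. Qed.
Lemma mdvd_exp p k j : (j <= k)%N -> mdivides (p ^+ j) (p ^+ k).
Proof. by move=> jk; exists (p ^+ (k - j)); rewrite -exprD subnKC. Qed.
Lemma mdvd_ev p q v : mdivides p q -> p.@[v 0] = 0 -> q.@[v 0] = 0.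
Proof. by move=> [a ->] pv; rewrite mevalM pv mul0r. Qed.
Lemma mdvd_mul2l p q r : p != 0 -> mdivides (p * q) (p * r) -> mdivides q r.
Proof. by move=> p0 [a]; rewrite -mulrA => /(mulfI p0) ->; exists a. Qed.

(** Applied to the substitution by a projection onto a hyperplane, which is congruent to the
    identity modulo the equation of that hyperplane. *)
Lemma rmorph_congr (T : comRingType) (f g : {rmorphism {mpoly R[n]} -> T}) (J : T -> Prop) :
  (forall x y, J x -> J y -> J (x + y)) -> (forall x y, J x -> J (x * y)) -> J 0 ->
  (forall c, f c%:MP = g c%:MP) -> (forall i, J (f 'X_i - g 'X_i)) ->
  forall p, J (f p - g p).
Proof.
move=> JD JM J0 fgC fgX; apply: mpoly_gen_ind => // [c|p q Jp Jq|p q Jp Jq].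
- by rewrite fgC subrr.
- by rewrite !rmorphD opprD addrACA; apply: JD.
- rewrite !rmorphM; have -> : f p * f q - g p * g q = (f p - g p) * f q + (f q - g q) * g p by ring.
  by apply: (JD); apply: (JM).
Qed.

Lemma mnm_subUU (i : 'I_n) : (U_(i) - U_(i) = 0 :> 'X_{1..n})%MM.
Proof. by apply/mnmP => k; rewrite mnmBE mnm0E subnn. Qed.

(** Pullback along the linear map [v |-> v *m A]. Reflections, projections and the passage between
    [V] and the cone are all of this kind. *)
Definition msub k (A : 'M[R]_(k, n)) p : {mpoly R[k]} :=
  p \mPo [tuple linform (row i A^T) | i < n].

HB.instance Definition _ k (A : 'M[R]_(k, n)) := GRing.RMorphism.copy (msub A)
  (comp_mpoly [tuple linform (row i A^T) | i < n]).

Lemma msubC k (A : 'M[R]_(k, n)) c : msub A c%:MP = c%:MP.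
Proof. exact: comp_mpolyC. Qed.

Lemma msubZ k (A : 'M[R]_(k, n)) c p : msub A (c *: p) = c *: msub A p.
Proof. exact: comp_mpolyZ. Qed.

Lemma ev_msub k (A : 'M[R]_(k, n)) p (v : 'rV[R]_k) : (msub A p).@[v 0] = p.@[(v *m A) 0].
Proof.
rewrite /msub comp_mpoly_meval; apply: meval_eq => i.
rewrite tnth_mktuple ev_linform dotvC /dotv mxE.
by apply: eq_bigr => j _; rewrite !mxE.
Qed.

Lemma msub_linform k (A : 'M[R]_(k, n)) w : msub A (linform w) = linform (w *m A^T).
Proof. by apply: mpoly_funP => v; rewrite ev_msub !ev_linform dotvC dotv_mulmx dotvC. Qed.

Lemma msubX k (A : 'M[R]_(k, n)) i : msub A 'X_i = linform (row i A^T).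
Proof. by rewrite /msub comp_mpolyXU -tnth_nth tnth_mktuple. Qed.

Lemma mderiv_msub k (A : 'M[R]_(k, n)) p j :
  (msub A p)^`M(j) = \sum_i A j i *: msub A p^`M(i).
Proof.
elim/mpoly_gen_ind: p => [c|i|p q Hp Hq|p q Hp Hq].
- by rewrite msubC mderivC big1 // => i _; rewrite mderivC rmorph0 scaler0.
- rewrite msubX mderiv_linform !mxE (bigD1 i) //= big1 => [|i' ii'].
    by rewrite mderivX mnm1E eqxx mnm_subUU mpolyX0 scale1r rmorph1 addr0 -alg_mpolyC.
  by rewrite mderivX mnm1E eq_sym (negPf ii') scale0r rmorph0 scaler0.
- rewrite rmorphD mderivD Hp Hq -big_split; apply: eq_bigr => i _ /=.
  by rewrite mderivD rmorphD scalerDr.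
- rewrite rmorphM mderivM Hp Hq big_distrl big_distrr -big_split.
  apply: eq_bigr => i _ /=; rewrite mderivM rmorphD !rmorphM scalerDr.
  by rewrite scalerAl scalerAr.
Qed.

(** Orthogonal projection onto the hyperplane of [w]. Pulling back along it replaces reduction
    modulo [linform w], so no quotient ring is needed. *)
Definition projm w : 'M[R]_n := 1%:M - (dotv w w)^-1 *: (w^T *m w).

Lemma mul_projm w v : v *m projm w = v - (dotv v w / dotv w w) *: w.
Proof.
rewrite /projm mulmxBr mulmx1 -scalemxAr mulmxA; congr (_ - _).
have -> : v *m w^T = (dotv v w)%:M.
  by apply/matrixP => i j; rewrite !ord1 !mxE /dotv; apply: eq_bigr => k _; rewrite mxE.
by rewrite mul_scalar_mx scalerA mulrC.
Qed.

Lemma dotv_projm w v : w != 0 -> dotv w (v *m projm w) = 0.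
Proof.
by move=> w0; rewrite mul_projm dotvBr dotvZr divfK ?dotv_eq0 // dotvC subrr.
Qed.

Lemma mul_projm_id w v : dotv w v = 0 -> v *m projm w = v.
Proof. by move=> wv; rewrite mul_projm dotvC wv mul0r scale0r subr0. Qed.

Lemma msub_projm_congr w p : mdivides (linform w) (p - msub (projm w) p).
Proof.
have H := @rmorph_congr _ idfun (msub (projm w)) (mdivides (linform w)).
apply: H => [x y|x y||c|i]; [exact: mdvdD|exact: mdvdMr|exact: mdvd0|by rewrite /= msubC|].
rewrite /= msubX; exists ((w 0 i / dotv w w)%:MP); apply: mpoly_funP => v.
rewrite mevalB mevalM mevalC !ev_linform mevalXU dotvC.
have -> : dotv v (row i (projm w)^T) = (v *m projm w) 0 i.
  by rewrite mxE; apply: eq_bigr => j _; rewrite !mxE.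
by rewrite mul_projm !mxE (dotvC w v); ring.
Qed.

Lemma linform_dvd w p : w != 0 ->
  (forall v, dotv w v = 0 -> p.@[v 0] = 0) -> mdivides (linform w) p.
Proof.
move=> w0 H; have := msub_projm_congr w p.
suff -> : msub (projm w) p = 0 by rewrite subr0.
by apply: mpoly_fun_eq0 => v; rewrite ev_msub H // dotv_projm.
Qed.

Lemma linform_dvd_ev w p v : mdivides (linform w) p -> dotv w v = 0 -> p.@[v 0] = 0.
Proof. by move=> d wv; apply: mdvd_ev d _; rewrite ev_linform. Qed.

Lemma linform_ndvd_proj w p : w != 0 -> ~ mdivides (linform w) p -> msub (projm w) p != 0.
Proof.
move=> w0 nd; apply/eqP => p0; apply: nd; apply: linform_dvd => // v wv.
by have := ev_msub (projm w) p v; rewrite p0 meval0 mul_projm_id.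
Qed.

Lemma linform_ndvd_point w p : w != 0 -> ~ mdivides (linform w) p ->
  exists2 v, dotv w v = 0 & p.@[v 0] != 0.
Proof.
move=> w0 /(linform_ndvd_proj w0)/mpoly_nonzero_point[v]; rewrite ev_msub => pv.
by exists (v *m projm w); rewrite ?dotv_projm.
Qed.

(** Modulo the form, a polynomial is represented by its pullback along the projection, and these
    pullbacks live in a domain. *)
Lemma linform_prime w p q : w != 0 ->
  mdivides (linform w) (p * q) -> mdivides (linform w) p \/ mdivides (linform w) q.
Proof.
move=> w0 d; have [?|np] := boolp.EM (mdivides (linform w) p); [by left|right].
apply: boolp.contrapT => nq.
have: msub (projm w) p * msub (projm w) q != 0.
  by rewrite mulf_neq0 ?linform_ndvd_proj.
rewrite -rmorphM => /mpoly_nonzero_point[v]; rewrite ev_msub => /eqP; apply.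
by apply: linform_dvd_ev d _; rewrite dotv_projm.
Qed.

Lemma linform_ndvdM w p q : w != 0 ->
  ~ mdivides (linform w) p -> ~ mdivides (linform w) q -> ~ mdivides (linform w) (p * q).
Proof. by move=> w0 np nq /(linform_prime w0)[]. Qed.

Lemma linform_ndvd1 w : ~ mdivides (linform w) 1.
Proof.
by move=> d; have := linform_dvd_ev d (dotv0r w); rewrite meval1 => /eqP; rewrite oner_eq0.
Qed.

Lemma linform_ndvd_prod (I : eqType) (s : seq I) F w : w != 0 ->
  {in s, forall i, ~ mdivides (linform w) (F i)} -> ~ mdivides (linform w) (\prod_(i <- s) F i).
Proof.
move=> w0; elim: s => [|i s IHs] H; first by rewrite big_nil; apply: linform_ndvd1.
rewrite big_cons; apply: linform_ndvdM => //; first by apply: H; rewrite mem_head.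
by apply: IHs => j js; apply: H; rewrite in_cons js orbT.
Qed.

Lemma linform_ndvdX w p k : w != 0 ->
  ~ mdivides (linform w) p -> ~ mdivides (linform w) (p ^+ k).
Proof.
move=> w0 np; elim: k => [|k IHk]; first by rewrite expr0; apply: linform_ndvd1.
by rewrite exprS; apply: linform_ndvdM.
Qed.

Lemma linform_dvdX_coprime w p q k : w != 0 -> ~ mdivides (linform w) q ->
  mdivides (linform w ^+ k) (q * p) -> mdivides (linform w ^+ k) p.
Proof.
move=> w0 nq; elim: k => [|k IHk] in p *; first by exists p; rewrite expr0 mul1r.
move=> d; have dw : mdivides (linform w) (q * p).
  by apply: mdvd_trans d; rewrite exprS; exists (linform w ^+ k).
have [//|[r pE]] := linform_prime w0 dw.
rewrite pE exprS; apply: mdvd_mul; first exact: mdvdr.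
apply: IHk; rewrite -linform_eq0 in w0; apply: (mdvd_mul2l w0).
by rewrite -exprS mulrCA -pE.
Qed.

Lemma linform_ndvd_linform w w' : (forall c, w' != c *: w) -> ~ mdivides (linform w) (linform w').
Proof.
move=> ww' d; have w'0 := ww' 0; rewrite scale0r in w'0.
have [w0|w0] := eqVneq w 0.
  case: d => r; have -> : linform w = 0 by apply/eqP; rewrite linform_eq0 w0.
  by rewrite mul0r => /eqP; rewrite linform_eq0 (negPf w'0).
pose v := w' *m projm w; have wv : dotv w v = 0 by rewrite dotv_projm.
have := linform_dvd_ev d wv; rewrite ev_linform => w'v.
have : dotv v v = 0.
  by rewrite {1}/v mul_projm dotvBl dotvZl wv w'v mulr0 subr0.
move/eqP; rewrite dotv_eq0 /v mul_projm subr_eq0 => /eqP w'E.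
by case/eqP: (ww' (dotv w' w / dotv w w)).
Qed.

(** This is what makes the linear forms of the list pairwise coprime. *)
Definition nprop (s : seq 'rV[R]_n) : Prop :=
  [/\ uniq s, 0 \notin s &
    forall a b, a \in s -> b \in s -> a != b -> forall c, b != c *: a].

Lemma linform_prod_dvd (s : seq 'rV[R]_n) (e : 'rV[R]_n -> nat) p : nprop s ->
  {in s, forall w, mdivides (linform w ^+ e w) p} ->
  mdivides (\prod_(w <- s) linform w ^+ e w) p.
Proof.
elim: s p => [|w s IHs] p [us s0 sP] H; first by rewrite big_nil; exists p; rewrite mul1r.
have /andP[ws us'] := us; move: s0; rewrite in_cons negb_or eq_sym => /andP[w0 s0].
have [r pE] := H w (mem_head _ _); rewrite big_cons pE.
apply: mdvd_mul; first exact: mdvdr.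
apply: IHs => [|w' w's].
  by split=> // a b as' bs; apply: sP; rewrite in_cons ?as' ?bs orbT.
have ww' : w != w' by apply: contraNneq ws => ->.
have w's' : w' \in w :: s by rewrite in_cons w's orbT.
apply: (@linform_dvdX_coprime _ _ (linform w ^+ e w)).
- by apply: contraNneq s0 => <-.
- apply: linform_ndvdX; first by apply: contraNneq s0 => <-.
  by apply: linform_ndvd_linform => c; apply: sP; rewrite ?mem_head // eq_sym.
- by rewrite -pE; apply: H.
Qed.

Definition dirD u p := \sum_i u 0 i *: p^`M(i).

Lemma dirD_is_linear u : linear (dirD u).
Proof.
move=> c p q; rewrite /dirD scaler_sumr -big_split; apply: eq_bigr => i _ /=.
by rewrite mderivD mderivZ scalerDr !scalerA mulrC.
Qed.
HB.instance Definition _ u := GRing.isLinear.Build _ _ _ _ (dirD u) (dirD_is_linear u).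

Lemma dirDM u p q : dirD u (p * q) = dirD u p * q + p * dirD u q.
Proof.
rewrite /dirD mulr_suml mulr_sumr -big_split; apply: eq_bigr => i _ /=.
by rewrite mderivM scalerDr scalerAl scalerAr.
Qed.

Lemma dirDC u c : dirD u c%:MP = 0.
Proof. by rewrite /dirD big1 // => i _; rewrite mderivC scaler0. Qed.

Lemma dirD_linform u w : dirD u (linform w) = (dotv w u)%:MP.
Proof.
rewrite /dirD /dotv raddf_sum; apply: eq_bigr => i _ /=.
by rewrite mderiv_linform -mul_mpolyC -mpolyCM mulrC.
Qed.

Lemma dirDX u p k : dirD u (p ^+ k.+1) = k.+1%:R *: (p ^+ k * dirD u p).
Proof.
elim: k => [|k IHk]; first by rewrite expr1 expr0 mul1r scale1r.
rewrite exprS dirDM IHk mulrC -scalerAr mulrA -exprS.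
by rewrite -[X in X + _]scale1r -scalerDl -[k.+2]add1n natrD.
Qed.

Lemma linep_dirD v u p : (linep v u p)^`() = linep v u (dirD u p).
Proof. by rewrite linep_deriv raddf_sum; apply: eq_bigr => i _; rewrite /= linepZ. Qed.

Lemma dirD_comm u v p : dirD u (dirD v p) = dirD v (dirD u p).
Proof.
rewrite /dirD; under eq_bigr => i _ do rewrite (raddf_sum (mderiv i)) scaler_sumr /=.
under [RHS]eq_bigr => i _ do rewrite (raddf_sum (mderiv i)) scaler_sumr /=.
rewrite exchange_big; apply: eq_bigr => i _; apply: eq_bigr => j _ /=.
by rewrite !mderivZ !scalerA mulrC mderiv_comm.
Qed.

Lemma euler_coeff p m : (\sum_i 'X_i * p^`M(i))@_m = (mdeg m)%:R * p@_m.
Proof.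
elim/mpolyind: p => [|c m' p _ _ IHp] /=.
  by rewrite big1 ?mcoeff0 ?mulr0 // => i _; rewrite mderiv0 mulr0.
under eq_bigr => i _ do rewrite mderivD mulrDr.
rewrite big_split /= mcoeffD IHp mcoeffD mulrDr; congr (_ + _).
rewrite mcoeffZ mcoeffX raddf_sum /=.
under eq_bigr => i _ do rewrite mderivZ mderivX scalerA -scalerAr mcoeffZ -mpolyXD mcoeffX.
have [<-|mm'] := eqVneq m' m; last first.
  rewrite !mulr0 big1 // => i _; case: eqP => [E|_]; rewrite ?mulr0 //.
  case: (posnP (m' i)) => [->|mi]; first by rewrite mulr0 mul0r.
  case/eqP: mm'; rewrite -E; apply/mnmP => j; rewrite mnmDE mnmBE mnm1E.
  by have [<-|_] := eqVneq i j; rewrite /=; lia.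
rewrite !mulr1 mdegE natr_sum mulr_suml; apply: eq_bigr => i _.
case: (posnP (m' i)) => [->|mi]; first by rewrite mulr0 !mul0r.
rewrite (_ : (_ + _)%MM == m'); first by rewrite mulr1 mulrC.
apply/eqP/mnmP => j; rewrite mnmDE mnmBE mnm1E.
by have [<-|_] := eqVneq i j; rewrite /=; lia.
Qed.

(** Monomials are eigenvectors of the Euler operator with their degrees as eigenvalues, so all
    monomials of an eigenvector share one degree. That [d] is a natural number is part of the
    conclusion. *)
Lemma euler_homog p (d : R) : p != 0 -> \sum_i 'X_i * p^`M(i) = d *: p ->
  exists2 k, d = k%:R & p \is k.-homog.
Proof.
move=> p0 E; have H m : m \in msupp p -> d = (mdeg m)%:R.
  rewrite mcoeff_msupp => pm; have := euler_coeff p m.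
  by rewrite E mcoeffZ => /(mulIf pm).
exists (mdeg (mlead p)); first exact: H (mlead_supp p0).
apply/dhomogP => m mp; apply/eqP.
by rewrite -(eqr_nat R) -(H _ mp) -(H _ (mlead_supp p0)).
Qed.

Lemma mhomogE d p : mhomog d p <-> p \is d.-homog.
Proof. by split=> [H|/dhomogP H]; [apply/dhomogP|]. Qed.

End Divisibility.

From mathcomp Require Import fraction generic_quotient.

Local Notation "x %:F" := (@FracField.tofrac _ x).

(** * Extension of morphisms and derivations to the fraction field *)

Section FractionExtension.
Variable D : idomainType.
Local Notation K := {fraction D}.

Lemma fraction_ex (x : K) : exists n d, d != 0 /\ x = n%:F / d%:F.
Proof.
exists (\n_(repr x)), (\d_(repr x)); have d0 := denom_ratioP (repr x); split=> //.
have xd : x * (\d_(repr x))%:F = (\n_(repr x))%:F.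
  rewrite -[x in x * _](@reprK _ K); unlock FracField.tofrac; rewrite -[LHS]FracField.pi_mul.
  apply/eqmodP; rewrite /= FracField.equivfE /FracField.mulf !numden_Ratio ?oner_neq0 ?mulr1 //.
  by rewrite mulrC.
by rewrite -xd mulfK // tofrac_eq0.
Qed.

Definition fnum (x : K) := sval (boolp.cid (fraction_ex x)).
Definition fden (x : K) := sval (boolp.cid (svalP (boolp.cid (fraction_ex x)))).

Lemma fden_neq0 x : fden x != 0.
Proof. by case: (svalP (boolp.cid (svalP (boolp.cid (fraction_ex x))))). Qed.

Lemma fracE x : x = (fnum x)%:F / (fden x)%:F.
Proof. by case: (svalP (boolp.cid (svalP (boolp.cid (fraction_ex x))))). Qed.

Lemma frac_cross (n d n' d' : D) : d != 0 -> d' != 0 ->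
  n%:F / d%:F = n'%:F / d'%:F -> n * d' = n' * d.
Proof.
move=> d0 d0' /eqP; rewrite eqr_div ?tofrac_eq0 // -!tofracM.
by rewrite tofrac_eq => /eqP.
Qed.

Variable f : {rmorphism D -> D}.
Hypothesis f_inj : injective f.

(** Computed on a chosen fraction; [fracmorE] shows that the choice does not matter, by cross
    multiplication. *)
Definition fracmor (x : K) : K := (f (fnum x))%:F / (f (fden x))%:F.

Let f0 d : d != 0 -> f d != 0.
Proof. by move=> d0; rewrite -(rmorph0 f) (inj_eq f_inj). Qed.

Lemma fracmorE n d : d != 0 -> fracmor (n%:F / d%:F) = (f n)%:F / (f d)%:F.
Proof.
move=> d0; apply/eqP; rewrite eqr_div ?tofrac_eq0 ?f0 ?fden_neq0 // -!tofracM.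
rewrite tofrac_eq -!rmorphM; apply/eqP; congr (f _).
by apply: frac_cross; rewrite ?fden_neq0 // -fracE.
Qed.

Lemma fracmor_tofrac n : fracmor n%:F = (f n)%:F.
Proof. by rewrite -[n%:F]divr1 -tofrac1 fracmorE ?oner_neq0 // rmorph1 tofrac1 divr1. Qed.

Lemma fracmor_is_additive : zmod_morphism fracmor.
Proof.
move=> x y; rewrite (fracE x) (fracE y).
have dx := fden_neq0 x; have dy := fden_neq0 y.
rewrite -mulNr -tofracN addf_div ?tofrac_eq0 // -!tofracM -tofracD !fracmorE ?mulf_neq0 //.
rewrite -mulNr -tofracN addf_div ?tofrac_eq0 ?f0 //.
by rewrite -!tofracM -tofracD rmorphD !rmorphM rmorphN.
Qed.

Lemma fracmor_is_multiplicative : monoid_morphism fracmor.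
Proof.
split=> [|x y]; first by rewrite -tofrac1 fracmor_tofrac rmorph1.
rewrite (fracE x) (fracE y) mulf_div -!tofracM !fracmorE ?mulf_neq0 ?fden_neq0 //.
by rewrite mulf_div -!tofracM !rmorphM.
Qed.

End FractionExtension.

Section FractionDerivation.
Variables (D : idomainType) (d : {additive D -> D}).
Hypothesis dM : forall x y, d (x * y) = d x * y + x * d y.
Local Notation K := {fraction D}.

(** The quotient rule on a chosen fraction; independence of the choice is [fracderE]. *)
Definition fracder (x : K) : K :=
  (d (fnum x) * fden x - fnum x * d (fden x))%:F / (fden x ^+ 2)%:F.

Lemma fracderE n e : e != 0 ->
  fracder (n%:F / e%:F) = (d n * e - n * d e)%:F / (e ^+ 2)%:F.
Proof.
move=> e0; rewrite /fracder; set x := n%:F / _.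
have E : fnum x * e = n * fden x by apply: frac_cross; rewrite ?fden_neq0 // -fracE.
have := fden_neq0 x; move: (fnum x) (fden x) E => a b E b0 {x}.
apply/eqP; rewrite eqr_div ?tofrac_eq0 ?expf_neq0 // -!tofracM tofrac_eq; apply/eqP.
have dE := congr1 d E; rewrite !dM in dE.
apply: (mulfI e0).
have -> : e * ((d a * b - a * d b) * e ^+ 2) =
  (d a * e) * b * e ^+ 2 - (a * e) * d b * e ^+ 2 by ring.
have -> : d a * e = d n * b + n * d b - a * d e by rewrite -dE; ring.
have -> : (d n * b + n * d b - a * d e) * b * e ^+ 2 =
  (d n * b + n * d b) * b * e ^+ 2 - (a * e) * d e * b * e by ring.
by rewrite E; ring.
Qed.

Lemma fracder_tofrac n : fracder n%:F = (d n)%:F.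
Proof.
rewrite -[n%:F]divr1 -tofrac1 fracderE ?oner_neq0 //.
have d1 : d 1 = 0.
  by have := dM 1 1; rewrite !mulr1 !mul1r => /eqP; rewrite -subr_eq0 opprD addrA subrr sub0r oppr_eq0 => /eqP.
by rewrite d1 mulr0 subr0 mulr1 expr1n divr1.
Qed.

Lemma fracder_is_additive : zmod_morphism fracder.
Proof.
move=> x y; rewrite (fracE x) (fracE y).
have := fden_neq0 x; have := fden_neq0 y.
move: (fnum x) (fden x) (fnum y) (fden y) => a b a' b' b0' b0.
rewrite -mulNr -tofracN addf_div ?tofrac_eq0 // -!tofracM -tofracD !fracderE ?mulf_neq0 //.
rewrite -[- (_ / _)]mulNr -tofracN addf_div ?tofrac_eq0 ?expf_neq0 // -!tofracM -tofracD.
congr (_%:F / _%:F); last by rewrite exprMn.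
by rewrite raddfD /= !dM raddfN /=; ring.
Qed.

Lemma fracderM x y : fracder (x * y) = fracder x * y + x * fracder y.
Proof.
rewrite (fracE x) (fracE y).
have := fden_neq0 x; have := fden_neq0 y.
move: (fnum x) (fden x) (fnum y) (fden y) => a b a' b' b0' b0.
rewrite mulf_div -!tofracM !fracderE ?mulf_neq0 // !mulf_div -!tofracM.
rewrite addf_div ?tofrac_eq0 ?mulf_neq0 ?expf_neq0 // -!tofracM -tofracD.
apply/eqP; rewrite eqr_div ?tofrac_eq0 ?mulf_neq0 ?expf_neq0 // -!tofracM tofrac_eq.
by rewrite !dM; apply/eqP; ring.
Qed.

End FractionDerivation.

(** * Root systems *)

Section Reflections.
Variable l : nat.
Implicit Types a b u v w : 'rV[R]_l.

(* [cr a v] is the pairing of [v] with the coroot of [a]. *)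
Definition cr a v : R := 2 * dotv v a / dotv a a.

Lemma reflE a v : refl a v = v - cr a v *: a. Proof. by []. Qed.

Lemma crD a u v : cr a (u + v) = cr a u + cr a v.
Proof. by rewrite /cr dotvDl; ring. Qed.
Lemma crZ a c v : cr a (c *: v) = c * cr a v.
Proof. by rewrite /cr dotvZl; ring. Qed.
Lemma crN a v : cr a (- v) = - cr a v.
Proof. by rewrite -scaleN1r crZ mulN1r. Qed.
Lemma crB a u v : cr a (u - v) = cr a u - cr a v.
Proof. by rewrite crD crN. Qed.
Lemma crNl a v : cr (- a) v = - cr a v.
Proof. by rewrite /cr !(dotvNr, dotvNl) opprK; ring. Qed.
Lemma cr_id a : a != 0 -> cr a a = 2.
Proof. by move=> a0; rewrite /cr mulfK // dotv_eq0. Qed.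
Lemma cr_sum a (I : Type) (r : seq I) (P : pred I) F :
  cr a (\sum_(i <- r | P i) F i) = \sum_(i <- r | P i) cr a (F i).
Proof. by rewrite /cr dotv_suml mulr_sumr mulr_suml. Qed.
Lemma cr_eq0 a v : a != 0 -> (cr a v == 0) = (dotv v a == 0).
Proof. by move=> a0; rewrite /cr !mulf_eq0 invr_eq0 dotv_eq0 (negPf a0) orbF pnatr_eq0. Qed.
Lemma cr_gt0 a v : a != 0 -> (0 < cr a v) = (0 < dotv v a).
Proof. by move=> a0; rewrite /cr -mulrA pmulr_rgt0 // pmulr_lgt0 // invr_gt0 dotv_gt0. Qed.

Lemma reflD a u v : refl a (u + v) = refl a u + refl a v.
Proof. by rewrite !reflE crD scalerDl opprD addrACA. Qed.
Lemma reflZ a c v : refl a (c *: v) = c *: refl a v.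
Proof. by rewrite !reflE crZ scalerBr scalerA. Qed.
Lemma reflN a v : refl a (- v) = - refl a v.
Proof. by rewrite -scaleN1r reflZ scaleN1r. Qed.
Lemma reflB a u v : refl a (u - v) = refl a u - refl a v.
Proof. by rewrite reflD reflN. Qed.
Lemma refl0 a : refl a 0 = 0.
Proof. by rewrite reflE /cr dotv0l mulr0 mul0r scale0r subr0. Qed.
Lemma refl_sum a (I : Type) (r : seq I) (P : pred I) F :
  refl a (\sum_(i <- r | P i) F i) = \sum_(i <- r | P i) refl a (F i).
Proof. by elim/big_rec2: _ => [|i y1 y2 _ <-]; rewrite ?refl0 ?reflD. Qed.
Lemma refl_id a : a != 0 -> refl a a = - a.
Proof. by move=> a0; rewrite reflE cr_id // scaler_nat mulr2n opprD addrA subrr add0r. Qed.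
Lemma reflNl a v : refl (- a) v = refl a v.
Proof. by rewrite !reflE crNl scaleNr scalerN opprK. Qed.
Lemma refl_fix a v : dotv v a = 0 -> refl a v = v.
Proof. by move=> va; rewrite reflE /cr va mulr0 mul0r scale0r subr0. Qed.

Lemma refl_mul a v : refl a v = v *m refl_mx a.
Proof.
rewrite [in LHS](row_sum_delta v) refl_sum; apply/rowP => j; rewrite mxE summxE.
by apply: eq_bigr => i _; rewrite reflZ !mxE.
Qed.

Lemma dotv_refl a u v : a != 0 -> dotv (refl a u) (refl a v) = dotv u v.
Proof.
move=> a0; rewrite !reflE /cr !(dotvBl, dotvBr, dotvZl, dotvZr) (dotvC a v).
by have := dotv_gt0 a0; move=> aa; field; lra.
Qed.

Lemma reflK a : a != 0 -> involutive (refl a).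
Proof.
move=> a0 v; rewrite {1}reflE [in cr _ _]reflE crB crZ cr_id // reflE.
have -> : cr a v - cr a v * 2 = - cr a v by ring.
by rewrite scaleNr opprK subrK.
Qed.

Lemma dotv_reflr a u v : a != 0 -> dotv u (refl a v) = dotv (refl a u) v.
Proof. by move=> a0; rewrite -(dotv_refl _ _ a0) reflK. Qed.

Lemma refl_mx_tr a : a != 0 -> (refl_mx a)^T = refl_mx a.
Proof.
move=> a0; apply/matrixP => i j; rewrite !mxE -!dotv_deltar !(dotvC a) eq_sym.
by rewrite [(j == i)]eq_sym; ring.
Qed.

Lemma refl_mx_mul a : a != 0 -> refl_mx a *m refl_mx a = 1%:M.
Proof.
move=> a0; apply/row_matrixP => i; rewrite rowE mulmxA -!refl_mul reflK //.
by rewrite rowE mulmx1.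
Qed.

Lemma cr_refl a b v : a != 0 -> cr (refl a b) (refl a v) = cr b v.
Proof. by move=> a0; rewrite /cr !dotv_refl. Qed.

Lemma refl_conj a b v : a != 0 -> refl (refl a b) v = refl a (refl b (refl a v)).
Proof.
move=> a0; rewrite [in RHS](reflE b) reflB reflZ reflK // reflE.
by rewrite -[v in cr _ v](reflK a0) cr_refl.
Qed.

End Reflections.

Section RootSystem.
Variables (l : nat) (Phi : seq 'rV[R]_l) (Delta : 'M[R]_l).
Hypotheses (rs : root_system Phi) (ss : simple_system Phi Delta).
Implicit Types a b v : 'rV[R]_l.

Let Phi0 : 0 \notin Phi. Proof. by case: rs. Qed.

Lemma root_neq0 a : a \in Phi -> a != 0.
Proof. by apply: contraTneq => ->. Qed.

Lemma root_refl a b : a \in Phi -> b \in Phi -> refl a b \in Phi.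
Proof. by case: rs => _ _ _ H _; apply: H. Qed.

Lemma rootN a : a \in Phi -> - a \in Phi.
Proof. by move=> aP; rewrite -refl_id ?root_neq0 // root_refl. Qed.

Lemma cr_int a b : a \in Phi -> b \in Phi -> is_intR (cr a b).
Proof. by case: rs => _ _ _ _ H; apply: H. Qed.

Lemma root_multiple a c : a \in Phi -> c *: a \in Phi -> c = 1 \/ c = -1.
Proof. by case: rs => _ _ H _ _; apply: H. Qed.

Definition Pos := undup (positive_roots Phi Delta).

Lemma mem_Pos a : (a \in Pos) = (a \in Phi) && nonneg_comb Delta a.
Proof. by rewrite mem_undup mem_filter andbC. Qed.

Lemma Pos_root a : a \in Pos -> a \in Phi.
Proof. by rewrite mem_Pos => /andP[]. Qed.

Lemma Pos_neq0 a : a \in Pos -> a != 0.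
Proof. by move/Pos_root/root_neq0. Qed.

Definition al (i : 'I_l) := row i Delta.

Lemma Delta_unit : Delta \in unitmx. Proof. by case: ss. Qed.

Lemma al_root i : al i \in Phi. Proof. by case: ss => _ H _; apply: H. Qed.

Lemma al_neq0 i : al i != 0. Proof. exact: root_neq0 (al_root i). Qed.

Lemma coordsD u v : coords Delta (u + v) = coords Delta u + coords Delta v.
Proof. by rewrite /coords mulmxDl. Qed.
Lemma coordsZ c v : coords Delta (c *: v) = c *: coords Delta v.
Proof. by rewrite /coords scalemxAl. Qed.
Lemma coordsN v : coords Delta (- v) = - coords Delta v.
Proof. by rewrite /coords mulNmx. Qed.
Lemma coordsB u v : coords Delta (u - v) = coords Delta u - coords Delta v.
Proof. by rewrite coordsD coordsN. Qed.

Lemma coords_al i : coords Delta (al i) = delta_mx 0 i.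
Proof. by rewrite /coords /al rowE -mulmxA mulmxV ?mulmx1 ?Delta_unit. Qed.

Lemma coordsE v : v = \sum_i coords Delta v 0 i *: al i.
Proof.
rewrite -[LHS](mulmxKV Delta_unit) -/(coords Delta v) [in LHS](row_sum_delta (coords Delta v)).
by rewrite mulmx_suml; apply: eq_bigr => i _; rewrite -scalemxAl -rowE.
Qed.

Lemma coords_inj u v : coords Delta u = coords Delta v -> u = v.
Proof. by move=> E; rewrite (coordsE u) E -coordsE. Qed.

Lemma nonnegP v : reflect (forall i, 0 <= coords Delta v 0 i) (nonneg_comb Delta v).
Proof. exact: forallP. Qed.

Lemma root_pos_or_neg a : a \in Phi -> a \in Pos \/ - a \in Pos.
Proof.
move=> aP; case: ss => _ _ /(_ a aP)[_ [H|H]]; [left|right]; rewrite mem_Pos H ?aP //.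
by rewrite rootN.
Qed.

Lemma nonnegN0 v : nonneg_comb Delta v -> nonneg_comb Delta (- v) -> v = 0.
Proof.
move=> /nonnegP p /nonnegP n; apply: coords_inj.
apply/rowP => i; have := n i; rewrite coordsN mxE oppr_ge0 => vi.
by apply/eqP; rewrite {2}/coords mul0mx [X in _ == X]mxE eq_le vi p.
Qed.

Lemma PosN a : a \in Pos -> - a \notin Pos.
Proof.
rewrite !mem_Pos => /andP[aP p]; rewrite rootN //=; apply: contraL (root_neq0 aP) => n.
by rewrite negbK (nonnegN0 p n).
Qed.

Lemma al_Pos i : al i \in Pos.
Proof.
rewrite mem_Pos al_root; apply/nonnegP => j; rewrite coords_al mxE.
by case: eqP => _ //=; rewrite ler0n.
Qed.

Lemma Pos_nonneg a i : a \in Pos -> 0 <= coords Delta a 0 i.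
Proof. by rewrite mem_Pos => /andP[_ /nonnegP]. Qed.

Lemma Pos_coord_root a i : a \in Phi -> 0 < coords Delta a 0 i -> a \in Pos.
Proof.
move=> aP ai; have [//|/(@Pos_nonneg _ i)] := root_pos_or_neg aP.
by rewrite coordsN mxE oppr_ge0 leNgt ai.
Qed.

Lemma nprop_Pos : nprop Pos.
Proof.
split=> [||a b aP bP ab c]; first exact: undup_uniq.
  by rewrite mem_Pos (negPf Phi0).
apply/negP => /eqP E; have := Pos_root bP; rewrite E => /(root_multiple (Pos_root aP)).
case=> c1; move: E; rewrite c1 ?scale1r => E; first by rewrite E eqxx in ab.
by have := PosN aP; rewrite -scaleN1r -E bP.
Qed.

Lemma coords_refl_al i a j :
  coords Delta (refl (al i) a) 0 j = coords Delta a 0 j - cr (al i) a * (j == i)%:R.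
Proof.
rewrite reflE coordsB coordsZ coords_al; move: (coords Delta a) => c.
by rewrite !mxE eqxx.
Qed.

Lemma refl_al_Pos i a : a \in Pos -> a != al i -> refl (al i) a \in Pos.
Proof.
move=> aP ai; have [j ji aj] : exists2 j, j != i & 0 < coords Delta a 0 j.
  apply: boolp.contrapT => H; have a0 := Pos_root aP.
  have E : a = coords Delta a 0 i *: al i.
    rewrite {1}(coordsE a) (bigD1 i) //= big1 ?addr0 // => j ji.
    suff -> : coords Delta a 0 j = 0 by rewrite scale0r.
    apply/eqP; rewrite eq_le Pos_nonneg // andbT leNgt.
    by apply/negP => aj; apply: H; exists j.
  have := a0; rewrite {1}E => /(root_multiple (al_root i))[] c1.
    by case/eqP: ai; rewrite E c1 scale1r.
  by have := Pos_nonneg i aP; rewrite c1 oppr_ge0 ler10.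
apply: (@Pos_coord_root _ j); first by rewrite root_refl ?al_root ?Pos_root.
by rewrite coords_refl_al (negPf ji) mulr0 subr0.
Qed.

Definition ht v := \sum_i coords Delta v 0 i.

Lemma ht_refl i a : ht (refl (al i) a) = ht a - cr (al i) a.
Proof.
rewrite /ht; under eq_bigr => j _ do rewrite coords_refl_al.
rewrite sumrB; congr (_ - _); rewrite (bigD1 i) //= eqxx mulr1 big1 ?addr0 // => j ji.
by rewrite (negPf ji) mulr0.
Qed.

(** Induction on the height. A positive root has a positive product with some simple root, since its
    own norm is positive; unless it is simple itself, reflecting in that simple root keeps it
    positive and lowers its height by a positive integer. *)
Lemma Pos_ind (P : 'rV[R]_l -> Prop) :
  (forall i, P (al i)) ->
  (forall i a, a \in Pos -> refl (al i) a \in Pos -> P a -> P (refl (al i) a)) ->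
  forall a, a \in Pos -> P a.
Proof.
move=> Pal Pr a aP; have [N] : exists N : nat, ht a < N%:R.
  exists (Num.bound (ht a)); apply: archi_boundP.
  by apply: sumr_ge0 => i _; apply: Pos_nonneg.
elim: N => [|N IHN] in a aP *.
  by rewrite ltNge sumr_ge0 // => i _; apply: Pos_nonneg.
move=> htN; have [/existsP[i /eqP ->]|nal] := boolP [exists i, a == al i]; first exact: Pal.
have [i ai] : exists i, 0 < dotv a (al i).
  apply: boolp.contrapT => H; have := dotv_gt0 (Pos_neq0 aP).
  rewrite {2}(coordsE a) dotv_sumr ltNge sumr_le0 // => i _; rewrite dotvZr.
  rewrite mulr_ge0_le0 ?Pos_nonneg // leNgt; apply/negP => ai; apply: H; by exists i.
have ra : refl (al i) a \in Pos.
  apply: refl_al_Pos => //; apply: contraNneq nal => ->; apply/existsP; by exists i.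
rewrite -(reflK (al_neq0 i) a); apply: Pr => //; first by rewrite reflK ?al_neq0.
apply: IHN => //; rewrite ht_refl.
have [z zE] := cr_int (al_root i) (Pos_root aP).
have : 0 < cr (al i) a by rewrite cr_gt0 ?al_neq0.
rewrite zE ltr0z => z0; have : (1 <= z%:~R :> R) by rewrite ler1z.
move: htN; rewrite -natr1; lra.
Qed.

(* Positive roots represent the roots up to sign, so even summands can be reindexed by reflections. *)
Lemma sum_Pos_refl (V : zmodType) (g : 'rV[R]_l -> V) b : b \in Phi ->
  (forall a, g (- a) = g a) -> (forall x : V, x *+ 2 = 0 -> x = 0) ->
  \sum_(a <- Pos) g (refl b a) = \sum_(a <- Pos) g a.
Proof.
move=> bP gN V2; set U := undup Phi.
have sumU (f : 'rV[R]_l -> V) : (forall a, f (- a) = f a) ->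
    \sum_(a <- U) f a = (\sum_(a <- Pos) f a) *+ 2.
  move=> fN; have : perm_eq U (Pos ++ map -%R Pos).
    apply: uniq_perm; first exact: undup_uniq.
      rewrite cat_uniq undup_uniq map_inj_uniq ?undup_uniq ?andbT //=; last exact: oppr_inj.
      apply/hasPn => x /mapP[a aP ->]; exact: PosN.
    move=> x; rewrite mem_undup mem_cat; apply/idP/orP => [xP|[|/mapP[a aP ->]]].
    - have [?|xn] := root_pos_or_neg xP; [by left|right].
      by apply/mapP; exists (- x); rewrite ?opprK.
    - exact: Pos_root.
    - by rewrite rootN ?Pos_root.
  move=> pU; rewrite (perm_big _ pU) big_cat /= big_map mulr2n; congr (_ + _).
  by apply: eq_bigr => a _; rewrite fN.
apply/eqP; rewrite -subr_eq0; apply/eqP/V2; rewrite mulrnBl -!sumU //; last first.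
  by move=> a; rewrite reflN gN.
apply/eqP; rewrite subr_eq0 -(big_map (refl b) xpredT g); apply/eqP/perm_big.
apply: uniq_perm; rewrite ?undup_uniq ?map_inj_uniq ?undup_uniq //.
  exact: can_inj (reflK (root_neq0 bP)).
move=> x; rewrite mem_undup; apply/mapP/idP => [[a]|xP].
  by rewrite mem_undup => aP ->; rewrite root_refl.
exists (refl b x); last by rewrite reflK ?root_neq0.
by rewrite mem_undup root_refl.
Qed.

End RootSystem.

(** * The Dynkin diagram and the Casimir operator *)

Section Dynkin.
Variables (l : nat) (Phi : seq 'rV[R]_l) (Delta : 'M[R]_l).
Hypotheses (rs : root_system Phi) (ss : simple_system Phi Delta).
Local Notation Pos := (Pos Phi Delta).
Local Notation al := (al Delta).

Definition adj (i j : 'I_l) := (i != j) && (dotv (al i) (al j) != 0).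

Lemma adjC i j : adj i j = adj j i.
Proof. by rewrite /adj eq_sym dotvC. Qed.

Let al0 i : al i != 0. Proof. exact: (al_neq0 rs ss). Qed.

Lemma al_inj : injective al.
Proof.
move=> i j /(congr1 (coords Delta)); rewrite !(coords_al ss) => /rowP/(_ j).
by rewrite !mxE !eqxx /=; case: eqP => //= _ /eqP; rewrite eq_sym oner_eq0.
Qed.

Lemma al_dot_le0 i j : i != j -> dotv (al i) (al j) <= 0.
Proof.
move=> ij; have rP : refl (al i) (al j) \in Pos.
  by apply: (refl_al_Pos rs ss) => //; [exact: (al_Pos ss)|rewrite (inj_eq al_inj) eq_sym].
have := Pos_nonneg i rP; rewrite (coords_refl_al ss) (coords_al ss) mxE (negPf ij) andbF eqxx.
by rewrite mulr1 sub0r oppr_ge0 leNgt cr_gt0 // dotvC -leNgt.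
Qed.

Lemma cr_mul_ge1 a b : a \in Phi -> b \in Phi -> dotv a b != 0 ->
  dotv a a * dotv b b <= 4 * dotv a b ^+ 2.
Proof.
move=> aP bP ab; have [x xE] := cr_int rs aP bP; have [y yE] := cr_int rs bP aP.
have A := dotv_gt0 (root_neq0 rs aP); have B := dotv_gt0 (root_neq0 rs bP).
have E : (x * y)%:~R * (dotv a a * dotv b b) = 4 * dotv a b ^+ 2.
  by rewrite rmorphM /= -xE -yE /cr (dotvC b a); field; rewrite !gt_eqF.
have xy0 : 0 < (x * y)%:~R :> R.
  rewrite -(pmulr_lgt0 _ (mulr_gt0 A B)) E mulr_gt0 // lt_def sqr_ge0 andbT.
  by rewrite expf_neq0.
have xy1 : 1 <= (x * y)%:~R :> R by rewrite ler1z; move: xy0; rewrite ltr0z; lia.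
by rewrite -E ler_peMl // mulr_ge0 ?ltW.
Qed.

(** If every vertex of [A] had two neighbours in [A], the sum of the normalized simple roots of [A]
    would have nonpositive norm: each vertex contributes [1] and each of its neighbours at most
    [-1/2]. Applied to all subsets, this says that the diagram is a forest. *)
Lemma Dynkin_leaf (A : {set 'I_l}) : A != set0 ->
  exists2 i, i \in A & (#|[set j in A | adj i j]| <= 1)%N.
Proof.
move=> A0; apply: boolp.contrapT => H.
have deg i : i \in A -> (2 <= #|[set j in A | adj i j]|)%N.
  by move=> iA; rewrite leqNgt; apply/negP => d; apply: H; exists i.
pose n i := Num.sqrt (dotv (al i) (al i)).
have n0 i : 0 < n i by rewrite sqrtr_gt0 dotv_gt0.
have nn i : n i ^+ 2 = dotv (al i) (al i) by rewrite sqr_sqrtr ?dotv_ge0.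
pose e i := (n i)^-1 *: al i; pose v := \sum_(i in A) e i.
have v0 : v != 0.
  have /set0Pn[i iA] := A0; apply/eqP => /(congr1 (fun v => coords Delta v 0 i)).
  rewrite {2}/coords mul0mx [RHS]mxE /v /coords mulmx_suml summxE (bigD1 i) //=.
  rewrite big1 => [|j /andP[_ ji]].
    rewrite addr0 -scalemxAl -/(coords _ _) (coords_al ss) !mxE !eqxx mulr1.
    by apply/eqP; rewrite invr_eq0 gt_eqF.
  by rewrite -scalemxAl -/(coords _ _) (coords_al ss) !mxE eq_sym (negPf ji) andbF mulr0.
have := dotv_gt0 v0; rewrite ltNge; case/negP.
rewrite /v dotv_suml; apply: sumr_le0 => i iA; rewrite dotv_sumr (bigD1 i) //=.
have -> : dotv (e i) (e i) = 1.
  by rewrite /e dotvZl dotvZr -nn; field; rewrite gt_eqF.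
have le12 j : adj i j -> dotv (e i) (e j) <= - 2^-1.
  move=> /andP[ij d0]; rewrite /e dotvZl dotvZr.
  have d1 := al_dot_le0 ij; have d2 := cr_mul_ge1 (al_root ss i) (al_root ss j) d0.
  have : n i * n j <= - (2 * dotv (al i) (al j)).
    rewrite -ler_sqr ?nnegrE ?oppr_ge0; last 2 first.
    - by rewrite mulr_ge0 ?ltW.
    - by rewrite mulr_ge0_le0.
    by rewrite exprMn !nn sqrrN exprMn; lra.
  have -> : (n i)^-1 * ((n j)^-1 * dotv (al i) (al j)) = dotv (al i) (al j) / (n i * n j).
    by field; rewrite !gt_eqF.
  by rewrite ler_pdivrMr ?mulr_gt0 //; lra.
have : \sum_(j in A | j != i) dotv (e i) (e j) <= \sum_(j in A | j != i) (if adj i j then - 2^-1 else 0).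
  apply: ler_sum => j /andP[jA ji]; case: ifP => [/le12 //|].
  rewrite /adj eq_sym ji => /negbT; rewrite negbK => /eqP d0.
  by rewrite /e dotvZl dotvZr d0 !mulr0.
have -> : \sum_(j in A | j != i) (if adj i j then - 2^-1 else 0 : R) =
    - (2^-1 * #|[set j in A | adj i j]|%:R).
  rewrite -big_mkcondr /= -sum1_card natr_sum mulr_sumr -sumrN; apply: eq_big => [j|j _].
    by rewrite inE /adj eq_sym; case: (j \in A); case: (i == j).
  by rewrite mulr1.
have : 2 <= #|[set j in A | adj i j]|%:R :> R by rewrite (ler_nat R 2) deg.
lra.
Qed.

(** Values are propagated along edges after removal of a leaf, so there is no cycle along which they
    could disagree. It serves both to rescale the odd sections and to define the levels of the
    vertices. *)
Lemma tree_potential (T : Type) (P : T -> Prop) (tau : 'I_l -> 'I_l -> T -> T) (x0 : T) :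
  P x0 -> (forall i j x, adj i j -> P x -> P (tau i j x)) ->
  (forall i j x, adj i j -> P x -> tau j i (tau i j x) = x) ->
  exists x : 'I_l -> T, (forall i, P (x i)) /\ forall i j, adj i j -> x j = tau i j (x i).
Proof.
move=> P0 Pt tK.
have H (A : {set 'I_l}) : exists x : 'I_l -> T, (forall i, P (x i)) /\
    forall i j, i \in A -> j \in A -> adj i j -> x j = tau i j (x i).
  have [n] := ubnP #|A|; elim: n => // n IHn in A *; rewrite ltnS => An.
  have [->|A0] := eqVneq A set0; first by exists (fun=> x0); split=> // i j; rewrite inE.
  have [i iA deg] := Dynkin_leaf A0.
  have [|x [Px xE]] := IHn (A :\ i).
    by apply: leq_trans An; rewrite [in X in (_ < X)%N](cardsD1 i) iA.
  have [N0|/set0Pn[j]] := eqVneq [set j in A | adj i j] set0.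
    exists x; split=> // p q pA qA pq; apply: xE => //; rewrite !inE ?pA ?qA andbT.
      by apply/eqP => pi; have /setP/(_ q) := N0; rewrite !inE qA -pi pq.
    by apply/eqP => qi; have /setP/(_ p) := N0; rewrite !inE pA -qi adjC pq.
  rewrite inE => /andP[jA ij].
  have uq k : k \in A -> adj i k -> k = j.
    move=> kA ik; apply/eqP; move: deg; rewrite leqNgt; apply: contraNT => kj.
    have : [set k; j] \subset [set j in A | adj i j].
      by apply/subsetP => z; rewrite !inE => /orP[]/eqP->; rewrite ?kA ?jA.
    by move/subset_leq_card; apply: leq_trans; rewrite cards2 kj.
  have ji : j != i by move: ij; rewrite /adj eq_sym => /andP[].
  exists (fun k => if k == i then tau j i (x j) else x k); split=> [k|p q pA qA pq].
    by case: eqP => // _; apply: Pt; rewrite // adjC.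
  have [pi|pi] := eqVneq p i.
    have qj : q = j by apply: uq => //; rewrite -pi.
    by rewrite qj (negPf ji) pi tK // adjC.
  have [qi|qi] := eqVneq q i.
    have <- : p = j by apply: uq; rewrite // adjC -qi.
    by rewrite qi.
  by apply: xE => //; rewrite !inE ?pi ?qi.
have [x [Px xE]] := H setT; exists x; split=> // i j ij; exact: xE.
Qed.

Hypothesis irr : irreducible_rs Phi.

(** A set of vertices closed under adjacency is orthogonal to its complement. The support of a root
    then stays on one side, because a simple reflection alters one coordinate and fixes the roots
    orthogonal to it; this would split [Phi]. *)
Lemma irr_conn (P : pred 'I_l) i0 : P i0 ->
  (forall i j, P i -> adj i j -> P j) -> forall i, P i.
Proof.
move=> Pi0 PA i; apply/negPn/negP => nPi; case: irr => _; apply.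
pose supp (Q : pred 'I_l) (a : 'rV[R]_l) := [forall k, (coords Delta a 0 k != 0) ==> Q k].
have suppP Q a k : supp Q a -> ~~ Q k -> coords Delta a 0 k = 0.
  by move=> /forallP/(_ k); case: eqP => //= _ ->.
have orth i1 i2 : P i1 -> ~~ P i2 -> dotv (al i1) (al i2) = 0.
  move=> P1 P2; apply/eqP/negPn/negP => d; case/negP: (P2); apply: (PA i1) => //.
  rewrite /adj d andbT; apply/negP => /eqP E; move: P2; by rewrite -E P1.
have dot0 a b : supp P a -> supp (predC P) b -> dotv a b = 0.
  move=> sa sb; rewrite (coordsE ss a) (coordsE ss b) dotv_suml big1 // => k1 _.
  rewrite dotv_sumr big1 // => k2 _; rewrite dotvZl dotvZr.
  have [P1|P1] := boolP (P k1); last by rewrite (suppP P) // mul0r.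
  have [P2|P2] := boolP (P k2); first by rewrite (suppP (predC P) b) ?mul0r ?mulr0 //= negbK.
  by rewrite orth // !mulr0.
have sal (Q : pred 'I_l) k : Q k -> supp Q (al k).
  move=> Qk; apply/forallP => j; rewrite (coords_al ss) mxE.
  by case: (eqVneq j k) => [->|_]; rewrite ?Qk ?implybT //= eqxx.
have sr (Q : pred 'I_l) a k : supp Q a -> (Q k \/ dotv a (al k) = 0) -> supp Q (refl (al k) a).
  move=> sa [Qk|d0]; last by rewrite refl_fix.
  apply/forallP => j; apply/implyP; apply: contraR => nQ.
  rewrite (coords_refl_al ss) (suppP Q) //; have [jk|_] := eqVneq j k; first by rewrite jk Qk in nQ.
  by rewrite mulr0 subr0.
have dich a : a \in Pos -> supp P a \/ supp (predC P) a.
  elim/(Pos_ind rs ss) => [k|k {}a aP _ [sa|sa]].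
  - by have [Pk|Pk] := boolP (P k); [left|right]; apply: sal.
  - have [Pk|Pk] := boolP (P k); left; apply: sr => //; [by left|right].
    exact: (dot0 _ _ sa (sal (predC P) _ Pk)).
  - have [Pk|Pk] := boolP (P k); right; apply: sr => //; [right|by left].
    by rewrite dotvC; apply: dot0 => //; apply: sal.
have suppN Q a : supp Q (- a) = supp Q a.
  by rewrite /supp; apply: eq_forallb => k; rewrite coordsN mxE oppr_eq0.
have dichR a : a \in Phi -> supp P a \/ supp (predC P) a.
  move=> aP; have [/dich //|/dich] := root_pos_or_neg rs ss aP.
  by rewrite !suppN.
exists (supp P); split.
- by exists (al i0); [exact: al_root|apply: sal].
- exists (al i); first exact: al_root.
  apply/negP => /(suppP P)/(_ nPi)/eqP; rewrite (coords_al ss) mxE !eqxx /=.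
  by rewrite oner_eq0.
- move=> a b aP bP sa nb; apply: dot0 => //; by case: (dichR b bP) nb => [->|].
Qed.

(** The operator [T] commutes with all reflections, so every simple root is an eigenvector; [T] is
    symmetric, so adjacent simple roots share their eigenvalue, and connectedness does the rest. The
    second equation is the trace of [T], to which every positive root contributes [cr a a = 2]. *)
Lemma Casimir_exists : exists h' : R, (forall v, \sum_(a <- Pos) cr a v *: a = h' *: v) /\
  h' * l%:R = 2 * (size Pos)%:R.
Proof.
have [i0] : exists i0 : 'I_l, true.
  case: irr => P0 _; have: exists a, a \in Phi.
    by move: P0; case: (Phi) => // a s _; exists a; rewrite mem_head.
  case=> a aP; case: (posnP l) => [l0|lp]; last by exists (Ordinal lp).
  by case/eqP: (root_neq0 rs aP); apply/rowP => -[j jl]; exfalso; rewrite l0 in jl.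
move=> _; pose T v := \sum_(a <- Pos) cr a v *: a.
have Tr b v : b \in Phi -> T (refl b v) = refl b (T v).
  move=> bP; have b0 := root_neq0 rs bP.
  rewrite /T -(sum_Pos_refl rs ss (g := fun a => cr a (refl b v) *: a) bP) => [|a|x].
  - by rewrite refl_sum; apply: eq_bigr => a _; rewrite cr_refl // reflZ.
  - by rewrite crNl scalerN scaleNr opprK.
  - by rewrite -scaler_nat => /eqP; rewrite scaler_eq0 pnatr_eq0 => /eqP.
have TZ c v : T (c *: v) = c *: T v.
  by rewrite /T scaler_sumr; apply: eq_bigr => a _; rewrite crZ scalerA.
have TS u v : dotv (T u) v = dotv u (T v).
  rewrite /T dotv_suml dotv_sumr; apply: eq_bigr => a _.
  by rewrite dotvZl dotvZr /cr (dotvC a v) /=; ring.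
pose lam i := cr (al i) (T (al i)) / 2.
have lamE i : T (al i) = lam i *: al i.
  have := Tr (al i) (al i) (al_root ss i); rewrite refl_id ?al0 // -scaleN1r TZ scaleN1r reflE.
  rewrite /lam; move: (T _) => x E.
  apply: (@scalerI _ _ (2 : R)); first by rewrite pnatr_eq0.
  rewrite scalerA mulrC divfK ?pnatr_eq0 //.
  have -> : 2 *: x = x - - x by rewrite opprK -[2]/(1 + 1) scalerDl scale1r.
  by rewrite E opprB addrC subrK.
have lam0 i : lam i = lam i0.
  apply/eqP; apply: (irr_conn (P := fun i => lam i == lam i0)) => // {}i j /eqP <- /andP[_ d].
  have := TS (al i) (al j); rewrite !lamE dotvZl dotvZr => /(mulIf d) ->.
  by [].
have TE v : T v = lam i0 *: v.
  rewrite {2}(coordsE ss v) {1}(coordsE ss v) scaler_sumr.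
  transitivity (\sum_i T (coords Delta v 0 i *: al i)).
    rewrite /T exchange_big; apply: eq_bigr => a _ /=; rewrite cr_sum scaler_suml.
    by [].
  by apply: eq_bigr => i _; rewrite TZ lamE lam0 !scalerA mulrC.
exists (lam i0); split=> //.
have : \sum_(i < l) (T (delta_mx 0 i)) 0 i = lam i0 * l%:R.
  under eq_bigr => i _ do rewrite TE !mxE !eqxx mulr1.
  by rewrite sumr_const card_ord mulr_natr.
move=> <-; rewrite /T; under eq_bigr => i _ do rewrite summxE.
rewrite exchange_big /= -sum1_size natr_sum mulr_sumr big_seq [RHS]big_seq.
apply: eq_bigr => a aP; rewrite mulr1 -[RHS](cr_id (Pos_neq0 rs aP)).
rewrite /cr {2}/dotv mulr_sumr mulr_suml; apply: eq_bigr => i _.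
by rewrite mxE dotvC dotv_deltar; ring.
Qed.

End Dynkin.

(** * Positive roots in a plane *)

Section RankTwo.
Variables (l : nat) (Phi : seq 'rV[R]_l) (Delta : 'M[R]_l).
Hypotheses (rs : root_system Phi) (ss : simple_system Phi Delta).
Local Notation Pos := (Pos Phi Delta).

Definition indep2 (a b : 'rV[R]_l) := forall x y : R, x *: a + y *: b = 0 -> x = 0 /\ y = 0.

Lemma indep2_inj a b x y x' y' : indep2 a b ->
  x *: a + y *: b = x' *: a + y' *: b -> x = x' /\ y = y'.
Proof.
move=> ab E; have [] := ab (x - x') (y - y').
  by rewrite !scalerBl addrACA -opprD E subrr.
by move=> /eqP; rewrite subr_eq0 => /eqP -> /eqP; rewrite subr_eq0 => /eqP ->.
Qed.

Lemma Pos_indep2 a b : a \in Pos -> b \in Pos -> a != b -> indep2 a b.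
Proof.
move=> aP bP ab x y E; have [_ _ H] := nprop_Pos rs ss.
have [y0|y0] := eqVneq y 0.
  split=> //; apply/eqP; move: E; rewrite y0 scale0r addr0 => /eqP.
  by rewrite scaler_eq0 (negPf (Pos_neq0 rs aP)) orbF.
case/eqP: (H a b aP bP ab (- (x / y))); apply: (scalerI y0).
by rewrite scalerA mulrN mulrCA divff // mulr1 scaleNr; apply/eqP; rewrite -addr_eq0 addrC E.
Qed.

Lemma cs_strict (a b : 'rV[R]_l) : indep2 a b -> dotv a b ^+ 2 < dotv a a * dotv b b.
Proof.
move=> ab; have b0 : b != 0.
  apply/eqP => b0; have [] := ab 0 1; first by rewrite b0 scale0r scaler0 addr0.
  by move=> _ /eqP; rewrite oner_eq0.
rewrite -subr_gt0 cauchy_schwarz_eq // divr_gt0 ?dotv_gt0 //; apply/eqP => E.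
have [] := ab (dotv b b) (- dotv a b); first by rewrite scaleNr.
by move=> /eqP; rewrite dotv_eq0 (negPf b0).
Qed.

(** Strict Cauchy-Schwarz bounds the product of the two pairings by [4], and both are integers. *)
Lemma cr_cases a b : a \in Phi -> b \in Phi -> indep2 a b -> dotv a b <= 0 ->
  exists p q : nat, [/\ cr a b = - p%:R, cr b a = - q%:R, (p * q < 4)%N & (p == 0%N) = (q == 0%N)].
Proof.
move=> aP bP ab d; have [x xE] := cr_int rs aP bP; have [y yE] := cr_int rs bP aP.
have a0 := root_neq0 rs aP; have b0 := root_neq0 rs bP.
have A := dotv_gt0 a0; have B := dotv_gt0 b0.
have x0 : x <= 0.
  by rewrite -(@ler_int R) -xE leNgt cr_gt0 // dotvC -leNgt.
have y0 : y <= 0.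
  by rewrite -(@ler_int R) -yE leNgt cr_gt0 // -leNgt.
have xy : x * y < 4.
  rewrite -(@ltr_int R) rmorphM /= -xE -yE /cr (dotvC b a).
  have -> : 2 * dotv a b / dotv a a * (2 * dotv a b / dotv b b) =
    4 * dotv a b ^+ 2 / (dotv a a * dotv b b) by field; rewrite !gt_eqF.
  by rewrite ltr_pdivrMr ?mulr_gt0 // ltr_pM2l // cs_strict.
have E0 : (x == 0) = (y == 0).
  by rewrite -!(eqr_int R) -xE -yE !cr_eq0 // dotvC.
exists `|x|%N, `|y|%N; rewrite xE yE; split.
- by rewrite !natr_absz ler0_norm // rmorphN opprK.
- by rewrite !natr_absz ler0_norm // rmorphN opprK.
- nia.
- by rewrite !absz_eq0.
Qed.

(* Coordinates, in a base [a, b] with [s_a b = b + p a] and [s_b a = a + b], of the positive roots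
   of type A1 x A1, A2, B2, G2 for p = 0, 1, 2, 3. *)
Definition rk2c (p : nat) : seq (nat * nat) :=
  match p with
  | 0 => [:: (1, 0); (0, 1)]
  | 1 => [:: (1, 0); (0, 1); (1, 1)]
  | 2 => [:: (1, 0); (0, 1); (1, 1); (2, 1)]
  | _ => [:: (1, 0); (0, 1); (1, 1); (2, 1); (3, 1); (3, 2)]
  end%N.

Definition comb (a b : 'rV[R]_l) (c : nat * nat) : 'rV[R]_l := c.1%:R *: a + c.2%:R *: b.

Definition rk2 (p : nat) (a b : 'rV[R]_l) :=
  [/\ (p <= 3)%N, indep2 a b, cr a b = - p%:R /\ cr b a = - ((0 < p)%N)%:R &
    forall x y : R, (x *: a + y *: b \in Pos) = (x *: a + y *: b \in map (comb a b) (rk2c p))].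

Definition base2 a b := [/\ a \in Pos, b \in Pos, a != b &
  forall x y : R, x *: a + y *: b \in Pos -> 0 <= x /\ 0 <= y].

Lemma base2C a b : base2 a b -> base2 b a.
Proof.
by case=> aP bP ab H; split=> // [|x y]; rewrite 1?eq_sym // addrC => /H[].
Qed.

Lemma root_sub a b : a \in Phi -> b \in Phi -> indep2 a b -> 0 < dotv a b -> a - b \in Phi.
Proof.
move=> aP bP ab d; have nbP := rootN rs bP.
have nab : indep2 a (- b) by move=> x y; rewrite scalerN -scaleNr => /ab[-> /eqP]; rewrite oppr_eq0 => /eqP.
have [|p [q [pE qE pq E0]]] := cr_cases aP nbP nab; first by rewrite dotvNr oppr_le0 ltW.
have p0 : p != 0%N.
  apply/eqP => p0; move: pE; rewrite p0 oppr0 crN => /eqP; rewrite oppr_eq0 cr_eq0 ?(root_neq0 rs) //.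
  by rewrite dotvC gt_eqF.
have [p1|q1] : p = 1%N \/ q = 1%N 
  by case: (p) (q) p0 E0 pq => [|[|p']] [|[|q']] //=; do ?[by left|by right]; nia.
  have := root_refl rs aP nbP; rewrite reflE pE p1 scaleN1r opprK addrC. by [].
have := root_refl rs nbP aP; rewrite reflE qE q1 scaleN1r opprK. by [].
Qed.

Lemma base2_dot a b : base2 a b -> dotv a b <= 0.
Proof.
case=> aP bP ab H; have ind := Pos_indep2 aP bP ab; rewrite leNgt; apply/negP => d.
have sP := root_sub (Pos_root aP) (Pos_root bP) ind d.
have [sp|sn] := root_pos_or_neg rs ss sP.
  by have [|_] := H 1 (-1); [rewrite scale1r scaleN1r|lra].
by have [|] := H (-1) 1; [rewrite scale1r scaleN1r addrC -opprB|lra].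
Qed.

(** Reflection in [a] leaves the positive coefficient of [b] unchanged, so the image cannot be
    negative. *)
Lemma base2_refl a b x y : base2 a b -> x *: a + y *: b \in Pos -> 0 < y ->
  (- cr a b * y - x) *: a + y *: b \in Pos.
Proof.
move=> [aP bP ab H] cP y0.
have a0 := Pos_neq0 rs aP.
have E : refl a (x *: a + y *: b) = (- cr a b * y - x) *: a + y *: b.
  rewrite reflE crD !crZ cr_id // addrAC -scalerBl; congr (_ *: _ + _); ring.
have rP : refl a (x *: a + y *: b) \in Phi by rewrite (root_refl rs) // (Pos_root cP, Pos_root aP).
rewrite -E; have [//|] := root_pos_or_neg rs ss rP.
rewrite E opprD -!scaleNr => /H[_]; rewrite oppr_ge0; lra.
Qed.

Lemma Pos_prop a c t : a \in Pos -> c \in Pos -> c = t *: a -> c = a.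
Proof.
move=> aP cP E; apply/eqP/negPn/negP => ca; have [_ _ H] := nprop_Pos rs ss.
by move: ca; rewrite eq_sym => /(H a c aP cP)/(_ t); rewrite E eqxx.
Qed.

(** One of the two pairings is [0] or [-1], and exchanging [a] and [b] makes it the one called
    [cr b a]. Repeated reflections in [a] and [b] confine the ratio of the coordinates of a positive
    root to finitely many values, and a positive root is determined by this ratio. *)
Lemma base2_rk2 a b : base2 a b -> exists2 p, (p <= 3)%N & rk2 p a b \/ rk2 p b a.
Proof.
suff main a' b' p q : base2 a' b' -> cr a' b' = - p%:R -> cr b' a' = - q%:R ->
    q = (0 < p)%N :> nat -> (p <= 3)%N -> rk2 p a' b'.
  move=> bs; have [aP bP ab _] := bs; have ind := Pos_indep2 aP bP ab.
  have [p [q [pE qE pq E0]]] := cr_cases (Pos_root aP) (Pos_root bP) ind (base2_dot bs).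
  have [q1|q1] := leqP q 1.
    exists p; first by move: E0; case: q pq q1 {qE} => [|[|]] //; [move=> _ _ /eqP -> |lia].
    left; apply: (main _ _ _ q) => //.
      by case: p q E0 q1 {pE qE pq} => [|p] [|[|q]].
    by move: E0; case: q pq q1 {qE} => [|[|]] //; [move=> _ _ /eqP -> |lia].
  exists q; first by nia.
  right; apply: (main _ _ _ p) => //; [exact: base2C| |nia].
  by case: p q E0 q1 pq {pE qE} => [|[|p]] [|[|q]] //; nia.
move=> {a b}; move: a' b' => a b bs pE qE qp p3.
have [aP bP ab H] := bs; have ind := Pos_indep2 aP bP ab; have bs' := base2C bs.
have rA x y : x *: a + y *: b \in Pos -> 0 < y -> (p%:R * y - x) *: a + y *: b \in Pos.
  by move=> cP y0; have := base2_refl bs cP y0; rewrite pE opprK.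
have rB x y : x *: a + y *: b \in Pos -> 0 < x -> x *: a + (q%:R * x - y) *: b \in Pos.
  by rewrite ![_ + _ *: b]addrC => cP x0; have := base2_refl bs' cP x0; rewrite qE opprK.
have P10 : 1 *: a + 0 *: b \in Pos by rewrite scale1r scale0r addr0.
have P01 : 0 *: a + 1 *: b \in Pos by rewrite scale1r scale0r add0r.
have prop x y x' y' : x *: a + y *: b \in Pos -> x' *: a + y' *: b \in Pos -> 0 < x' \/ 0 < y' ->
    x * y' = x' * y -> x *: a + y *: b = x' *: a + y' *: b.
  move=> cP cP' pos E; case: pos => z0.
    apply: (@Pos_prop _ _ (x / x') cP' cP); rewrite scalerDr !scalerA divfK ?gt_eqF //.
    by congr (_ + _ *: _); apply: (mulfI (lt0r_neq0 z0)); rewrite -E; field; rewrite gt_eqF.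
  apply: (@Pos_prop _ _ (y / y') cP' cP); rewrite scalerDr !scalerA divfK ?gt_eqF //.
  by congr (_ *: _ + _); apply: (mulIf (lt0r_neq0 z0)); rewrite E; field; rewrite gt_eqF.
have rw x y x' y' : x *: a + y *: b \in Pos -> x = x' -> y = y' -> x' *: a + y' *: b \in Pos.
  by move=> cP <- <-.
have int x y : x *: a + y *: b \in Pos -> [\/ x *: a + y *: b = a, x *: a + y *: b = b | 0 < x /\ 0 < y].
  move=> cP; have [x0 y0] := H _ _ cP.
  have [x1|x1] := eqVneq x 0.
    constructor 2; move: cP; rewrite x1 scale0r add0r => cP; exact: (Pos_prop bP cP (erefl _)).
  have [y1|y1] := eqVneq y 0.
    constructor 1; move: cP; rewrite y1 scale0r addr0 => cP; exact: (Pos_prop aP cP (erefl _)).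
  by constructor 3; rewrite !lt_def x1 y1 x0 y0.
(* The coordinates of the two reflected roots are nonnegative as well, which bounds the ratio
   [x : y] from both sides. *)
have iA x y : x *: a + y *: b \in Pos -> 0 < x -> 0 < y -> x <= p%:R * y /\ y <= q%:R * x.
  move=> cP x0 y0; have [+ _] := H _ _ (rA _ _ cP y0); have [_ +] := H _ _ (rB _ _ cP x0); lra.
split=> //; first by rewrite pE qE qp.
move: p3 qp pE qE rA rB iA; case: p => [|[|[|[|//]]]] _ -> pE qE rA rB iA x y; rewrite /= in rA rB iA *.
all: rewrite /comb /= !scale0r !scale1r ?addr0 ?add0r.
- apply/idP/idP => [cP|]; last by rewrite !inE => /orP[]/eqP->.
  rewrite !inE; have [->|->|[x0 y0]] := int _ _ cP; rewrite ?eqxx ?orbT //.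
  by have := iA _ _ cP x0 y0; lra.
- have P11 : 1 *: a + 1 *: b \in Pos by apply: rw (rB _ _ P10 ltr01) _ _; lra.
  have E11 : 1 *: a + 1 *: b = a + b by rewrite !scale1r.
  apply/idP/idP => [cP|]; last by rewrite !inE => /or3P[]/eqP-> //; rewrite -E11.
  rewrite !inE; have [->|->|[x0 y0]] := int _ _ cP; rewrite ?eqxx ?orbT //.
  rewrite (prop _ _ _ _ cP P11) ?E11 ?eqxx ?orbT //; first by left.
  by have := iA _ _ cP x0 y0; lra.
- have P11 : 1 *: a + 1 *: b \in Pos by apply: rw (rB _ _ P10 ltr01) _ _; lra.
  have P21 : 2 *: a + 1 *: b \in Pos by apply: rw (rA _ _ P01 ltr01) _ _; lra.
  have E11 : 1 *: a + 1 *: b = a + b by rewrite !scale1r.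
  have E21 : 2 *: a + 1 *: b = 2 *: a + b by rewrite scale1r.
  apply/idP/idP => [cP|]; last by rewrite !inE => /or4P[]/eqP-> //; rewrite -?E11 -?E21.
  rewrite !inE; have [->|->|[x0 y0]] := int _ _ cP; rewrite ?eqxx ?orbT //.
  have [xy|/eqP xy] := eqVneq x y.
    by rewrite (prop _ _ _ _ cP P11) ?E11 ?eqxx ?orbT //; [left|lra].
  have [xy2|/eqP xy2] := eqVneq x (2 * y).
    by rewrite (prop _ _ _ _ cP P21) ?E21 ?eqxx ?orbT //; [left|lra].
  have i1 := iA _ _ cP x0 y0; have r1 := rA _ _ cP y0.
  have z0 : 0 < 2 * y - x by lra.
  by have := iA _ _ r1 z0 y0; lra.
- have P11 : 1 *: a + 1 *: b \in Pos by apply: rw (rB _ _ P10 ltr01) _ _; lra.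
  have P31 : 3 *: a + 1 *: b \in Pos by apply: rw (rA _ _ P01 ltr01) _ _; lra.
  have P21 : 2 *: a + 1 *: b \in Pos by apply: rw (rA _ _ P11 ltr01) _ _; lra.
  have P32 : 3 *: a + 2 *: b \in Pos by apply: rw (rB _ _ P31 _) _ _; lra.
  have E11 : 1 *: a + 1 *: b = a + b by rewrite !scale1r.
  have E21 : 2 *: a + 1 *: b = 2 *: a + b by rewrite scale1r.
  have E31 : 3 *: a + 1 *: b = 3 *: a + b by rewrite scale1r.
  apply/idP/idP => [cP|].
    rewrite !inE; have [->|->|[x0 y0]] := int _ _ cP; rewrite ?eqxx ?orbT //.
    have [xy|/eqP xy] := eqVneq x y.
      by rewrite (prop _ _ _ _ cP P11) ?E11 ?eqxx ?orbT //; [left|lra].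
    have [xy2|/eqP xy2] := eqVneq x (2 * y).
      by rewrite (prop _ _ _ _ cP P21) ?E21 ?eqxx ?orbT //; [left|lra].
    have [xy3|/eqP xy3] := eqVneq x (3 * y).
      by rewrite (prop _ _ _ _ cP P31) ?E31 ?eqxx ?orbT //; [left|lra].
    have [xy4|/eqP xy4] := eqVneq (2 * x) (3 * y).
      by rewrite (prop _ _ _ _ cP P32) ?eqxx ?orbT //; [left|lra].
    have i1 := iA _ _ cP x0 y0.
    have z1 : 0 < 3 * y - x by lra.
    have := iA _ _ (rA _ _ cP y0) z1 y0.
    have r2 := rw _ _ x (x - y) (rB _ _ cP x0) erefl.
    have {}r2 : x *: a + (x - y) *: b \in Pos by apply: r2; lra.
    have z2 : 0 < x - y by lra.
    have i2 := iA _ _ r2 x0 z2.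
    have z3 : 0 < 3 * (x - y) - x by lra.
    by have := iA _ _ (rA _ _ r2 z2) z3 z2; lra.
  by rewrite !inE => /orP[|/orP[|/orP[|/orP[|/orP[|]]]]]/eqP-> //; rewrite -?E11 -?E21 -?E31.
Qed.

End RankTwo.

(** * Flat sections *)

Local Notation "x %:F" := (@FracField.tofrac _ x).

(** * Integrability of the connection *)

Section Commutation.
Variables (l : nat) (Phi : seq 'rV[R]_l) (Delta : 'M[R]_l).
Hypotheses (rs : root_system Phi) (ss : simple_system Phi Delta).
Local Notation Pos := (Pos Phi Delta).
Local Notation S := {mpoly R[l]}.
Local Notation K := {fraction S}.

Definition Pm (a : 'rV[R]_l) : 'M[R]_l := 1%:M - refl_mx a.

Lemma mul_Pm a v : v *m Pm a = cr a v *: a.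
Proof. by rewrite mulmxBr mulmx1 -refl_mul reflE subKr. Qed.

Lemma PmN a : Pm (- a) = Pm a.
Proof.
congr (_ - _); apply/row_matrixP => i; rewrite !rowE -!refl_mul.
by rewrite reflNl.
Qed.

Lemma Pm_refl a b : a != 0 -> Pm (refl a b) = refl_mx a *m Pm b *m refl_mx a.
Proof.
move=> a0; apply/row_matrixP => i; rewrite !rowE !mulmxA !mul_Pm -scalemxAl -!refl_mul.
by rewrite -{1}[delta_mx 0 i](reflK a0) cr_refl.
Qed.

Definition Qall : S := \prod_(c <- Pos) linform c.
Definition Qwo a : S := \prod_(c <- Pos | c != a) linform c.
Definition Qwo2 a b : S := \prod_(c <- Pos | (c != a) && (c != b)) linform c.

Let uP : uniq Pos. Proof. exact: undup_uniq. Qed.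

Lemma Qall_split a : a \in Pos -> Qall = linform a * Qwo a.
Proof. by move=> aP; rewrite /Qall (bigD1_seq a) ?undup_uniq. Qed.

Lemma Qwo_split a b : b \in Pos -> a != b -> Qwo a = linform b * Qwo2 a b.
Proof.
move=> bP ab; rewrite /Qwo -big_filter (bigD1_seq b) /=; last by rewrite filter_uniq.
  by rewrite big_filter_cond.
by rewrite mem_filter bP eq_sym ab.
Qed.

Lemma Qall_neq0 : Qall != 0.
Proof.
by rewrite /Qall prodf_seq_neq0; apply/allP => a aP; rewrite /= linform_eq0 (Pos_neq0 rs aP).
Qed.

Lemma Qwo_ndvd a : a \in Pos -> ~ mdivides (linform a) (Qwo a).
Proof.
move=> aP; rewrite /Qwo -big_filter; apply: linform_ndvd_prod (Pos_neq0 rs aP) _ => b.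
rewrite mem_filter => /andP[ba bP]; apply: linform_ndvd_linform.
by have [_ _ H] := nprop_Pos rs ss; apply: H; rewrite // eq_sym.
Qed.

Lemma Qall_dvd p : (forall a, a \in Pos -> mdivides (linform a) p) -> mdivides Qall p.
Proof. by move=> H; apply: (@linform_prod_dvd _ Pos (fun=> 1%N)); [exact: nprop_Pos|]. Qed.

Lemma Qall_homog : Qall \is (size Pos).-homog.
Proof.
rewrite /Qall; elim: Pos => [|a s IHs]; first by rewrite big_nil dhomog1.
by rewrite big_cons -[size _]/(1 + size s)%N dhomogM // dhomog_linform.
Qed.

Lemma Qwo2_homog a b : a \in Pos -> b \in Pos -> a != b ->
  Qwo2 a b \is (size Pos - 2).-homog.
Proof.
move=> aP bP ab; have H (s : seq 'rV[R]_l) (P : pred 'rV[R]_l) :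
    \prod_(c <- s | P c) linform c \is (count P s).-homog.
  elim: s => [|c s IHs]; first by rewrite big_nil dhomog1.
  by rewrite big_cons /=; case: (P c) => //=; rewrite dhomogM // dhomog_linform.
rewrite /Qwo2; have := H Pos (fun c => (c != a) && (c != b)).
have : (count (fun c => (c != a) && (c != b)) Pos + 2 = size Pos)%N.
  rewrite -(count_predC (fun c => (c != a) && (c != b)) Pos); congr (_ + _)%N.
  rewrite (eq_count (a2 := predU (pred1 a) (pred1 b))); last first.
    by move=> c /=; rewrite negb_and !negbK.
  have := count_predUI (pred1 a) (pred1 b) Pos; rewrite !count_uniq_mem // aP bP.
  rewrite [count (predI _ _) _](eq_count (a2 := pred0)) ?count_pred0 ?addn0 //.
  by move=> c /=; case: eqP => //= ->; rewrite (negPf ab).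
by move=> <-; rewrite addnK.
Qed.

Section Point.
Variables xi eta : 'rV[R]_l.

Definition omega a b := dotv a xi * dotv b eta - dotv a eta * dotv b xi.

Lemma omega_anti a b : omega b a = - omega a b.
Proof. by rewrite /omega; ring. Qed.

Lemma omega_id a : omega a a = 0.
Proof. by rewrite /omega; ring. Qed.

(** [Qall] times the commutator of the connection matrices in the directions [xi] and [eta]. For
    [a = b] the factor [Qwo2 a b] would be too large by one degree, but there [omega] vanishes. *)
Definition commN : 'M[S]_l := \sum_(a <- Pos) \sum_(b <- Pos)
  (omega a b *: Qwo2 a b) *: map_mx (@mpolyC l R) (Pm a *m Pm b).

Lemma commN_homog i j : commN i j \is (size Pos - 2).-homog.
Proof.
rewrite summxE big_seq; apply: rpred_sum => a aP; rewrite summxE big_seq.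
apply: rpred_sum => b bP; rewrite !mxE mulrC mul_mpolyC rpredZ //.
have [->|ba] := eqVneq b a; first by rewrite omega_id scale0r rpred0.
by rewrite rpredZ // Qwo2_homog // eq_sym.
Qed.

(** Only terms containing [a] survive on the hyperplane of [a]. They cancel under the substitution
    of [s_a b] for [b]: it preserves [omega a b] and [dotv b v], whereas conjugation by [s_a]
    reverses the commutator of [Pm a] and [Pm b]. *)
Lemma commN_ev a v : a \in Pos -> dotv a v = 0 -> (Qwo a).@[v 0] != 0 ->
  map_mx (meval (v 0)) commN = 0.
Proof.
move=> aP av qv; have a0 := Pos_neq0 rs aP; have aPhi := Pos_root aP.
have bv b : b \in Pos -> b != a -> dotv b v != 0.
  move=> bP ba; apply: contraNneq qv => bv0; rewrite eq_sym in ba.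
  by rewrite (Qwo_split bP ba) mevalM ev_linform bv0 mul0r.
pose g b := ((omega a b) / dotv b v) *: (Pm a *m Pm b - Pm b *m Pm a).
have Q2 b : b \in Pos -> b != a -> (Qwo2 a b).@[v 0] = (Qwo a).@[v 0] / dotv b v.
  move=> bP ba; rewrite eq_sym in ba; rewrite (Qwo_split bP ba) mevalM ev_linform.
  by rewrite mulrC mulKf // bv // eq_sym.
have Q2C b : Qwo2 b a = Qwo2 a b by apply: eq_bigl => c; rewrite andbC.
pose T b c := (omega b c * (Qwo2 b c).@[v 0]) *: (Pm b *m Pm c).
have evT : map_mx (meval (v 0)) commN = \sum_(b <- Pos) \sum_(c <- Pos) T b c.
  rewrite /commN raddf_sum; apply: eq_bigr => b _; rewrite /= raddf_sum.
  apply: eq_bigr => c _; rewrite /= map_mxZ /= mevalZ -map_mx_comp; congr (_ *: _).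
  by apply/matrixP => i j; rewrite !mxE /= mevalC.
have T0 b c : b \in Pos -> b != a -> c != a -> T b c = 0.
  move=> bP ba ca; rewrite /T; suff -> : (Qwo2 b c).@[v 0] = 0 by rewrite mulr0 scale0r.
  rewrite /Qwo2 -big_filter (bigD1_seq a) /=; last by rewrite filter_uniq.
    by rewrite mevalM ev_linform av mul0r.
  by rewrite mem_filter aP ![a == _]eq_sym ba ca.
have gE : map_mx (meval (v 0)) commN = (Qwo a).@[v 0] *: \sum_(b <- Pos) g b.
  rewrite evT (bigD1_seq a) //= (bigD1_seq a) //= {1}/T omega_id mul0r scale0r add0r.
  rewrite [\sum_(b <- Pos) g b](bigD1_seq a) //= {1}/g subrr scaler0 add0r.
  rewrite scaler_sumr -big_split /= big_seq_cond [RHS]big_seq_cond.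
  apply: eq_bigr => b /andP[bP ba]; rewrite (bigD1_seq a) //= big1 ?addr0; last first.
    by move=> c ca; apply: T0.
  rewrite /T /g Q2C Q2 // (omega_anti a b) scalerA scalerBr mulNr scaleNr.
  by congr (_ *: _ - _ *: _); ring.
have gr b : g (refl a b) = - g b.
  rewrite /g Pm_refl // /omega.
  have -> : dotv (refl a b) v = dotv b v by rewrite -dotv_reflr // refl_fix // dotvC.
  have -> : dotv a xi * dotv (refl a b) eta - dotv a eta * dotv (refl a b) xi =
      dotv a xi * dotv b eta - dotv a eta * dotv b xi.
    by rewrite reflE !dotvBl !dotvZl; ring.
  rewrite -scalerN opprB; congr (_ *: _).
  have ss1 := refl_mx_mul a0; move: (Pm b) => P; rewrite /Pm.
  have E1 : refl_mx a *m (refl_mx a *m P *m refl_mx a) = P *m refl_mx a.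
    by rewrite !mulmxA ss1 mul1mx.
  have E2 : (refl_mx a *m P *m refl_mx a) *m refl_mx a = refl_mx a *m P.
    by rewrite -mulmxA ss1 mulmx1.
  rewrite !mulmxBl !mulmxBr !mul1mx !mulmx1 E1 E2.
  have E (x y z : 'M[R]_l) : x - y - (x - z) = z - y by rewrite opprB addrC addrA subrK.
  by rewrite !E.
have gN b : g (- b) = g b.
  rewrite /g PmN /omega !dotvNl !mulrN -opprD mulNr invrN mulrN opprK.
  by congr (_ / _ *: _); ring.
have := sum_Pos_refl rs ss aPhi gN; rewrite (eq_bigr _ (fun b _ => gr b)) sumrN.
have V2 (x : 'M[R]_l) : x *+ 2 = 0 -> x = 0.
  by rewrite -scaler_nat => /eqP; rewrite scaler_eq0 pnatr_eq0 => /eqP.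
move=> /(_ V2) E; rewrite gE (V2 (\sum_(b <- Pos) g b)) ?scaler0 //.
by rewrite mulr2n -{1}E addNr.
Qed.

(** Each entry is divisible by [Qall] but has degree two less. *)
Lemma commN0 : commN = 0.
Proof.
apply/matrixP => i j; rewrite [RHS]mxE; apply/eqP/negPn/negP => n0.
have sP : (0 < size Pos)%N.
  by rewrite lt0n size_eq0; apply: contraNneq n0 => P0; rewrite /commN P0 big_nil mxE.
have [r E] : mdivides Qall (commN i j).
  apply: Qall_dvd => a aP; have a0 := Pos_neq0 rs aP.
  have : mdivides (linform a) (Qwo a * commN i j).
    apply: linform_dvd => // v av; rewrite mevalM.
    have [->|qv] := eqVneq (Qwo a).@[v 0] 0; first by rewrite mul0r.
    have := commN_ev aP av qv; move/matrixP/(_ i j); rewrite !mxE => ->.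
    by rewrite mulr0.
  by case/(linform_prime a0) => // /(Qwo_ndvd aP).
have r0 : r != 0 by apply: contraNneq n0 => r0; rewrite E r0 mulr0.
have := congr1 (fun p => msize p) E; rewrite /= msizeM ?Qall_neq0 //.
have hs d (p : S) : p != 0 -> p \is d.-homog -> msize p = d.+1.
  move=> p0 pd; have := dhomog_uniq p0 pd (dhomog_msize pd) => ->.
  by rewrite -mpolySpred.
rewrite (hs _ _ n0 (commN_homog i j)) (hs _ _ Qall_neq0 Qall_homog).
have : (0 < msize r)%N by rewrite lt0n msize_poly_eq0.
by move: (msize r) => k; lia.
Qed.

End Point.
End Commutation.

Section FieldIdentities.
Variable F : fieldType.
Implicit Types x y d : F.

Lemma inv_deriv_identity x y d : x != 0 -> d * x^-1 + x * y = 0 -> y = - d / x ^+ 2.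
Proof.
move=> x0 /eqP; rewrite addrC addr_eq0 => /eqP E.
by apply: (mulfI x0); rewrite E; field.
Qed.

Lemma two_forms_identity o x y q : x != 0 -> y != 0 ->
  (x * (y * q)) * (o / (x * y)) = o * q :> F.
Proof. by move=> x0 y0; field; rewrite x0 y0. Qed.

End FieldIdentities.

(** * Regular sections of the connection and parallel transport *)

Section Connection.
Variables (l : nat) (Phi : seq 'rV[R]_l) (Delta : 'M[R]_l).
Hypotheses (rs : root_system Phi) (ss : simple_system Phi Delta).
Variable m : nat.
Local Notation Pos := (Pos Phi Delta).
Local Notation Qall := (Qall Phi Delta).
Local Notation Qwo := (Qwo Phi Delta).
Local Notation S := {mpoly R[l]}.

(* [K] is the fraction field of [S], kept abstract so that unification never unfolds it. *)
Variables (K : fieldType) (tau : {rmorphism S -> K}) (dK : 'rV[R]_l -> {additive K -> K}).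
Hypothesis tau_inj : injective tau.
Hypothesis tau_frac : forall x : K, exists n d, d != 0 /\ x = tau n / tau d.
Hypothesis dKM : forall xi x y, dK xi (x * y) = dK xi x * y + x * dK xi y.
Hypothesis dK_tau : forall xi p, dK xi (tau p) = tau (dirD xi p).

Definition kc (c : R) : K := tau c%:MP.
HB.instance Definition _ := GRing.RMorphism.copy kc (tau \o @mpolyC l R).

Definition lK (a : 'rV[R]_l) : K := tau (linform a).

Lemma tau_eq0 p : (tau p == 0) = (p == 0).
Proof. by rewrite -(rmorph0 tau) (inj_eq tau_inj). Qed.

Lemma dK_kc xi c : dK xi (kc c) = 0.
Proof. by rewrite dK_tau dirDC rmorph0. Qed.

Lemma dK_lK xi a : dK xi (lK a) = kc (dotv a xi).
Proof. by rewrite dK_tau dirD_linform. Qed.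

Lemma dK_inv xi x : x != 0 -> dK xi x^-1 = - dK xi x / x ^+ 2.
Proof.
move=> x0; apply: inv_deriv_identity => //; rewrite -dKM mulfV //.
by rewrite -(rmorph1 kc) dK_kc.
Qed.

Lemma dirD_linearl (xi eta : 'rV[R]_l) (c : R) (p : S) :
  dirD (c *: xi + eta) p = c *: dirD xi p + dirD eta p.
Proof.
rewrite /dirD scaler_sumr -big_split; apply: eq_bigr => i _ /=.
by rewrite !mxE scalerDl scalerA.
Qed.

Lemma dK_linearl (xi eta : 'rV[R]_l) (c : R) x :
  dK (c *: xi + eta) x = kc c * dK xi x + dK eta x.
Proof.
have [n [d [d0 xE]]] := tau_frac x; have dF0 : tau d != 0 by rewrite tau_eq0.
have E : x * tau d = tau n by rewrite xE mulfVK.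
have H h : dK h x * tau d = tau (dirD h n) - x * tau (dirD h d).
  by rewrite -!dK_tau -E dKM addrK.
apply: (mulIf dF0); rewrite mulrDl -mulrA !H !dirD_linearl.
by rewrite -!mul_mpolyC !rmorphD !rmorphM /= /kc; ring.
Qed.

Lemma dK_comm xi eta x : dK xi (dK eta x) = dK eta (dK xi x).
Proof.
have [n [d [d0 xE]]] := tau_frac x; have dF0 : tau d != 0 by rewrite tau_eq0.
have E : x * tau d = tau n by rewrite xE mulfVK.
have := congr1 (fun y => dK xi (dK eta y) - dK eta (dK xi y)) E.
rewrite /= !dK_tau dirD_comm subrr !dKM !raddfD /= !dKM !dK_tau => H.
apply/eqP; rewrite -subr_eq0 -(inj_eq (mulIf dF0)) mul0r; apply/eqP; rewrite -[RHS]H.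
by rewrite (dirD_comm xi eta d); ring.
Qed.

Definition KM xi : 'M[K]_l := \sum_(a <- Pos) (kc (dotv a xi) / lK a) *: map_mx kc (Pm a).

Definition nab r xi (z : 'M[K]_(r, l)) : 'M[K]_(r, l) := map_mx (dK xi) z - m%:R *: (z *m KM xi).

Lemma lK_neq0 a : a \in Pos -> lK a != 0.
Proof. by move=> aP; rewrite tau_eq0 linform_eq0 (Pos_neq0 rs aP). Qed.

Lemma KM_comm xi eta : KM xi *m KM eta = KM eta *m KM xi.
Proof.
have QF0 : tau Qall != 0 by rewrite tau_eq0 Qall_neq0.
apply/eqP; rewrite -subr_eq0 -(inj_eq (scalerI QF0)) scaler0; apply/eqP.
have mulKM x y : KM x *m KM y = \sum_(a <- Pos) \sum_(b <- Pos)
    (kc (dotv a x * dotv b y) / (lK a * lK b)) *: map_mx kc (Pm a *m Pm b).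
  rewrite {1}/KM mulmx_suml; apply: eq_bigr => a _; rewrite mulmx_sumr.
  apply: eq_bigr => b _; rewrite -scalemxAl -scalemxAr scalerA map_mxM rmorphM /=.
  by rewrite mulf_div.
rewrite !mulKM -sumrB scaler_sumr.
transitivity (map_mx tau (commN Phi Delta xi eta)); last first.
  by rewrite commN0 // map_mx0.
rewrite /commN raddf_sum [LHS]big_seq [RHS]big_seq; apply: eq_bigr => a aP /=.
rewrite -sumrB scaler_sumr [RHS]raddf_sum [LHS]big_seq [RHS]big_seq; apply: eq_bigr => b bP /=.
rewrite map_mxZ /= -map_mx_comp -scalerBl scalerA; congr (_ *: _).
have [a0 b0] := (lK_neq0 aP, lK_neq0 bP).
rewrite -mulrBl -rmorphB /= -/(omega xi eta a b) -mul_mpolyC rmorphM -/(kc _) /=.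
have [<-|ab] := eqVneq a b; first by rewrite omega_id rmorph0 !mul0r mulr0.
rewrite (Qall_split aP) (Qwo_split bP ab) !rmorphM -/(lK a) -/(lK b).
exact: two_forms_identity.
Qed.

Lemma dK_mulmx r s t xi (A : 'M[K]_(r, s)) (B : 'M[K]_(s, t)) :
  map_mx (dK xi) (A *m B) = map_mx (dK xi) A *m B + A *m map_mx (dK xi) B.
Proof.
apply/matrixP => i j; rewrite !mxE raddf_sum -big_split; apply: eq_bigr => k _ /=.
by rewrite dKM !mxE.
Qed.

Lemma dK_scale r s xi c (A : 'M[K]_(r, s)) :
  map_mx (dK xi) (c *: A) = dK xi c *: A + c *: map_mx (dK xi) A.
Proof. by apply/matrixP => i j; rewrite !mxE dKM. Qed.

Lemma dK_kcmx r s xi (A : 'M[R]_(r, s)) : map_mx (dK xi) (map_mx kc A) = 0.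
Proof. by apply/matrixP => i j; rewrite !mxE dK_kc. Qed.

Lemma dK_nat xi n : dK xi n%:R = 0.
Proof. by rewrite -(rmorph_nat kc) dK_kc. Qed.

(** The connection form combines logarithmic differentials with constant matrices, hence is
    closed. *)
Lemma dK_KM xi eta : map_mx (dK xi) (KM eta) = map_mx (dK eta) (KM xi).
Proof.
rewrite /KM !raddf_sum big_seq [RHS]big_seq; apply: eq_bigr => a aP /=.
rewrite !dK_scale !dK_kcmx !scaler0 !addr0; congr (_ *: _).
rewrite !dKM !dK_kc !dK_inv ?lK_neq0 // !dK_lK !mul0r !add0r !mulrA; congr (_ / _).
by rewrite !mulrN mulrC.
Qed.

Lemma nabD r xi (y z : 'M[K]_(r, l)) : nab xi (y + z) = nab xi y + nab xi z.
Proof. by rewrite /nab map_mxD mulmxDl scalerDr opprD addrACA. Qed.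

Lemma nab0 r xi : nab xi (0 : 'M[K]_(r, l)) = 0.
Proof. by rewrite /nab map_mx0 mul0mx scaler0 subr0. Qed.

Lemma nab_sum r xi (I : Type) (s : seq I) (P : pred I) (F : I -> 'M[K]_(r, l)) :
  nab xi (\sum_(i <- s | P i) F i) = \sum_(i <- s | P i) nab xi (F i).
Proof. by elim/big_rec2: _ => [|i y1 y2 _ <-]; rewrite ?nab0 ?nabD. Qed.

Lemma nabZ r xi c (z : 'M[K]_(r, l)) : nab xi (c *: z) = dK xi c *: z + c *: nab xi z.
Proof. by rewrite /nab dK_scale -scalemxAl !scalerBr !scalerA addrA mulrC. Qed.

Lemma nab_mulmx r s xi (g : 'M[K]_(r, s)) (z : 'M[K]_(s, l)) :
  nab xi (g *m z) = map_mx (dK xi) g *m z + g *m nab xi z.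
Proof. by rewrite /nab dK_mulmx mulmxBr -scalemxAr mulmxA addrA. Qed.

Lemma KM_linear (xi eta : 'rV[R]_l) (c : R) : KM (c *: xi + eta) = kc c *: KM xi + KM eta.
Proof.
rewrite /KM scaler_sumr -big_split; apply: eq_bigr => a _ /=.
rewrite scalerA -scalerDl; congr (_ *: _).
by rewrite dotvDr dotvZr rmorphD rmorphM /= mulrDl mulrA.
Qed.

Lemma nab_linearl r (xi eta : 'rV[R]_l) (c : R) (z : 'M[K]_(r, l)) :
  nab (c *: xi + eta) z = kc c *: nab xi z + nab eta z.
Proof.
rewrite /nab KM_linear mulmxDr -scalemxAr scalerBr !scalerDr opprD.
have -> : map_mx (dK (c *: xi + eta)) z = kc c *: map_mx (dK xi) z + map_mx (dK eta) z.
  by apply/matrixP => i j; rewrite !mxE dK_linearl.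
by rewrite !scalerA (mulrC m%:R) addrACA.
Qed.

(** Zero curvature: closedness of the connection form together with the commutation of its
    matrices. *)
Lemma nab_comm r xi eta (z : 'M[K]_(r, l)) : nab xi (nab eta z) = nab eta (nab xi z).
Proof.
rewrite {1 3}/nab; have mapB (x y : 'M[K]_(r, l)) h : map_mx (dK h) (x - y) = map_mx (dK h) x - map_mx (dK h) y.
  by rewrite raddfB.
have mapn (x : 'M[K]_(r, l)) h : map_mx (dK h) (m%:R *: x) = m%:R *: map_mx (dK h) x.
  by rewrite dK_scale dK_nat scale0r add0r.
rewrite /nab !mapB !mapn !dK_mulmx !mulmxBl -!scalemxAl -!mulmxA (KM_comm eta xi) (dK_KM eta xi).
have -> : map_mx (dK xi) (map_mx (dK eta) z) = map_mx (dK eta) (map_mx (dK xi) z).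
  by apply/matrixP => i j; rewrite !mxE dK_comm.
rewrite !scalerDr !scalerN -!addrA -!opprD; congr (_ - _).
by rewrite addrACA [RHS]addrACA (addrC (_ *: (_ *m _ : 'M[K]_(r, l)))).
Qed.

Section LocalRing.
Variable a : 'rV[R]_l.
Hypothesis aP : a \in Pos.

Let a0 : a != 0. Proof. exact: (Pos_neq0 rs aP). Qed.

(** The local ring of the hyperplane of [a], inside the fraction field. *)
Definition Oa (x : K) := exists n d, ~ mdivides (linform a) d /\ x = tau n / tau d.
Definition Omx r s (A : 'M[K]_(r, s)) := forall i j, Oa (A i j).

Let ndvd_neq0 d : ~ mdivides (linform a) d -> tau d != 0.
Proof. by rewrite tau_eq0 => nd; apply/eqP => d0; apply: nd; rewrite d0; apply: mdvd0. Qed.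

Lemma Oa_tau p : Oa (tau p).
Proof. by exists p, 1; rewrite rmorph1 divr1; split=> //; apply: linform_ndvd1. Qed.
Lemma Oa_inv d : ~ mdivides (linform a) d -> Oa (tau d)^-1.
Proof. by move=> nd; exists 1, d; rewrite rmorph1 div1r. Qed.
Lemma OaD x y : Oa x -> Oa y -> Oa (x + y).
Proof.
move=> [n [d [nd ->]]] [n' [d' [nd' ->]]]; exists (n * d' + n' * d), (d * d').
by rewrite addf_div ?ndvd_neq0 // !rmorphD !rmorphM; split=> //; apply: (linform_ndvdM a0).
Qed.
Lemma OaM x y : Oa x -> Oa y -> Oa (x * y).
Proof.
move=> [n [d [nd ->]]] [n' [d' [nd' ->]]]; exists (n * n'), (d * d').
by rewrite mulf_div !rmorphM; split=> //; apply: (linform_ndvdM a0).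
Qed.
Lemma Oa_kc c : Oa (kc c). Proof. exact: Oa_tau. Qed.
Lemma Oa0 : Oa 0. Proof. by rewrite -(rmorph0 tau); apply: Oa_tau. Qed.
Lemma Oa_nat n : Oa n%:R. Proof. by rewrite -(rmorph_nat tau); apply: Oa_tau. Qed.
Lemma OaN x : Oa x -> Oa (- x).
Proof. by move=> ox; rewrite -mulN1r -(rmorphN1 tau); apply: OaM => //; apply: Oa_tau. Qed.
Lemma OaX x n : Oa x -> Oa (x ^+ n).
Proof.
by move=> ox; elim: n => [|n IHn]; [exact: (Oa_nat 1)|rewrite exprS; apply: OaM].
Qed.
Lemma Oa_sum (I : Type) (r : seq I) (P : pred I) F :
  (forall i, P i -> Oa (F i)) -> Oa (\sum_(i <- r | P i) F i).
Proof. by move=> H; apply: big_ind => //; [exact: Oa0|exact: OaD]. Qed.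
Lemma Oa_dK xi x : Oa x -> Oa (dK xi x).
Proof.
move=> [n [d [nd xE]]]; have d0 := ndvd_neq0 nd.
have E : x * tau d = tau n by rewrite xE mulfVK.
have -> : dK xi x = (tau (dirD xi n) - x * tau (dirD xi d)) / tau d.
  by rewrite -!dK_tau -E dKM addrK mulfK.
apply: OaM; last exact: Oa_inv; apply: OaD; first exact: Oa_tau.
by apply: OaN; apply: OaM; [exists n, d|exact: Oa_tau].
Qed.

Lemma OmxD r s (A B : 'M[K]_(r, s)) : Omx A -> Omx B -> Omx (A + B).
Proof. by move=> oA oB i j; rewrite mxE; apply: OaD. Qed.
Lemma OmxZ r s c (A : 'M[K]_(r, s)) : Oa c -> Omx A -> Omx (c *: A).
Proof. by move=> oc oA i j; rewrite mxE; apply: OaM. Qed.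
Lemma OmxN r s (A : 'M[K]_(r, s)) : Omx A -> Omx (- A).
Proof. by move=> oA i j; rewrite mxE; apply: OaN. Qed.
Lemma OmxB r s (A B : 'M[K]_(r, s)) : Omx A -> Omx B -> Omx (A - B).
Proof. by move=> oA oB; apply: OmxD => //; apply: OmxN. Qed.
Lemma OmxM r s q (A : 'M[K]_(r, s)) (B : 'M[K]_(s, q)) : Omx A -> Omx B -> Omx (A *m B).
Proof. by move=> oA oB i j; rewrite mxE; apply: Oa_sum => k _; apply: OaM. Qed.
Lemma Omx_dK r s xi (A : 'M[K]_(r, s)) : Omx A -> Omx (map_mx (dK xi) A).
Proof. by move=> oA i j; rewrite mxE; apply: Oa_dK. Qed.
Lemma Omx_kc r s (A : 'M[R]_(r, s)) : Omx (map_mx kc A).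
Proof. by move=> i j; rewrite mxE; apply: Oa_kc. Qed.

Local Notation t := (lK a).
Let t0 : t != 0. Proof. exact: (lK_neq0 aP). Qed.
Let nu := (dotv a a)^-1 *: a.
Let a_nu : dotv a nu = 1.
Proof. by rewrite dotvZr mulVf // dotv_eq0. Qed.
Let Oa_t : Oa t. Proof. exact: Oa_tau. Qed.

Definition KR xi : 'M[K]_l :=
  \sum_(b <- Pos | b != a) (kc (dotv b xi) / lK b) *: map_mx kc (Pm b).

Lemma Omx_KR xi : Omx (KR xi).
Proof.
rewrite /KR big_seq_cond; apply: big_ind => [i j|A B|b /andP[bP ba]].
- by rewrite mxE; apply: Oa0.
- exact: OmxD.
- apply: OmxZ; last exact: Omx_kc.
  apply: OaM; [exact: Oa_kc|apply: Oa_inv; apply: linform_ndvd_linform].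
  by have [_ _ H] := nprop_Pos rs ss; apply: H; rewrite // eq_sym.
Qed.

Lemma KM_split xi : KM xi = (kc (dotv a xi) / t) *: map_mx kc (Pm a) + KR xi.
Proof. by rewrite /KM (bigD1_seq a) ?undup_uniq. Qed.

Lemma Omx_nab_tangent r xi (z : 'M[K]_(r, l)) : dotv a xi = 0 -> Omx z -> Omx (nab xi z).
Proof.
move=> axi oz; rewrite /nab KM_split axi rmorph0 mul0r scale0r add0r.
apply: OmxB; first exact: Omx_dK; apply: OmxZ; first exact: Oa_nat.
by apply: OmxM => //; apply: Omx_KR.
Qed.

(** Regularity along [a] is not preserved by [nab], which has a pole there. Demanding it of all
    iterated normal derivatives gives a condition that is preserved: tangential derivatives have no
    pole along [a] and commute with the normal one. *)
Definition reg r (z : 'M[K]_(r, l)) := forall b, Omx (iter b (nab nu) z).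

Lemma reg_nab r xi (z : 'M[K]_(r, l)) : reg z -> reg (nab xi z).
Proof.
move=> rz b; pose y := xi - dotv a xi *: nu.
have ay : dotv a y = 0 by rewrite dotvBr dotvZr a_nu mulr1 subrr.
have -> : xi = dotv a xi *: nu + y by rewrite addrC subrK.
have itD (u v : 'M[K]_(r, l)) : iter b (nab nu) (u + v) = iter b (nab nu) u + iter b (nab nu) v.
  by elim: (b) => //= k ->; rewrite nabD.
have itZ c (u : 'M[K]_(r, l)) : iter b (nab nu) (kc c *: u) = kc c *: iter b (nab nu) u.
  by elim: (b) => //= k ->; rewrite nabZ dK_kc scale0r add0r.
have itC (u : 'M[K]_(r, l)) : iter b (nab nu) (nab y u) = nab y (iter b (nab nu) u).
  by elim: (b) => //= k ->; rewrite nab_comm.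
rewrite nab_linearl itD itZ itC; apply: OmxD; last exact: Omx_nab_tangent.
by apply: OmxZ; [exact: Oa_kc|rewrite -iterSr; apply: rz].
Qed.

Lemma regD r (y z : 'M[K]_(r, l)) : reg y -> reg z -> reg (y + z).
Proof.
move=> ry rz b; have -> : iter b (nab nu) (y + z) = iter b (nab nu) y + iter b (nab nu) z.
  by elim: b => //= b ->; rewrite nabD.
exact: OmxD.
Qed.

Lemma reg_scale r g (z : 'M[K]_(r, l)) : Oa g -> reg z -> reg (g *: z).
Proof.
move=> og rz b; elim: b g z og rz => [|b IHb] g z og rz; first exact: OmxZ (rz 0%N).
rewrite iterSr nabZ; have itD (u v : 'M[K]_(r, l)) :
    iter b (nab nu) (u + v) = iter b (nab nu) u + iter b (nab nu) v.
  by elim: (b) => //= k ->; rewrite nabD.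
rewrite itD; apply: OmxD; first by apply: IHb => //; apply: Oa_dK.
by apply: IHb => //; apply: reg_nab.
Qed.

Variable sg : {rmorphism K -> K}.
Hypothesis sg_tau : forall p, sg (tau p) = tau (msub (refl_mx a) p).
Hypothesis m_gt0 : (0 < m)%N.

Lemma sg_kc c : sg (kc c) = kc c.
Proof. by rewrite sg_tau msubC. Qed.

Lemma sg_lK b : sg (lK b) = lK (refl a b).
Proof. by rewrite sg_tau msub_linform refl_mx_tr // -refl_mul. Qed.

Lemma sg_t : sg t = - t.
Proof. by rewrite sg_lK refl_id // /lK linformN rmorphN. Qed.

Let hyp_fix v : dotv a v = 0 -> v *m refl_mx a = v.
Proof. by move=> av; rewrite -refl_mul refl_fix // dotvC. Qed.

Lemma sg_congr x : Oa x -> exists2 y, Oa y & sg x - x = t * y.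
Proof.
move=> [n [d [nd ->]]]; set n' := msub (refl_mx a) n; set d' := msub (refl_mx a) d.
have nd' : ~ mdivides (linform a) d'.
  have [v av dv] := linform_ndvd_point a0 nd => /linform_dvd_ev/(_ av)/eqP.
  by rewrite ev_msub hyp_fix // (negPf dv).
have [r E] : mdivides (linform a) (n' * d - n * d').
  apply: linform_dvd => // v av; rewrite mevalB !mevalM !ev_msub hyp_fix //; ring.
exists (tau r / tau (d' * d)).
  by exists r, (d' * d); split=> //; apply: linform_ndvdM.
have [td td'] := (ndvd_neq0 nd, ndvd_neq0 nd').
rewrite fmorph_div !sg_tau -/n' -/d' -mulNr -rmorphN addf_div // mulrA -!rmorphM -rmorphD.
by rewrite -E mulNr.
Qed.

Lemma sg_dK xi x : sg (dK xi x) = dK (refl a xi) (sg x).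
Proof.
have dmsub p : msub (refl_mx a) (dirD xi p) = dirD (refl a xi) (msub (refl_mx a) p).
  rewrite /dirD raddf_sum /=; under eq_bigr => i _ do rewrite msubZ.
  under [RHS]eq_bigr => i _ do rewrite mderiv_msub scaler_sumr.
  rewrite exchange_big /=; apply: eq_bigr => i _.
  under eq_bigr => j _ do rewrite scalerA; rewrite -scaler_suml; congr (_ *: _).
  by rewrite -[in LHS](reflK a0 xi) refl_mul mxE.
have [n [d [d0 xE]]] := tau_frac x; have dF0 : tau d != 0 by rewrite tau_eq0.
have E : x * tau d = tau n by rewrite xE mulfVK.
have sd0 : sg (tau d) != 0 by rewrite fmorph_eq0.
apply: (mulIf sd0); rewrite -rmorphM.
have -> : dK xi x * tau d = tau (dirD xi n) - x * tau (dirD xi d).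
  by rewrite -!dK_tau -E dKM addrK.
rewrite rmorphB rmorphM /= !sg_tau !dmsub -!dK_tau -!sg_tau -E rmorphM dKM.
by rewrite addrK.
Qed.

Definition sig r (z : 'M[K]_(r, l)) := map_mx sg z *m map_mx kc (refl_mx a).

Lemma char_K2 r s (x : 'M[K]_(r, s)) : x *+ 2 = 0 -> x = 0.
Proof.
rewrite -scaler_nat => /eqP; rewrite scaler_eq0 => /orP[|/eqP//].
by rewrite -(rmorph_nat kc) tau_eq0 mpolyC_eq0 pnatr_eq0.
Qed.

Lemma sg_KM xi : map_mx kc (refl_mx a) *m map_mx sg (KM xi) *m map_mx kc (refl_mx a) =
  KM (refl a xi).
Proof.
pose G b := (kc (dotv b (refl a xi)) / lK b) *: map_mx kc (Pm b).
have GN b : G (- b) = G b.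
  by rewrite /G PmN dotvNl /lK linformN !rmorphN /= invrN mulrNN.
rewrite {2}/KM -[RHS](sum_Pos_refl rs ss (Pos_root aP) GN); last exact: char_K2.
rewrite /KM raddf_sum mulmx_sumr mulmx_suml; apply: eq_bigr => b _ /=.
have E1 : sg (kc (dotv b xi) / lK b) = kc (dotv b xi) / lK (refl a b).
  by rewrite fmorph_div sg_kc sg_lK.
have E2 : map_mx sg (map_mx kc (Pm b)) = map_mx kc (Pm b).
  by apply/matrixP => i j; rewrite !mxE sg_kc.
by rewrite map_mxZ E1 E2 -scalemxAr -scalemxAl /G dotv_refl // Pm_refl // !map_mxM.
Qed.

Lemma kc_refl2 : map_mx kc (refl_mx a) *m map_mx kc (refl_mx a) = 1%:M.
Proof. by rewrite -map_mxM refl_mx_mul // map_mx1. Qed.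

Lemma sig_nab r xi (z : 'M[K]_(r, l)) : sig (nab xi z) = nab (refl a xi) (sig z).
Proof.
rewrite /sig /nab map_mxB mulmxBl map_mxZ -scalemxAl rmorph_nat map_mxM /=; congr (_ - _ *: _).
  rewrite dK_mulmx dK_kcmx mulmx0 addr0; congr (_ *m _).
  by apply/matrixP => i j; rewrite !mxE sg_dK.
by rewrite -sg_KM !mulmxA -(mulmxA (map_mx sg z) (map_mx kc (refl_mx a))) kc_refl2 mulmx1.
Qed.

Lemma sigZ r c (z : 'M[K]_(r, l)) : sig (c *: z) = sg c *: sig z.
Proof. by rewrite /sig map_mxZ scalemxAl. Qed.

Lemma sigB r (y z : 'M[K]_(r, l)) : sig (y - z) = sig y - sig z.
Proof. by rewrite /sig map_mxB mulmxBl. Qed.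

Lemma nab_nu_t k r (w : 'M[K]_(r, l)) : nab nu (t ^+ k.+1 *: w) =
  t ^+ k *: (k.+1%:R *: w - m%:R *: (w *m map_mx kc (Pm a))) +
  t ^+ k.+1 *: (map_mx (dK nu) w - m%:R *: (w *m KR nu)).
Proof.
have dt : dK nu (t ^+ k.+1) = k.+1%:R * t ^+ k.
  elim: (k) => [|j IHj]; first by rewrite expr1 dK_lK a_nu rmorph1 expr0 mulr1.
  by rewrite exprS dKM IHj dK_lK a_nu rmorph1 mul1r mulrCA -exprS -[in RHS]natr1 mulrDl mul1r addrC.
rewrite nabZ dt /nab KM_split a_nu rmorph1 mulmxDr -scalemxAr.
rewrite !scalerBr !scalerDr !scalerA opprD !addrA; congr (_ - _).
rewrite addrAC; congr (_ + _); rewrite mulrC; congr (_ - _ *: _).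
by rewrite exprS; field.
Qed.

(** One more order of flatness in the normal direction. Adding [t^(k+1) w] changes the leading term
    through [w |-> (k+1) w - m w Pm a], with eigenvalues [k+1] and [k+1-2m]. The only resonance is
    [k+1 = 2m], where invariance under [sig] makes the obstructing component divisible by [t]; this
    is where a logarithm would otherwise arise. *)
Lemma nab_step k r (z u : 'M[K]_(r, l)) : (k < 2 * m)%N -> sig z = z ->
  nab nu z = t ^+ k *: u -> Omx u ->
  exists w u', [/\ Omx w, Omx u', sig (z - t ^+ k.+1 *: w) = z - t ^+ k.+1 *: w &
    nab nu (z - t ^+ k.+1 *: w) = t ^+ k.+1 *: u'].
Proof.
move=> km ez nz ou.
have su : sig u = (-1) ^+ k.+1 *: u.
  have nu_refl : refl a nu = - nu by rewrite reflZ refl_id // scalerN.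
  have nabN (y : 'M[K]_(r, l)) : nab (- nu) y = - nab nu y.
    have := nab_linearl nu 0 (-1) y; rewrite scaleN1r addr0 rmorphN1 scaleN1r => ->.
    have := nab_linearl (0 : 'rV[R]_l) 0 1 y; rewrite scaler0 addr0 rmorph1 scale1r.
    by move/eqP; rewrite -subr_eq0 opprD addrA subrr sub0r oppr_eq0 => /eqP ->; rewrite addr0.
  have := sig_nab nu z; rewrite ez nu_refl nabN nz sigZ rmorphXn /= sg_t => E.
  have tk0 : t ^+ k != 0 by rewrite expf_neq0.
  apply: (scalerI tk0); rewrite scalerA exprS mulN1r mulrN scaleNr -scalerN mulrC -scalerA.
  have <- : (-1) ^+ k *: ((- t) ^+ k *: sig u) = t ^+ k *: sig u.
    by rewrite scalerA [(- t) ^+ k]exprNn mulrA -expr2 sqrr_sign mul1r.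
  by rewrite E -scalerN.
pose e : 'M[R]_l := 2^-1 *: Pm a.
have PmE : Pm a = 2 *: e by rewrite scalerA mulfV ?scale1r // pnatr_eq0.
have ee : e *m e = e.
  have PP : Pm a *m Pm a = 2 *: Pm a.
    apply/row_matrixP => i; rewrite !rowE mulmxA -scalemxAr !mul_Pm crZ cr_id // scalerA.
    by rewrite mulrC.
  by rewrite /e -scalemxAl -scalemxAr PP !scalerA -mulrA mulVf ?mulr1 // pnatr_eq0.
have eE : e = 2^-1 *: Pm a by [].
clearbody e.
(* The value [0] at the resonance leaves the component [del *: e] uncorrected; it is absorbed into
   the next order by [uy]. *)
pose c : R := if k.+1 == (2 * m)%N then 0 else (k.+1%:R - 2 * m%:R)^-1.
pose W : 'M[R]_l := k.+1%:R^-1 *: (1%:M - e) + c *: e.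
have k0 : k.+1%:R != 0 :> R by rewrite pnatr_eq0.
pose del : R := if k.+1 == (2 * m)%N then 1 else 0.
have WE : k.+1%:R *: W - m%:R *: (W *m Pm a) = 1%:M - del *: e.
  rewrite /W PmE mulmxDl -!scalemxAl -!scalemxAr mulmxBl mul1mx ee subrr !scaler0 add0r.
  rewrite scalerDr !scalerA mulfV // scale1r -addrA -scalerBl -addrA -[- e]scaleN1r -scalerDl.
  rewrite -scaleNr; congr (_ + _ *: _).
  rewrite /c /del; case: ifP => [_|/eqP k2]; first by ring.
  have : k.+1%:R - 2 * m%:R != 0 :> R.
    by rewrite subr_eq0 -natrM eqr_nat; apply/eqP.
  by move: (k.+1%:R : R) (m%:R : R) => x y xy; field.
pose w := u *m map_mx kc W; have ow : Omx w by apply: OmxM => //; apply: Omx_kc.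
(* At the resonance [k+1] is even, hence [u] is invariant and [u *m Pm a] is the difference of [u]
   and [sg u], a multiple of [t]. *)
have [y oy uy] : exists2 y, Omx y & kc del *: (u *m map_mx kc e) = t *: y.
  rewrite /del; case: ifP => [/eqP k2|_]; last first.
    exists 0; last by rewrite rmorph0 scale0r scaler0.
    by move=> i j; rewrite mxE; apply: Oa0.
  have su1 : map_mx sg u = u *m map_mx kc (refl_mx a).
    move: su; rewrite k2 exprM sqrrN !expr1n scale1r /sig => {2}<-.
    by rewrite -mulmxA kc_refl2 mulmx1.
  have [f fP] : exists f : 'I_r -> 'I_l -> K, forall i j, Oa (f i j) /\ sg (u i j) - u i j = t * f i j.
    have H i j : {y : K | Oa y /\ sg (u i j) - u i j = t * y}.
      by apply: boolp.cid; have [y oy yE] := sg_congr (ou i j); exists y.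
    by exists (fun i j => sval (H i j)) => i j; apply: (svalP (H i j)).
  exists (kc (- 2^-1) *: \matrix_(i, j) f i j).
    by apply: OmxZ; [exact: Oa_kc|move=> i j; rewrite mxE; case: (fP i j)].
  have -> : u *m map_mx kc e = kc (- 2^-1) *: (map_mx sg u - u).
    rewrite eE map_mxZ -scalemxAr rmorphN scaleNr -scalerN opprB su1.
    by rewrite /Pm map_mxB map_mx1 mulmxBr mulmx1.
  rewrite rmorph1 scale1r; apply/matrixP => i j; rewrite !mxE; case: (fP i j) => _ ->.
  by rewrite mulrCA.
exists w, (y - (map_mx (dK nu) w - m%:R *: (w *m KR nu))); split=> //.
- apply: OmxB => //; apply: OmxB; first exact: Omx_dK.
  by apply: OmxZ; [exact: Oa_nat|apply: OmxM => //; apply: Omx_KR].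
- rewrite sigB ez sigZ; congr (_ - _).
  rewrite rmorphXn /= sg_t.
  have -> : sig w = (-1) ^+ k.+1 *: w.
    have We : W *m refl_mx a = refl_mx a *m W.
      have -> : refl_mx a = 1%:M - 2 *: e by rewrite -PmE subKr.
      rewrite mulmxBr mulmxBl mulmx1 mul1mx -scalemxAr -scalemxAl; congr (_ - _ *: _).
      rewrite /W mulmxDl mulmxDr -!scalemxAl -!scalemxAr mulmxBl mulmxBr mul1mx mulmx1.
      by [].
    rewrite /sig /w map_mxM -mulmxA -!map_mx_comp.
    have -> : map_mx (sg \o kc) W = map_mx kc W.
      by apply/matrixP => i j; rewrite !mxE /= sg_kc.
    by rewrite -map_mxM We map_mxM mulmxA -/(sig u) su scalemxAl.
  by rewrite scalerA -exprMn mulrN1 opprK.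
- have nabB (y1 y2 : 'M[K]_(r, l)) : nab nu (y1 - y2) = nab nu y1 - nab nu y2.
    have := nabD nu (y1 - y2) y2; rewrite subrK => ->; by rewrite addrK.
  rewrite nabB nz nab_nu_t opprD addrA -scalerBr.
  have -> : k.+1%:R *: w - m%:R *: (w *m map_mx kc (Pm a)) = u - t *: y.
    rewrite -uy /w -mulmxA -map_mxM scalemxAr scalemxAr -mulmxBr.
    rewrite -(rmorph_nat kc k.+1) -(rmorph_nat kc m) -!map_mxZ -map_mxB WE map_mxB map_mx1.
    by rewrite mulmxBr mulmx1 map_mxZ scalemxAr.
  by rewrite subKr scalerA -exprSr [in RHS]scalerBr.
Qed.

(** The constant term is the projection that annihilates the residue [Pm a], so it is flat to order
    zero; [nab_step] is then iterated [2 m] times. This frame accounts for the exponent [0] only. *)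
Lemma even_frame : exists Z Y U : 'M[K]_l,
  [/\ Omx Z, Omx Y, Omx U, Z = map_mx kc (1%:M - 2^-1 *: Pm a) + t *: Y &
     nab nu Z = t ^+ (2 * m) *: U].
Proof.
set Z0 := map_mx kc _.
suff H k : (k <= 2 * m)%N -> exists Z Y U : 'M[K]_l,
    [/\ Omx Y, Omx U, sig Z = Z, Z = Z0 + t *: Y & nab nu Z = t ^+ k *: U].
  have [Z [Y [U [oY oU _ ZE nZ]]]] := H _ (leqnn _); exists Z, Y, U; split=> //.
  by rewrite ZE; apply: OmxD; [exact: Omx_kc|exact: OmxZ].
elim: k => [_|k IHk km].
  exists Z0, 0, (- (m%:R *: (Z0 *m KR nu))); split.
  - by move=> i j; rewrite mxE; apply: Oa0.
  - apply: OmxN; apply: OmxZ; first exact: Oa_nat.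
    by apply: OmxM; [exact: Omx_kc|exact: Omx_KR].
  - rewrite /sig /Z0 -map_mx_comp.
    have -> : map_mx (sg \o kc) (1%:M - 2^-1 *: Pm a) = map_mx kc (1%:M - 2^-1 *: Pm a).
      by apply/matrixP => i j; rewrite !mxE /= sg_kc.
    rewrite -map_mxM; congr map_mx; apply/row_matrixP => i; rewrite !rowE mulmxA -refl_mul.
    rewrite refl_fix // mulmxBr mulmx1 -scalemxAr mul_Pm scalerA dotvBl dotvZl /cr.
    by field; rewrite dotv_eq0.
  - by rewrite scaler0 addr0.
  - rewrite /nab dK_kcmx sub0r expr0 scale1r KM_split mulmxDr -scalemxAr -map_mxM.
    suff -> : (1%:M - 2^-1 *: Pm a) *m Pm a = 0 by rewrite map_mx0 scaler0 add0r.
    apply/row_matrixP => i; rewrite !rowE mulmxA mul_Pm mulmx0 mulmxBr mulmx1 -scalemxAr mul_Pm.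
    rewrite scalerA crB crZ cr_id //.
    have -> : cr a (delta_mx 0 i) - 2^-1 * cr a (delta_mx 0 i) * 2 = 0 by field.
    by rewrite scale0r.
have [Z [Y [U [oY oU sZ ZE nZ]]]] := IHk (ltnW km).
have [w [u' [ow ou' sZ' nZ']]] := nab_step km sZ nZ oU.
exists (Z - t ^+ k.+1 *: w), (Y - t ^+ k *: w), u'; split=> //.
  by apply: OmxB => //; apply: OmxZ => //; apply: OaX.
by rewrite {1}ZE scalerBr scalerA -exprS addrA.
Qed.

(** The lattice generated by the even frame and by [t^(2m)] is stable under the normal derivative:
    that of [t^(2m) v] has leading coefficient [2m v (1 - Pm a / 2)] at [t^(2m-1)], which modulo [t]
    is a combination of the even frame. *)
Lemma reg_t2m r (u : 'M[K]_(r, l)) : Omx u -> reg (t ^+ (2 * m) *: u).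
Proof.
have [Z [Y [U [oZ oY oU ZE nZ]]]] := even_frame.
pose L (z : 'M[K]_(r, l)) := exists g u : 'M[K]_(r, l),
  [/\ Omx g, Omx u & z = g *m Z + t ^+ (2 * m) *: u].
have Ot k : Oa (t ^+ k) by apply: OaX.
have LO z : L z -> Omx z.
  by move=> [g [v [og ov ->]]]; apply: OmxD; [exact: OmxM|exact: OmxZ].
have Lnab z : L z -> L (nab nu z).
  move=> [g [v [og ov ->]]]; have [n mE] : exists n, (2 * m)%N = n.+1.
    by exists (2 * m).-1; rewrite prednK // muln_gt0.
  rewrite nabD nab_mulmx nZ mE nab_nu_t -mE.
  have -> : (2 * m)%:R *: v - m%:R *: (v *m map_mx kc (Pm a)) =
      (2 * m)%:R *: (v *m Z) - t *: ((2 * m)%:R *: (v *m Y)).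
    have -> : v *m Z = v - 2^-1 *: (v *m map_mx kc (Pm a)) + t *: (v *m Y).
      rewrite ZE mulmxDr map_mxB map_mx1 mulmxBr mulmx1 -scalemxAr; congr (_ - _ + _).
      by rewrite map_mxZ -scalemxAr fmorphV rmorph_nat.
    rewrite scalerDr scalerBr !scalerA natrM (mulrC t) mulrAC mulfV ?mul1r ?addrK //.
    by rewrite -(rmorph_nat kc) tau_eq0 mpolyC_eq0 pnatr_eq0.
  exists (map_mx (dK nu) g + ((2 * m)%:R * t ^+ n) *: v),
    (g *m U - (2 * m)%:R *: (v *m Y) + (map_mx (dK nu) v - m%:R *: (v *m KR nu))); split.
  - by apply: OmxD; [exact: Omx_dK|apply: OmxZ => //; apply: OaM => //; apply: Oa_nat].
  - apply: OmxD; apply: OmxB; [exact: OmxM| |exact: Omx_dK|].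
      by apply: OmxZ; [exact: Oa_nat|exact: OmxM].
    by apply: OmxZ; [exact: Oa_nat|apply: OmxM => //; apply: Omx_KR].
  - rewrite mulmxDl -scalemxAl -scalemxAr [in RHS]scalerDr [in RHS]scalerBr scalerBr.
    have -> : t ^+ n *: (t *: ((2 * m)%:R *: (v *m Y))) = t ^+ (2 * m) *: ((2 * m)%:R *: (v *m Y)).
      by rewrite scalerA mE -exprSr.
    have -> : t ^+ n *: ((2 * m)%:R *: (v *m Z)) = ((2 * m)%:R * t ^+ n) *: (v *m Z).
      by rewrite scalerA mulrC.
    have E4 (p q x y w : 'M[K]_(r, l)) : p + q + (x - y + w) = p + x + (q - y + w).
      by rewrite -addrA [q + (x - y + w)]addrA [q + (x - y)]addrCA -[x + (q - y) + w]addrA addrA.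
    exact: E4.
move=> ou b; apply: LO; elim: b => [|b IHb]; last by rewrite iterS; apply: Lnab.
exists 0, u; split=> //; last by rewrite mul0mx add0r.
by move=> i j; rewrite mxE; apply: Oa0.
Qed.

End LocalRing.
Section Transport.
Variable sg : 'rV[R]_l -> {rmorphism K -> K}.
Hypothesis sg_tau : forall a p, sg a (tau p) = tau (msub (refl_mx a) p).
Hypothesis m_gt0 : (0 < m)%N.

Definition inQ (x : K) := exists k p, x = tau p / tau Qall ^+ k.

Let Q0 : tau Qall != 0. Proof. by rewrite tau_eq0 Qall_neq0. Qed.

Lemma inQ_tau p : inQ (tau p).
Proof. by exists 0%N, p; rewrite expr0 divr1. Qed.
Lemma inQD x y : inQ x -> inQ y -> inQ (x + y).
Proof.
move=> [k [p ->]] [k' [p' ->]]; exists (k + k')%N, (p * Qall ^+ k' + p' * Qall ^+ k).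
by rewrite addf_div ?expf_neq0 // exprD rmorphD !rmorphM !rmorphXn.
Qed.
Lemma inQM x y : inQ x -> inQ y -> inQ (x * y).
Proof.
move=> [k [p ->]] [k' [p' ->]]; exists (k + k')%N, (p * p').
by rewrite mulf_div exprD rmorphM.
Qed.
Lemma inQN x : inQ x -> inQ (- x).
Proof. by move=> [k [p ->]]; exists k, (- p); rewrite rmorphN mulNr. Qed.
Lemma inQ_sum (I : Type) (r : seq I) (P : pred I) F :
  (forall i, P i -> inQ (F i)) -> inQ (\sum_(i <- r | P i) F i).
Proof.
move=> H; apply: big_ind => //; last exact: inQD.
by rewrite -(rmorph0 tau); apply: inQ_tau.
Qed.
Lemma inQ_dK xi x : inQ x -> inQ (dK xi x).
Proof.
move=> [k [p xE]]; have E : x * tau (Qall ^+ k) = tau p by rewrite xE rmorphXn mulfVK ?expf_neq0.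
have -> : dK xi x = (tau (dirD xi p) - x * tau (dirD xi (Qall ^+ k))) / tau Qall ^+ k.
  by rewrite -!dK_tau -E dKM addrK rmorphXn mulfK ?expf_neq0.
apply: inQM; last by exists k, 1; rewrite rmorph1 div1r.
apply: inQD; first exact: inQ_tau.
by apply: inQN; apply: inQM; [exists k, p|exact: inQ_tau].
Qed.

(** The denominators are powers of [Qall] and nothing has a pole along any root, so the entries are
    polynomials; unlike polynomiality alone, this is stable under [nab]. *)
Definition good (z : 'rV[K]_l) := (forall a, a \in Pos -> reg a z) /\ (forall j, inQ (z 0 j)).

Lemma good_nab xi z : good z -> good (nab xi z).
Proof.
move=> [gz qz]; split=> [a aP|j]; first by apply: reg_nab => //; apply: gz.
rewrite !mxE; apply: inQD; first exact: inQ_dK.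
apply: inQN; apply: inQM; first by rewrite -(rmorph_nat tau); apply: inQ_tau.
apply: inQ_sum => k _; apply: inQM => //; rewrite summxE big_seq; apply: inQ_sum => b bP.
rewrite !mxE; apply: inQM; last exact: inQ_tau; apply: inQM; first exact: inQ_tau.
exists 1%N, (Qwo b); rewrite (Qall_split bP) expr1 rmorphM invfM mulrCA mulfV ?mulr1 //.
have := Q0; rewrite (Qall_split bP) rmorphM mulf_eq0 negb_or => /andP[//].
Qed.

Lemma goodD y z : good y -> good z -> good (y + z).
Proof.
move=> [gy qy] [gz qz]; split=> [a aP|j]; first exact: (regD aP (gy a aP) (gz a aP)).
by rewrite mxE; apply: inQD.
Qed.

Lemma good_scale p z : good z -> good (tau p *: z).
Proof.
move=> [gz qz]; split=> [a aP|j]; last by rewrite mxE; apply: inQM => //; apply: inQ_tau.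
by apply: reg_scale => //; [exact: Oa_tau|exact: gz].
Qed.

Lemma good_poly z : good z -> exists u : 'rV[S]_l, z = map_mx tau u.
Proof.
move=> [gz qz]; have H j : {p : S | z 0 j = tau p}.
  apply: boolp.cid; have [k [p zE]] := qz j.
  have [r pE] : mdivides (\prod_(a <- Pos) linform a ^+ k) p.
    apply: (@linform_prod_dvd _ _ (fun=> k)); first exact: nprop_Pos.
    move=> a aP; have a0 := Pos_neq0 rs aP.
    have [n [d [nd zE']]] := gz a aP 0%N 0 j.
    have d0 : tau d != 0.
      by rewrite tau_eq0; apply/eqP => d0; apply: nd; rewrite d0; apply: mdvd0.
    apply: (linform_dvdX_coprime a0 nd).
    have -> : d * p = n * Qall ^+ k.
      apply: tau_inj; rewrite !rmorphM rmorphXn mulrC; apply/eqP.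
      by rewrite -eqr_div ?expf_neq0 // -zE -zE'.
    by apply: mdvdMl; rewrite (Qall_split aP) exprMn; apply: mdvdMr; apply: mdvdr.
  exists r; rewrite zE pE prodrXl rmorphM rmorphXn -/Qall mulrC mulKf ?expf_neq0 //.
exists (\row_j sval (H j)); apply/rowP => j; rewrite !mxE.
by rewrite -(svalP (H j)).
Qed.

Lemma good_start (u : 'rV[S]_l) : good (tau (Qall ^+ (2 * m)) *: map_mx tau u).
Proof.
split=> [a aP|j]; last by rewrite !mxE -rmorphM; apply: inQ_tau.
rewrite (Qall_split aP) exprMn rmorphM rmorphXn -scalerA -/(lK a).
apply: (reg_t2m aP (sg := sg a)) => // i j; rewrite !mxE -rmorphM; exact: Oa_tau.
Qed.

Lemma tauQ_nab xi (u : 'rV[S]_l) j : tau Qall * nab xi (map_mx tau u) 0 j =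
  tau (Qall * dirD xi (u 0 j) - m%:R *: \sum_(a <- Pos)
    (dotv a xi *: Qwo a) * \sum_k (Pm a k j *: u 0 k)).
Proof.
rewrite rmorphB rmorphM /= !mxE dK_tau mulrBr; congr (_ - _).
rewrite -mul_mpolyC rmorphM /= -/(kc _) rmorph_nat mulrCA; congr (_ * _).
rewrite raddf_sum mulr_sumr; under eq_bigr => k _ do rewrite summxE mulrA mulr_sumr.
rewrite exchange_big /= big_seq [RHS]big_seq; apply: eq_bigr => a aP.
transitivity (tau (dotv a xi *: Qwo a) * \sum_(k < l) tau (Pm a k j *: u 0 k)); last first.
  by rewrite -rmorph_sum -rmorphM.
rewrite mulr_sumr; apply: eq_bigr => k _.
rewrite !mxE -!mul_mpolyC !rmorphM /= -!/(kc _) (Qall_split aP) rmorphM -/(lK a).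
have gen (x1 x2 x3 x4 x5 : K) : x1 != 0 -> x1 * x3 * x4 * (x2 / x1 * x5) = x2 * x3 * (x5 * x4).
  by move=> ?; field.
by apply: gen; apply: lK_neq0.
Qed.

Definition bd N (z : 'rV[K]_l) := forall j, exists2 p, z 0 j = tau p & (msize p <= N)%N.

(** The entries of the connection matrix have degree [-1], so once the result is known to be
    polynomial, its degree has dropped. This makes [nab xi] locally nilpotent on good sections, and
    Taylor series finite. *)
Lemma bd_nab N xi z : good z -> bd N.+1 z -> bd N (nab xi z).
Proof.
move=> gz bz j; have [u uE] := good_poly (good_nab xi gz).
exists (u 0 j); first by rewrite uE mxE.
have H k : {p : S | z 0 k = tau p /\ (msize p <= N.+1)%N}.
  by apply: boolp.cid; have [p pE ps] := bz k; exists p.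
pose p k := sval (H k); have pE k : z 0 k = tau (p k) by case: (svalP (H k)).
have ps k : (msize (p k) <= N.+1)%N by case: (svalP (H k)).
have [u0|u0] := eqVneq (u 0 j) 0; first by rewrite u0 msize0.
have E : Qall * u 0 j = Qall * dirD xi (p j) - m%:R *: \sum_(a <- Pos)
    (dotv a xi *: Qwo a) * \sum_k (Pm a k j *: p k).
  have zE : z = map_mx tau (\row_k p k) by apply/rowP => k; rewrite !mxE pE.
  apply: tau_inj; have := tauQ_nab xi (\row_k p k) j.
  rewrite -zE uE [X in _ * X = _]mxE -rmorphM => ->.
  rewrite mxE; congr (tau (_ - _ *: _)); apply: eq_bigr => a _; congr (_ * _).
  by apply: eq_bigr => k _; rewrite mxE.
have sQ : msize Qall = (size Pos).+1.
  have h := Qall_homog Phi Delta; have Q1 := Qall_neq0 Delta rs.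
  by rewrite [RHS]/= -(dhomog_uniq Q1 (dhomog_msize h) h) -mpolySpred.
have sw a : a \in Pos -> (msize (Qwo a) <= size Pos)%N.
  move=> aP; have := sQ; rewrite (Qall_split aP) => E1.
  have w0 : Qwo a != 0.
    by have := Qall_neq0 Delta rs; rewrite (Qall_split aP) mulf_eq0 negb_or => /andP[].
  have a0 : linform a != 0 by rewrite linform_eq0 (Pos_neq0 rs aP).
  move: E1; rewrite msizeM // -(mlead_deg a0).
  have -> : mdeg (mlead (linform a)) = 1%N.
    by have /dhomogP := dhomog_linform a; apply; apply: mlead_supp.
  by rewrite add2n => -[->].
have bsum (I : eqType) (s : seq I) (F : I -> S) B : {in s, forall i, (msize (F i) <= B)%N} ->
    (msize (\sum_(i <- s) F i) <= B)%N.
  elim: s => [|i s IHs] HF; first by rewrite big_nil msize0.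
  rewrite big_cons; apply: leq_trans (msizeD_le _ _) _.
  rewrite geq_max HF ?mem_head //= IHs // => k ks; by rewrite HF // in_cons ks orbT.
have mM (p1 p2 : S) B1 B2 : (msize p1 <= B1)%N -> (msize p2 <= B2.+1)%N ->
    (msize (p1 * p2) <= B1 + B2)%N.
  have [->|n1] := eqVneq p1 0; first by rewrite mul0r msize0.
  have [->|n2] := eqVneq p2 0; first by rewrite mulr0 msize0.
  by rewrite msizeM //; move: (mmeasure _ p1) (mmeasure _ p2) => x y; lia.
have : (msize (Qall * u 0 j)%R <= size Pos + N)%N.
  rewrite E; apply: leq_trans (msizeD_le _ _) _; rewrite msizeN geq_max; apply/andP; split.
    have [->|d0] := eqVneq (dirD xi (p j)) 0; first by rewrite mulr0 msize0.
    rewrite msizeM ?(Qall_neq0 Delta rs) // sQ.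
    suff : (msize (dirD xi (p j)) <= N)%N by move: (msize _); lia.
    apply: (bsum) => i _; apply: leq_trans (msizeZ_le _ _) _.
    have [->|p0] := eqVneq (p j) 0; first by rewrite mderiv0 msize0.
    by have := leq_trans (msize_mderiv i p0) (ps j); rewrite ltnS.
  apply: leq_trans (msizeZ_le _ _) _; apply: (bsum) => a aP; apply: mM.
    exact: leq_trans (msizeZ_le _ _) (sw a aP).
  by apply: (bsum) => k _; apply: leq_trans (msizeZ_le _ _) (ps k).
by rewrite msizeM ?(Qall_neq0 Delta rs) // sQ addSn leq_add2l.
Qed.

Lemma good_nilp xi z : good z -> exists N, iter N (nab xi) z = 0.
Proof.
move=> gz; have [u uE] := good_poly gz.
have [N bz] : exists N, bd N z.
  exists (\big[maxn/0%N]_(j < l) msize (u 0 j)) => j; exists (u 0 j); first by rewrite uE mxE.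
  exact: (leq_bigmax (F := fun j => msize (u 0 j)) j).
exists N; elim: N z gz bz {u uE} => [|N IHN] z gz bz; last first.
  by rewrite iterSr; apply: IHN; [exact: good_nab|exact: bd_nab].
apply/rowP => j; rewrite mxE; have [p -> ] := bz j; rewrite leqn0 msize_poly_eq0 => /eqP ->.
by rewrite rmorph0.
Qed.

Variable pt : 'rV[R]_l.

Definition val_at (z : 'rV[K]_l) (v : 'rV[R]_l) :=
  exists2 u : 'rV[S]_l, z = map_mx tau u & forall j, (u 0 j).@[pt 0] = v 0 j.

Local Notation ei i := (delta_mx 0 i : 'rV[R]_l).

(* Parallel transport along the coordinate direction [i] by a finite Taylor series. *)
Lemma transport1 i z v : good z -> val_at z v -> exists s, [/\ good s, val_at s v,
  nab (ei i) s = 0 & forall j, j != i -> nab (ei j) z = 0 -> nab (ei j) s = 0].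
Proof.
move=> gz vz; have [N nN] := good_nilp (ei i) gz.
(* The derivative of [c n.+1] in direction [i] is [- c n], so the covariant derivative of the series
   telescopes; its last term vanishes by the choice of [N]. *)
pose c n : S := (n`!%:R^-1)%:MP * ((pt 0 i)%:MP - 'X_i) ^+ n.
have dcX j : dirD (ei j) ((pt 0 i)%:MP - 'X_i) = - (j == i)%:R%:MP.
  rewrite raddfB /= dirDC sub0r; congr (- _).
  have -> : 'X_i = linform (ei i) :> S.
    by apply: mpoly_funP => x; rewrite mevalXU ev_linform dotvC dotv_deltar.
  by rewrite dirD_linform dotv_deltar mxE eqxx.
have dc0 j n : j != i -> dirD (ei j) (c n) = 0.
  move=> ji; rewrite dirDM dirDC mul0r add0r; case: n => [|n].
    by rewrite expr0 -mpolyC1 dirDC mulr0.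
  by rewrite dirDX dcX (negPf ji) oppr0 !mulr0 scaler0 mulr0.
have dcS n : dirD (ei i) (c n.+1) = - c n.
  rewrite dirDM dirDC mul0r add0r dirDX dcX eqxx /c mulrN1 scalerN mulrN; congr (- _).
  rewrite -scalerAr scalerAl -mul_mpolyC -mpolyCM; congr (_%:MP * _).
  rewrite factS natrM invfM mulrA mulfV ?mul1r // pnatr_eq0; by [].
have dc00 : dirD (ei i) (c 0%N) = 0 by rewrite dirDM dirDC mul0r add0r expr0 -mpolyC1 dirDC mulr0.
have gI n : good (iter n (nab (ei i)) z) by elim: n => //= n; apply: good_nab.
exists (\sum_(n < N) tau (c n) *: iter n (nab (ei i)) z); split.
- apply: big_ind => //; [|exact: goodD|by move=> n _; apply: good_scale].
  split=> [a aP b|j]; last by rewrite mxE -(rmorph0 tau); apply: inQ_tau.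
  have -> : iter b (nab ((dotv a a)^-1 *: a)) 0 = 0 :> 'rV[K]_l by elim: b => //= b ->; rewrite nab0.
  by move=> i' j'; rewrite mxE; apply: Oa0.
- case: N nN => [z0|N _].
    rewrite big_ord0; exists 0; first by rewrite map_mx0.
    by case: vz => u zu uv j; rewrite -uv; move: zu; rewrite /= in z0; rewrite z0 => /rowP/(_ j);
       rewrite !mxE -(rmorph0 tau) => /tau_inj <-.
  rewrite big_ord_recl /=.
  have U n : {u : 'rV[S]_l | iter n (nab (ei i)) z = map_mx tau u}.
    by apply: boolp.cid; apply: good_poly.
  case: vz => u zu uv; exists (c 0%N *: u + \sum_(n < N) c n.+1 *: sval (U n.+1)).
    rewrite map_mxD map_mxZ raddf_sum -zu; congr (_ + _); apply: eq_bigr => n _ /=.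
    by rewrite map_mxZ -(svalP (U n.+1)).
  move=> j; rewrite mxE summxE mevalD raddf_sum big1 ?addr0 => [|n _].
    by rewrite mxE mevalM /c fact0 invr1 expr0 mulr1 mevalC mul1r uv.
  by rewrite /= mxE mevalM /c mevalM rmorphXn /= mevalB !mevalC mevalXU subrr expr0n mulr0 mul0r.
- rewrite nab_sum; under eq_bigr => n _ do rewrite nabZ dK_tau -iterS.
  rewrite big_split /=; case: N nN => [|N nN]; first by rewrite !big_ord0 addr0.
  rewrite big_ord_recl dc00 rmorph0 scale0r add0r big_ord_recr /= -iterS nN scaler0 addr0.
  by rewrite -big_split big1 // => n _ /=; rewrite /bump /= dcS rmorphN scaleNr addNr.
- move=> j ji nz; rewrite nab_sum big1 // => n _; rewrite nabZ dK_tau dc0 // rmorph0 scale0r add0r.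
  have -> : nab (ei j) (iter n (nab (ei i)) z) = 0; last by rewrite scaler0.
  by elim: (n : nat) => //= k IHk; rewrite nab_comm IHk nab0.
Qed.

(** The constant section, rescaled by [Qall^(2m)], is good and has the prescribed value at [pt]; it
    is made flat in one coordinate direction after another, each transport keeping the flatness
    already gained. *)
Lemma flat_section (v : 'rV[R]_l) : Qall.@[pt 0] != 0 -> exists u : 'rV[S]_l,
  (forall j, (u 0 j).@[pt 0] = v 0 j) /\ (forall xi, nab xi (map_mx tau u) = 0).
Proof.
move=> Qp; pose c := (Qall ^+ (2 * m)).@[pt 0].
have c0 : c != 0 by rewrite /c rmorphXn expf_neq0.
have g0 := good_start (map_mx (@mpolyC l R) (c^-1 *: v)).
have v0 : val_at (tau (Qall ^+ (2 * m)) *: map_mx tau (map_mx (@mpolyC l R) (c^-1 *: v))) v.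
  exists (Qall ^+ (2 * m) *: map_mx (@mpolyC l R) (c^-1 *: v)); first by apply/rowP => j; rewrite !mxE -rmorphM.
  by move=> j; rewrite !mxE mevalM mevalC -/c mulrA mulfV ?mul1r.
suff [s [gs [u su uv] fs]] : exists s, [/\ good s, val_at s v & forall i, i \in enum 'I_l -> nab (ei i) s = 0].
  exists u; split=> // xi; rewrite -su (row_sum_delta xi).
  elim/big_rec: _ => [|i y _ IH].
    have := nab_linearl (0 : 'rV[R]_l) 0 1 s; rewrite scaler0 addr0 rmorph1 scale1r.
    by move/eqP; rewrite -subr_eq0 opprD addrA subrr sub0r oppr_eq0 => /eqP.
  by rewrite nab_linearl IH addr0 fs ?scaler0 // mem_enum.
elim: (enum 'I_l) => [|i r [s [gs vs fs]]]; first by eexists; split; [exact: g0|exact: v0|].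
have [s' [gs' vs' fi fj]] := transport1 i gs vs.
exists s'; split=> // j; rewrite in_cons; have [->//|ji /= jr] := eqVneq j i.
by apply: fj => //; apply: fs.
Qed.

End Transport.
End Connection.

Section FlatSections.
Variables (l : nat) (Phi : seq 'rV[R]_l) (Delta : 'M[R]_l).
Hypotheses (rs : root_system Phi) (ss : simple_system Phi Delta).
Variable m : nat.
Local Notation Pos := (Pos Phi Delta).
Local Notation Qall := (Qall Phi Delta).
Local Notation Qwo := (Qwo Phi Delta).
Local Notation S := {mpoly R[l]}.

(* Horizontality for the connection [d - m sum_a (da / a) (1 - s_a)], cleared of denominators. *)
Definition flat (u : 'rV[S]_l) := forall xi j, Qall * dirD xi (u 0 j) =
  m%:R *: \sum_(a <- Pos) (dotv a xi *: Qwo a) * \sum_k (Pm a k j *: u 0 k).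

Let dF xi : {additive {fraction S} -> {fraction S}} :=
  HB.pack (fracder (dirD xi))
   (GRing.isZmodMorphism.Build _ _ (fracder (dirD xi)) (fracder_is_additive (dirDM xi))).

Lemma msub_refl_inj (a : 'rV[R]_l) : injective (msub (refl_mx a)).
Proof.
move=> p q E; apply: mpoly_funP => v.
have [a0|a0] := eqVneq a 0.
  have sE (x : 'rV[R]_l) : x *m refl_mx a = x by rewrite -refl_mul reflE a0 scaler0 subr0.
  by rewrite -(sE v) -!ev_msub E.
by rewrite -(reflK a0 v) [refl a (refl a v)]refl_mul -!ev_msub E.
Qed.

Let sgF (a : 'rV[R]_l) : {rmorphism {fraction S} -> {fraction S}} :=
  HB.pack (fracmor (msub (refl_mx a)))
   (GRing.isZmodMorphism.Build _ _ (fracmor (msub (refl_mx a))) (fracmor_is_additive (@msub_refl_inj a)))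
   (GRing.isMonoidMorphism.Build _ _ (fracmor (msub (refl_mx a)))
     (fracmor_is_multiplicative (@msub_refl_inj a))).

Theorem flat_exists (pt v : 'rV[R]_l) : (0 < m)%N -> Qall.@[pt 0] != 0 ->
  exists2 u : 'rV[S]_l, flat u & forall j, (u 0 j).@[pt 0] = v 0 j.
Proof.
move=> m0 Qp.
have tinj : injective (@FracField.tofrac S) by move=> x y /eqP; rewrite tofrac_eq => /eqP.
have dM xi x y : dF xi (x * y) = dF xi x * y + x * dF xi y.
  exact: (fracderM (dirDM xi)).
have dt xi p : dF xi (FracField.tofrac p) = FracField.tofrac (dirD xi p).
  exact: (fracder_tofrac (dirDM xi)).
have st a p : sgF a (FracField.tofrac p) = FracField.tofrac (msub (refl_mx a) p).
  exact: (fracmor_tofrac (@msub_refl_inj a)).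
have [u [uv nu]] := flat_section rs ss tinj (@fraction_ex S) dM dt st m0 v Qp.
exists u => // xi j; apply/eqP; rewrite -subr_eq0; apply/eqP/tinj.
have /= <- := tauQ_nab (dK := dF) (tau := @FracField.tofrac S) Delta rs m tinj dt xi u j.
by rewrite nu mxE mulr0 rmorph0.
Qed.

End FlatSections.

(** * Restriction of flat sections to lines and their exponents *)

Section VectorPolynomials.
Variable l : nat.
Local Notation S := {mpoly R[l]}.
Implicit Types (u w : 'rV[S]_l) (v xi : 'rV[R]_l) (y : 'rV[{poly R}]_l).

Definition evr v u : 'rV[R]_l := map_mx (meval (v 0)) u.

Lemma evrE v u j : evr v u 0 j = (u 0 j).@[v 0]. Proof. by rewrite mxE. Qed.
Lemma evrD v u w : evr v (u + w) = evr v u + evr v w. Proof. exact: map_mxD. Qed.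
Lemma evrN v u : evr v (- u) = - evr v u. Proof. exact: map_mxN. Qed.
Lemma evrZ v (p : S) u : evr v (p *: u) = p.@[v 0] *: evr v u. Proof. exact: map_mxZ. Qed.
Lemma evrC v (c : R) u : evr v (c%:MP *: u) = c *: evr v u.
Proof. by rewrite evrZ mevalC. Qed.

Lemma evr_inj u w : (forall v, evr v u = evr v w) -> u = w.
Proof.
by move=> H; apply/rowP => j; apply: mpoly_funP => v; rewrite -!evrE H.
Qed.

Lemma evr_neq0 u : u != 0 -> exists v, evr v u != 0.
Proof.
move=> u0; apply: boolp.contrapT => H; case/eqP: u0; apply: evr_inj => v.
have -> : evr v 0 = 0 by rewrite /evr map_mx0.
by have [//|uv] := eqVneq (evr v u) 0; case: H; exists v.
Qed.

(* The vector field [x |-> u(s_a x)] followed by [s_a]. *)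
Definition act (a : 'rV[R]_l) u : 'rV[S]_l :=
  map_mx (msub (refl_mx a)) u *m map_mx (@mpolyC l R) (refl_mx a).

Lemma evr_act a u v : evr v (act a u) = refl a (evr (refl a v) u).
Proof.
rewrite /evr /act map_mxM -map_mx_comp refl_mul; congr (_ *m _).
  by apply/rowP => j; rewrite !mxE /= ev_msub -refl_mul.
by apply/matrixP => i j; rewrite !mxE /= mevalC.
Qed.

Lemma actK a : a != 0 -> involutive (act a).
Proof. by move=> a0 u; apply: evr_inj => v; rewrite !evr_act !reflK. Qed.

Lemma actD a u w : act a (u + w) = act a u + act a w.
Proof. by apply: evr_inj => v; rewrite evrD !evr_act evrD reflD. Qed.

Lemma actN a u : act a (- u) = - act a u.
Proof. by apply: evr_inj => v; rewrite evrN !evr_act evrN reflN. Qed.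

Lemma actB a u w : act a (u - w) = act a u - act a w.
Proof. by rewrite actD actN. Qed.

Lemma actC a (c : R) u : act a (c%:MP *: u) = c%:MP *: act a u.
Proof. by apply: evr_inj => v; rewrite evrC !evr_act evrC reflZ. Qed.

Lemma act_conj a b u : a != 0 -> act (refl a b) u = act a (act b (act a u)).
Proof.
by move=> a0; apply: evr_inj => v; rewrite !evr_act !refl_conj // !reflK.
Qed.

Definition liner v xi u : 'rV[{poly R}]_l := map_mx (linep v xi) u.

Definition hor0 y : 'rV[R]_l := map_mx (horner^~ 0) y.

Lemma hor0_liner v xi u : hor0 (liner v xi u) = evr v u.
Proof. by apply/rowP => j; rewrite !mxE linep_ev scale0r addr0. Qed.

Lemma polyvec_val y : y != 0 -> exists k (w : 'rV[{poly R}]_l), y = 'X^k *: w /\ hor0 w != 0.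
Proof.
move=> y0; have [N yN] : exists N : nat, forall j, (size (y 0%R j) <= N)%N.
  exists (\max_(j < l) size (y 0%R j)) => j.
  exact: (leq_bigmax (F := fun j => size (y 0%R j)) j).
elim: N y y0 yN => [|N IHN] y y0 yN.
  by case/eqP: y0; apply/rowP => j; have := yN j; rewrite leqn0 size_poly_eq0 mxE => /eqP.
have [h0|h0] := eqVneq (hor0 y) 0; last by exists 0%N, y; rewrite expr0 scale1r.
have H j : {p : {poly R} | y 0 j = p * 'X}.
  apply: boolp.cid; have /eqP/factor_theorem[q] : (y 0 j).[0] = 0.
    by have /rowP/(_ j) := h0; rewrite !mxE.
  by rewrite subr0 => yE; exists q.
pose y' : 'rV[{poly R}]_l := \row_j sval (H j).
have yE : y = 'X *: y' by apply/rowP => j; rewrite !mxE mulrC; case: (H j).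
have y0' : y' != 0 by apply: contraNneq y0 => y'0; rewrite yE y'0 scaler0.
have [j|k [w [wE w0]]] := IHN y' y0'; last first.
  by exists k.+1, w; split=> //; rewrite yE wE scalerA -exprS.
have := yN j; rewrite yE [('X *: y') 0 j]mxE; have [->|q0] := eqVneq (y' 0 j) 0.
  by rewrite size_poly0.
by rewrite mulrC size_mulX.
Qed.

(** Lowest order terms at a regular singular point: the order of vanishing is an eigenvalue of the
    residue, and the leading vector an eigenvector. *)
Lemma ode_exponent (q : {poly R}) (B : 'M[{poly R}]_l) k (w : 'rV[{poly R}]_l) :
  ('X * q) *: map_mx (@deriv R) ('X^k *: w) = ('X^k *: w) *m B ->
  (k%:R * q.[0]) *: hor0 w = hor0 w *m map_mx (horner^~ 0) B.
Proof.
move=> E; have E' : (k%:R * q) *: w + ('X * q) *: map_mx (@deriv R) w = w *m B.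
  have Xk : 'X^k != 0 :> {poly R} by rewrite monic_neq0 ?monicXn.
  apply/rowP => j; apply: (mulfI Xk); rewrite -scalemxAl in E.
  have := congr1 (fun z : 'rV[{poly R}]_l => z 0 j) E; rewrite [RHS]mxE => <-.
  rewrite !mxE derivM derivXn; case: k {E Xk} => [|k].
    by rewrite expr0 mulr0n; ring.
  by rewrite /= -[in RHS]mulr_natl exprS; ring.
apply/rowP => j; have /rowP/(_ j)/(congr1 (horner^~ 0)) := E'.
have kE : (k%:R : {poly R}).[0] = k%:R by rewrite -polyC_natr hornerC.
rewrite !mxE !hornerE ?mul0r ?addr0 kE => ->.
by rewrite horner_sum; apply: eq_bigr => i _; rewrite hornerM !mxE.
Qed.

End VectorPolynomials.

Section FlatTheory.
Variables (l : nat) (Phi : seq 'rV[R]_l) (Delta : 'M[R]_l).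
Hypotheses (rs : root_system Phi) (ss : simple_system Phi Delta).
Variable m : nat.
Local Notation Pos := (Pos Phi Delta).
Local Notation Qall := (Qall Phi Delta).
Local Notation Qwo := (Qwo Phi Delta).
Local Notation S := {mpoly R[l]}.
Local Notation flat := (@flat l Phi Delta m).
Implicit Types (u w : 'rV[S]_l) (v xi : 'rV[R]_l).

Let Q0 : Qall != 0. Proof. exact: (Qall_neq0 Delta rs). Qed.

Lemma Qall_ev_neq0 v : Qall.@[v 0] != 0 -> forall a, a \in Pos -> dotv a v != 0.
Proof.
by move=> Qv a aP; apply: contraNneq Qv => av; rewrite (Qall_split aP) mevalM ev_linform av mul0r.
Qed.

Definition dvec xi u : 'rV[S]_l := map_mx (dirD xi) u.

(** At points off the hyperplanes the denominators may stay; polynomial identities are determined by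
    those points, as [Qall] is not zero. *)
Lemma flatP u : flat u <-> forall v, Qall.@[v 0] != 0 -> forall xi,
  evr v (dvec xi u) = m%:R *: \sum_(a <- Pos) (dotv a xi / dotv a v) *: (evr v u *m Pm a).
Proof.
have rhs v xi j : Qall.@[v 0] != 0 ->
    (m%:R *: \sum_(a <- Pos) (dotv a xi *: Qwo a) * \sum_k (Pm a k j *: u 0 k)).@[v 0] =
    Qall.@[v 0] * (m%:R *: \sum_(a <- Pos) (dotv a xi / dotv a v) *: (evr v u *m Pm a)) 0 j.
  move=> Qv; rewrite mevalZ !mxE mulrCA; congr (_ * _).
  rewrite raddf_sum summxE mulr_sumr big_seq [RHS]big_seq; apply: eq_bigr => a aP /=.
  rewrite mevalM mevalZ !mxE (Qall_split aP) mevalM ev_linform raddf_sum /=.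
  have -> : \sum_k (Pm a k j *: u 0 k).@[v 0] = \sum_k (evr v u) 0 k * Pm a k j.
    by apply: eq_bigr => k _; rewrite mevalZ evrE mulrC.
  by have := Qall_ev_neq0 Qv aP; move: (\sum_k _) => X ?; field.
split=> [fu v Qv xi|H xi j].
  apply/rowP => j; apply: (mulfI Qv); rewrite -rhs // -fu mevalM.
  by rewrite !mxE.
apply: (mulfI Q0); apply: mpoly_funP => v; rewrite !mevalM.
have [->|Qv] := eqVneq Qall.@[v 0] 0; first by rewrite !mul0r.
by rewrite rhs // -H // !mxE.
Qed.

Lemma flatD u w : flat u -> flat w -> flat (u + w).
Proof.
move=> /flatP fu /flatP fw; apply/flatP => v Qv xi.
have -> : dvec xi (u + w) = dvec xi u + dvec xi w by apply/rowP => j; rewrite !mxE raddfD.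
rewrite !evrD fu // fw // -scalerDr -big_split; congr (_ *: _); apply: eq_bigr => a _ /=.
by rewrite mulmxDl scalerDr.
Qed.

Lemma flatC (c : R) u : flat u -> flat (c%:MP *: u).
Proof.
move=> /flatP fu; apply/flatP => v Qv xi.
have -> : dvec xi (c%:MP *: u) = c%:MP *: dvec xi u.
  by apply/rowP => j; rewrite !mxE dirDM dirDC mul0r add0r.
rewrite !evrC fu // scalerA mulrC -scalerA; congr (_ *: _); rewrite scaler_sumr.
by apply: eq_bigr => a _; rewrite -scalemxAl !scalerA mulrC.
Qed.

Lemma flat0 : flat 0.
Proof.
move=> xi j; rewrite mxE raddf0 mulr0 big1 ?scaler0 // => a _.
by rewrite big1 ?mulr0 // => k _; rewrite [(0 : 'rV[S]_l) 0 k]mxE scaler0.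
Qed.

Lemma flat_sum (I : Type) (r : seq I) (P : pred I) (F : I -> 'rV[S]_l) :
  (forall i, P i -> flat (F i)) -> flat (\sum_(i <- r | P i) F i).
Proof. by move=> H; apply: big_ind => //; [exact: flat0|exact: flatD]. Qed.

Lemma flatN u : flat u -> flat (- u).
Proof. by move=> fu; rewrite -scaleN1r -mpolyC1 -mpolyCN; apply: flatC. Qed.

Lemma Qall_refl_neq0 b v : b \in Phi -> Qall.@[v 0] != 0 -> Qall.@[(refl b v) 0] != 0.
Proof.
move=> bP Qv; rewrite /Qall (rmorph_prod (meval _)) /= prodf_seq_neq0; apply/allP => a aP /=.
rewrite ev_linform dotv_reflr ?(root_neq0 rs) //.
have raP : refl b a \in Phi by rewrite root_refl ?(Pos_root aP).
have [|rP] := root_pos_or_neg rs ss raP; first exact: Qall_ev_neq0.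
by have := Qall_ev_neq0 Qv rP; rewrite dotvNl oppr_eq0.
Qed.

Lemma flat_act b u : b \in Phi -> flat u -> flat (act b u).
Proof.
move=> bP /flatP fu; have b0 := root_neq0 rs bP; apply/flatP => v Qv xi.
have Qr := Qall_refl_neq0 bP Qv.
have -> : evr v (dvec xi (act b u)) = refl b (evr (refl b v) (dvec (refl b xi) u)).
  have dm (p : S) : dirD xi (msub (refl_mx b) p) = msub (refl_mx b) (dirD (refl b xi) p).
    rewrite /dirD raddf_sum /=; under [RHS]eq_bigr => i _ do rewrite msubZ.
    under eq_bigr => i _ do rewrite mderiv_msub scaler_sumr.
    rewrite exchange_big /=; apply: eq_bigr => i _.
    under eq_bigr => j _ do rewrite scalerA; rewrite -scaler_suml; congr (_ *: _).
    by rewrite refl_mul mxE.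
  have -> : dvec xi (act b u) = act b (dvec (refl b xi) u); last by rewrite evr_act.
  apply/rowP => j; rewrite !mxE raddf_sum; apply: eq_bigr => k _ /=.
  rewrite [X in dirD _ (_ * X)]mxE [X in dirD _ (X * _)]mxE dirDM dirDC mulr0 addr0 dm.
  by rewrite [X in _ = _ * X]mxE [X in _ = X * _]mxE [dvec _ _ _ _]mxE.
rewrite fu // reflZ refl_sum evr_act; congr (_ *: _).
pose g a := (dotv a xi / dotv a v) *: (refl b (evr (refl b v) u) *m Pm a).
have gN a : g (- a) = g a by rewrite /g PmN !dotvNl invrN mulrNN.
rewrite -[RHS](sum_Pos_refl rs ss bP gN) => [|x]; last first.
  by rewrite -scaler_nat => /eqP; rewrite scaler_eq0 pnatr_eq0 => /eqP.
apply: eq_bigr => a _; rewrite /g reflZ Pm_refl // !mulmxA -!refl_mul reflK //.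
by rewrite -!dotv_reflr.
Qed.

(** At [t = 0] only the hyperplanes through [p] are singular on the line. For such a root the
    equation restricts to [dotv a xi] times [t], and the factor [dotv a xi] cancels that of the
    connection, so the residue does not depend on the direction. *)
Lemma flat_exponent u p xi : flat u ->
  (forall a, a \in Pos -> dotv a p = 0 -> dotv a xi != 0) -> liner p xi u != 0 ->
  exists k (w : 'rV[{poly R}]_l), [/\ liner p xi u = 'X^k *: w, hor0 w != 0 &
    k%:R *: hor0 w = m%:R *: \sum_(a <- Pos | dotv a p == 0) cr a (hor0 w) *: a].
Proof.
move=> fu pxi y0; have [k [w [yE w0]]] := polyvec_val y0; exists k, w; split=> //.
pose X a := dotv a p == 0; pose L a := linep p xi (linform a).
pose q : {poly R} := \prod_(a <- Pos | ~~ X a) L a.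
pose qw b : {poly R} := \prod_(a <- Pos | ~~ X a && (a != b)) L a.
pose c : {poly R} := \prod_(a <- Pos | X a) L a.
have LX a : X a -> L a = dotv a xi *: 'X by move=> /eqP Xa; rewrite /L linep_linform Xa add0r.
have L0 a : a \in Pos -> L a != 0.
  move=> aP; have [Xa|nXa] := boolP (X a).
    by rewrite LX // scaler_eq0 polyX_eq0 orbF pxi //; apply/eqP.
  apply: contraNneq nXa => /(congr1 (horner^~ 0)).
  by rewrite /L linep_linform !hornerE => /eqP.
have c0 : c != 0.
  by rewrite /c -big_filter prodf_seq_neq0; apply/allP => a; rewrite mem_filter => /andP[_ /L0].
have QE : linep p xi Qall = c * q by rewrite /Qall rmorph_prod (bigID X).
have QwX a : a \in Pos -> X a -> dotv a xi *: 'X * linep p xi (Qwo a) = c * q.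
  by move=> aP Xa; rewrite -LX // -QE (Qall_split aP) rmorphM.
have QwN a : a \in Pos -> ~~ X a -> linep p xi (Qwo a) = c * qw a.
  move=> aP nXa; rewrite /Qwo rmorph_prod (bigID X) /=; congr (_ * _).
    by apply: eq_bigl => b; case: eqP => // ->; rewrite (negPf nXa).
  by apply: eq_bigl => b; rewrite andbC.
(* Connection matrix of the line with the denominator ['X * q] cleared: roots through [p] carry [q],
   the others carry ['X] and drop out at [t = 0]. *)
pose B : 'M[{poly R}]_l := m%:R *: (q *: map_mx (@polyC R) (\sum_(a <- Pos | X a) Pm a) +
  'X *: \sum_(a <- Pos | ~~ X a) (dotv a xi *: qw a) *: map_mx (@polyC R) (Pm a)).
have ode : ('X * q) *: map_mx (@deriv R) ('X^k *: w) = ('X^k *: w) *m B.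
  rewrite -yE; apply/rowP => j; apply: (mulfI c0).
  have E : c * q * linep p xi (dirD xi (u 0 j)) = m%:R *: \sum_(a <- Pos)
      linep p xi ((dotv a xi *: Qwo a) * \sum_k (Pm a k j *: u 0 k)).
    have := congr1 (linep p xi) (fu xi j); rewrite linepZ rmorphM [in RHS]rmorph_sum => <-.
    by rewrite -QE.
  rewrite !mxE linep_dirD.
  have -> : c * ('X * q * linep p xi (dirD xi (u 0 j))) = 'X * (c * q * linep p xi (dirD xi (u 0 j))).
    by ring.
  rewrite {}E; pose Y a := \sum_k linep p xi (u 0 k) * (Pm a k j)%:P.
  have -> : \sum_(a <- Pos) linep p xi (dotv a xi *: Qwo a * \sum_k Pm a k j *: u 0 k) =
      \sum_(a <- Pos) (dotv a xi *: linep p xi (Qwo a)) * Y a.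
    apply: eq_bigr => a _; rewrite rmorphM /= linepZ rmorph_sum; congr (_ * _).
    by apply: eq_bigr => i _; rewrite /= linepZ mulrC mul_polyC.
  have -> : \sum_k0 liner p xi u 0 k0 * B k0 j = m%:R *
      (q * (\sum_(a <- Pos | X a) Y a) + 'X * \sum_(a <- Pos | ~~ X a) (dotv a xi *: qw a) * Y a).
    rewrite mulrDr !mulr_sumr.
    have -> : \sum_(i < l) liner p xi u 0 i * B i j = \sum_(i < l)
        (\sum_(a <- Pos | X a) m%:R * (q * (linep p xi (u 0 i) * (Pm a i j)%:P)) +
         \sum_(a <- Pos | ~~ X a) m%:R * ('X * ((dotv a xi *: qw a) * (linep p xi (u 0 i) * (Pm a i j)%:P)))).
      apply: eq_bigr => i _; rewrite !mxE !summxE raddf_sum /= mulrDr [in LHS]mulrDr.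
      congr (_ + _); rewrite !mulr_sumr; apply: eq_bigr => a _; rewrite ?mxE; ring.
    rewrite big_split /=; congr (_ + _); rewrite exchange_big /=; apply: eq_bigr => a _;
      by rewrite /Y !mulr_sumr.
  have mz (z : {poly R}) : m%:R *: z = m%:R * z by rewrite scaler_nat mulr_natl.
  rewrite mz [LHS]mulrCA [RHS]mulrCA; congr (m%:R * _).
  rewrite (bigID X) /= !mulrDr; congr (_ + _).
    rewrite !mulr_sumr big_seq_cond [RHS]big_seq_cond; apply: eq_bigr => a /andP[aP Xa].
    by rewrite [RHS]mulrA -(QwX a aP Xa) -!mul_polyC; ring.
  rewrite mulrCA; congr (_ * _); rewrite !mulr_sumr big_seq_cond [RHS]big_seq_cond.
  by apply: eq_bigr => a /andP[aP nXa]; rewrite QwN // -!scalerAl -!scalerAr mulrA.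
have q00 : q.[0] != 0.
  rewrite -[q.[0]]/(horner_eval 0 q) /q (rmorph_prod (horner_eval 0)) /= prodf_seq_neq0; apply/allP => a aP /=.
  by apply/implyP => nXa; rewrite /L horner_evalE linep_linform !hornerE.
have := ode_exponent ode; have -> : map_mx (horner^~ 0) B = (m%:R * q.[0]) *: \sum_(a <- Pos | X a) Pm a.
  have mE : (m%:R : {poly R}).[0] = m%:R by rewrite -polyC_natr hornerC.
  apply/matrixP => i j; rewrite !mxE hornerM mE hornerD !hornerM hornerX mul0r addr0 hornerC.
  by rewrite mulrA.
rewrite -scalemxAr => E; apply: (scalerI q00); rewrite scalerA mulrC E mulrC -scalerA.
congr (_ *: (_ *: _)); rewrite mulmx_sumr; apply: eq_bigr => a _.
exact: mul_Pm.
Qed.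

End FlatTheory.

(** * Flat sections that are odd under a reflection *)

Section OddSections.
Variables (l : nat) (Phi : seq 'rV[R]_l) (Delta : 'M[R]_l).
Hypotheses (rs : root_system Phi) (ss : simple_system Phi Delta).
Variable m : nat.
Hypothesis m0 : (0 < m)%N.
Local Notation Pos := (Pos Phi Delta).
Local Notation Qall := (Qall Phi Delta).
Local Notation Qwo := (Qwo Phi Delta).
Local Notation S := {mpoly R[l]}.
Local Notation flat := (@flat l Phi Delta m).
Implicit Types (u w : 'rV[S]_l) (v xi p : 'rV[R]_l).

Let Q0 : Qall != 0. Proof. exact: (Qall_neq0 Delta rs). Qed.
Let mR : m%:R != 0 :> R. Proof. by rewrite pnatr_eq0 -lt0n. Qed.

Lemma liner_ev p xi u j t : (liner p xi u 0 j).[t] = evr (p + t *: xi) u 0 j.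
Proof. by rewrite !mxE linep_ev. Qed.

Lemma Qall_evP v : (Qall.@[v 0] != 0) = all (fun a => dotv a v != 0) Pos.
Proof.
rewrite /Qall (rmorph_prod (meval _)) /= prodf_seq_neq0; apply: eq_all => a /=.
by rewrite ev_linform.
Qed.

Lemma regular_on_line p xi : (forall a, a \in Pos -> dotv a p = 0 -> dotv a xi != 0) ->
  exists t, Qall.@[(p + t *: xi) 0] != 0.
Proof.
move=> H; have : linep p xi Qall != 0.
  rewrite /Qall rmorph_prod prodf_seq_neq0; apply/allP => a aP /=; rewrite linep_linform.
  have [ap|ap] := eqVneq (dotv a p) 0.
    by rewrite ap polyC0 add0r scaler_eq0 polyX_eq0 orbF H.
  by apply: contraNneq ap => /(congr1 (horner^~ 0)); rewrite !hornerE => /eqP.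
move=> L0; apply: boolp.contrapT => N; case/eqP: L0; apply: poly_fun_eq0 => t.
by rewrite linep_ev; apply/eqP/negPn/negP => Qt; apply: N; exists t.
Qed.

(** At a regular point the residue is an empty sum, which forces the order of vanishing to be zero
    on every line through it. *)
Lemma flat_uniq u p : flat u -> Qall.@[p 0] != 0 -> evr p u = 0 -> u = 0.
Proof.
move=> fu Qp up; apply/eqP/negPn/negP => u0; have [v uv] := evr_neq0 u0.
have y0 : liner p (v - p) u != 0.
  apply: contraNneq uv => y0; apply/eqP/rowP => j.
  have := liner_ev p (v - p) u j 1; rewrite y0 scale1r addrC subrK => <-.
  by rewrite !mxE horner0.
have np a : a \in Pos -> dotv a p = 0 -> dotv a (v - p) != 0.
  by move=> aP ap; move: Qp; rewrite Qall_evP => /allP/(_ a aP); rewrite ap eqxx.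
have [k [w [yE w0 kE]]] := flat_exponent fu np y0.
have k0 : k = 0%N.
  apply/eqP; move: kE; rewrite big1_seq => [|a /andP[/eqP ap aP]].
    by rewrite scaler0 => /eqP; rewrite scaler_eq0 (negPf w0) orbF pnatr_eq0.
  by have := np a aP ap; move: Qp; rewrite Qall_evP => /allP/(_ a aP); rewrite ap eqxx.
by case/eqP: w0; rewrite -up -(hor0_liner p (v - p)) yE k0 expr0 scale1r.
Qed.

Lemma flat_exp u p xi : flat u -> u != 0 ->
  (forall a, a \in Pos -> dotv a p = 0 -> dotv a xi != 0) ->
  exists k (w : 'rV[{poly R}]_l), [/\ liner p xi u = 'X^k *: w, hor0 w != 0 &
    k%:R *: hor0 w = m%:R *: \sum_(a <- Pos | dotv a p == 0) cr a (hor0 w) *: a].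
Proof.
move=> fu u0 np; apply: flat_exponent => //; apply: contraNneq u0 => y0.
have [t Qt] := regular_on_line np; apply/eqP/(flat_uniq fu Qt)/rowP => j.
by rewrite -liner_ev y0 !mxE horner0.
Qed.

(** Comparing lowest terms at [t] and [-t] passes a symmetry of [u] about [p] on to the leading
    vector, up to the parity of the order. *)
Lemma line_symmetry u p xi (M : 'M[R]_l) (eps : R) k (w : 'rV[{poly R}]_l) :
  (forall t, evr (p - t *: xi) u *m M = eps *: evr (p + t *: xi) u) ->
  liner p xi u = 'X^k *: w -> (-1) ^+ k *: (hor0 w *m M) = eps *: hor0 w.
Proof.
move=> H yE; apply/rowP => j.
have ev t i : evr (p + t *: xi) u 0 i = t ^+ k * (w 0 i).[t].
  by rewrite -liner_ev yE mxE hornerM hornerXn.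
pose P : {poly R} := \sum_i (M i j * (-1) ^+ k) *: (w 0 i \Po - 'X) - eps *: w 0 j.
have P0 : P = 0.
  have Xk : 'X^k != 0 :> {poly R} by rewrite monic_neq0 ?monicXn.
  apply: (mulfI Xk); rewrite mulr0; apply: poly_fun_eq0 => t.
  rewrite hornerM hornerXn hornerD hornerN hornerZ horner_sum mulrBr.
  have /rowP/(_ j) := H t; rewrite [LHS]mxE [RHS]mxE ev => E.
  rewrite [X in _ - X]mulrCA -E mulr_sumr -sumrB big1 // => i _.
  by rewrite hornerZ horner_comp hornerN hornerX -scaleNr ev [(- t) ^+ k]exprNn; ring.
have := congr1 (horner^~ 0) P0; rewrite hornerD hornerN hornerZ horner_sum horner0 => /eqP.
rewrite subr_eq0 => /eqP E; rewrite !mxE -E mulr_sumr; apply: eq_bigr => i _.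
by rewrite hornerZ horner_comp hornerN hornerX oppr0 [hor0 w 0 i]mxE; ring.
Qed.

Lemma generic_on a : a \in Pos ->
  exists2 p, dotv a p = 0 & forall b, b \in Pos -> dotv b p = 0 -> b = a.
Proof.
move=> aP; have [v av Qv] := linform_ndvd_point (Pos_neq0 rs aP) (Qwo_ndvd rs ss aP).
exists v => // b bP bv; apply/eqP/negPn/negP => ba; case/eqP: Qv.
by rewrite (Qwo_split bP) 1?eq_sym // mevalM ev_linform bv mul0r.
Qed.

Lemma generic_dvd a (f : S) : a \in Pos ->
  (forall p, dotv a p = 0 -> (forall b, b \in Pos -> dotv b p = 0 -> b = a) -> f.@[p 0] = 0) ->
  mdivides (linform a) f.
Proof.
move=> aP H; have a0 := Pos_neq0 rs aP.
have : mdivides (linform a) (Qwo a * f).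
  apply: linform_dvd => // p ap; rewrite mevalM.
  have [->|Qp] := eqVneq (Qwo a).@[p 0] 0; first by rewrite mul0r.
  rewrite H ?mulr0 // => b bP bp; apply/eqP/negPn/negP => ba; case/eqP: Qp.
  by rewrite (Qwo_split bP) 1?eq_sym // mevalM ev_linform bp mul0r.
by case/(linform_prime a0) => // /(Qwo_ndvd rs ss aP).
Qed.

Lemma sum_single a (F : 'rV[R]_l -> 'rV[R]_l) p : a \in Pos -> dotv a p = 0 ->
  (forall b, b \in Pos -> dotv b p = 0 -> b = a) -> \sum_(b <- Pos | dotv b p == 0) F b = F a.
Proof.
move=> aP ap H; rewrite -big_filter.
have -> : [seq b <- Pos | dotv b p == 0] = [:: a]; last by rewrite big_seq1.
apply: perm_small_eq => //; apply: uniq_perm; rewrite ?filter_uniq ?undup_uniq // => b.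
rewrite mem_filter inE; apply/andP/eqP => [[/eqP bp /H ->]|->] //.
by rewrite ap eqxx.
Qed.

(** The [-1] eigenspace of [s_a] on flat sections; it plays the part of the root line in the
    representation carried by the flat sections. *)
Definition odds a u := flat u /\ act a u = - u.

Lemma oddsB a u w c : odds a u -> odds a w -> odds a (u - c%:MP *: w).
Proof.
move=> [fu au] [fw aw]; split; first by apply: (flatD rs) => //; apply: (flatN rs); apply: (flatC rs).
by rewrite actB actC au aw scalerN opprB opprK addrC.
Qed.

Lemma odds_sym a u : a != 0 -> flat u -> a \in Phi -> odds a (u - act a u).
Proof.
move=> a0 fu aP; split; first by apply: (flatD rs) => //; apply: (flatN rs); apply: (flat_act rs ss).
by rewrite actB actK // opprB.
Qed.

Lemma odds_conj a b u : a \in Phi -> odds b u -> odds (refl a b) (act a u).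
Proof.
move=> aP [fu bu]; have a0 := root_neq0 rs aP; split; first exact: (flat_act rs ss).
by rewrite act_conj // actK // bu actN.
Qed.

(** The exponents are [0] and [2 m]. Exponent [0] would give a value at [p] lying in the hyperplane,
    hence fixed by [s_a], and at the same time negated by oddness. *)
Lemma odds_line a u p : a \in Pos -> odds a u -> u != 0 -> dotv a p = 0 ->
  (forall b, b \in Pos -> dotv b p = 0 -> b = a) ->
  exists (w : 'rV[{poly R}]_l) (x : R),
    [/\ liner p a u = 'X^(2 * m) *: w, hor0 w = x *: a & x != 0].
Proof.
move=> aP [fu au] u0 ap H; have a0 := Pos_neq0 rs aP.
have np b : b \in Pos -> dotv b p = 0 -> dotv b a != 0.
  by move=> bP bp; rewrite (H b bP bp) dotv_eq0.
have [k [w [yE w0]]] := flat_exp fu u0 np; rewrite (sum_single _ aP ap H) => kE.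
have k0 : k != 0%N.
  apply: contraNneq w0 => k0; move: yE kE; rewrite k0 expr0 !scale1r scale0r => yE /esym/eqP.
  rewrite !scaler_eq0 (negPf a0) (negPf mR) orbF /= => /eqP c0.
  have up : hor0 w = evr p u by rewrite -yE hor0_liner.
  have : evr p u = - evr p u.
    have := evr_act a u p; rewrite au evrN (refl_fix (v := p)) 1?dotvC // refl_fix //.
    by apply/eqP; rewrite -(cr_eq0 _ a0) -up c0.
  by move=> E; rewrite up; apply/eqP; move: E => /eqP; rewrite -addr_eq0 -mulr2n -scaler_nat scaler_eq0 pnatr_eq0 => /eqP.
have w0E : hor0 w = (m%:R / k%:R * cr a (hor0 w)) *: a.
  have kR : k%:R != 0 :> R by rewrite pnatr_eq0.
  by apply: (scalerI kR); rewrite kE !scalerA; congr (_ *: _); field.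
exists w, (m%:R / k%:R * cr a (hor0 w)); split=> //; last first.
  by apply: contraNneq w0 => x0; rewrite w0E x0 scale0r.
rewrite yE; congr ('X^_ *: _); apply/eqP; rewrite -(eqr_nat R) natrM.
have c0 : cr a (hor0 w) != 0 by apply: contraNneq w0 => c0; rewrite w0E c0 mulr0 scale0r.
have := congr1 (cr a) kE; rewrite !crZ cr_id // => E; apply/eqP; apply: (mulIf c0); rewrite E; ring.
Qed.

Definition Pmw a w (j : 'I_l) : S := \sum_k Pm a k j *: w 0 k.

Lemma ev_Pmw a w j v : (Pmw a w j).@[v 0] = cr a (evr v w) * a 0 j.
Proof.
have -> : cr a (evr v w) * a 0 j = (evr v w *m Pm a) 0 j by rewrite mul_Pm mxE.
rewrite /Pmw raddf_sum mxE; apply: eq_bigr => k _ /=; by rewrite mevalZ evrE mulrC.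
Qed.

(** Half of [Pmw a w] is the projection of [w] to the line of [a], so the second part says that [w]
    is proportional to [a] along the hyperplane. Both parts are read off from [odds_line] at generic
    points. *)
Lemma odds_dvd a u : a \in Pos -> odds a u -> exists2 w, u = linform a ^+ (2 * m) *: w &
  forall j, mdivides (linform a) (w 0 j - 2^-1 *: Pmw a w j).
Proof.
move=> aP ou; have a0 := Pos_neq0 rs aP.
have [->|u0] := eqVneq u 0.
  exists 0; first by rewrite scaler0.
  move=> j; rewrite /Pmw big1 => [|k _]; first by rewrite mxE scaler0 subr0; apply: mdvd0.
  by rewrite [(0 : 'rV[S]_l) 0 k]mxE scaler0.
have lin0 : linform a != 0 by rewrite linform_eq0.
have ll p w k j : dotv a p = 0 -> u = linform a ^+ k *: w ->
    liner p a u 0 j = (dotv a a ^+ k) *: ('X^k * linep p a (w 0 j)).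
  move=> ap ->; rewrite !mxE rmorphM rmorphXn /= linep_linform ap polyC0 add0r exprZn.
  by rewrite scalerAl.
have [w wE] : exists w, u = linform a ^+ (2 * m) *: w.
  have : (2 * m <= 2 * m)%N by []. move: {1 3}(2 * m)%N => k.
  elim: k => [|k IHk] km; first by exists u; rewrite expr0 scale1r.
  have [w wE] := IHk (ltnW km).
  have H j : {q : S | w 0 j = linform a * q}.
    apply: boolp.cid; apply: generic_dvd => // p ap H.
    have [w' [x [yE _ _]]] := odds_line aP ou u0 ap H.
    have := ll p w k j ap wE; rewrite yE mxE => /esym E.
    have aa : dotv a a ^+ k != 0 by rewrite expf_neq0 // dotv_eq0.
    have : linep p a (w 0 j) = (dotv a a ^+ k)^-1 *: ('X^(2 * m - k) * w' 0 j).
      have Xk : 'X^k != 0 :> {poly R} by rewrite monic_neq0 ?monicXn.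
      apply: (mulfI Xk); rewrite -scalerAr mulrA -exprD subnKC; last exact: ltnW.
      by rewrite -E scalerA mulVf // scale1r.
    move/(congr1 (horner^~ 0)); rewrite linep_ev scale0r addr0 => ->.
    by rewrite hornerZ hornerM hornerXn expr0n subn_eq0 leqNgt km mul0r mulr0.
  exists (\row_j sval (H j)); rewrite wE exprSr -scalerA; congr (_ *: _).
  by apply/rowP => j; rewrite !mxE; case: (H j).
exists w => // j; apply: generic_dvd => // p ap H.
have [w' [x [yE w'E _]]] := odds_line aP ou u0 ap H.
have aa : dotv a a ^+ (2 * m) != 0 by rewrite expf_neq0 // dotv_eq0.
have E : evr p w = ((dotv a a ^+ (2 * m))^-1 * x) *: a.
  apply/rowP => i; have := ll p w _ i ap wE; rewrite yE mxE => /esym E.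
  have Xk : 'X^(2 * m) != 0 :> {poly R} by rewrite monic_neq0 ?monicXn.
  have : linep p a (w 0 i) = (dotv a a ^+ (2 * m))^-1 *: w' 0 i.
    by apply: (mulfI Xk); rewrite -scalerAr -E scalerA mulVf // scale1r.
  move/(congr1 (horner^~ 0)); rewrite linep_ev scale0r addr0 evrE => ->.
  have /rowP/(_ i) := w'E; rewrite !mxE hornerZ => ->; ring.
by rewrite mevalB mevalZ ev_Pmw -evrE E crZ cr_id // mxE; field.
Qed.

(** Leading vectors at a generic point are multiples of [a]; a suitable difference is an odd section
    whose leading vector vanishes, hence is zero. *)
Lemma odds_uniq a u u' : a \in Pos -> odds a u -> u != 0 -> odds a u' ->
  exists c : R, u' = c%:MP *: u.
Proof.
move=> aP ou u0 ou'; have [->|u'0] := eqVneq u' 0.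
  by exists 0; rewrite mpolyC0 scale0r.
have [p ap H] := generic_on aP.
have [w [x [yE wE x0]]] := odds_line aP ou u0 ap H.
have [w' [x' [yE' wE' x0']]] := odds_line aP ou' u'0 ap H.
exists (x' / x); apply/eqP; rewrite -subr_eq0; apply/negPn/negP => z0.
have oz := oddsB (x' / x) ou' ou.
have [w2 [x2 [yE2 wE2]]] := odds_line aP oz z0 ap H; case/eqP.
have E : w2 = w' - (x' / x)%:P *: w.
  have Xk : 'X^(2 * m) != 0 :> {poly R} by rewrite monic_neq0 ?monicXn.
  apply/rowP => j; apply: (mulfI Xk).
  have /rowP/(_ j) := yE2; rewrite [RHS]mxE => <-.
  have /rowP/(_ j) := yE; have /rowP/(_ j) := yE'; rewrite !mxE rmorphB rmorphM /= linepC => -> ->; ring.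
have : hor0 w2 = 0.
  apply/rowP => j; have /rowP/(_ j) := wE; have /rowP/(_ j) := wE'; rewrite E !mxE !hornerE => -> ->.
  by field.
by move/eqP; rewrite wE2 scaler_eq0 (negPf (Pos_neq0 rs aP)) orbF => /eqP.
Qed.

Lemma regular_exists : exists p, Qall.@[p 0] != 0.
Proof. exact: mpoly_nonzero_point. Qed.

(** If all flat sections were even, their values at a generic point [p] of the hyperplane would lie
    in it, so a nonzero flat section would vanish at [p]. Its order is then [2 m] and its leading
    vector is a multiple of [a]; as the order is even, evenness makes this vector invariant under
    [s_a], which is absurd. *)
Lemma odds_exists a : a \in Pos -> exists2 u, odds a u & u != 0.
Proof.
move=> aP; have a0 := Pos_neq0 rs aP; apply: boolp.contrapT => N.
have even u : flat u -> act a u = u.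
  move=> fu; apply/eqP; rewrite eq_sym -subr_eq0; apply/negPn/negP => z0.
  by apply: N; exists (u - act a u) => //; apply: odds_sym => //; apply: (Pos_root aP).
have [q Qq] := regular_exists; have [p ap H] := generic_on aP.
have np b : b \in Pos -> dotv b p = 0 -> dotv b a != 0.
  by move=> bP bp; rewrite (H b bP bp) dotv_eq0.
have X (i : 'I_l) : {u | flat u & forall j, (u 0 j).@[q 0] = (delta_mx 0 i : 'rV[R]_l) 0 j}.
  by apply: boolp.cid2; apply: (flat_exists rs ss).
pose f i := s2val (X i).
have ff i : flat (f i) by rewrite /f; case: (X i).
have fq i : evr q (f i) = delta_mx 0 i.
  by rewrite /f; case: (X i) => u /= _ E; apply/rowP => j; rewrite evrE E.
pose E : 'M[R]_l := \matrix_i evr p (f i).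
have : \det E^T == 0.
  apply/det0P; exists a => //; apply/rowP => i; rewrite mxE [RHS]mxE.
  transitivity (dotv a (evr p (f i))); first by apply: eq_bigr => k _; rewrite !mxE.
  have := evr_act a (f i) p; rewrite (even _ (ff i)) (refl_fix (v := p)) 1?dotvC // reflE => /eqP.
  rewrite eq_sym subr_eq -subr_eq0 opprD addrA subrr sub0r oppr_eq0 scaler_eq0 (negPf a0) orbF cr_eq0 //.
  by rewrite dotvC => /eqP.
rewrite det_tr => /det0P[c c0 cE].
pose u := \sum_i (c 0 i)%:MP *: f i.
have fu : flat u by apply: (flat_sum rs) => i _; apply: (flatC rs).
have evu v : evr v u = c *m \matrix_i evr v (f i).
  rewrite /u /evr raddf_sum /= mulmx_sum_row; apply: eq_bigr => i _.
  by rewrite -!/(evr _ _) evrC rowK.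
have u0 : u != 0.
  apply: contraNneq c0 => u0; have := evu q; rewrite u0.
  have -> : \matrix_i evr q (f i) = 1%:M by apply/row_matrixP => i; rewrite rowK fq row1.
  by rewrite mulmx1 => <-; rewrite /evr map_mx0.
have [k [w [yE w0]]] := flat_exp fu u0 np; rewrite (sum_single _ aP ap H) => kE.
have up : evr p u = 0 by rewrite evu.
have k0 : k != 0%N.
  by apply: contraNneq w0 => k0; rewrite -up -(hor0_liner p a) yE k0 expr0 scale1r.
have c0' : cr a (hor0 w) != 0.
  apply: contraNneq w0 => z; move: kE; rewrite z scale0r scaler0 => /eqP.
  by rewrite scaler_eq0 pnatr_eq0 (negPf k0).
have kR : k%:R != 0 :> R by rewrite pnatr_eq0.
have kE2 : k%:R = 2 * m%:R :> R.
  by have := congr1 (cr a) kE; rewrite !crZ cr_id // => E'; apply: (mulIf c0'); rewrite E'; ring.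
have k2 : k = (2 * m)%N by apply/eqP; rewrite -(eqr_nat R) natrM kE2.
have sym t : evr (p - t *: a) u *m refl_mx a = 1 *: evr (p + t *: a) u.
  rewrite scale1r -refl_mul -{2}(even u fu) evr_act; congr (refl a (evr _ u)).
  by rewrite reflD reflZ refl_id // refl_fix 1?dotvC // scalerN.
have := line_symmetry sym yE; rewrite k2 exprM sqrrN !expr1n !scale1r -refl_mul reflE => /eqP.
rewrite -subr_eq0 addrAC subrr sub0r oppr_eq0 scaler_eq0 (negPf a0) orbF.
by rewrite (negPf c0').
Qed.

End OddSections.

(** * Vanishing orders at flats of codimension two *)

Section RankTwoMonodromy.
Variables (l : nat) (Phi : seq 'rV[R]_l) (Delta : 'M[R]_l).
Hypotheses (rs : root_system Phi) (ss : simple_system Phi Delta).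
Variable m : nat.
Hypothesis m0 : (0 < m)%N.
Local Notation Pos := (Pos Phi Delta).
Local Notation Qall := (Qall Phi Delta).
Local Notation S := {mpoly R[l]}.
Local Notation flat := (@flat l Phi Delta m).
Local Notation odds := (@odds l Phi Delta m).
Local Notation rk2 := (@rk2 l Phi Delta).

Lemma projm_tr (w : 'rV[R]_l) : (projm w)^T = projm w.
Proof. by rewrite /projm linearB linearZ /= trmx1 trmx_mul trmxK. Qed.

Lemma uniq_rk2 p a b : rk2 p a b -> uniq (map (comb a b) (rk2c p)).
Proof.
case=> p3 ind _ _; rewrite map_inj_uniq; first by case: p p3 => [|[|[|[|]]]].
move=> [x y] [x' y'] /(indep2_inj ind)[/eqP + /eqP]; rewrite !eqr_nat => /eqP /= -> /eqP -> //.
Qed.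

Lemma rk2_generic p a b : rk2 p a b -> exists pt xi : 'rV[R]_l,
  [/\ forall c, c \in Pos -> (dotv c pt == 0) = (c \in map (comb a b) (rk2c p)),
      dotv a pt = 0 /\ dotv b pt = 0,
      exists x y, xi = x *: a + y *: b &
      forall c, c \in map (comb a b) (rk2c p) -> dotv c xi != 0].
Proof.
move=> [p3 ind _ XE].
have a0 : a != 0.
  apply/eqP => a0; have [] := ind 1 0; first by rewrite a0 scale0r scaler0 addr0.
  by move=> /eqP; rewrite oner_eq0.
pose b' := b *m projm a.
have b'E : b' = b - (dotv b a / dotv a a) *: a by rewrite /b' mul_projm.
have b'0 : b' != 0.
  apply/eqP => z; have [] := ind (- (dotv b a / dotv a a)) 1; first by rewrite scale1r addrC scaleNr -b'E.
  by move=> _ /eqP; rewrite oner_eq0.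
(* Gram-Schmidt: since [a] and [b'] are orthogonal, [M] projects onto the flat where [a] and [b]
   vanish. *)
pose M := projm b' *m projm a; pose X := map (comb a b) (rk2c p).
have ab' : dotv a b' = 0 by rewrite /b' dotv_projm.
have aM v : dotv a (v *m M) = 0 by rewrite /M mulmxA dotv_projm.
have bM v : dotv b (v *m M) = 0.
  have -> : b = b' + (dotv b a / dotv a a) *: a by rewrite b'E subrK.
  rewrite dotvDl dotvZl aM mulr0 addr0 /M mulmxA mul_projm dotvBr dotvZr (dotvC b' a) ab' mulr0 subr0.
  exact: dotv_projm.
have XM c v : c \in X -> dotv c (v *m M) = 0.
  by case/mapP => -[x y] _ ->; rewrite /comb dotvDl !dotvZl aM bM !mulr0 addr0.
have cM c : c \in Pos -> c \notin X -> c *m M^T != 0.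
  move=> cP; apply: contraNneq; rewrite /M trmx_mul !projm_tr mulmxA mul_projm => /eqP.
  rewrite subr_eq0 => /eqP E.
  have [x [y cE]] : exists x y, c = x *: a + y *: b.
    move: E; rewrite [c *m projm a]mul_projm.
    move: (dotv c a / _) (dotv _ b' / _) => s t /eqP; rewrite subr_eq => /eqP ->.
    exists (s - t * (dotv b a / dotv a a)), t; rewrite b'E scalerBr scalerBl scalerA.
    by rewrite addrC [RHS]addrAC -[RHS]addrA.
  by rewrite cE -XE -cE.
pose f : S := \prod_(c <- Pos | c \notin X) linform (c *m M^T).
have [|v fv] := @mpoly_nonzero_point _ f.
  rewrite /f -big_filter prodf_seq_neq0; apply/allP => c; rewrite mem_filter => /andP[cX cP] /=.
  by rewrite linform_eq0 cM.
have [t ct] : exists t : R, forall c, c \in X -> dotv c (a + t *: b) != 0.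
  pose g : {poly R} := \prod_(c <- X) linep a b (linform c).
  have g0 : g != 0.
    rewrite /g prodf_seq_neq0; apply/allP => c cX /=; rewrite linep_linform; apply/eqP => z.
    have ca : dotv c a = 0 by have := congr1 (horner^~ 0) z; rewrite !hornerE.
    have cb : dotv c b = 0 by have := congr1 (horner^~ 1) z; rewrite !hornerE ca add0r.
    have /mapP[[x y] xy cE] := cX.
    have : c == 0.
      by rewrite -dotv_eq0 {2}cE /comb dotvDr !dotvZr ca cb !mulr0 addr0.
    rewrite cE => /eqP/ind[/eqP + /eqP]; rewrite /= !pnatr_eq0 => /eqP x0 /eqP y0.
    by move: xy; rewrite x0 y0; case: p p3 {XE X XM cM f fv g cX} => [|[|[|[|]]]].
  apply: boolp.contrapT => N; case/eqP: g0; apply: poly_fun_eq0 => t; apply/eqP/negPn/negP => gt.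
  apply: N; exists t => c cX; apply: contraNneq gt => z.
  by rewrite -[g.[t]]/(horner_eval t g) /g (rmorph_prod (horner_eval t)) /= (big_rem c) //= horner_evalE linep_ev ev_linform z mul0r.
exists (v *m M), (a + t *: b); split=> //.
- move=> c cP; apply/idP/idP => [|cX]; last by rewrite XM.
  apply: contraLR => cX; move: fv; rewrite /f (big_rem c) //= cX mevalM mulf_eq0 negb_or.
  by case/andP; rewrite ev_linform dotv_mulmx trmxK.
- by exists 1, t; rewrite scale1r.
Qed.

(** For a dihedral group the number of reflections is its Coxeter number; here it is also correct
    for the reducible type, and all four types are checked by computation. *)
Lemma rk2_Casimir p a b x y : a \in Pos -> b \in Pos -> rk2 p a b ->
  \sum_(c <- map (comb a b) (rk2c p)) cr c (x *: a + y *: b) *: c =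
  (size (rk2c p))%:R *: (x *: a + y *: b).
Proof.
move=> aP bP [p3 ind [pE qE] _].
have A := dotv_gt0 (Pos_neq0 rs aP); have B := dotv_gt0 (Pos_neq0 rs bP).
have G : dotv a b = - (p%:R * dotv a a / 2).
  by move: pE; rewrite /cr (dotvC b a) => E; rewrite -[p%:R]opprK -E; field; rewrite gt_eqF.
have G2 : dotv a b = - ((0 < p)%N%:R * dotv b b / 2).
  by move: qE; rewrite /cr => E; rewrite -[(0 < p)%N%:R]opprK -E; field; rewrite gt_eqF.
have crc i j : cr (comb a b (i, j)) (x *: a + y *: b) =
    2 * (x * i%:R * dotv a a + (x * j%:R + y * i%:R) * dotv a b + y * j%:R * dotv b b) /
    (i%:R ^+ 2 * dotv a a + 2 * i%:R * j%:R * dotv a b + j%:R ^+ 2 * dotv b b).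
  rewrite /cr /comb /= !(dotvDl, dotvDr, dotvZl, dotvZr) (dotvC b a); congr (_ / _); ring.
rewrite big_map; set F := fun c => cr (comb a b c) (x *: a + y *: b).
have -> : \sum_(c <- rk2c p) cr (comb a b c) (x *: a + y *: b) *: comb a b c =
    (\sum_(c <- rk2c p) F c * c.1%:R) *: a + (\sum_(c <- rk2c p) F c * c.2%:R) *: b.
  rewrite !scaler_suml -big_split; apply: eq_bigr => c _ /=.
  by rewrite /comb scalerDr !scalerA.
rewrite scalerDr !scalerA.
have BE : (0 < p)%N -> dotv b b = p%:R * dotv a a.
  by move=> p0; move: G2; rewrite G p0 mulr1n; lra.
have cong x1 x2 y1 y2 : x1 = x2 -> y1 = y2 -> x1 *: a + y1 *: b = x2 *: a + y2 *: b by move=> -> ->.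
move: p3 G BE {pE qE G2}; rewrite /F {F}; case: p => [|[|[|[|//]]]] _ G BE.
2-4: have {}BE := BE isT.
2-4: rewrite /rk2c !big_cons !big_nil !crc /= G BE; apply: cong; field.
1: rewrite /rk2c !big_cons !big_nil !crc /= G; apply: cong; field.
all: try by rewrite ?gt_eqF.
all: do ?[apply/andP; split]; apply/eqP; lra.
Qed.

(** Vanishing at the point excludes order zero, so the leading vector lies in the image of the
    residue, the plane of [a] and [b]; there the residue is the scalar [m * size (rk2c p)]. *)
Lemma rk2_lead p a b pt xi u : a \in Pos -> b \in Pos -> rk2 p a b ->
  (forall c, c \in Pos -> (dotv c pt == 0) = (c \in map (comb a b) (rk2c p))) ->
  (forall c, c \in map (comb a b) (rk2c p) -> dotv c xi != 0) ->
  flat u -> u != 0 -> evr pt u = 0 ->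
  exists (w : 'rV[{poly R}]_l) (x y : R),
    [/\ liner pt xi u = 'X^(m * size (rk2c p)) *: w, hor0 w != 0 & hor0 w = x *: a + y *: b].
Proof.
move=> aP bP rk ptE xiE fu u0 up.
have np c : c \in Pos -> dotv c pt = 0 -> dotv c xi != 0.
  by move=> cP /eqP; rewrite ptE //; apply: xiE.
have [k [w [yE w0 kE]]] := flat_exp fu u0 np.
have k0 : k != 0%N.
  by apply: contraNneq w0 => k0; rewrite -up -(hor0_liner pt xi) yE k0 expr0 scale1r.
have XP : perm_eq [seq c <- Pos | dotv c pt == 0] (map (comb a b) (rk2c p)).
  apply: uniq_perm; rewrite ?filter_uniq ?undup_uniq ?(uniq_rk2 rk) // => c.
  rewrite mem_filter; apply/andP/idP => [[z cP]|cX]; first by rewrite -ptE.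
  suff cP : c \in Pos by rewrite ptE.
  have [_ _ _ XE] := rk; have /mapP[[i j] _ cE] := cX.
  by rewrite cE /comb XE -/(comb a b (i, j)) -cE.
have kR : k%:R != 0 :> R by rewrite pnatr_eq0.
move: kE; rewrite -big_filter (perm_big _ XP) /= => kE.
have [x [y w0E]] : exists x y, hor0 w = x *: a + y *: b.
  exists (k%:R^-1 * m%:R * \sum_(c <- rk2c p) cr (comb a b c) (hor0 w) * c.1%:R),
         (k%:R^-1 * m%:R * \sum_(c <- rk2c p) cr (comb a b c) (hor0 w) * c.2%:R).
  apply: (scalerI kR); rewrite kE big_map scalerDr !scalerA !mulrA divff // mul1r -!scalerA.
  rewrite -scalerDr; congr (_ *: _); rewrite !scaler_suml -big_split; apply: eq_bigr => c _ /=.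
  by rewrite /comb scalerDr !scalerA.
exists w, x, y; split=> //; rewrite yE; congr ('X^_ *: _).
move: kE; rewrite w0E rk2_Casimir // -w0E scalerA => /eqP; rewrite -subr_eq0 -scalerBl scaler_eq0.
by rewrite (negPf w0) orbF subr_eq0 -natrM eqr_nat => /eqP.
Qed.

Lemma odds_ev0 a u pt : a \in Pos -> odds a u -> dotv a pt = 0 -> evr pt u = 0.
Proof.
move=> aP ou ap; have [w -> _] := odds_dvd rs ss m0 aP ou.
by rewrite evrZ rmorphXn /= ev_linform ap expr0n muln_eq0 /= eqn0Ngt m0 scale0r.
Qed.

(** Such a section is the product of all [c^(2m)], for [c] in [s], with some [v], and its order at
    the flat is [m * size (rk2c p)]. If the bound failed, the leading vector would be a multiple of
    the value of [v] there; but that value is proportional to every [c] in [s], hence zero. *)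
Lemma rk2_bound p a b u (s : seq 'rV[R]_l) : a \in Pos -> b \in Pos -> rk2 p a b ->
  flat u -> u != 0 -> uniq s -> (1 < size s)%N -> {subset s <= map (comb a b) (rk2c p)} ->
  (forall c, c \in s -> odds c u) -> (2 * size s < size (rk2c p))%N.
Proof.
move=> aP bP rk fu u0 us s1 sX os.
have [pt [xi [ptE _ _ xiE]]] := rk2_generic rk.
have sP c : c \in s -> c \in Pos.
  move=> /sX cX; have [_ _ _ XE] := rk; have /mapP[[i j] _ cE] := cX.
  by rewrite cE /comb XE -/(comb a b (i, j)) -cE.
have spt c : c \in s -> dotv c pt = 0 by move=> cs; apply/eqP; rewrite ptE ?sX ?sP.
have [c1 [c2 [c1s c2s c12]]] : exists c1 c2, [/\ c1 \in s, c2 \in s & c1 != c2].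
  case: (s) us s1 => [|c1 [|c2 s']] //=; rewrite inE negb_or => /andP[/andP[c12 _] _] _.
  by exists c1, c2; rewrite !inE !eqxx ?orbT.
have up : evr pt u = 0 by apply: (odds_ev0 (sP _ c1s) (os _ c1s)); apply: spt.
have [w [x [y [yE w0 _]]]] := rk2_lead aP bP rk ptE xiE fu u0 up.
have ns : nprop s.
  have [_ P0 PP] := nprop_Pos rs ss; split=> // [|c c' cs c's]; last by apply: PP; apply: sP.
  by apply/negP => /sP; rewrite (negPf P0).
pose Pi (t : seq 'rV[R]_l) : S := \prod_(c <- t) linform c ^+ (2 * m).
have V j : {q : S | u 0 j = Pi s * q}.
  apply: boolp.cid; apply: (linform_prod_dvd (e := fun=> (2 * m)%N)) => // c cs.
  by have [w' -> _] := odds_dvd rs ss m0 (sP _ cs) (os _ cs); exists (w' 0 j); rewrite mxE.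
pose v : 'rV[S]_l := \row_j sval (V j).
have uE : u = Pi s *: v by apply/rowP => j; rewrite !mxE; case: (V j).
pose kap := \prod_(c <- s) dotv c xi ^+ (2 * m).
have kap0 : kap != 0.
  by rewrite prodf_seq_neq0; apply/allP => c cs /=; rewrite expf_neq0 // xiE // sX.
have PiL : linep pt xi (Pi s) = kap *: 'X^(size s * (2 * m)).
  rewrite /Pi /kap rmorph_prod {us s1 sX os sP c1 c2 c1s c2s c12 up ns V v uE kap kap0}.
  move: (2 * m)%N => M; elim: s spt => [|c s IHs] spt /=; first by rewrite !big_nil mul0n expr0 scale1r.
  rewrite !big_cons IHs => [|c' cs]; last by rewrite spt // inE cs orbT.
  rewrite rmorphXn /= linep_linform spt ?mem_head // add0r exprZn mulSn exprD.
  by rewrite -scalerAl -scalerAr scalerA.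
rewrite ltnNge; apply/negP => big.
have vE j : 'X^(m * size (rk2c p)) * w 0 j = kap *: ('X^(size s * (2 * m)) * linep pt xi (v 0 j)).
  have /rowP/(_ j) := yE; rewrite [RHS]mxE => <-; rewrite mxE uE [(_ *: v) 0 j]mxE rmorphM /= PiL.
  by rewrite scalerAl.
have le : (m * size (rk2c p) <= size s * (2 * m))%N by nia.
have wE j : w 0 j = kap *: ('X^(size s * (2 * m) - m * size (rk2c p)) * linep pt xi (v 0 j)).
  have Xk : 'X^(m * size (rk2c p)) != 0 :> {poly R} by rewrite monic_neq0 ?monicXn.
  by apply: (mulfI Xk); rewrite vE -scalerAr mulrA -exprD subnKC.
case/eqP: w0; apply/rowP => j; rewrite !mxE wE hornerZ hornerM hornerXn linep_ev scale0r addr0 -evrE.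
suff -> : evr pt v = 0 by rewrite mxE !mulr0.
have vc c : c \in s -> evr pt v = (2^-1 * cr c (evr pt v)) *: c.
  move=> cs; have cP := sP _ cs; have c0 := Pos_neq0 rs cP.
  have [wc uc cd] := odds_dvd rs ss m0 cP (os _ cs).
  pose rest := Pi (rem c s).
  have PiE : Pi s = linform c ^+ (2 * m) * rest by rewrite /Pi (big_rem c).
  have lc0 : linform c ^+ (2 * m) != 0 by rewrite expf_neq0 // linform_eq0.
  have wcE j' : wc 0 j' = rest * v 0 j'.
    apply: (mulfI lc0); rewrite mulrA -PiE.
    by have /rowP/(_ j') := uE; rewrite uc !mxE.
  apply/rowP => i; rewrite [RHS]mxE.
  have nrest : ~ mdivides (linform c) rest.
    apply: linform_ndvd_prod => // c' c's; apply: linform_ndvdX => //.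
    have [_ _ PP] := ns; apply: linform_ndvd_linform => t; apply: PP => //.
      exact: mem_rem c's.
    by apply/eqP => cc'; move: c's; rewrite -cc' mem_rem_uniqF.
  have := cd i; have -> : wc 0 i - 2^-1 *: Pmw c wc i = rest * (v 0 i - 2^-1 *: Pmw c v i).
    rewrite wcE mulrBr; congr (_ - _); rewrite -scalerAr; congr (_ *: _).
    by rewrite /Pmw mulr_sumr; apply: eq_bigr => k _; rewrite wcE scalerAr.
  case/(linform_prime c0) => [/nrest //|]; move/linform_dvd_ev => /(_ pt (spt _ cs)).
  rewrite mevalB mevalZ ev_Pmw -evrE => /eqP; rewrite subr_eq0 => /eqP ->; ring.
have ind := Pos_indep2 rs ss (sP _ c1s) (sP _ c2s) c12.
have := vc _ c1s; have := vc _ c2s; move: (2^-1 * _) (2^-1 * _) => s2 t1 E2 E1.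
have [] := ind s2 (- t1); first by rewrite scaleNr -E1 -E2 subrr.
by move=> t0 _; rewrite E1 t0 scale0r.
Qed.

(** The composite of the two orthogonal reflections is the half turn of the plane. It fixes [u], and
    the order of [u] at the flat is even, so the leading vector would be fixed by a map acting as
    [-1] on the plane. *)
Lemma rk2_parity p a b c c' u : a \in Pos -> b \in Pos -> rk2 p a b -> c \in Pos -> c' \in Pos ->
  c \in map (comb a b) (rk2c p) -> dotv c c' = 0 ->
  a = (dotv a c / dotv c c) *: c + (dotv a c' / dotv c' c') *: c' ->
  b = (dotv b c / dotv c c) *: c + (dotv b c' / dotv c' c') *: c' ->
  ~~ odd (size (rk2c p)) -> c' \in map (comb a b) (rk2c p) ->
  odds c u -> odds c' u -> u = 0.
Proof.
move=> aP bP rk cP c'P cX cc' aE bE ev c'X oc oc'; apply/eqP/negPn/negP => u0.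
have [fu cu] := oc; have [_ cu'] := oc'.
have [pt [xi [ptE _ [x [y xiE]] xiN]]] := rk2_generic rk.
have cpt : dotv c pt = 0 by apply/eqP; rewrite ptE.
have c'pt : dotv c' pt = 0 by apply/eqP; rewrite ptE.
have up := odds_ev0 cP oc cpt.
have [w [x1 [y1 [yE w0 w0E]]]] := rk2_lead aP bP rk ptE xiN fu u0 up.
have c0 := Pos_neq0 rs cP; have c'0 := Pos_neq0 rs c'P.
pose rho v := refl c (refl c' v).
have rhoc : rho c = - c by rewrite /rho (refl_fix cc') refl_id.
have rhoc' : rho c' = - c' by rewrite /rho refl_id // reflN refl_fix // dotvC.
have rhoD u1 u2 : rho (u1 + u2) = rho u1 + rho u2 by rewrite /rho !reflD.
have rhoZ t u1 : rho (t *: u1) = t *: rho u1 by rewrite /rho !reflZ.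
have rhoa : rho a = - a by rewrite aE rhoD !rhoZ rhoc rhoc' !scalerN -opprD -aE.
have rhob : rho b = - b by rewrite bE rhoD !rhoZ rhoc rhoc' !scalerN -opprD -bE.
have rhoS s t : rho (s *: a + t *: b) = - (s *: a + t *: b).
  by rewrite rhoD !rhoZ rhoa rhob !scalerN -opprD.
have rhoC v : refl c' (refl c v) = rho v.
  rewrite /rho !reflE !crB !crZ.
  have -> : cr c c' = 0 by apply/eqP; rewrite cr_eq0 // dotvC cc'.
  have -> : cr c' c = 0 by apply/eqP; rewrite cr_eq0 // cc'.
  by rewrite !mulr0 !subr0 addrAC.
have sym t : evr (pt - t *: xi) u *m (refl_mx c' *m refl_mx c) = 1 *: evr (pt + t *: xi) u.
  rewrite scale1r mulmxA -!refl_mul.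
  have E : act c (act c' u) = u by rewrite cu' actN cu opprK.
  rewrite -{2}E !evr_act rhoC; congr (refl c (refl c' (evr _ u))).
  rewrite rhoD rhoZ xiE rhoS scalerN; congr (_ - _).
  by rewrite /rho !refl_fix // dotvC.
have := line_symmetry sym yE; rewrite -signr_odd oddM (negPf ev) andbF expr0 !scale1r.
rewrite mulmxA -!refl_mul w0E -/(rho _) rhoS -w0E => /eqP.
by rewrite eq_sym -addr_eq0 -mulr2n -scaler_nat scaler_eq0 pnatr_eq0 (negPf w0).
Qed.

End RankTwoMonodromy.

(** * The reflection representation on flat sections *)

Section FlatFrame.
Variables (l : nat) (Phi : seq 'rV[R]_l) (Delta : 'M[R]_l).
Hypotheses (rs : root_system Phi) (ss : simple_system Phi Delta).
Local Notation Pos := (Pos Phi Delta).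
Local Notation Qall := (Qall Phi Delta).
Local Notation al := (al Delta).
Local Notation S := {mpoly R[l]}.
Local Notation rk2 := (@rk2 l Phi Delta).

Lemma mpolyC_inj_vec (x : R) (u : 'rV[S]_l) : u != 0 -> x%:MP *: u = 0 -> x = 0.
Proof.
move=> u0 E; apply/eqP/negPn/negP => x0; case/eqP: u0.
by rewrite -[u]scale1r -mpolyC1 -(mulVf x0) mpolyCM -scalerA E scaler0.
Qed.

Section Positive.
Variable m : nat.
Hypothesis m0 : (0 < m)%N.
Local Notation flat := (@flat l Phi Delta m).
Local Notation odds := (@odds l Phi Delta m).

Section Pair.
Variables (p : nat) (a b : 'rV[R]_l) (fa fb : 'rV[S]_l) (c c' : R).
Hypotheses (aP : a \in Pos) (bP : b \in Pos) (rk : rk2 p a b).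
Hypotheses (oa : odds a fa) (ob : odds b fb) (fa0 : fa != 0) (fb0 : fb != 0).
Hypotheses (ab : act a fb = fb - c%:MP *: fa) (ba : act b fa = fa - c'%:MP *: fb).

Let a0 : a != 0. Proof. exact: (Pos_neq0 rs aP). Qed.
Let b0 : b != 0. Proof. exact: (Pos_neq0 rs bP). Qed.
Let aPh := Pos_root aP.
Let bPh := Pos_root bP.

Let refl_ab : refl a b = p%:R *: a + b.
Proof. by case: rk => _ _ [E _] _; rewrite reflE E scaleNr opprK addrC. Qed.
Let refl_ba : refl b a = a + (0 < p)%N%:R *: b.
Proof. by case: rk => _ _ [_ E] _; rewrite reflE E scaleNr opprK. Qed.

Let combE x y : comb a b (x, y) = x%:R *: a + y%:R *: b. Proof. by []. Qed.

Let bound u (s : seq (nat * nat)) : flat u -> uniq s -> (1 < size s)%N -> {subset s <= rk2c p} ->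
  (size (rk2c p) <= 2 * size s)%N -> (forall x, x \in s -> odds (comb a b x) u) -> u = 0.
Proof.
move=> fu us s1 sX sz os; apply/eqP/negPn/negP => u0.
have ci : injective (comb a b).
  case: rk => _ ind _ _ [x y] [x' y'] /(indep2_inj ind)[/eqP + /eqP].
  by rewrite !eqr_nat => /eqP /= -> /eqP ->.
have /= := @rk2_bound _ _ _ rs ss m m0 p a b u (map (comb a b) s) aP bP rk fu u0.
rewrite map_inj_uniq // size_map => /(_ us s1); rewrite ltnNge sz.
suff H1 : {subset map (comb a b) s <= map (comb a b) (rk2c p)}.
  by move=> /(_ H1) H; suff : false by []; apply: H => c1 /mapP[x xs ->]; apply: os.
by move=> z /mapP[x xs ->]; apply: map_f; apply: sX.
Qed.

Let ca : comb a b (1, 0)%N = a. Proof. by rewrite /comb scale1r scale0r addr0. Qed.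
Let cb : comb a b (0, 1)%N = b. Proof. by rewrite /comb scale1r scale0r add0r. Qed.

Let odds_both u : odds a u -> odds b u -> u = 0.
Proof.
move=> oau obu; have fu := oau.1; have [p3 _ _ _] := rk.
have [p3'|p3'] := ltnP p 3.
  apply: (@bound _ [:: (1, 0); (0, 1)]%N) => //.
  - by case: (p) p3' => [|[|[|]]] // _ x; rewrite !inE => /orP[]/eqP->.
  - by case: (p) p3' => [|[|[|]]].
  - by move=> x; rewrite !inE => /orP[]/eqP->; rewrite ?ca ?cb.
(* Two of the six roots are too few for the bound; oddness under [a] and [b] also gives oddness
   under [s_a b = 3 a + b]. *)
have pE : p = 3%N by lia.
apply: (@bound _ [:: (1, 0); (0, 1); (3, 1)]%N) => //; rewrite ?pE //.
  by move=> x; rewrite !inE => /or3P[]/eqP->.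
move=> x; rewrite !inE => /or3P[]/eqP->; rewrite ?ca ?cb //.
have -> : comb a b (3, 1)%N = refl a b by rewrite refl_ab pE /comb scale1r.
split=> //; by rewrite act_conj // oau.2 actN obu.2 opprK oau.2.
Qed.

Let cmb (x y : R) : 'rV[S]_l := x%:MP *: fa + y%:MP *: fb.

Let cmb_inj x y x' y' : cmb x y = cmb x' y' -> x = x' /\ y = y'.
Proof.
move=> E; have {}E : cmb (x - x') (y - y') = 0.
  rewrite /cmb !mpolyCB !scalerBl addrACA -opprD -/(cmb x y) -/(cmb x' y') E subrr. by [].
suff [/eqP + /eqP] : x - x' = 0 /\ y - y' = 0 by rewrite !subr_eq0 => /eqP -> /eqP ->.
move: (x - x') (y - y') E => {}x {}y E.
have y0 : y = 0.
  apply/eqP/negPn/negP => y0; case/eqP: fb0; apply: odds_both => //.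
  have -> : fb = (- (x / y))%:MP *: fa.
    have : (y^-1)%:MP *: cmb x y = 0 by rewrite E scaler0.
    rewrite /cmb scalerDr !scalerA -!mpolyCM mulVf // mpolyC1 scale1r => /eqP.
    by rewrite addrC addr_eq0 => /eqP ->; rewrite mpolyCN scaleNr mulrC.
  by split; [apply: (flatC rs); case: oa|rewrite actC oa.2 scalerN].
split=> //; apply: (@mpolyC_inj_vec _ fa) => //; move: E.
by rewrite /cmb y0 mpolyC0 scale0r addr0.
Qed.

Let act_a x y : act a (cmb x y) = cmb (- x - c * y) y.
Proof.
rewrite /cmb actD !actC oa.2 ab scalerBr scalerA -mpolyCM scalerN -scaleNr -mpolyCN.
by rewrite addrCA addrC -scalerBl -mpolyCB mulrC.
Qed.

Let act_b x y : act b (cmb x y) = cmb x (- y - c' * x).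
Proof.
rewrite /cmb actD !actC ob.2 ba scalerBr scalerA -mpolyCM scalerN -scaleNr -mpolyCN.
by rewrite -addrA; congr (_ + _); rewrite -scalerBl -mpolyCB addrC mulrC.
Qed.

Let cmbZ t x y : t%:MP *: cmb x y = cmb (t * x) (t * y).
Proof. by rewrite /cmb scalerDr !scalerA !mpolyCM. Qed.

Let fbE : fb = cmb 0 1. Proof. by rewrite /cmb mpolyC0 scale0r add0r mpolyC1 scale1r. Qed.
Let faE : fa = cmb 1 0. Proof. by rewrite /cmb mpolyC0 scale0r addr0 mpolyC1 scale1r. Qed.
Let cmb0 x y : cmb x y = 0 -> x = 0 /\ y = 0.
Proof. by move=> E; apply: cmb_inj; rewrite E /cmb !mpolyC0 !scale0r addr0. Qed.
Let act_neq0 (r : 'rV[R]_l) (u : 'rV[S]_l) : r != 0 -> u != 0 -> act r u != 0.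
Proof.
move=> r0; apply: contraNneq => E; rewrite -(actK r0 u) E.
by apply/eqP; apply: evr_inj => v; rewrite evr_act /evr !map_mx0 refl0.
Qed.

Let inX x : x \in rk2c p -> comb a b x \in Pos.
Proof. by case: x => x y xX; case: rk => _ _ _ XE; rewrite /comb XE; apply: map_f xX. Qed.

(** A root fixed by a reflection, or reached by two words, has a line of odd sections on which the
    corresponding action is a scalar. This gives polynomial equations in [c] and [c']; their
    unwanted solutions would make one section odd under too many roots, or under two orthogonal
    ones. *)
Lemma rk2_structure : c * c' = p%:R /\ (p = 0%N -> c = 0 /\ c' = 0).
Proof.
have [p3 ind [crab crba] XE] := rk; have A := dotv_gt0 a0; have B := dotv_gt0 b0.
have G : dotv a b = - (p%:R * dotv a a / 2).
  by move: crab; rewrite /cr (dotvC b a) => E; rewrite -[p%:R]opprK -E; field; rewrite gt_eqF.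
have G2 : dotv a b = - ((0 < p)%N%:R * dotv b b / 2).
  by move: crba; rewrite /cr => E; rewrite -[(0 < p)%N%:R]opprK -E; field; rewrite gt_eqF.
have oab := odds_conj rs ss aPh ob; have oba := odds_conj rs ss bPh oa.
case: (p) p3 G G2 crab crba XE refl_ab refl_ba bound inX => [|[|[|[|//]]]] _ G G2 {}crab {}crba {}XE rab rba bnd iX; rewrite ?mulr1n in G2.
- have [z zE] : exists z, act a fb = z%:MP *: fb.
    have H : odds b (act a fb) by move: oab; rewrite rab scale0r add0r.
    exact: (odds_uniq rs ss m0 bP ob fb0 H).
  have [z' zE'] : exists z, act b fa = z%:MP *: fa.
    have H : odds a (act b fa) by move: oba; rewrite rba scale0r addr0.
    exact: (odds_uniq rs ss m0 aP oa fa0 H).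
  move: zE zE'; rewrite {1}fbE act_a {1}faE act_b {1}fbE {1}faE !cmbZ => /cmb_inj[+ _] /cmb_inj[_].
  rewrite !mulr0 !oppr0 !mulr1 => E1 E2.
  have -> : c = 0 by lra.
  by split=> [|_]; [rewrite mul0r|split; lra].
- have d : comb a b (1, 1)%N \in Pos by apply: iX.
  have dE : refl a b = comb a b (1, 1)%N by rewrite rab /comb !scale1r.
  have dE' : refl b a = comb a b (1, 1)%N by rewrite rba /comb !scale1r.
  have [z] : exists z, act a fb = z%:MP *: act b fa.
    rewrite dE' in oba; rewrite dE in oab.
    exact: (odds_uniq rs ss m0 d oba (act_neq0 b0 fa0) oab).
  rewrite fbE faE act_a act_b cmbZ => /cmb_inj[E1 E2]; split=> //.
  have -> : c = - z by lra.
  lra.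
- pose d := comb a b (2, 1)%N; have dP : d \in Pos by apply: iX.
  have dE : refl a b = d by rewrite rab /d /comb !scale1r.
  have bd : refl b d = d.
    by apply: refl_fix; rewrite /d /comb /= dotvDl !dotvZl; lra.
  have od : odds d (act a fb) by rewrite -dE.
  have ga0 : act a fb != 0 by apply: act_neq0.
  have [z zE] : exists z, act b (act a fb) = z%:MP *: act a fb.
    have H : odds d (act b (act a fb)) by rewrite -{1}bd; exact: (odds_conj rs ss bPh od).
    exact: (odds_uniq rs ss m0 dP od ga0 H).
  have E := zE; move: E; rewrite fbE act_a act_b cmbZ => /cmb_inj[E1 E2]; split=> //.
  (* For [c = 0] the section would be odd under the orthogonal roots [b] and [2 a + b], two out of
     four. *)
  have [c0|c0] := eqVneq c 0; last first.
    have z1 : z = 1 by apply: (mulIf c0); move: E1; rewrite ?mulr1 ?oppr0; lra.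
    by move: E2; rewrite z1 ?oppr0; lra.
  case/eqP: ga0; apply: (bnd _ [:: (0, 1); (2, 1)]%N od.1 isT isT _ isT).
    by move=> x; rewrite !inE => /orP[]/eqP->.
  move=> x; rewrite !inE => /orP[]/eqP->; [rewrite cb; split; first exact: od.1|exact: od].
  have z1 : z = -1 by move: E2; rewrite c0; lra.
  by rewrite zE z1 mpolyCN mpolyC1 scaleN1r.
- pose d := comb a b (3, 1)%N; have dP : d \in Pos by apply: iX.
  pose e := comb a b (3, 2)%N; have eP : e \in Pos by apply: iX.
  have dE : refl a b = d by rewrite rab /d /comb !scale1r.
  have eE : refl b d = e.
    rewrite reflE /d /e /comb /= crD !crZ crba cr_id // -addrA -scalerBl; congr (_ + _ *: _).
    by rewrite mulr1n; lra.
  have ae : refl a e = e by apply: refl_fix; rewrite /e /comb /= dotvDl !dotvZl (dotvC b a); lra.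
  pose g := act b (act a fb).
  have oe : odds e g by rewrite -eE -dE; exact: (odds_conj rs ss bPh oab).
  have g0 : g != 0 by apply: act_neq0 => //; apply: act_neq0.
  have [z zE] : exists z, act a g = z%:MP *: g.
    have H : odds e (act a g) by rewrite -{1}ae; exact: (odds_conj rs ss aPh oe).
    exact: (odds_uniq rs ss m0 eP oe g0 H).
  have gE : g = cmb (- c) (c * c' - 1).
    rewrite /g fbE act_a act_b; congr (cmb _ _); ring.
  have E := zE; move: E; rewrite gE act_a cmbZ => /cmb_inj[E1 E2]; split=> //.
  (* For [c = 0] the section [fb] would be odd under three of the six roots: [b], [3 a + b] and
     [3 a + 2 b]. *)
  have [c0|c0] := eqVneq c 0.
    case/eqP: fb0; apply: (bnd _ [:: (0, 1); (3, 1); (3, 2)]%N ob.1 isT isT _ isT).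
      by move=> x; rewrite !inE => /or3P[]/eqP->.
    have fbd : odds d fb.
      by move: oab; rewrite dE ab c0 mpolyC0 scale0r subr0.
    have fbe : odds e fb.
      have -> : fb = - g by rewrite gE c0 oppr0 mul0r sub0r /cmb mpolyC0 scale0r add0r mpolyCN mpolyC1 scaleN1r opprK.
      by split; [apply: (flatN rs); case: oe|rewrite actN oe.2].
    by move=> x; rewrite !inE => /or3P[]/eqP->; rewrite ?cb; [exact: ob|exact: fbd|exact: fbe].
  have z2 : z = c * c' - 2 by apply: (mulIf c0); move: E1; lra.
  have /eqP : (c * c' - 1) * (c * c' - 3) = 0 by move: E2; rewrite z2; lra.
  rewrite mulf_eq0 !subr_eq0 => /orP[]/eqP x1; last by [].
  (* The remaining solution [c * c' = 1] belongs to the two-dimensional representation in which the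
     product of the two reflections has order three. It makes [g] odd under the orthogonal roots [a]
     and [3 a + 2 b]. *)
  case/eqP: g0; have z1 : z = -1 by lra.
  have oag : odds a g by split; [case: oe|rewrite zE z1 mpolyCN mpolyC1 scaleN1r].
  have G2' : dotv b b = 3 * dotv a a by lra.
  have aeo : dotv a e = 0 by rewrite /e /comb /= dotvDr !dotvZr; lra.
  have ee : dotv e e = 3 * dotv a a.
    by rewrite /e /comb /= !(dotvDl, dotvDr, dotvZl, dotvZr) (dotvC b a); lra.
  have be : dotv b e = 3 / 2 * dotv a a.
    by rewrite /e /comb /= !(dotvDl, dotvDr, dotvZl, dotvZr) (dotvC b a); lra.
  have rk3 : rk2 3 a b by split.
  apply: (rk2_parity rs ss m0 aP bP rk3 aP eP _ aeo) => //.
  - by rewrite -{1}ca; apply: map_f.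
  - by rewrite aeo mul0r scale0r addr0 divff ?gt_eqF // scale1r.
  - rewrite be ee (dotvC b a) G.
    have -> : - (3 * dotv a a / 2) / dotv a a = - (3 / 2) by field; rewrite gt_eqF.
    have -> : 3 / 2 * dotv a a / (3 * dotv a a) = 2^-1 by field; rewrite gt_eqF.
    rewrite /e /comb /= scalerDr !scalerA addrA -scalerDl.
    have -> : - (3 / 2) + 2^-1 * 3 = 0 :> R by field.
    by rewrite mulVf ?pnatr_eq0 // scale0r scale1r add0r.
  - by apply: map_f.
Qed.

End Pair.

Lemma base2_al i j : i != j -> base2 Phi Delta (al i) (al j).
Proof.
move=> ij; split; rewrite ?(al_Pos ss) ?(inj_eq (al_inj ss)) // => x y cP.
have := Pos_nonneg i cP; have := Pos_nonneg j cP.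
rewrite coordsD !coordsZ !(coords_al ss) !mxE !eqxx (negPf ij) eq_sym (negPf ij) /=.
by rewrite !mulr1 !mulr0 addr0 add0r.
Qed.

(** Odd sections of the simple roots are determined up to scalars. The resulting matrix [C] has the
    same products of opposite entries as the Cartan matrix, and on a forest a rescaling turns the
    one into the other. *)
Lemma odd_frame : exists f : 'I_l -> 'rV[S]_l,
  (forall i, odds (al i) (f i) /\ f i != 0) /\
  forall i j, act (al i) (f j) = f j - (cr (al i) (al j))%:MP *: f i.
Proof.
have al0 i : al i != 0 by apply: (al_neq0 rs ss).
have F i : {u | odds (al i) u & u != 0} by apply: boolp.cid2; apply: (odds_exists rs ss m0); apply: (al_Pos ss).
pose f i := s2val (F i).
have of_ i : odds (al i) (f i) by rewrite /f; case: (F i).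
have f0 i : f i != 0 by rewrite /f; case: (F i).
have C_ i j : {c : R | act (al i) (f j) = f j - c%:MP *: f i}.
  apply: boolp.cid; have [c cE] : exists c : R, f j - act (al i) (f j) = c%:MP *: f i.
    apply: (odds_uniq rs ss m0 (al_Pos ss i)) => //.
    by apply: (odds_sym rs ss); rewrite ?al0 ?(al_root ss) //; case: (of_ j).
  by exists c; rewrite -cE opprB addrC subrK.
pose C i j := sval (C_ i j).
have CE i j : act (al i) (f j) = f j - (C i j)%:MP *: f i by rewrite /C; case: (C_ i j).
have prod i j : i != j -> C i j * C j i = cr (al i) (al j) * cr (al j) (al i) /\
    (cr (al i) (al j) = 0 -> C i j = 0).
  move=> ij; have [p _ [rk|rk]] := base2_rk2 rs ss (base2_al ij).
    have [E E0] := rk2_structure (al_Pos ss i) (al_Pos ss j) rk (of_ i) (of_ j) (f0 i) (f0 j) (CE i j) (CE j i).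
    have [_ _ [-> ->] _] := rk; rewrite E mulrNN; split.
      by case: (p) => [|n]; rewrite ?mulr0 ?mulr1.
    by move=> /eqP; rewrite oppr_eq0 pnatr_eq0 => /eqP /E0[].
  have [E E0] := rk2_structure (al_Pos ss j) (al_Pos ss i) rk (of_ j) (of_ i) (f0 j) (f0 i) (CE j i) (CE i j).
  have [_ _ [-> ->] _] := rk; rewrite mulrC E mulrNN; split.
    by case: (p) => [|n]; rewrite ?mul0r ?mul1r.
  by move=> /eqP; rewrite oppr_eq0 pnatr_eq0 eqb0 -eqn0Ngt => /eqP /E0[].
have adjN i j : adj Delta i j -> cr (al i) (al j) != 0 /\ C i j != 0.
  move=> /andP[ij d]; have c1 : cr (al i) (al j) != 0 by rewrite cr_eq0 // dotvC.
  have c2 : cr (al j) (al i) != 0 by rewrite cr_eq0.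
  split=> //; apply/eqP => C0; have [E _] := prod i j ij; move: E => /eqP.
  by rewrite C0 mul0r eq_sym mulf_eq0 (negPf c1) (negPf c2).
have [||i j x ij x0|x [x0 xE]] := @tree_potential _ _ _ rs ss R (fun x => x != 0)
    (fun i j x => x * cr (al i) (al j) / C i j) 1.
- exact: oner_neq0.
- by move=> i j x /adjN[c1 c2] x0; apply: mulf_neq0; [exact: mulf_neq0|rewrite invr_eq0].
- have [c1 c2] := adjN _ _ ij; have [c3 c4] := adjN j i (etrans (adjC _ _ _) ij).
  have [E _] := prod i j (proj1 (andP ij)).
  move: E c1 c2 c3 c4; move: (cr _ _) (cr _ _) (C _ _) (C _ _) => a1 a2 C1 C2 E c1 c2 c3 c4.
  have -> : x * a2 / C2 * a1 / C1 = x * (a2 * a1) / (C2 * C1) by field; rewrite c2 c4.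
  by rewrite -E mulfK // mulf_neq0.
exists (fun i => (x i)%:MP *: f i); split=> [i|i j].
  split; last by apply/eqP => /(mpolyC_inj_vec (f0 i))/eqP; rewrite (negPf (x0 i)).
  by split; [apply: (flatC rs); case: (of_ i)|rewrite actC (of_ i).2 scalerN].
rewrite actC; have [<-|ij] := eqVneq i j.
  rewrite (of_ i).2 cr_id // scalerN mpolyC_nat -[2%:R]/(1 + 1) scalerDl scale1r opprD addrA subrr sub0r.
  by [].
rewrite CE scalerBr !scalerA; congr (_ - _ *: _); rewrite -!mpolyCM; congr (_%:MP).
have [aij|nij] := boolP (adj Delta i j).
  rewrite (xE _ _ aij); have [c1 c2] := adjN _ _ aij.
  by move: c1 c2; move: (cr _ _) (C _ _) (x _) => a1 C1 x1 c1 c2; field.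
have c0 : cr (al i) (al j) = 0.
  by apply/eqP; rewrite cr_eq0 // dotvC; move: nij; rewrite /adj ij negbK.
by have [_ ->] := prod i j ij; rewrite // c0 mulr0 mul0r.
Qed.

End Positive.

(** In the radial direction [xi = v] all quotients of the connection are [1] and their sum is the
    Casimir operator, so [u] is an eigenvector of the Euler operator. *)
Lemma flat_homog m (h' : R) (D : nat) (u : 'rV[S]_l) j : flat Phi Delta m u ->
  (forall v, \sum_(a <- Pos) cr a v *: a = h' *: v) -> m%:R * h' = D%:R -> u 0 j \is D.-homog.
Proof.
move=> fu cas Dh; have Q0 := Qall_neq0 Delta rs.
have E : \sum_i 'X_i * (u 0 j)^`M(i) = D%:R *: u 0 j.
  apply: (mulfI Q0); apply: mpoly_funP => v; rewrite !mevalM.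
  have [->|Qv] := eqVneq Qall.@[v 0] 0; first by rewrite !mul0r.
  congr (_ * _); have /(flatP Delta rs) /(_ v Qv v) /rowP/(_ j) := fu.
  have -> : \sum_(a <- Pos) (dotv a v / dotv a v) *: (evr v u *m Pm a) = h' *: evr v u.
    rewrite -cas big_seq [RHS]big_seq; apply: eq_bigr => a aP.
    by rewrite divff ?scale1r ?mul_Pm // (Qall_ev_neq0 Qv).
  rewrite scalerA Dh !mxE mevalZ => <-; rewrite /dirD !raddf_sum /=; apply: eq_bigr => i _.
  by rewrite mevalM mevalXU mevalZ.
have [->|u0] := eqVneq (u 0 j) 0; first exact: dhomog0.
have [d dE] := euler_homog u0 E; by move: dE => /eqP; rewrite eqr_nat => /eqP <-.
Qed.

(** Sending each simple root to its odd section intertwines the reflections, so by induction over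
    the positive roots [U a] is odd under [s_a]. A vector with [U v = 0] is orthogonal to the simple
    roots, for the same reason. *)
Theorem flat_frame m (h' : R) (D : nat) : (forall v, \sum_(a <- Pos) cr a v *: a = h' *: v) ->
  m%:R * h' = D%:R -> exists U : 'rV[R]_l -> 'rV[S]_l,
  [/\ forall x u v, U (x *: u + v) = x%:MP *: U u + U v,
      forall v j, (U v) 0 j \is D.-homog,
      forall a, a \in Pos -> exists2 w, U a = linform a ^+ (2 * m) *: w &
        forall j, mdivides (linform a) (w 0 j - 2^-1 *: Pmw a w j) &
      forall (q v : 'rV[R]_l), Qall.@[q 0] != 0 -> evr q (U v) = 0 -> v = 0].
Proof.
move=> cas Dh; case: (posnP m) => [m0|m0].
  (* For [m = 0] the connection is trivial and the constant vector fields serve. *)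
  move: Dh; rewrite m0 mul0r => /esym/eqP; rewrite pnatr_eq0 => /eqP ->.
  have evC q v : evr q (map_mx (@mpolyC l R) v) = v by apply/rowP => j; rewrite !mxE mevalC.
  exists (map_mx (@mpolyC l R)); split.
  - by move=> x u v; rewrite map_mxD map_mxZ.
  - by move=> v j; rewrite mxE -alg_mpolyC; apply: rpredZ; apply: dhomog1.
  - move=> a aP; exists (map_mx (@mpolyC l R) a); first by rewrite muln0 expr0 scale1r.
    move=> j; suff -> : map_mx (@mpolyC l R) a 0 j - 2^-1 *: Pmw a (map_mx (@mpolyC l R) a) j = 0.
      exact: mdvd0.
    apply: mpoly_fun_eq0 => v; rewrite mevalB mevalZ ev_Pmw evC cr_id ?(Pos_neq0 rs aP) // mxE mevalC.
    by field.
  - by move=> q v _; rewrite evC.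
have [f [fo fE]] := odd_frame m0.
have al0 i : al i != 0 by apply: (al_neq0 rs ss).
pose U (v : 'rV[R]_l) : 'rV[S]_l := \sum_i (coords Delta v 0 i)%:MP *: f i.
have Ulin x u v : U (x *: u + v) = x%:MP *: U u + U v.
  rewrite /U scaler_sumr -big_split; apply: eq_bigr => i _ /=.
  by rewrite coordsD coordsZ [X in X%:MP]mxE [X in (X + _)%:MP]mxE mpolyCD mpolyCM scalerDl scalerA.
have UB u v x : U (v - x *: u) = U v - x%:MP *: U u.
  by rewrite -scaleNr addrC Ulin mpolyCN scaleNr addrC.
have Ual i : U (al i) = f i.
  rewrite /U (bigD1 i) //= (coords_al ss) mxE !eqxx mpolyC1 scale1r big1 ?addr0 // => j ji.
  by rewrite mxE eqxx (negPf ji) mpolyC0 scale0r.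
have act0 a : act a 0 = 0 :> 'rV[S]_l by apply: evr_inj => v; rewrite evr_act /evr !map_mx0 refl0.
have Uact i v : act (al i) (U v) = U (refl (al i) v).
  rewrite reflE UB Ual {1}/U (big_morph (act (al i)) (actD (al i)) (act0 (al i))).
  have -> : cr (al i) v = \sum_j coords Delta v 0 j * cr (al i) (al j).
    by rewrite {1}(coordsE ss v) cr_sum; apply: eq_bigr => j _; rewrite crZ.
  rewrite (rmorph_sum (mpolyC l (R := R))) scaler_suml /U -sumrB; apply: eq_bigr => j _.
  by rewrite actC fE scalerBr scalerA -mpolyCM.
have Uodd a : a \in Pos -> odds Phi Delta m a (U a).
  elim/(Pos_ind rs ss) => [i|i {}a aP _ oa]; first by rewrite Ual; case: (fo i).
  by rewrite -Uact; apply: (odds_conj rs ss) => //; apply: (al_root ss).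
have Uflat v : flat Phi Delta m (U v).
  by apply: (flat_sum rs) => i _; apply: (flatC rs); case: (fo i) => -[].
exists U; split=> //.
- by move=> v j; apply: flat_homog (Uflat v) cas Dh.
- by move=> a aP; apply: (odds_dvd rs ss m0 aP (Uodd a aP)).
- move=> q v Qq uq; have U0 := flat_uniq (Uflat v) Qq uq.
  have d0 i : dotv v (al i) = 0.
    have := Uact i v; rewrite U0 act0 reflE UB U0 Ual sub0r => /esym/eqP; rewrite oppr_eq0 => /eqP.
    by case: (fo i) => _ fi0 /(mpolyC_inj_vec fi0)/eqP; rewrite cr_eq0 // => /eqP.
  apply/eqP; rewrite -dotv_eq0 {2}(coordsE ss v) dotv_sumr big1 // => i _.
  by rewrite dotvZr d0 mulr0.
Qed.

End FlatFrame.

(** * The Coxeter number *)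

Section Words.
Variables (l : nat) (Phi : seq 'rV[R]_l) (Delta : 'M[R]_l).
Hypotheses (rs : root_system Phi) (ss : simple_system Phi Delta).
Local Notation Pos := (Pos Phi Delta).
Local Notation al := (al Delta).
Implicit Types (s : seq 'I_l) (w : 'M[R]_l) (a v : 'rV[R]_l).

Let al0 i : al i != 0. Proof. exact: (al_neq0 rs ss). Qed.

(** Row vectors are acted on from the right, so the first letter acts first. *)
Definition wmx s : 'M[R]_l := foldr (fun i M => refl_mx (al i) *m M) 1%:M s.

Lemma wmx_cons i s v : v *m wmx (i :: s) = refl (al i) v *m wmx s.
Proof. by rewrite /= mulmxA -refl_mul. Qed.

Lemma wmx_cat s t : wmx (s ++ t) = wmx s *m wmx t.
Proof. by elim: s => [|i s IHs] /=; rewrite ?mul1mx // IHs mulmxA. Qed.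

Lemma wmx_rev s : wmx s *m wmx (rev s) = 1%:M.
Proof.
elim: s => [|i s IHs]; first by rewrite mul1mx.
rewrite rev_cons -cats1 wmx_cat /= mulmx1 -mulmxA [wmx s *m _]mulmxA IHs mul1mx.
exact: refl_mx_mul.
Qed.

Lemma wmx_revl s : wmx (rev s) *m wmx s = 1%:M.
Proof. by rewrite -{2}(revK s) wmx_rev. Qed.

Lemma dotv_wmx s u v : dotv (u *m wmx s) (v *m wmx s) = dotv u v.
Proof.
elim: s u v => [|i s IHs] u v; first by rewrite !mulmx1.
by rewrite !wmx_cons IHs dotv_refl.
Qed.

Lemma dotv_wmx_rev s u v : dotv (u *m wmx s) v = dotv u (v *m wmx (rev s)).
Proof. by rewrite -[in RHS](dotv_wmx s) -mulmxA wmx_revl mulmx1. Qed.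

Lemma root_wmx s a : a \in Phi -> a *m wmx s \in Phi.
Proof.
elim: s a => [|i s IHs] a aP; first by rewrite mulmx1.
by rewrite wmx_cons IHs // root_refl // al_root.
Qed.

Lemma coords_wmx s v k : k \notin s -> coords Delta (v *m wmx s) 0 k = coords Delta v 0 k.
Proof.
elim: s v => [|i s IHs] v; first by rewrite mulmx1.
rewrite inE negb_or => /andP[ki ks]; rewrite wmx_cons IHs // (coords_refl_al ss).
by rewrite (negPf ki) mulr0 subr0.
Qed.

(** The coordinate belonging to the first letter is untouched by the other letters, so that letter
    alone must already fix [v]. *)
Lemma wmx_fixed s v : uniq s -> v *m wmx s = v -> forall i, i \in s -> dotv v (al i) = 0.
Proof.
elim: s v => [//|j s IHs] v /andP[js us]; rewrite wmx_cons => E.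
have c0 : cr (al j) v = 0.
  have := congr1 (fun x => coords Delta x 0 j) E.
  rewrite coords_wmx // (coords_refl_al ss) eqxx mulr1 => /eqP.
  by rewrite -subr_eq0 addrAC subrr sub0r oppr_eq0 => /eqP.
have d0 : dotv v (al j) = 0 by apply/eqP; rewrite -cr_eq0 // c0.
have {}E : v *m wmx s = v by rewrite -{1}(refl_fix d0).
by move=> i; rewrite inE => /orP[/eqP -> //|]; apply: IHs.
Qed.

Lemma coxeter_fixed v : v *m wmx (enum 'I_l) = v -> v = 0.
Proof.
move=> E; apply/eqP; rewrite -dotv_eq0 {2}(coordsE ss v) dotv_sumr big1 // => i _.
by rewrite dotvZr (wmx_fixed _ E) ?mulr0 ?enum_uniq ?mem_enum.
Qed.

(** The number of inversions; [reduced_word] identifies it as the length of a word. *)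
Definition nneg w := count (fun a => - (a *m w) \in Pos) Pos.

Lemma perm_refl_Pos i : perm_eq (map (refl (al i)) (rem (al i) Pos)) (rem (al i) Pos).
Proof.
have uP := undup_uniq (positive_roots Phi Delta).
have us : uniq (map (refl (al i)) (rem (al i) Pos)).
  by rewrite map_inj_uniq ?rem_uniq //; apply: can_inj (reflK (al0 i)).
have sub : {subset map (refl (al i)) (rem (al i) Pos) <= rem (al i) Pos}.
  move=> b /mapP[a]; rewrite !mem_rem_uniq // !inE => /andP[ai aP] ->.
  rewrite (refl_al_Pos rs ss) // andbT; apply/eqP => E.
  have : a = - al i by rewrite -(reflK (al0 i) a) E refl_id.
  by move=> aE; have := PosN rs ss aP; rewrite aE opprK (al_Pos ss).
apply: uniq_perm => //; first exact: rem_uniq.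
by have [] := uniq_min_size us sub; rewrite ?size_map.
Qed.

Lemma count_refl (Q : pred 'rV[R]_l) i :
  (count (fun a => Q (refl (al i) a)) Pos + Q (al i) = count Q Pos + Q (- al i))%N.
Proof.
have aP := al_Pos ss i; have pP := perm_to_rem aP.
rewrite !(permP pP) /= refl_id // -(permP (perm_refl_Pos i) Q) count_map.
rewrite -[count (preim _ _) _]/(count (fun a => Q (refl (al i) a)) _).
by move: (count _ _) => c; lia.
Qed.

Lemma nneg_refl w i s : w = wmx s ->
  (nneg (refl_mx (al i) *m w) + ((- (al i *m w)) \in Pos)
   = nneg w + (al i *m w \in Pos))%N.
Proof.
move=> _; rewrite /nneg.
have := count_refl (fun a => - (a *m w) \in Pos) i; rewrite /= mulNmx opprK => <-.
congr (_ + _)%N; apply: eq_count => a /=; by rewrite mulmxA -refl_mul.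
Qed.

Lemma nneg_size s : (nneg (wmx s) <= size s)%N.
Proof.
elim: s => [|i s IHs] /=.
  rewrite /nneg (@eq_in_count _ _ pred0) ?count_pred0 // => a aP /=.
  by rewrite mulmx1; apply/negbTE/(PosN rs ss).
have := nneg_refl i (erefl (wmx s)); case: (_ \in Pos) (_ \in Pos) => [] [] /=; lia.
Qed.

(** A simple reflection makes only its own simple root negative, so the sign changes at a letter
    where the running image of [a] is simple. *)
Lemma word_split s a : a \in Pos -> - (a *m wmx s) \in Pos ->
  exists s1 j s2, s = s1 ++ j :: s2 /\ a *m wmx s1 = al j.
Proof.
elim: s a => [|j s IHs] a aP.
  by rewrite mulmx1 => naP; have := PosN rs ss aP; rewrite naP.
have [->|aj] := eqVneq a (al j); first by exists [::], j, s; rewrite mulmx1.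
rewrite wmx_cons => n; have [s1 [k [s2 [-> E]]]] := IHs _ (refl_al_Pos rs ss aP aj) n.
by exists (j :: s1), k, s2; rewrite wmx_cons.
Qed.

Lemma refl_mx_conj s a b : a != 0 -> a *m wmx s = b -> refl_mx a *m wmx s = wmx s *m refl_mx b.
Proof.
move=> a0 ab; apply/row_matrixP => i; rewrite !rowE !mulmxA -!refl_mul.
move: (delta_mx 0 i) => v; rewrite !reflE mulmxBl -scalemxAl ab; congr (_ - _ *: _).
by rewrite /cr -ab !dotv_wmx.
Qed.

(** Deletion argument. The first letter makes its root negative, so a later letter has to undo it;
    conjugating, the two letters cancel and a shorter word gives the same element. *)
Lemma word_preserving s : nneg (wmx s) = 0%N -> wmx s = 1%:M.
Proof.
have [n] := ubnP (size s); elim: n => // n IHn in s *; rewrite ltnS.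
case: s => [//|i s] sn n0.
have pos a : a \in Pos -> a *m wmx (i :: s) \in Pos.
  move=> aP; have [//|neg] := root_pos_or_neg rs ss (root_wmx (i :: s) (Pos_root aP)).
  by move/eqP: n0; rewrite -leqn0 leqNgt -has_count => /hasP[]; exists a.
have := pos _ (al_Pos ss i); rewrite wmx_cons refl_id // mulNmx => neg.
have [s1 [j [s2 [sE E]]]] := word_split (al_Pos ss i) neg.
have wE : wmx (i :: s) = wmx (s1 ++ s2).
  rewrite sE /= !wmx_cat /= mulmxA (refl_mx_conj (al0 i) E) -!mulmxA.
  by rewrite [refl_mx _ *m (refl_mx _ *m _)]mulmxA refl_mx_mul // mul1mx.
rewrite wE; apply: IHn; last by rewrite -wE.
by move: sn; rewrite sE /= !size_cat /=; lia.
Qed.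

(** An element with an inversion sends some simple root to a negative one, and prefixing that
    reflection removes exactly one inversion. *)
Lemma reduced_word s : exists2 t, wmx t = wmx s & size t = nneg (wmx s).
Proof.
have [n] := ubnP (nneg (wmx s)); elim: n => // n IHn in s *; rewrite ltnS => sn.
have [n0|n0] := posnP (nneg (wmx s)).
  by exists [::]; rewrite ?n0 // (word_preserving n0).
have [i neg] : exists i, - (al i *m wmx s) \in Pos.
  apply: boolp.contrapT => N; move: n0; rewrite -has_count => /hasP[a aP neg].
  have posi i : al i *m wmx s \in Pos.
    have [//|ng] := root_pos_or_neg rs ss (root_wmx s (al_root ss i)).
    by case: N; exists i.
  have : nonneg_comb Delta (a *m wmx s).
    apply/nonnegP => k; rewrite (coordsE ss a) mulmx_suml /coords mulmx_suml summxE.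
    apply: sumr_ge0 => i _; rewrite -!scalemxAl -!/(coords _ _) mxE.
    by rewrite mulr_ge0 ?(Pos_nonneg _ aP) // (Pos_nonneg _ (posi i)).
  move=> nn; have : a *m wmx s \in Pos by rewrite mem_Pos nn andbT root_wmx // (Pos_root aP).
  by move=> p; have := PosN rs ss p; rewrite neg.
have := nneg_refl i (erefl (wmx s)); rewrite neg.
have -> : (al i *m wmx s \in Pos) = false.
  by apply/negbTE/negP => p; have := PosN rs ss p; rewrite neg.
rewrite addn0 addn1 => E.
have [|t tE tn] := IHn (i :: s); first by rewrite /= -E in sn *.
exists (i :: t); first by rewrite /= tE /= mulmxA refl_mx_mul // mul1mx.
by rewrite /= tn /= E.
Qed.

Lemma rank_wmx s : (\rank (1%:M - wmx s)%R <= size s)%N.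
Proof.
elim: s => [|i s IHs]; first by rewrite subrr mxrank0.
have -> : 1%:M - wmx (i :: s) = Pm (al i) + refl_mx (al i) *m (1%:M - wmx s).
  by rewrite /Pm mulmxBr mulmx1 addrA subrK.
apply: leq_trans (mxrank_add _ _) _; rewrite -[size (i :: s)]add1n; apply: leq_add.
  have -> : Pm (al i) = (\col_k cr (al i) (delta_mx 0 k)) *m al i.
    apply/row_matrixP => k; rewrite rowE mul_Pm row_mul; apply/rowP => j.
    by rewrite !mxE big_ord1 !mxE.
  by apply: leq_trans (mxrankM_maxl _ _) _; apply: rank_leq_col.
by apply: leq_trans (mxrankM_maxr _ _) IHs.
Qed.

(** A product of [n] reflections fixes a subspace of codimension at most [n]. *)
Lemma nneg_no_fixed s : (forall v, v *m wmx s = v -> v = 0) -> (l <= nneg (wmx s))%N.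
Proof.
move=> nf; have [t tE <-] := reduced_word s; apply: leq_trans (rank_wmx t).
have /eqP -> // : row_free (1%:M - wmx t).
apply: inj_row_free => v; rewrite mulmxBr mulmx1 tE => /eqP; rewrite subr_eq0 => /eqP E.
exact: nf.
Qed.

(** Reflecting in a simple root that is negative on [q] lowers the number of positive roots that are
    negative on [q]. *)
Lemma to_chamber q : (forall a, a \in Phi -> dotv a q != 0) ->
  exists s, forall a, a \in Pos -> 0 < dotv a (q *m wmx s).
Proof.
have [n] := ubnP (count (fun a => dotv a q < 0) Pos); elim: n => // n IHn in q *.
rewrite ltnS => qn q0.
have [/existsP[i ai]|N] := boolP [exists i, dotv (al i) q < 0]; last first.
  exists [::] => a aP; rewrite mulmx1 lt_def q0 ?(Pos_root aP) // (coordsE ss a) dotv_suml.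
  apply: sumr_ge0 => i _; rewrite dotvZl mulr_ge0 ?(Pos_nonneg _ aP) // leNgt.
  by apply: contra N => ai; apply/existsP; exists i.
have E := count_refl (fun a => dotv a q < 0) i.
have [|a aP|s sE] := IHn (refl (al i) q); last by exists (i :: s) => a aP; rewrite wmx_cons sE.
  apply: leq_trans qn; rewrite (@eq_count _ _ (fun a => dotv (refl (al i) a) q < 0)); last first.
    by move=> a /=; rewrite dotv_reflr.
  by move: E; rewrite /= ai dotvNl oppr_lt0 (lt_gtF ai) addn0 addn1 => <-.
by rewrite dotv_reflr // q0 // root_refl // al_root.
Qed.

End Words.

(** * A positive eigenvector for the lowest eigenvalue *)

Section PerronFrobenius.
Variables (n : nat) (G : 'M[R]_n).
Hypothesis Gsym : G^T = G.
Implicit Types x y z : 'rV[R]_n.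

Let B (M : 'M[R]_n) x y := dotv (x *m M) y.

Let BC (M : 'M[R]_n) x y : M^T = M -> B M x y = B M y x.
Proof. by move=> Ms; rewrite /B dotv_mulmx Ms dotvC. Qed.

Let Bl M c x y z : B M (c *: x + y) z = c * B M x z + B M y z.
Proof. by rewrite /B mulmxDl -scalemxAl dotvDl dotvZl. Qed.

Let Br M c x y z : B M z (c *: x + y) = c * B M z x + B M z y.
Proof. by rewrite /B dotvDr dotvZr. Qed.

Let psd M := forall x, 0 <= B M x x.

Let psd_cs (M : 'M[R]_n) x z : M^T = M -> psd M -> B M z x ^+ 2 <= B M z z * B M x x.
Proof.
move=> Ms p; have [x0|x0] := eqVneq (B M x x) 0.
  suff -> : B M z x = 0 by rewrite expr0n /= mulr_ge0.
  apply/eqP/negPn/negP => zx.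
  have := p ((- (B M z z + 1) / (2 * B M z x)) *: x + z).
  rewrite Bl !Br x0 (BC x z Ms) mulr0 add0r.
  have -> : - (B M z z + 1) / (2 * B M z x) * B M z x + (- (B M z z + 1) / (2 * B M z x) * B M z x + B M z z) = -1.
    by field.
  by rewrite oppr_ge0 ler10.
have xp : 0 < B M x x by rewrite lt_def x0 p.
have := p ((- B M z x) *: x + (B M x x *: z + 0)).
rewrite !(Bl, Br) (BC x z Ms).
have B0l u : B M 0 u = 0 by rewrite /B mul0mx dotv0l.
have B0r u : B M u 0 = 0 by rewrite /B dotv0r.
rewrite !B0l !B0r => H; rewrite -subr_ge0 -(pmulr_rge0 _ xp); apply: le_trans H _.
rewrite le_eqVlt; apply/orP; left; apply/eqP; ring.
Qed.

Let B_bound (M : 'M[R]_n) : exists2 C, 0 < C & forall x, B M x x <= C * dotv x x.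
Proof.
exists (1 + \sum_i \sum_j `|M i j|).
  by rewrite ltr_pwDl ?ltr01 // sumr_ge0 // => i _; apply: sumr_ge0.
move=> x; rewrite mulrDl mul1r; apply: le_trans (_ : _ <= (\sum_i \sum_j `|M i j|) * dotv x x) _; last first.
  by rewrite lerDr dotv_ge0.
rewrite /B /dotv; under eq_bigr => j _ do rewrite mxE mulr_suml.
rewrite exchange_big /= mulr_suml; apply: ler_sum => i _; rewrite mulr_suml; apply: ler_sum => j _.
have sq k : x 0 k ^+ 2 <= \sum_i x 0 i * x 0 i.
  by rewrite (bigD1 k) //= expr2 lerDl sumr_ge0 // => i' _; rewrite -expr2 sqr_ge0.
apply: le_trans (ler_norm _) _; rewrite !normrM mulrAC mulrC ler_wpM2l //.
have := sq i; have := sq j; move: (\sum_ _ _) => T sj si.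
rewrite -normrM ler_norml; nra.
Qed.

Hypotheses (Goff : forall i j, i != j -> G i j <= 0) (n0 : (0 < n)%N).
Hypothesis Gpos : forall x, x != 0 -> 0 < dotv (x *m G) x.
Hypothesis Gconn : forall P : pred 'I_n, (exists i, P i) ->
  (forall i j, P i -> i != j -> G i j != 0 -> P j) -> forall i, P i.

(** The supremum [k] of the lower bounds of the Rayleigh quotient makes [G - k] semidefinite and
    singular. Absolute values of a kernel vector do not increase the form, as off-diagonal entries
    are nonpositive, so they give a kernel vector again. A zero coordinate would spread to all
    neighbours. *)
Lemma Perron_Frobenius : exists (k : R) (y : 'rV[R]_n), [/\ 0 < k, k <= G (Ordinal n0) (Ordinal n0),
  y *m G = k *: y & forall i, 0 < y 0 i].
Proof.
pose S : classical_sets.set R := fun t => forall x, t * dotv x x <= B G x x.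
have e1 : dotv (delta_mx 0 (Ordinal n0) : 'rV[R]_n) (delta_mx 0 (Ordinal n0)) = 1.
  by rewrite dotv_deltar mxE !eqxx.
have e2 : B G (delta_mx 0 (Ordinal n0)) (delta_mx 0 (Ordinal n0)) = G (Ordinal n0) (Ordinal n0).
  by rewrite /B dotv_deltar -rowE mxE.
have Gpsd : psd G.
  move=> x; have [->|x0] := eqVneq x 0; first by rewrite /B dotv0r.
  exact: ltW (Gpos x0).
have hs : classical_sets.has_sup S.
  split; first by exists 0 => x; rewrite mul0r.
  exists (G (Ordinal n0) (Ordinal n0)) => t /(_ (delta_mx 0 (Ordinal n0))).
  by rewrite e1 mulr1 e2.
pose k := reals.sup S.
have Sk : S k.
  move=> x; rewrite leNgt; apply/negP => lt.
  have xx : 0 < dotv x x.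
    rewrite lt_def dotv_ge0 andbT; apply: contraTneq lt => xx.
    by rewrite -leNgt xx mulr0; apply: Gpsd.
  have eps : 0 < k - B G x x / dotv x x by rewrite subr_gt0 ltr_pdivrMr.
  have [t St] := reals.sup_adherent eps hs; rewrite opprB addrCA subrr addr0.
  by rewrite ltr_pdivrMr // ltNge => /negP; apply; apply: St.
pose M := G - k%:M.
have Ms : M^T = M by rewrite /M linearB /= Gsym tr_scalar_mx.
have ME x y : B M x y = B G x y - k * dotv x y.
  by rewrite /B /M mulmxBr mul_mx_scalar dotvBl dotvZl.
have Mpsd : psd M by move=> x; rewrite ME subr_ge0; apply: Sk.
(* Were [M] invertible, a bound [C] of its inverse would allow [k + C^-1] as a lower bound as
   well. *)
have nM : M \notin unitmx.
  apply/negP => uM; have [C C0 CB] := B_bound (invmx M).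
  have : S (k + C^-1).
    move=> x; have [->|x0] := eqVneq x 0; first by rewrite /B !dotv0r mulr0.
    rewrite mulrDl -lerBrDl -ME.
    have xx := dotv_gt0 x0; pose z := x *m invmx M.
    have zM : z *m M = x by rewrite /z -mulmxA mulVmx // mulmx1.
    have := psd_cs x z Ms Mpsd; rewrite {1 2}/B zM => H.
    have := CB x; rewrite /B -/z (dotvC z x) => H2.
    have Bx : 0 <= B M x x := Mpsd x.
    rewrite mulrC ler_pdivrMr //.
    have : dotv x x * dotv x x <= dotv x x * (B M x x * C).
      rewrite -expr2; apply: le_trans H _.
      have -> : dotv x x * (B M x x * C) = (C * dotv x x) * B M x x by ring.
      by rewrite ler_wpM2r.
    by rewrite ler_pM2l.
  move=> /(reals.sup_upper_bound hs); rewrite -/k gerDl leNgt invr_gt0 C0. by [].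
have /det0P[x x0 xM] : \det M == 0 by move: nM; rewrite unitmxE unitfE negbK.
(* Once the form vanishes at [y], the Cauchy-Schwarz inequality for the semidefinite form puts [y]
   in the kernel. *)
pose y : 'rV[R]_n := \row_i `|x 0 i|.
have yM0 : B M y y <= 0.
  have -> : 0 = B M x x by rewrite /B xM dotv0l.
  rewrite /B /dotv; apply: ler_sum => j _; rewrite !mxE !mulr_suml; apply: ler_sum => i _.
  have [ij|ij] := eqVneq i j.
    rewrite ij !mxE mulrAC [X in _ <= X]mulrAC -!expr2 real_normK ?num_real //.
  rewrite !mxE (negPf ij) mulr0n subr0 mulrAC [X in _ <= X]mulrAC -normrM.
  rewrite [X in X <= _]mulrC [X in _ <= X]mulrC ler_wnM2l ?Goff //; exact: ler_norm.
have yM : y *m M = 0.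
  apply/eqP; rewrite -dotv_eq0; have := psd_cs y (y *m M) Ms Mpsd.
  have -> : B M y y = 0 by apply/eqP; rewrite eq_le yM0 Mpsd.
  rewrite mulr0 (BC _ y Ms) {1}/B => H.
  by rewrite -sqrf_eq0 eq_le H sqr_ge0.
have yG : y *m G = k *: y.
  by apply/eqP; rewrite -subr_eq0 -mul_mx_scalar -mulmxBr -/M yM.
have y0 : y != 0.
  apply: contraNneq x0 => y0; apply/eqP/rowP => i; have /rowP/(_ i) := y0; rewrite !mxE.
  by move/eqP; rewrite normr_eq0 => /eqP.
have yge i : 0 <= y 0 i by rewrite mxE.
exists k, y; split=> //.
- have /Gpos : y != 0 by []. rewrite yG dotvZl pmulr_lgt0 // dotv_gt0 //.
- by have := Sk (delta_mx 0 (Ordinal n0)); rewrite e1 mulr1 e2.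
move=> i; rewrite lt_def yge andbT; apply/negP => /eqP yi; case/eqP: y0; apply/rowP => i'.
rewrite [RHS]mxE; apply/eqP; apply: (Gconn (P := fun j => y 0 j == 0)); first by exists i; apply/eqP.
move=> a b /eqP ya ab Gab; have /rowP/(_ a) := yG; rewrite [LHS]mxE [RHS]mxE ya mulr0 => /eqP.
rewrite -oppr_eq0 -sumrN psumr_eq0 => [/allP/(_ b (mem_index_enum _))|j _]; last first.
  rewrite oppr_ge0; have [->|ja] := eqVneq j a; first by rewrite ya mul0r.
  by rewrite mulr_ge0_le0 ?Goff.
have -> : G b a = G a b by rewrite -[in LHS]Gsym mxE.
by rewrite /= oppr_eq0 mulf_eq0 (negPf Gab) orbF.
Qed.

End PerronFrobenius.

From mathcomp Require Import complex.
Section ComplexParts.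
Implicit Types x y : R[i].

Lemma cReM x y : complex.Re (x * y) =
  complex.Re x * complex.Re y - complex.Im x * complex.Im y.
Proof. by case: x y => [a b] [c d]. Qed.
Lemma cImM x y : complex.Im (x * y) =
  complex.Re x * complex.Im y + complex.Im x * complex.Re y.
Proof. by case: x y => [a b] [c d]. Qed.
Lemma cReD x y : complex.Re (x + y) = complex.Re x + complex.Re y.
Proof. by case: x y => [a b] [c d]. Qed.
Lemma cRe_sum (I : Type) (r : seq I) (P : pred I) (F : I -> R[i]) :
  complex.Re (\sum_(i <- r | P i) F i) = \sum_(i <- r | P i) complex.Re (F i).
Proof. exact: (big_morph _ cReD). Qed.
Lemma cReC (t : R) x : complex.Re (t%:C%C * x) = t * complex.Re x.
Proof. by rewrite cReM /= mul0r subr0. Qed.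

End ComplexParts.

Local Notation piR := (@trigo.pi RbaseSymbolsImpl_R__canonical__reals_Real).

(** * Sign changes of a sampled sinusoid *)

Section RotationSigns.
Variable h : nat.
Hypothesis h3 : (2 < h)%N.
Let psi : R := 2 * piR / h%:R.
Let S (k : nat) : R := trigo.sin (k%:R * psi).
Let C (k : nat) : R := trigo.cos (k%:R * psi).
Definition rot_root : R[i] := Complex (trigo.cos psi) (trigo.sin psi).

Let hR : 0 < h%:R :> R. Proof. by rewrite ltr0n; lia. Qed.
Let pi0 : 0 < piR. Proof. exact: trigo.pi_gt0. Qed.

Let sp : trigo.sin piR = 0. Proof. exact: trigo.sinpi. Qed.
Let cp : trigo.cos piR = -1. Proof. exact: trigo.cospi. Qed.

Let SD k : S k.+1 = S k * C 1 + C k * S 1.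
Proof. by rewrite /S /C -natr1 mulrDl mul1r trigo.sinD. Qed.
Let CD k : C k.+1 = C k * C 1 - S k * S 1.
Proof. by rewrite /S /C -natr1 mulrDl mul1r trigo.cosD. Qed.

Lemma rot_rootX k : rot_root ^+ k = Complex (C k) (S k).
Proof.
elim: k => [|k IHk]; first by rewrite expr0 /C /S mul0r trigo.cos0 trigo.sin0.
have E : rot_root = Complex (C 1) (S 1) by rewrite /rot_root /C /S mul1r.
by rewrite exprSr IHk E (SD k) (CD k); congr Complex; rewrite addrC.
Qed.

Lemma rot_root_order : rot_root ^+ h = 1.
Proof.
rewrite rot_rootX /C /S.
have -> : h%:R * psi = piR + piR by rewrite /psi; field; rewrite gt_eqF.
have c2 : trigo.cos (piR + piR) = 1 by have := trigo.cosD piR piR; rewrite sp cp => ->; ring.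
have s2 : trigo.sin (piR + piR) = 0 by have := trigo.sinD piR piR; rewrite sp cp => ->; ring.
by rewrite c2 s2.
Qed.

Let S_ge0 k : (2 * k <= h)%N -> 0 <= S k.
Proof.
move=> kh; apply: trigo.sin_ge0_pi; apply/andP; split.
  by rewrite !mulr_ge0 ?invr_ge0 ?ler0n ?ltW.
have : (2 * k)%:R <= h%:R :> R by rewrite ler_nat.
rewrite natrM /psi => H; rewrite mulrA ler_pdivrMr //.
have -> : k%:R * (2 * piR) = piR * (2 * k%:R) by ring.
by rewrite ler_pM2l.
Qed.

Let S_le0 k : (h <= 2 * k)%N -> (k <= h)%N -> S k <= 0.
Proof.
move=> hk kh; have : 0 <= trigo.sin (k%:R * psi - piR).
  apply: trigo.sin_ge0_pi.
  have H1 : h%:R <= (2 * k)%:R :> R by rewrite ler_nat.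
  have H2 : k%:R <= h%:R :> R by rewrite ler_nat.
  have -> : k%:R * psi - piR = ((2 * k)%:R - h%:R) / h%:R * piR.
    by rewrite natrM /psi; field; rewrite gt_eqF.
  have t0 : 0 <= ((2 * k)%:R - h%:R) / h%:R :> R by rewrite divr_ge0 ?subr_ge0 // ltW.
  have t1 : ((2 * k)%:R - h%:R) / h%:R <= 1 :> R by rewrite ler_pdivrMr // mul1r natrM; lra.
  by rewrite mulr_ge0 ?(ltW pi0) //= ler_piMl // ltW.
by rewrite trigo.sinB sp cp -/(S k); lra.
Qed.

Let S1 : 0 < S 1.
Proof.
apply: trigo.sin_gt0_pi; rewrite mul1r /psi; apply/andP; split.
  by rewrite divr_gt0 ?mulr_gt0.
rewrite ltr_pdivrMr // mulrC ltr_pM2l // (ltr_nat _ 2). by [].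
Qed.

Lemma rot_root_prim k : (0 < k < h)%N -> rot_root ^+ k != 1.
Proof.
move=> /andP[k0 kh]; rewrite rot_rootX; apply/eqP => E.
have SE : S k = 0 := congr1 (@complex.Im R) E.
have CE : C k = 1 := congr1 (@complex.Re R) E.
have kR : 0 < k%:R :> R by rewrite ltr0n.
have H2 : k%:R < h%:R :> R by rewrite ltr_nat.
have psiE : k%:R * psi = (2 * k)%:R / h%:R * piR by rewrite natrM /psi; field; rewrite gt_eqF.
have [lt|gt|eq] := ltngtP (2 * k) h.
- suff : 0 < S k by rewrite SE ltxx.
  apply: trigo.sin_gt0_pi; rewrite psiE.
  have H1 : (2 * k)%:R < h%:R :> R by rewrite ltr_nat.
  have t0 : 0 < (2 * k)%:R / h%:R :> R by rewrite divr_gt0 // ltr0n muln_gt0.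
  have t1 : (2 * k)%:R / h%:R < 1 :> R by rewrite ltr_pdivrMr // mul1r.
  by rewrite mulr_gt0 //= -[X in _ < X]mul1r ltr_pM2r.
- suff : 0 < trigo.sin (k%:R * psi - piR).
    by rewrite trigo.sinB sp cp -/(S k) SE mul0r mulr0 subrr ltxx.
  apply: trigo.sin_gt0_pi.
  have H1 : h%:R < (2 * k)%:R :> R by rewrite ltr_nat.
  have -> : k%:R * psi - piR = ((2 * k)%:R - h%:R) / h%:R * piR.
    by rewrite psiE; field; rewrite gt_eqF.
  have t0 : 0 < ((2 * k)%:R - h%:R) / h%:R :> R by rewrite divr_gt0 ?subr_gt0.
  have t1 : ((2 * k)%:R - h%:R) / h%:R < 1 :> R by rewrite ltr_pdivrMr // mul1r natrM; lra.
  by rewrite mulr_gt0 //= -[X in _ < X]mul1r ltr_pM2r.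
- move: CE; rewrite /C psiE eq divff ?gt_eqF // mul1r cp => /eqP.
  by rewrite -subr_eq0 -opprD oppr_eq0 -(natrD _ 1 1) pnatr_eq0.
Qed.

(** A sinusoid sampled [h] times per period passes from positive to negative only once. By [xE] each
    sample is a combination of the first two with sines as coefficients, and the sines are
    nonnegative in the first half period and nonpositive in the second. *)
Lemma rot_sign_change (z : R[i]) (b : nat) :
  let x k := complex.Re (z * rot_root ^+ k) in
  0 < x 0%N -> x 1%N < 0 -> (0 < b < h)%N -> 0 < x b -> 0 <= x b.+1.
Proof.
move=> x x0 x1 /andP[b0 bh] xb.
have xE k : S 1 * x k.+1 = x 1%N * S k.+1 - x 0%N * S k.
  rewrite /x !cReM !rot_rootX /=.
  have C0 : C 0 = 1 by rewrite /C mul0r trigo.cos0.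
  have S0 : S 0 = 0 by rewrite /S mul0r trigo.sin0.
  have CS : C 1 ^+ 2 + S 1 ^+ 2 = 1 by rewrite /C /S trigo.cos2Dsin2.
  rewrite C0 S0 (SD k) (CD k); move: CS; move: (C 1) (S 1) (C k) (S k) => c s cc sk CS.
  have cE : c ^+ 2 = 1 - s ^+ 2 by lra.
  have -> : (complex.Re z * c - complex.Im z * s) * (sk * c + cc * s) =
    complex.Re z * (sk * c ^+ 2) + complex.Re z * c * cc * s - complex.Im z * s * (sk * c + cc * s) by ring.
  by rewrite cE; ring.
have [bl|bg] := leqP (2 * b) h.
  case: b b0 bh xb bl => // k _ kh xk kl.
  have H1 : 0 <= S k.+1 by apply: S_ge0.
  have H2 : 0 <= S k by apply: S_ge0; lia.
  have := mulr_gt0 S1 xk; rewrite xE; nra.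
have H1 : S b <= 0 by apply: S_le0 => //; lia.
have H2 : S b.+1 <= 0 by apply: S_le0; lia.
by rewrite -(pmulr_rge0 _ S1) xE; nra.
Qed.

End RotationSigns.

(** * An eigenfunctional of the Coxeter element *)

Section CoxeterPlane.
Variables (l : nat) (Phi : seq 'rV[R]_l) (Delta : 'M[R]_l).
Hypotheses (rs : root_system Phi) (ss : simple_system Phi Delta) (irr : irreducible_rs Phi).
Hypothesis l0 : (0 < l)%N.
Local Notation Pos := (Pos Phi Delta).
Local Notation al := (al Delta).
Local Notation wmx := (wmx Delta).

Let al0 i : al i != 0. Proof. exact: (al_neq0 rs ss). Qed.

(** The levels record in which order adjacent simple reflections occur in the Coxeter element. They
    become exponents of a phase, which makes any order of the simple reflections as good as a
    bipartite one. *)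
Lemma heights : exists n : 'I_l -> int, forall i j : 'I_l, (i < j)%N -> adj Delta i j -> n j = n i + 1.
Proof.
have [|//||n [_ nE]] := @tree_potential _ _ _ rs ss int (fun=> True)
    (fun i j x => if (i < j)%N then x + 1 else x - 1) 0; rewrite //=.
  move=> i j x /andP[ij _] _; have [lt|gt|E] := ltngtP i j; [by rewrite addrK|by rewrite subrK|].
  by rewrite (ord_inj E) eqxx in ij.
by exists n => i j ij /nE; rewrite ij.
Qed.

(** Applied to the Gram matrix of the normalized simple roots, whose diagonal entries give [k <= 1];
    the factors [nr i] undo the normalization. *)
Lemma PF_simple : exists (k : R) (q : 'I_l -> R), [/\ 0 < k, k <= 1, forall i, 0 < q i &
  forall j, \sum_i cr (al i) (al j) * q i = 2 * k * q j].
Proof.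
pose nr i := Num.sqrt (dotv (al i) (al i)).
have n0 i : 0 < nr i by rewrite sqrtr_gt0 dotv_gt0.
have nn i : nr i ^+ 2 = dotv (al i) (al i) by rewrite sqr_sqrtr ?dotv_ge0.
pose e i := (nr i)^-1 *: al i; pose G : 'M[R]_l := \matrix_(i, j) dotv (e i) (e j).
have Gsym : G^T = G by apply/matrixP => i j; rewrite !mxE dotvC.
have Goff i j : i != j -> G i j <= 0.
  move=> ij; rewrite mxE /e dotvZl dotvZr !pmulr_rle0 ?invr_gt0 //.
  exact: (al_dot_le0 rs ss).
have Gpos x : x != 0 -> 0 < dotv (x *m G) x.
  move=> x0; pose v := \sum_i x 0 i *: e i.
  have -> : dotv (x *m G) x = dotv v v.
    rewrite {2}/v dotv_sumr {1}/dotv; apply: eq_bigr => j _; rewrite dotvZr mulrC; congr (_ * _).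
    by rewrite mxE /v dotv_suml; apply: eq_bigr => i _; rewrite dotvZl mxE.
  apply: dotv_gt0; apply: contraNneq x0 => v0; apply/eqP/rowP => i.
  have := congr1 (fun v => coords Delta v 0 i) v0; rewrite {2}/coords mul0mx [RHS]mxE => E.
  rewrite mxE; move: E; rewrite /v /coords mulmx_suml summxE (bigD1 i) //= big1 => [|j ji].
    rewrite addr0 /e scalerA -scalemxAl -/(coords _ _) (coords_al ss) !mxE !eqxx mulr1 => /eqP.
    by rewrite mulf_eq0 invr_eq0 (gt_eqF (n0 i)) orbF => /eqP.
  by rewrite /e scalerA -scalemxAl -/(coords _ _) (coords_al ss) !mxE eq_sym (negPf ji) andbF mulr0.
have Gconn (P : pred 'I_l) : (exists i, P i) ->
    (forall i j, P i -> i != j -> G i j != 0 -> P j) -> forall i, P i.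
  move=> [i0 Pi0] H; apply: (irr_conn rs ss irr Pi0) => i j Pi /andP[ij d]; apply: (H i) => //.
  by rewrite mxE /e dotvZl dotvZr !mulf_neq0 // invr_eq0 gt_eqF.
have [k [y [k0 k1 yG y0]]] := Perron_Frobenius Gsym Goff l0 Gpos Gconn.
exists k, (fun i => nr i * y 0 i); split=> // [|i|j].
- apply: le_trans k1 _; rewrite mxE /e dotvZl dotvZr -nn expr2.
  by move: (n0 (Ordinal l0)); move: (nr _) => a a0; rewrite mulKf ?gt_eqF // mulVf ?gt_eqF.
- by rewrite mulr_gt0.
have /rowP/(_ j) := yG; rewrite !mxE => E.
transitivity (2 * nr j * \sum_i y 0 i * G i j); last by rewrite E; ring.
rewrite mulr_sumr; apply: eq_bigr => i _; rewrite mxE /e dotvZl dotvZr /cr (dotvC (al j)) -nn.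
move: (n0 i) (n0 j); move: (nr i) (nr j) (dotv _ _) (y 0 i) => a b c d a0 b0; field; by rewrite !gt_eqF.
Qed.

Definition cfun (z : 'I_l -> R[i]) (v : 'rV[R]_l) : R[i] := \sum_i (cr (al i) v)%:C%C * z i.

(** The phase [ze] has absolute value one and twice its real part is [2 (1 - k)]. The functional
    with weights [q i * ze ^ n i] changes by the factor [lam = ze ^- 2] in one coordinate with each
    simple reflection, so the whole product multiplies it by [lam]. *)
Lemma coxeter_functional : exists (lam : R[i]) (z : 'I_l -> R[i]),
  [/\ lam != 1, forall i, z i != 0 & forall v, cfun z (v *m wmx (enum 'I_l)) = lam * cfun z v].
Proof.
have [n nE] := heights; have [k [q [k0 k1 q0 qE]]] := PF_simple.
pose mu := 2 * (1 - k); pose sn := Num.sqrt (1 - (mu / 2) ^+ 2).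
have mu1 : 0 < 1 - (mu / 2) ^+ 2.
  have -> : mu / 2 = 1 - k by rewrite /mu; field.
  nra.
have sn0 : 0 < sn by rewrite sqrtr_gt0.
have sn2 : sn ^+ 2 = 1 - (mu / 2) ^+ 2 by rewrite sqr_sqrtr // ltW.
pose ze : R[i] := Complex (mu / 2) sn.
have ze0 : ze != 0 by rewrite eq_complex /= (gt_eqF sn0) andbF.
have zeE : ze + ze^-1 = mu%:C%C.
  apply: (mulIf ze0); rewrite mulrDl mulVf //.
  apply/eqP; rewrite eq_complex !cReD !cReM /=; apply/andP; split; apply/eqP.
    by move: sn2; rewrite !expr2; lra.
  by rewrite /=; lra.
pose lam := ze ^- 2; pose z i := (q i)%:C%C * ze ^ (n i).
have q0C i : (q i)%:C%C != 0 by rewrite eq_complex /= (gt_eqF (q0 i)).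
have z0 i : z i != 0 by rewrite mulf_neq0 // expfz_neq0.
have lam1 : lam != 1.
  rewrite /lam invr_eq1; apply/eqP => z2.
  have : complex.Im (ze ^+ 2) = 0 by rewrite z2.
  have : complex.Re (ze ^+ 2) = 1 by rewrite z2.
  rewrite expr2 cReM cImM /= => H1 H2.
  have mu0 : mu / 2 = 0.
    apply: (mulIf (lt0r_neq0 sn0)); rewrite mul0r; move: H2; rewrite [sn * _]mulrC; lra.
  by move: H1; rewrite mu0; nra.
exists lam, z; split=> //.
(* After the letters before [m] have been applied, the coordinates still to be treated carry the
   factor [lam]. *)
pose co (m : nat) (i : 'I_l) : R[i] := if (i < m)%N then 1 else lam.
pose F m v := \sum_i co m i * ((cr (al i) v)%:C%C * z i).
(* The levels give every neighbour of [m] the same phase, whether it precedes or follows [m]; what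
   remains is the eigenvector equation for [q]. *)
have rel (m : 'I_l) : (1 + lam) * z m + \sum_(i | i != m) co m i * ((cr (al i) (al m))%:C%C * z i) = 0.
  have -> : \sum_(i | i != m) co m i * ((cr (al i) (al m))%:C%C * z i) =
      ze ^ (n m - 1) * (\sum_(i | i != m) cr (al i) (al m) * q i)%:C%C.
    rewrite (rmorph_sum (real_complex R)) mulr_sumr; apply: eq_bigr => i im.
    rewrite /= [in RHS]rmorphM /=.
    have [c0|c0] := eqVneq (cr (al i) (al m)) 0; first by rewrite c0 !(mul0r, mulr0).
    have aim : adj Delta i m by rewrite /adj im /= dotvC -cr_eq0.
    have -> : ze ^ (n m - 1) = co m i * ze ^ n i.
      rewrite /co; have [lt|gt|E] := ltngtP i m.
      - by rewrite (nE _ _ lt aim) addrK mul1r.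
      - rewrite adjC in aim; rewrite (nE _ _ gt aim) -[lam]/(ze ^ (-2)) -expfzDr //.
        by congr (_ ^ _); ring.
      - by rewrite (ord_inj E) eqxx in im.
    by rewrite /z; ring.
  have -> : \sum_(i | i != m) cr (al i) (al m) * q i = - (mu * q m).
    have := qE m; rewrite (bigD1 m) //= cr_id // => E; rewrite /mu; lra.
  rewrite rmorphN rmorphM /= -zeE /z.
  have -> : ze ^ n m = ze ^ (n m - 1) * ze by rewrite -[X in _ * X]expr1z -expfzDr // subrK.
  by rewrite /lam; field.
have step (m : 'I_l) v : F m.+1 (refl (al m) v) = F m v.
  rewrite /F (bigD1 m) //= [RHS](bigD1 m) //=.
  have cE i : cr (al i) (refl (al m) v) = cr (al i) v - cr (al m) v * cr (al i) (al m).
    by rewrite reflE crB crZ.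
  have -> : \sum_(i | i != m) co m.+1 i * ((cr (al i) (refl (al m) v))%:C%C * z i) =
     \sum_(i | i != m) co m i * ((cr (al i) v)%:C%C * z i) -
     (cr (al m) v)%:C%C * \sum_(i | i != m) co m i * ((cr (al i) (al m))%:C%C * z i).
    have cC (x y t : R) : (x - y * t)%:C%C = x%:C%C - y%:C%C * t%:C%C by rewrite rmorphB rmorphM.
    rewrite mulr_sumr -sumrB; apply: eq_bigr => i im; rewrite cE cC.
    have -> : co m.+1 i = co m i.
      by rewrite /co ltnS leq_eqVlt; have /negbTE -> : (i : nat) != m by rewrite (inj_eq (@ord_inj l)).
    by ring.
  have -> : \sum_(i | i != m) co m i * ((cr (al i) (al m))%:C%C * z i) = - ((1 + lam) * z m).
    by apply/eqP; rewrite -subr_eq0 opprK addrC rel.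
  rewrite cE cr_id // /co ltnS leqnn ltnn; set s := \sum_(_ | _) _.
  have -> : (cr (al m) v - cr (al m) v * 2)%:C%C = - (cr (al m) v)%:C%C.
    by rewrite -rmorphN; congr (_%:C%C); ring.
  by ring.
move=> v.
have FE d m u : (m + d = l)%N -> cfun z (u *m wmx (drop m (enum 'I_l))) = F m u.
  elim: d m u => [|d IHd] m u md.
    rewrite addn0 in md; rewrite drop_oversize ?size_enum_ord ?md // mulmx1 /F /cfun.
    by apply: eq_bigr => i _; rewrite /co ltn_ord mul1r.
  have ml : (m < l)%N by lia.
  rewrite (drop_nth (Ordinal ml)) ?size_enum_ord // (nth_ord_enum _ (Ordinal ml)) wmx_cons.
  by rewrite IHd ?addSnnS // -(step (Ordinal ml)).
have := FE l 0%N v (add0n l); rewrite drop0 => ->.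
by rewrite /F /cfun mulr_sumr; apply: eq_bigr => i _.
Qed.

End CoxeterPlane.

(** * Counting sign changes along Coxeter orbits *)

Section CoxeterNumber.
Variables (l : nat) (Phi : seq 'rV[R]_l) (Delta : 'M[R]_l).
Hypotheses (rs : root_system Phi) (ss : simple_system Phi Delta) (irr : irreducible_rs Phi).
Hypothesis l0 : (0 < l)%N.
Local Notation Pos := (Pos Phi Delta).
Local Notation al := (al Delta).
Local Notation wmx := (wmx Delta).

Let al0 i : al i != 0. Proof. exact: (al_neq0 rs ss). Qed.

(** [Phi] may have repetitions; this list of the same roots has none, so it can be used for
    counting. *)
Definition allr := Pos ++ map -%R Pos.

Lemma mem_allr a : (a \in allr) = (a \in Phi).
Proof.
rewrite mem_cat; apply/orP/idP => [[/Pos_root //|/mapP[b /Pos_root bP ->]]|aP].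
  exact: (rootN rs).
have [p|p] := root_pos_or_neg rs ss aP; [by left|right].
by apply/mapP; exists (- a); rewrite ?opprK.
Qed.

Lemma uniq_allr : uniq allr.
Proof.
rewrite cat_uniq undup_uniq map_inj_uniq ?undup_uniq ?andbT //=; last exact: oppr_inj.
by apply/hasPn => a /mapP[b bP ->]; apply: (PosN rs ss).
Qed.

Lemma perm_wmx s : perm_eq (map (mulmx^~ (wmx s)) allr) allr.
Proof.
have inj : injective (fun v : 'rV[R]_l => v *m wmx s).
  move=> u v /= E; rewrite -(mulmx1 u) -(mulmx1 v) -(wmx_rev rs ss s) !mulmxA.
  by rewrite E.
have us : uniq (map (mulmx^~ (wmx s)) allr) by rewrite map_inj_uniq // uniq_allr.
apply: uniq_perm => //; first exact: uniq_allr.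
have sub : {subset map (mulmx^~ (wmx s)) allr <= allr}.
  by move=> b /mapP[a]; rewrite !mem_allr => aP ->; apply: (root_wmx rs ss).
by have [] := uniq_min_size us sub; rewrite ?size_map.
Qed.

Lemma sum_wmx s (F : 'rV[R]_l -> nat) : (\sum_(b <- allr) F (b *m wmx s) = \sum_(b <- allr) F b)%N.
Proof. by rewrite -[RHS](perm_big _ (perm_wmx s)) big_map. Qed.

Definition wpow (s : seq 'I_l) k := flatten (nseq k s).

Lemma wpowS s k : wmx (wpow s k.+1) = wmx s *m wmx (wpow s k).
Proof. by rewrite /wpow /= wmx_cat. Qed.

Lemma wpowD s j k : wmx (wpow s (j + k)) = wmx (wpow s j) *m wmx (wpow s k).
Proof. by elim: j => [|j IHj]; rewrite ?mul1mx // addSn !wpowS IHj mulmxA. Qed.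

Lemma wpowSr s k : wmx (wpow s k.+1) = wmx (wpow s k) *m wmx s.
Proof. by rewrite -addn1 wpowD wpowS mulmx1. Qed.

Lemma wpowM s j k : wmx (wpow (wpow s j) k) = wmx (wpow s (j * k)).
Proof. by elim: k => [|k IHk]; rewrite ?muln0 // wpowS IHk mulnS wpowD. Qed.

(** Double counting: each power of the element permutes the roots, so every step of the orbits sees
    the same number of changes. *)
Lemma sign_changes s (P : pred 'rV[R]_l) h :
  (\sum_(b <- allr) \sum_(k < h) (P (b *m wmx (wpow s k)) && ~~ P (b *m wmx (wpow s k.+1))) =
   h * \sum_(b <- allr) (P b && ~~ P (b *m wmx s)))%N.
Proof.
rewrite exchange_big /= -[h in RHS]card_ord -sum_nat_const; apply: eq_bigr => k _.
rewrite -[RHS](sum_wmx (wpow s k)); apply: eq_bigr => b _.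
by rewrite wpowSr mulmxA.
Qed.

Lemma nneg_allr s :
  nneg Phi Delta (wmx s) = (\sum_(b <- allr) ((b \in Pos) && (b *m wmx s \notin Pos)))%N.
Proof.
rewrite /nneg /allr big_cat /= [X in (_ + X)%N]big1_seq => [|b /andP[_ /mapP[a aP ->]]]; last first.
  by rewrite (negPf (PosN rs ss aP)).
rewrite addn0 -sum1_count big_mkcond big_seq [RHS]big_seq; apply: eq_bigr => a aP; rewrite aP.
have [p|p] := root_pos_or_neg rs ss (root_wmx rs ss s (Pos_root aP)).
  by rewrite p (negPf (PosN rs ss p)).
by rewrite p; have := PosN rs ss p; rewrite opprK => ->.
Qed.

Lemma ht_Pos a : a \in Pos -> 0 < ht Delta a.
Proof.
move=> aP; have ge : 0 <= ht Delta a by apply: sumr_ge0 => i _; apply: (Pos_nonneg _ aP).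
rewrite lt_def ge andbT.
apply/negP; rewrite /ht psumr_eq0 => [/allP z|i _]; last exact: (Pos_nonneg _ aP).
case/eqP: (Pos_neq0 rs aP); apply: (coords_inj ss); rewrite [in RHS]/coords mul0mx.
by apply/rowP => i; rewrite [RHS]mxE; apply/eqP; apply: z; apply: mem_index_enum.
Qed.

Lemma htD u v : ht Delta (u + v) = ht Delta u + ht Delta v.
Proof.
rewrite /ht -big_split; apply: eq_bigr => i _; rewrite coordsD.
by rewrite mxE.
Qed.

Lemma ht0 : ht Delta 0 = 0.
Proof. by rewrite /ht big1 // => i _; rewrite /coords mul0mx mxE. Qed.

Variable h : nat.
Hypothesis hc : is_coxeter_number Delta h.
Let c := enum 'I_l.

Let cE k : wmx (wpow c k) = iter k (mulmx (coxeter_elt Delta)) 1%:M.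
Proof. by elim: k => // k IHk; rewrite wpowS IHk. Qed.

Let h0 : (0 < h)%N. Proof. by case: hc. Qed.
Let ch : wmx (wpow c h) = 1%:M. Proof. by rewrite cE; case: hc. Qed.

(** The sum over an orbit is fixed by the Coxeter element, hence zero, so the heights along it
    cannot all have one sign. *)
Let changes b : b \in Phi ->
  exists2 k, (k < h)%N & b *m wmx (wpow c k) \in Pos /\ b *m wmx (wpow c k.+1) \notin Pos.
Proof.
move=> bP; apply: boolp.contrapT => N.
pose P k := b *m wmx (wpow c k) \in Pos.
have PS k : (k < h)%N -> P k -> P k.+1.
  by move=> kh Pk; apply/negPn/negP => nP; apply: N; exists k.
have up j k : (j <= k <= h)%N -> P j -> P k.
  case/andP; elim: k => [|k IHk]; first by rewrite leqn0 => /eqP ->.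
  rewrite leq_eqVlt => /orP[/eqP -> //|jk] kh Pj; apply: PS => //; apply: IHk => //; exact: ltnW.
have P0 : P h -> P 0%N by rewrite /P ch mulmx1.
pose v := \sum_(k < h) b *m wmx (wpow c k).
have v0 : v = 0.
  apply: (coxeter_fixed rs ss); rewrite /v mulmx_suml.
  under eq_bigr => k _ do rewrite -mulmxA -wpowSr.
  move: ch; case: (h) => [|n] cn; first by rewrite !big_ord0.
  by rewrite big_ord_recr [RHS]big_ord_recl /= cn addrC.
have hv : \sum_(k < h) ht Delta (b *m wmx (wpow c k)) = 0.
  by rewrite -(big_morph _ htD ht0) -/v v0 ht0.
have [/existsP[k Pk]|nP] := boolP [exists k : 'I_h, P k].
  have all k' : (k' <= h)%N -> P k'.
    move=> kh; apply: (up 0%N); first by rewrite leq0n.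
    by apply: P0; apply: up Pk; rewrite leqnn andbT ltnW.
  move/eqP: hv; rewrite psumr_eq0 => [/allP/(_ k (mem_index_enum _))|k' _].
    by rewrite gt_eqF // ht_Pos.
  by apply/ltW/ht_Pos/all/ltnW.
have neg (k : 'I_h) : - (b *m wmx (wpow c k)) \in Pos.
  have [p|//] := root_pos_or_neg rs ss (root_wmx rs ss (wpow c k) bP).
  by case/existsP: nP; exists k.
have htN u : ht Delta (- u) = - ht Delta u by apply/eqP; rewrite -addr_eq0 addrC -htD subrr ht0.
move/eqP: hv; rewrite -oppr_eq0 -sumrN psumr_eq0 => [/allP/(_ (Ordinal h0) (mem_index_enum _))|k _].
  by rewrite /= -htN gt_eqF // (ht_Pos (neg (Ordinal h0))).
by rewrite -htN ltW // ht_Pos.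
Qed.

(** Every root has at least one change in [h] steps, and a single step makes at most [l] of them. *)
Lemma coxeter_number_ge : (2 * size Pos <= h * l)%N.
Proof.
apply: leq_trans (_ : h * nneg Phi Delta (wmx c) <= _)%N; last first.
  by rewrite leq_mul2l (leq_trans (nneg_size rs ss c)) ?orbT // size_enum_ord.
rewrite nneg_allr -(sign_changes c (mem Pos)).
have -> : (2 * size Pos = \sum_(b <- allr) 1)%N.
  by rewrite sum1_size size_cat size_map addnn mul2n.
rewrite big_seq [X in (_ <= X)%N]big_seq; apply: leq_sum => b; rewrite mem_allr => bP.
have [k kh [p n]] := changes bP; rewrite (bigD1 (Ordinal kh)) //=.
by rewrite [X in nat_of_bool (X && _)]p n.
Qed.

(** Positivity is now measured by a generic real part of the eigenfunctional, which amounts to a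
    conjugate of the Coxeter element. Along each orbit this is a sampled sinusoid with at most one
    change in [h] steps, while an element without fixed vectors makes at least [l] changes in each
    step. *)
Lemma coxeter_number_le : (h * l <= 2 * size Pos)%N.
Proof.
have [lam [z [lam1 z0 fE]]] := coxeter_functional rs ss irr l0.
pose f := cfun Delta z.
have fD u v : f (u + v) = f u + f v.
  by rewrite /f /cfun -big_split; apply: eq_bigr => i _ /=; rewrite crD rmorphD mulrDl.
have fN u : f (- u) = - f u.
  by rewrite /f /cfun -sumrN; apply: eq_bigr => i _ /=; rewrite crN rmorphN mulNr.
have fpow k v : f (v *m wmx (wpow c k)) = lam ^+ k * f v.
  elim: k v => [|k IHk] v; first by rewrite mulmx1 expr0 mul1r.
  by rewrite wpowS mulmxA IHk /f fE exprSr mulrA.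
(* Where the orbit of [b] changes sign it meets, up to sign, the difference of a fundamental weight
   [om] and its image, and the eigenfunctional is [(1 - lam) * z j] there. *)
have f0 b : b \in Phi -> f b != 0.
  move=> bP; have [k kh [p n]] := changes bP.
  have neg : - (b *m wmx (wpow c k) *m wmx c) \in Pos.
    have [p2|//] := root_pos_or_neg rs ss (root_wmx rs ss (wpow c k.+1) bP).
      by rewrite p2 in n.
    by rewrite wpowSr mulmxA.
  have [s1 [j [s2 [cs E]]]] := word_split rs ss p neg.
  have us : uniq (s1 ++ j :: s2) by rewrite -cs enum_uniq.
  pose om : 'rV[R]_l := (dotv (al j) (al j) / 2) *: row j (invmx Delta)^T.
  have omE i : cr (al i) om = (i == j)%:R.
    have uD : Delta \in unitmx by case: ss.
    rewrite /om crZ /cr.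
    have -> : dotv (row j (invmx Delta)^T) (al i) = (i == j)%:R.
      rewrite /dotv; transitivity ((Delta *m invmx Delta) i j); last by rewrite mulmxV // mxE.
      by rewrite mxE; apply: eq_bigr => k' _; rewrite !mxE mulrC.
    have [->|_] := eqVneq i j; last by rewrite !mulr0 mul0r mulr0.
    by have := dotv_gt0 (al0 j); move: (dotv _ _) => d d0; change (d / 2 * (2 * 1 / d) = 1); field; rewrite gt_eqF.
  have fix_ s : j \notin s -> om *m wmx s = om.
    elim: s => [|i s IHs]; first by rewrite mulmx1.
    rewrite inE negb_or => /andP[ji js]; rewrite wmx_cons reflE omE eq_sym (negPf ji).
    by rewrite scale0r subr0 IHs.
  have js1 : j \notin s1 by move: us; rewrite cat_uniq => /and3P[_ /norP[]].
  have js2 : j \notin s2 by move: us; rewrite cat_uniq => /and3P[_ _ /andP[]].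
  have omc : om *m wmx c = om - al j *m wmx s2.
    rewrite cs wmx_cat mulmxA fix_ // wmx_cons reflE omE eqxx scale1r mulmxBl fix_ //.
  have fom : f om = z j.
    rewrite /f /cfun (bigD1 j) //= omE eqxx mul1r big1 ?addr0 // => i ij.
    by rewrite omE (negPf ij) mul0r.
  have fa : f (al j *m wmx s2) = (1 - lam) * z j.
    have := fE om; rewrite -/f omc -[X in f (_ + X)]/(- _) fD fN fom => E2.
    by rewrite mulrBl mul1r -E2 opprB addrC subrK.
  have : f (b *m wmx (wpow c k.+1)) != 0.
    have -> : b *m wmx (wpow c k.+1) = - (al j *m wmx s2).
      by rewrite wpowSr mulmxA [in X in _ *m X]cs wmx_cat mulmxA E wmx_cons refl_id // mulNmx.
    by rewrite fN oppr_eq0 fa mulf_neq0 // subr_eq0 eq_sym.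
  by rewrite fpow mulf_eq0 negb_or => /andP[].
(* Turning by a generic complex factor keeps the real part away from zero at all roots. *)
have [t tE] : exists t : R, forall b, b \in Phi -> complex.Re (Complex 1 t * f b) != 0.
  pose g : {poly R} := \prod_(b <- Phi) ((complex.Re (f b))%:P - complex.Im (f b) *: 'X).
  have g0 : g != 0.
    rewrite prodf_seq_neq0; apply/allP => b bP /=; apply/eqP => E; case/eqP: (f0 b bP).
    have r0 : complex.Re (f b) = 0 by have := congr1 (horner^~ 0) E; rewrite !hornerE subr0.
    have i0 : complex.Im (f b) = 0.
      by have := congr1 (horner^~ 1) E; rewrite !hornerE r0 sub0r => /eqP; rewrite oppr_eq0 => /eqP.
    by move: r0 i0; case: (f b) => x y /= -> ->.
  apply: boolp.contrapT => N; case/eqP: g0; apply: poly_fun_eq0 => t; apply/eqP/negPn/negP => gt.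
  apply: N; exists t => b bP; apply: contraNneq gt; rewrite cReM /= mul1r => z1.
  rewrite -[g.[t]]/(horner_eval t g) /g (rmorph_prod (horner_eval t)) /= (big_rem b) //=.
  by rewrite horner_evalE !hornerE [_ * t]mulrC z1 mul0r.
pose tau : R[i] := Complex 1 t.
pose q : 'rV[R]_l := \sum_i (2 * complex.Re (tau * z i) / dotv (al i) (al i)) *: al i.
have qE v : dotv v q = complex.Re (tau * f v).
  rewrite /f /cfun mulr_sumr cRe_sum /q dotv_sumr; apply: eq_bigr => i _.
  by rewrite dotvZr mulrCA cReC /cr; move: (dotv _ _) (dotv _ _) (complex.Re _) => x y w; ring.
have q0 b : b \in Phi -> dotv b q != 0 by move=> bP; rewrite qE tE.
have [s sE] := to_chamber rs ss q0.
pose rho := wmx (rev s).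
have rhoP b : b \in Phi -> (0 < dotv (b *m rho) q) = (b \in Pos).
  move=> bP; have dE u : dotv (u *m rho) q = dotv u (q *m wmx s).
    by rewrite /rho (dotv_wmx_rev rs ss) revK.
  have [p|p] := root_pos_or_neg rs ss bP; first by rewrite p dE sE.
  have := PosN rs ss p; rewrite opprK => /negbTE ->; apply/negbTE; rewrite -leNgt.
  by have := sE _ p; rewrite dotvNl -dE oppr_gt0 => /ltW.
have nn w0 : let w' := wmx (rev s ++ w0 ++ s) in
    nneg Phi Delta w' = (\sum_(b <- allr) ((0 < dotv b q)%R && ~~ (0 < dotv (b *m wmx w0) q)%R))%N.
  rewrite /= -(sum_wmx (rev s)) -/rho.
  have wE u : u *m wmx (rev s ++ w0 ++ s) *m rho = u *m rho *m wmx w0.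
    by rewrite !wmx_cat !mulmxA -/rho -mulmxA /rho (wmx_rev rs ss) mulmx1.
  rewrite nneg_allr big_seq [RHS]big_seq; apply: eq_bigr => b; rewrite mem_allr => bP.
  by rewrite -wE !rhoP // (root_wmx rs ss).
(* When [lam ^+ k = 1] the power does not change any sign, so its conjugate has no inversions; hence
   [lam] has the same order as the Coxeter element. *)
have reg k : lam ^+ k = 1 -> wmx (wpow c k) = 1%:M.
  move=> lk; have /(word_preserving rs ss) : nneg Phi Delta (wmx (rev s ++ wpow c k ++ s)) = 0%N.
    by rewrite nn big1 // => b _; rewrite !qE fpow lk mul1r andbN.
  rewrite !wmx_cat mulmxA => E.
  have <- : wmx s *m (wmx (rev s) *m wmx (wpow c k) *m wmx s) *m wmx (rev s) = wmx (wpow c k).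
    by rewrite !mulmxA (wmx_rev rs ss) mul1mx -mulmxA (wmx_rev rs ss) mulmx1.
  by rewrite E mulmx1 (wmx_rev rs ss).
pose i0 : 'I_l := Ordinal l0.
have lamh : lam ^+ h = 1.
  apply: (mulIf (f0 _ (al_root ss i0))); rewrite mul1r -fpow ch mulmx1. by [].
have lamk k : (0 < k < h)%N -> lam ^+ k != 1.
  by move=> kh; apply/eqP => /reg; rewrite cE; case: hc => _ _ /(_ k kh) /eqP.
have primP (x : R[i]) : x ^+ h = 1 -> (forall k, (0 < k < h)%N -> x ^+ k != 1) -> h.-primitive_root x.
  move=> xh xk; apply/andP; split=> //; apply/forallP => k; rewrite unity_rootE; apply/eqP.
  have [->|kh] := eqVneq k.+1 h; first by rewrite xh eqxx.
  by apply/negbTE/xk; apply/andP; split=> //; rewrite ltn_neqAle kh ltn_ord.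
have lamP := primP _ lamh lamk.
have h1 : (1 < h)%N.
  rewrite ltn_neqAle h0 andbT; apply/eqP => h1; case/eqP: (al0 i0).
  apply: (coxeter_fixed rs ss); rewrite -/c; have := ch; rewrite -h1 wpowS mulmx1 => ->.
  by rewrite mulmx1.
(* The sine of the rotation angle vanishes for [h = 2], so that case is kept apart. *)
pose eps : R[i] := if (2 < h)%N then rot_root h else -1.
have epsh : eps ^+ h = 1.
  rewrite /eps; case: ifP => h2; first exact: rot_root_order.
  have -> : h = 2%N by lia.
  by rewrite sqrrN expr1n.
have epsk k : (0 < k < h)%N -> eps ^+ k != 1.
  move=> kh; rewrite /eps; case: ifP => h2; first exact: rot_root_prim.
  have -> : k = 1%N by lia.
  by rewrite expr1 eq_complex /= -subr_eq0 -opprD oppr_eq0 -(natrD _ 1 1) pnatr_eq0.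
have epsP := primP _ epsh epsk.
(* [lam] is only known to be some primitive root, so the Coxeter element is replaced by the power
   [C] that turns by exactly one [h]-th of the circle; a power of [C] is the Coxeter element again,
   which rules out fixed vectors. *)
have [r rE] := prim_rootP lamP epsh; have [j jE] := prim_rootP epsP lamh.
pose C := wpow c r.
have fC k b : f (b *m wmx (wpow C k)) = eps ^+ k * f b.
  by rewrite /C wpowM fpow exprM -rE.
have nofix (u : 'rV[R]_l) : u *m wmx C = u -> u = 0.
  move=> uC; apply: (coxeter_fixed rs ss); rewrite -/c.
  have uCk k : u *m wmx (wpow C k) = u.
    by elim: k => [|k IHk]; rewrite ?mulmx1 // wpowS mulmxA uC.
  have : lam ^+ (r * j) = lam by rewrite exprM -rE -jE.
  case E : (r * j)%N => [|n] ln; first by rewrite -ln expr0 eqxx in lam1.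
  have lam0 : lam != 0 by apply: contraNneq (oner_neq0 R[i]) => z1; rewrite -lamh z1 expr0n gtn_eqF.
  have ln1 : lam ^+ n = 1 by apply: (mulIf lam0); rewrite -exprSr ln mul1r.
  by have := uCk j; rewrite /C wpowM E wpowS (reg _ ln1) mulmx1.
have lC : (l <= nneg Phi Delta (wmx (rev s ++ C ++ s)))%N.
  apply: (nneg_no_fixed rs ss) => v; rewrite !wmx_cat !mulmxA -/rho => E.
  have := congr1 (mulmx^~ rho) E; rewrite /= -mulmxA [wmx s *m rho](wmx_rev rs ss) mulmx1.
  by move/nofix => vr; rewrite -(mulmx1 v) -(wmx_revl rs ss s) mulmxA -/rho vr mul0mx.
apply: leq_trans (leq_mul (leqnn h) lC) _; rewrite nn -(sign_changes C (fun b => 0 < dotv b q)).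
have -> : (2 * size Pos = \sum_(b <- allr) 1)%N by rewrite sum1_size size_cat size_map addnn mul2n.
rewrite big_seq [X in (_ <= X)%N]big_seq; apply: leq_sum => b; rewrite mem_allr => bP.
pose x k := dotv (b *m wmx (wpow C k)) q.
have x0 k : x k != 0 by rewrite q0 // (root_wmx rs ss).
have uq (a d : nat) : (a < d)%N -> (d < h)%N -> 0 < x a -> ~~ (0 < x a.+1) -> 0 < x d -> 0 < x d.+1.
  move=> ad dh xa xa1 xd.
  have xa1' : x a.+1 < 0 by rewrite lt_def eq_sym x0 leNgt xa1.
  have [E|ne] := eqVneq d a.+1; first by rewrite -E xd in xa1.
  have h2 : (2 < h)%N by lia.
  have xE k : x (a + k)%N = complex.Re (tau * f b * eps ^+ a * rot_root h ^+ k).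
    by rewrite /x qE fC exprD /eps h2; congr complex.Re; ring.
  have := @rot_sign_change h h2 (tau * f b * eps ^+ a) (d - a); rewrite /= -!xE addn0 addn1.
  rewrite addnS !subnKC ?(ltnW ad) // => H.
  by rewrite lt_def x0; apply: H => //; lia.
have [/existsP[a /andP[xa xa1]]|N] := boolP [exists a : 'I_h, (0 < x a) && ~~ (0 < x a.+1)]; last first.
  rewrite big1 // => k _; apply/eqP; rewrite eqb0.
  by apply: contra N => Nk; apply/existsP; exists k.
rewrite (bigD1 a) //= big1 ?addn0; first by case: (_ && _).
move=> d da; apply/eqP; rewrite eqb0; apply/negP => /andP[xd xd1].
have [lt|gt|E] := ltngtP a d.
- by move/negP: xd1; apply; apply: (uq a d).
- by move/negP: xa1; apply; apply: (uq d a).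
- by case/eqP: da; apply: ord_inj.
Qed.

Theorem coxeter_Casimir v : \sum_(a <- Pos) cr a v *: a = h%:R *: v.
Proof.
have [h' [cas tr]] := Casimir_exists rs ss irr; rewrite cas; congr (_ *: _).
have lR : l%:R != 0 :> R by rewrite pnatr_eq0 -lt0n.
apply: (mulIf lR); rewrite tr -!natrM; congr (_%:R); apply/eqP.
by rewrite eqn_leq coxeter_number_ge coxeter_number_le.
Qed.

End CoxeterNumber.

(** * Multiderivations *)

Section MultiDerivations.
Variables (l : nat) (Phi : seq 'rV[R]_l) (Delta : 'M[R]_l).
Hypotheses (rs : root_system Phi) (ss : simple_system Phi Delta).
Local Notation Pos := (Pos Phi Delta).
Local Notation Qall := (Qall Phi Delta).
Local Notation S := {mpoly R[l]}.

Lemma dhomog_det n d (A : 'M[S]_n) : (forall i j, A i j \is d.-homog) -> \det A \is (n * d).-homog.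
Proof.
move=> hA; apply: rpred_sum => s _; rewrite mulr_sign.
have H (r : seq 'I_n) : \prod_(i <- r) A i (perm.fun_of_perm s i) \is (size r * d).-homog.
  elim: r => [|i r IHr] /=; first by rewrite big_nil dhomog1.
  by rewrite big_cons mulSn; apply: dhomogM.
have := H (enum 'I_n); rewrite big_enum size_enum_ord => hp.
by case: ifP => _; rewrite ?rpredN.
Qed.

Lemma dhomog_quotient_const n (p q s : S) : p \is n.-homog -> q \is n.-homog -> p != 0 ->
  p = q * s -> exists2 c : R, c != 0 & s = c%:MP.
Proof.
move=> hp hq p0 pE; have : q * s != 0 by rewrite -pE.
rewrite mulf_eq0 negb_or => /andP[q0 s0].
have sz : msize s = 1%N.
  have hs (r : S) : r \is n.-homog -> r != 0 -> msize r = n.+1.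
    by move=> /dhomogP hr r0; rewrite -(mlead_deg r0) (hr _ (mlead_supp r0)).
  have := congr1 (fun x => msize x) pE; rewrite /= msizeM // (hs p) // (hs q) // addSn /=.
  move: (mmeasure _ s) => x; lia.
have sE : s = (s@_0%MM)%:MP by apply: msize1_polyC; rewrite sz.
exists (s@_0%MM) => //; by apply: contraNneq s0 => z; rewrite sE z mpolyC0.
Qed.

Lemma mdvd_det_row n (A : 'M[S]_n) (i : 'I_n) (p : S) : (forall j, mdivides p (A i j)) ->
  mdivides p (\det A).
Proof.
by move=> H; rewrite (expand_det_row A i); apply: mdvd_sum => j _; apply: mdvdMr.
Qed.

Variables (h m : nat).
Hypothesis cas : forall v, \sum_(a <- Pos) cr a v *: a = h%:R *: v.
Hypothesis count : (h * l = 2 * size Pos)%N.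
Variables (Psi : seq 'rV[R]_l) (e : 'I_l -> nat).
Hypothesis sPsi : {subset Psi <= Pos}.

Definition mlt a := (2 * m + (a \in Psi))%N.

(** Saito's criterion by degrees: the determinant of the frame is divisible by [Qall^(2m)] and has
    the same degree, so Cramer's rule inverts [Fi] on the derivations with multiplicity [2 m]. Along
    a root, the extra factor for [Psi] on one side corresponds to the logarithmic condition on the
    other. *)
Theorem multi_basis : free_with_exponents Psi e -> exists T : 'I_l -> 'I_l -> S,
  [/\ forall i a, a \in Pos -> mdivides (linform a ^+ mlt a) (deriv_apply (T i) a),
      forall i j, T i j \is (e i + m * h).-homog,
      forall th, (forall a, a \in Pos -> mdivides (linform a ^+ mlt a) (deriv_apply th a)) ->
        exists g : 'I_l -> S, forall j, th j = \sum_i g i * T i j &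
      forall g : 'I_l -> S, (forall j, \sum_i g i * T i j = 0) -> forall i, g i = 0].
Proof.
move=> [B [Blog Bhom Bspan Bfree]].
have [|U [Ulin Uhom Uodd Uinj]] := flat_frame rs ss (m := m) (D := (m * h)%N) cas.
  by rewrite -natrM.
pose E (j : 'I_l) : 'rV[R]_l := delta_mx 0 j.
have UE w k : U w 0 k = \sum_j w 0 j *: U (E j) 0 k.
  have U0 : U 0 = 0.
    have := Ulin (-1) 0 0; rewrite scaler0 add0r mpolyCN mpolyC1 scaleN1r addrC subrr. by [].
  have -> : U w = \sum_j (w 0 j)%:MP *: U (E j).
    rewrite {1}[w]row_sum_delta.
    apply: (big_ind2 (fun x y => U x = y)) => // [x1 x2 y1 y2 <- <-|j _].
      by rewrite -{1}[x1]scale1r Ulin mpolyC1 scale1r.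
    by rewrite -[X in U X]addr0 Ulin U0 addr0.
  by rewrite summxE; apply: eq_bigr => j _; rewrite mxE mul_mpolyC.
pose M : 'M[S]_l := \matrix_(j, k) U (E j) 0 k.
(* The components of [eta] are paired with the frame, so that [Fi eta] has the value
   [\sum_k eta k * U a 0 k] at [a]; in this way the divisibility of [U a] enters. *)
pose Fi (eta : 'I_l -> S) (j : 'I_l) : S := \sum_k eta k * U (E j) 0 k.
have FiE eta w : deriv_apply (Fi eta) w = \sum_k eta k * U w 0 k.
  rewrite /deriv_apply /Fi; under eq_bigr => j _ do rewrite scaler_sumr.
  rewrite exchange_big; apply: eq_bigr => k _ /=; rewrite UE mulr_sumr.
  by apply: eq_bigr => j _; rewrite scalerAr.
have MN (N : 'M[R]_l) i k : (map_mx (@mpolyC l R) N *m M) i k = U (row i N) 0 k.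
  by rewrite UE mxE; apply: eq_bigr => j _; rewrite !mxE mul_mpolyC.
have dM0 : \det M != 0.
  have [q Qq] := mpoly_nonzero_point (Qall_neq0 Delta rs).
  suff : (\det M).@[q 0] != 0 by apply: contraNneq => ->; rewrite meval0.
  rewrite -det_map_mx; apply/det0P => -[v v0 vM]; case/eqP: v0.
  apply: (Uinj q v Qq); apply/rowP => k; have /rowP/(_ k) := vM; rewrite !mxE UE => vk.
  rewrite -[RHS]vk raddf_sum; apply: eq_bigr => j _; by rewrite /= mevalZ !mxE.
(* A constant change of basis with [a] as a row makes a power of [a] divide a whole row, and changes
   the determinant by a nonzero constant. *)
have complete a : a != 0 -> exists2 N : 'M[R]_l, N \in unitmx & exists i, row i N = a.
  move=> a0; have [i ai] : exists i, a 0 i != 0.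
    apply: boolp.contrapT => N; case/eqP: a0; apply/rowP => i; rewrite mxE.
    by apply/eqP/negPn/negP => ai; apply: N; exists i.
  pose N : 'M[R]_l := \matrix_j (if j == i then a else E j).
  exists N; last by exists i; rewrite rowK eqxx.
  rewrite -row_free_unit; apply: inj_row_free => v vN.
  have vj : v *m N = v 0 i *: a + \sum_(j | j != i) v 0 j *: E j.
    rewrite mulmx_sum_row (bigD1 i) //= rowK eqxx; congr (_ + _).
    by apply: eq_bigr => k ki; rewrite rowK (negPf ki).
  have vi : v 0 i = 0.
    have := congr1 (fun x : 'rV[R]_l => x 0 i) vN; rewrite vj !mxE summxE big1 => [|k ki].
      by rewrite addr0 => /eqP; rewrite mulf_eq0 (negPf ai) orbF => /eqP.
    by rewrite !mxE eqxx eq_sym (negPf ki) mulr0.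
  apply/rowP => k; rewrite [RHS]mxE; have [->//|ki] := eqVneq k i.
  have := congr1 (fun x : 'rV[R]_l => x 0 k) vN; rewrite vj vi scale0r add0r summxE (bigD1 k) //=.
  rewrite !mxE !eqxx mulr1 big1 ?addr0 // => j /andP[_ jk].
  by rewrite !mxE eqxx eq_sym (negPf jk) mulr0.
have det_dvd a (A : 'M[S]_l) d : a \in Pos ->
    (forall N : 'M[R]_l, forall i, row i N = a ->
      forall j, mdivides (linform a ^+ d) ((map_mx (@mpolyC l R) N *m A) i j)) ->
    mdivides (linform a ^+ d) (\det A).
  move=> aP H; have [N uN [i iN]] := complete a (Pos_neq0 rs aP).
  have : mdivides (linform a ^+ d) (\det (map_mx (@mpolyC l R) N *m A)).
    by apply: (@mdvd_det_row _ _ i) => j; apply: H.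
  rewrite det_mulmx det_map_mx /= => -[r rE]; exists ((\det N)^-1%:MP * r).
  move: uN; rewrite unitmxE unitfE => dN.
  by rewrite mulrCA -rE mulrA -mpolyCM mulVf // mpolyC1 mul1r.
pose Q2 : S := \prod_(a <- Pos) linform a ^+ (2 * m).
have Q2E : Q2 = Qall ^+ (2 * m) by rewrite /Q2 prodrXl.
have Q2h : Q2 \is (l * (m * h)).-homog.
  rewrite Q2E; have -> : (l * (m * h) = size Pos * (2 * m))%N by nia.
  exact: dhomogMn (Qall_homog _ _).
have Q2dvd p : (forall a, a \in Pos -> mdivides (linform a ^+ (2 * m)) p) -> mdivides Q2 p.
  by move=> H; apply: (linform_prod_dvd (e := fun=> (2 * m)%N) (nprop_Pos rs ss)).
have [c c0 dME] : exists2 c : R, c != 0 & \det M = Q2 * c%:MP.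
  have [|s sE] := Q2dvd (\det M).
    move=> a aP; apply: det_dvd => // N i iN j; rewrite MN iN.
    by have [w -> _] := Uodd a aP; rewrite mxE; apply: mdvdMr; apply: mdvdr.
  have dh : \det M \is (l * (m * h)).-homog by apply: dhomog_det => i j; rewrite mxE; apply: Uhom.
  have [c c0 cE] := dhomog_quotient_const dh Q2h dM0 sE.
  by exists c; rewrite // sE cE.
have Finj eta : (forall j, Fi eta j = 0) -> forall k, eta k = 0.
  move=> F0 k; pose v : 'rV[S]_l := \row_k eta k.
  have : v *m M^T = 0 by apply/rowP => j; rewrite !mxE -[RHS](F0 j); apply: eq_bigr => i _; rewrite !mxE.
  move=> /(congr1 (mulmx^~ (\adj M^T))); rewrite -mulmxA mul_mx_adj mul0mx det_tr => /rowP/(_ k).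
  rewrite mul_mx_scalar !mxE => /eqP; rewrite mulf_eq0 (negPf dM0) /= => /eqP. by [].
have Fsurj th : (forall a, a \in Pos -> mdivides (linform a ^+ (2 * m)) (deriv_apply th a)) ->
    exists eta, forall j, th j = Fi eta j.
  move=> H; pose t : 'cV[S]_l := \col_j th j.
  have num k : {r | (\adj M *m t) k 0 = Q2 * r}.
    apply: boolp.cid; apply: Q2dvd => a aP.
    pose A : 'M[S]_l := \matrix_(i, j) if j == k then t i 0 else M i j.
    have -> : (\adj M *m t) k 0 = \det A.
      rewrite mxE (expand_det_col A k); apply: eq_bigr => j _; rewrite [A j k]mxE eqxx mulrC.
      have E2 : row' j (col' k M) = row' j (col' k A).
        by apply/matrixP => x y; rewrite !mxE eq_sym (negPf (neq_lift _ _)).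
      by rewrite [(\adj M) k j]mxE /cofactor E2.
    apply: det_dvd => // N i iN j.
    have -> : (map_mx (@mpolyC l R) N *m A) i j = if j == k then deriv_apply th a else U a 0 j.
      case: ifP => jk.
        rewrite mxE /deriv_apply; apply: eq_bigr => x _; rewrite [A x j]mxE jk !mxE mul_mpolyC.
        by rewrite -iN mxE.
      by rewrite -iN -MN !mxE; apply: eq_bigr => x _; rewrite [A x j]mxE jk.
    case: ifP => _; first exact: H.
    by have [w -> _] := Uodd a aP; rewrite mxE; apply: mdvdMr; apply: mdvdr.
  exists (fun k => (c^-1)%:MP * sval (num k)) => j.
  have adjE : M *m (\adj M *m t) = \det M *: t by rewrite mulmxA mul_mx_adj mul_scalar_mx.
  apply: (mulfI dM0); have := congr1 (fun z : 'cV[S]_l => z j 0) adjE.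
  rewrite [RHS]mxE [t j 0]mxE => <-; rewrite mxE /Fi mulr_sumr; apply: eq_bigr => k _.
  case: (num k) => r /= ->; rewrite [M j k]mxE dME.
  have -> : Q2 * c%:MP * ((c^-1)%:MP * r * U (E j) 0 k) = (c%:MP * (c^-1)%:MP) * (Q2 * r * U (E j) 0 k) by ring.
  by rewrite -mpolyCM divff // mpolyC1 mul1r mulrC.
(* Along the hyperplane [w] is [ga] times [a], so [Fi eta] at [a] is [a^(2m) * ga * eta(a)] modulo
   [a^(2m+1)]. If [a] divided [ga], then [a^(2m+1)] would divide the determinant. *)
have key a : a \in Pos -> exists (w : 'rV[S]_l) (ga : S),
    [/\ U a = linform a ^+ (2 * m) *: w, ~ mdivides (linform a) ga &
     forall eta : 'I_l -> S, mdivides (linform a) (\sum_k eta k * w 0 k - ga * deriv_apply eta a)].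
  move=> aP; have a0 := Pos_neq0 rs aP; have [w wE wd] := Uodd a aP.
  pose ga : S := 2^-1 *: \sum_j cr a (E j) *: w 0 j.
  have gE k : 2^-1 *: Pmw a w k = a 0 k *: ga.
    rewrite /Pmw /ga scalerA mulrC -scalerA; congr (_ *: _); rewrite scaler_sumr; apply: eq_bigr => j _.
    rewrite scalerA; congr (_ *: _); have := mul_Pm a (E j); rewrite -rowE => /rowP/(_ k).
    by rewrite !mxE mulrC.
  exists w, ga; split=> //.
    move=> gd; have : mdivides (linform a ^+ (2 * m).+1) (\det M).
      apply: det_dvd => // N i iN j; rewrite MN iN wE mxE exprSr; apply: mdvd_mul; first exact: mdvdr.
      rewrite -[w 0 j](subrK (2^-1 *: Pmw a w j)); apply: mdvdD; first exact: wd.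
      by rewrite gE; apply: mdvdZ.
    rewrite dME /Q2 (big_rem a) //= exprSr -mulrA.
    have la0 : linform a ^+ (2 * m) != 0 by rewrite expf_neq0 // linform_eq0.
    move=> /(mdvd_mul2l la0)/(linform_prime a0)[].
      apply: linform_ndvd_prod => // b bP; apply: linform_ndvdX => //; apply: linform_ndvd_linform => t.
      have [u _ H] := nprop_Pos rs ss; apply: H => //; first exact: mem_rem bP.
      by apply/eqP => ab; move: bP; rewrite -ab mem_rem_uniqF.
    by move=> -[r /(congr1 (meval ((0 : 'rV[R]_l) 0)))]; rewrite mevalC mevalM ev_linform dotv0r mul0r => /eqP; rewrite (negPf c0).
  move=> eta; rewrite /deriv_apply mulr_sumr -sumrB; apply: mdvd_sum => k _.
  have -> : eta k * w 0 k - ga * (a 0 k *: eta k) = eta k * (w 0 k - 2^-1 *: Pmw a w k).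
    by rewrite gE -!mul_mpolyC; ring.
  exact: mdvdMl.
have FM g (eta : 'I_l -> 'I_l -> S) j : \sum_i g i * Fi (eta i) j = Fi (fun k => \sum_i g i * eta i k) j.
  rewrite /Fi; under eq_bigr => i _ do rewrite mulr_sumr.
  by rewrite exchange_big; apply: eq_bigr => k _; rewrite mulr_suml; apply: eq_bigr => i _; rewrite mulrA.
exists (fun i => Fi (B i)); split.
- move=> i a aP; rewrite FiE; have [w [ga [wE _ H]]] := key a aP.
  have -> : \sum_k B i k * U a 0 k = linform a ^+ (2 * m) * \sum_k B i k * w 0 k.
    by rewrite wE mulr_sumr; apply: eq_bigr => k _; rewrite mxE mulrCA.
  rewrite /mlt exprD; apply: mdvd_mul; first exact: mdvdr.
  case: (boolP (a \in Psi)) => aPsi; last by exists (\sum_k B i k * w 0 k); rewrite expr0 mul1r.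
  rewrite expr1 -[X in mdivides _ X](subrK (ga * deriv_apply (B i) a)); apply: mdvdD; first exact: H.
  by apply: mdvdMl; apply: Blog.
- move=> i j; apply: rpred_sum => k _; apply: dhomogM; last exact: Uhom.
  by apply/mhomogE; case: (Bhom i).
- move=> th H; have [|eta etaE] := Fsurj th.
    by move=> a aP; apply: mdvd_trans (H a aP); apply: mdvd_exp; apply: leq_addr.
  have [|g gE] := Bspan eta.
    move=> a aPsi; have aP := sPsi aPsi; have [w [ga [wE gn Hk]]] := key a aP.
    have a0 := Pos_neq0 rs aP.
    have la0 : linform a ^+ (2 * m) != 0 by rewrite expf_neq0 // linform_eq0.
    have := H a aP; rewrite /mlt aPsi addn1 exprSr.
    have -> : deriv_apply th a = linform a ^+ (2 * m) * \sum_k eta k * w 0 k.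
      transitivity (deriv_apply (Fi eta) a); first by apply: eq_bigr => j _; rewrite etaE.
      by rewrite FiE wE mulr_sumr; apply: eq_bigr => k _; rewrite mxE mulrCA.
    move=> /(mdvd_mul2l la0) d1; have := mdvdB d1 (Hk eta); rewrite opprB addrC subrK.
    by case/(linform_prime a0).
  exists g => j; rewrite etaE FM; apply: eq_bigr => k _; by rewrite gE.
- move=> g g0; apply: Bfree => k; apply: (Finj (fun k => \sum_i g i * B i k)) => j.
  by rewrite -FM g0.
Qed.

End MultiDerivations.

(** * Rank two arrangements *)

Section LinePolyDegree.
Variable n : nat.
Implicit Types (p : {mpoly R[n]}) (u v w : 'rV[R]_n).

Lemma size_linep v u p : (size (linep v u p) <= msize p)%N.
Proof.
rewrite {1}[p]mpolyE rmorph_sum /=; apply: leq_trans (size_sum _ _ _) _.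
apply/bigmax_leqP_seq => m mp _; rewrite /= linepZ; apply: leq_trans (size_scale_leq _ _) _.
apply: leq_trans (msize_mdeg_lt mp); rewrite mpolyXE_id rmorph_prod /= mdegE.
elim: (index_enum _) => [|i r IHr]; first by rewrite !big_nil size_poly1.
rewrite !big_cons; apply: leq_trans (size_polyMleq _ _) _.
have : (size (linep v u ('X_i ^+ m i)) <= (m i).+1)%N.
  rewrite rmorphXn /=; apply: leq_trans (size_poly_exp_leq _ _) _; rewrite ltnS.
  have : (size (linep v u 'X_i) <= 2)%N.
    rewrite linepX; apply: leq_trans (size_polyD _ _) _; rewrite geq_max size_polyC.
    by rewrite (leq_trans (size_scale_leq _ _)) ?size_polyX // andbT; case: (_ == _).
  by move: (size (linep v u 'X_i)) => s; nia.
move: IHr; move: (size _) (size _) (\sum_(_ <- _) _)%N => a b c; lia.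
Qed.

Lemma homog_scale d p (c : R) v : p \is d.-homog -> p.@[(c *: v) 0] = c ^+ d * p.@[v 0].
Proof.
move=> /dhomogP hp; rewrite !mevalE mulr_sumr big_seq [RHS]big_seq; apply: eq_bigr => m mp.
rewrite mulrCA; congr (_ * _).
have -> : d = (\sum_i m i)%N by rewrite -mdegE hp.
have -> : c ^+ (\sum_i m i) = \prod_i c ^+ m i by rewrite (big_morph _ (exprD c) (expr0 c)).
by rewrite -big_split; apply: eq_bigr => i _; rewrite mxE exprMn.
Qed.

(* [Ev p w0 w1 G] is [G (p + t (w0 + s w1))], as a polynomial in [t] over the polynomials in [s]. *)
Definition Ev (z0 w0 w1 : 'rV[R]_n) (G : {mpoly R[n]}) : {poly {poly R}} :=
  mmap (polyC \o polyC) (fun i => (z0 0 i)%:P%:P + ((w0 0 i)%:P + w1 0 i *: 'X) *: 'X) G.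

HB.instance Definition _ (z0 w0 w1 : 'rV[R]_n) := GRing.RMorphism.copy (Ev z0 w0 w1)
  (mmap (polyC \o polyC) (fun i => (z0 0 i)%:P%:P + ((w0 0 i)%:P + w1 0 i *: 'X) *: 'X)).

Lemma EvC z0 w0 w1 c : Ev z0 w0 w1 c%:MP = c%:P%:P.
Proof. by rewrite /Ev mmapC. Qed.

Lemma EvX z0 w0 w1 i : Ev z0 w0 w1 'X_i = (z0 0 i)%:P%:P + ((w0 0 i)%:P + w1 0 i *: 'X) *: 'X.
Proof. by rewrite /Ev mmapX mmap1U. Qed.

(** In the substitution every [s] comes with a [t]. *)
Lemma Ev_coef z0 w0 w1 G k : (size ((Ev z0 w0 w1 G)`_k)%R <= k.+1)%N.
Proof.
elim/mpoly_gen_ind: G k => [c|i|p q Hp Hq|p q Hp Hq] k.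
- rewrite EvC coefC; case: eqP => _; last by rewrite size_poly0.
  by rewrite size_polyC; case: (_ == _).
- rewrite EvX coefD coefC coefZ coefX; case: k => [|[|k]] /=.
  + by rewrite mulr0 addr0 size_polyC; case: (_ == _).
  + rewrite add0r mulr1; apply: leq_trans (size_polyD _ _) _; rewrite geq_max size_polyC.
    by rewrite (leq_trans (size_scale_leq _ _)) ?size_polyX // andbT; case: (_ == _).
  + by rewrite mulr0 addr0 size_poly0.
- rewrite rmorphD coefD; apply: leq_trans (size_polyD _ _) _; by rewrite geq_max Hp Hq.
- rewrite rmorphM coefM; apply: leq_trans (size_sum _ _ _) _; apply/bigmax_leqP => i _.
  apply: leq_trans (size_polyMleq _ _) _; have := Hp i; have := Hq (k - i)%N; have := ltn_ord i.
  move: (size _) (size _) => a b; lia.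
Qed.

Lemma Ev_spec z0 w0 w1 G s : map_poly (horner_eval s) (Ev z0 w0 w1 G) = linep z0 (w0 + s *: w1) G.
Proof.
elim/mpoly_gen_ind: G => [c|i|p q Hp Hq|p q Hp Hq].
- by rewrite EvC linepC map_polyC /= horner_evalE hornerC.
- rewrite EvX linepX rmorphD /= map_polyC /= map_polyZ map_polyX /= !horner_evalE !hornerE !mxE.
  by rewrite [s * _]mulrC.
- by rewrite !rmorphD /= Hp Hq.
- by rewrite !rmorphM /= Hp Hq.
Qed.

End LinePolyDegree.

Lemma prodXsub_dvd (T : seq R) (e : R -> nat) (p : {poly R}) : uniq T ->
  (forall t, t \in T -> (('X - t%:P) ^+ e t %| p)%R) -> (\prod_(t <- T) ('X - t%:P) ^+ e t %| p)%R.
Proof.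
elim: T => [|t T IHT] /=; first by rewrite big_nil dvd1p.
move=> /andP[tT uT] tp; rewrite big_cons Gauss_dvdp; last first.
  rewrite coprimep_sym; apply: coprimep_expr; rewrite coprimep_XsubC.
  rewrite /root -[X in X == 0]/(horner_eval t _) (rmorph_prod (horner_eval t)) /= prodf_seq_neq0.
  apply/allP => r rT /=; rewrite horner_evalE !hornerE expf_neq0 // subr_eq0.
  by apply: contraNneq tT => ->.
rewrite tp ?mem_head //= IHT // => r rT; by apply: tp; rewrite inE rT orbT.
Qed.

Lemma sum_fibers (A : eqType) (B : eqType) (f : A -> B) (s : seq A) :
  (\sum_(b <- undup (map f s)) size [seq a <- s | f a == b] = size s)%N.
Proof.
under eq_bigr => b _ do rewrite size_filter -sum1_count big_mkcond.
rewrite exchange_big /= -[RHS]sum1_size big_seq [RHS]big_seq; apply: eq_bigr => a as_.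
rewrite -big_mkcond sum1_count /= (eq_count (a2 := pred1 (f a))) => [|b]; last by rewrite /= eq_sym.
by rewrite count_uniq_mem ?undup_uniq // mem_undup map_f.
Qed.

(** * Adding a line to a free arrangement of affine lines *)

Section AffineLines.
Local Notation S := {mpoly R[3]}.
Definition o0 : 'I_3 := Ordinal (isT : (0 < 3)%N).
Definition o1 : 'I_3 := Ordinal (isT : (1 < 3)%N).
Definition o2 : 'I_3 := Ordinal (isT : (2 < 3)%N).
Definition row3 (c a b : R) : 'rV[R]_3 := \row_(i < 3) [:: c; a; b]`_i.

Lemma dot3 u v : dotv u v = u 0 o0 * v 0 o0 + u 0 o1 * v 0 o1 + u 0 o2 * v 0 o2.
Proof.
rewrite /dotv !big_ord_recl big_ord0 addr0 addrA.
by congr (_ + _ + _); congr (u 0 _ * v 0 _); apply: val_inj.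
Qed.

Lemma row3E c a b : ((row3 c a b 0 o0 = c) * (row3 c a b 0 o1 = a) * (row3 c a b 0 o2 = b))%type.
Proof. by rewrite !mxE. Qed.

Lemma row3_inj (u v : 'rV[R]_3) : u 0 o0 = v 0 o0 -> u 0 o1 = v 0 o1 -> u 0 o2 = v 0 o2 -> u = v.
Proof.
move=> e0 e1 e2; apply/rowP => -[[|[|[|//]]] i3].
- by have -> : Ordinal i3 = o0 by apply: val_inj.
- by have -> : Ordinal i3 = o1 by apply: val_inj.
- by have -> : Ordinal i3 = o2 by apply: val_inj.
Qed.

(** The value at [lam] of the derivation with components [(0, P, Q)]; index [o0] is the coordinate
    of the cone. *)
Definition ap (lam : 'rV[R]_3) (P Q : S) : S := lam 0 o1 *: P + lam 0 o2 *: Q.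

(** Saito's criterion for the derivations that kill the cone coordinate. The Euler derivation and
    the line at infinity are left out, so [L] contains only affine lines. *)
Definition Free2 (L : seq 'rV[R]_3) (d1 d2 : nat) := exists P1 Q1 P2 Q2 : S,
  [/\ P1 \is d1.-homog /\ Q1 \is d1.-homog, P2 \is d2.-homog /\ Q2 \is d2.-homog,
      forall lam, lam \in L -> mdivides (linform lam) (ap lam P1 Q1) /\
                             mdivides (linform lam) (ap lam P2 Q2) &
      exists2 c : R, c != 0 & P1 * Q2 - P2 * Q1 = c%:MP * \prod_(lam <- L) linform lam].

Lemma Free2C L d1 d2 : Free2 L d1 d2 -> Free2 L d2 d1.
Proof.
move=> [P1 [Q1 [P2 [Q2 [h1 h2 H [c c0 E]]]]]]; exists P2, Q2, P1, Q1; split=> // [lam /H[]//|].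
exists (- c); rewrite ?oppr_eq0 //; rewrite mpolyCN mulNr -E; ring.
Qed.

Lemma Free2_perm L L' d1 d2 : perm_eq L L' -> Free2 L d1 d2 -> Free2 L' d1 d2.
Proof.
move=> LL [P1 [Q1 [P2 [Q2 [h1 h2 H [c c0 E]]]]]]; exists P1, Q1, P2, Q2; split=> //.
  by move=> lam; rewrite -(perm_mem LL) => /H.
by exists c; rewrite // E (perm_big _ LL).
Qed.

Variables (L : seq 'rV[R]_3) (x y k n1 n2 : R) (d1 d2 : nat).
Hypothesis bez : x * n1 + y * n2 = 1.
Let H := row3 (- k) x y.
Hypotheses (nL : nprop (H :: L)) (aff : forall lam, lam \in L -> (lam 0 o1 != 0) || (lam 0 o2 != 0)).
Hypotheses (d12 : (d1 <= d2)%N) (sL : size L = (d1 + d2)%N).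

(** By the Bezout relation [g0 + t g1] runs through the affine line [H], and [gn] is transversal to
    it. [Dh lam] vanishes when [lam] is parallel to [H]; otherwise [posn lam] is the parameter of
    the intersection. *)
Let g0 := row3 1 (k * n1) (k * n2).
Let g1 := row3 0 (- y) x.
Let gn := row3 0 n1 n2.
Definition Dh (lam : 'rV[R]_3) := x * lam 0 o2 - lam 0 o1 * y.
Let An (lam : 'rV[R]_3) := lam 0 o1 * n1 + lam 0 o2 * n2.
Definition posn (lam : 'rV[R]_3) := (- lam 0 o0 - k * An lam) / Dh lam.
Let res : S -> {poly R} := linep g0 g1.

Let H0 : H != 0. Proof. by case: nL => _; rewrite inE negb_or eq_sym => /andP[]. Qed.
Let lam0 lam : lam \in L -> lam != 0.
Proof. by move=> lL; case: nL => _ N _; apply: contraNneq N => <-; rewrite inE lL orbT. Qed.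
Let npL lam lam' : lam \in L -> lam' \in L -> lam != lam' -> forall c, lam' != c *: lam.
Proof. by move=> h1 h2; case: nL => _ _ N; apply: N; rewrite inE ?h1 ?h2 orbT. Qed.
Let npH lam : lam \in L -> forall c, lam != c *: H.
Proof.
move=> lL; case: nL => /andP[HL _] _ N; apply: N; rewrite ?inE ?eqxx ?lL ?orbT //.
by apply: contraNneq HL => ->.
Qed.
Let npH' lam : lam \in L -> forall c, H != c *: lam.
Proof.
move=> lL; case: nL => /andP[HL _] _ N; apply: N; rewrite ?inE ?eqxx ?lL ?orbT //.
by apply: contraNneq HL => <-.
Qed.

Let res_lam lam : res (linform lam) = (lam 0 o0 + k * An lam)%:P + Dh lam *: 'X.
Proof.
rewrite /res linep_linform !dot3 /g0 /g1 !row3E /Dh /An; congr (_%:P + _ *: _); ring.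
Qed.

Let coef1 (lam : 'rV[R]_3) : lam 0 o1 = An lam * x - Dh lam * n2.
Proof. rewrite /An /Dh -[LHS]mulr1 -bez; ring. Qed.
Let coef2 (lam : 'rV[R]_3) : lam 0 o2 = An lam * y + Dh lam * n1.
Proof. rewrite /An /Dh -[LHS]mulr1 -bez; ring. Qed.

Let par_neq lam : lam \in L -> Dh lam = 0 -> lam 0 o0 + k * An lam != 0 /\ An lam != 0.
Proof.
move=> lL D0; have c1 := coef1 lam; have c2 := coef2 lam.
move: c1 c2; rewrite D0 !mul0r subr0 addr0 => c1 c2.
have A0 : An lam != 0.
  by apply/eqP => A0; have := aff lL; rewrite c1 c2 A0 !mul0r eqxx.
split=> //; apply/eqP => z; case/eqP: (npH lL (An lam)).
by apply: row3_inj; rewrite [RHS]mxE /H !row3E //; lra.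
Qed.

Let res_size d p : p \is d.-homog -> (size (res p) <= d.+1)%N.
Proof.
have [->|p0] := eqVneq p 0; first by rewrite /res rmorph0 size_poly0.
move=> /dhomogP hp; apply: leq_trans (size_linep _ _ _) _.
by rewrite -(mlead_deg p0) (hp _ (mlead_supp p0)).
Qed.

(** By homogeneity, vanishing on the affine line gives vanishing on the plane of [H] wherever the
    cone coordinate is not zero; multiplying by that coordinate covers the rest. *)
Let res0 d p : p \is d.-homog -> res p = 0 -> mdivides (linform H) p.
Proof.
move=> hp r0.
have : mdivides (linform H) (linform (row3 1 0 0) * p).
  apply: linform_dvd => // v; rewrite dot3 /H !row3E => Hv; rewrite mevalM ev_linform dot3 !row3E.
  have [->|c0] := eqVneq (v 0 o0) 0; first by rewrite !(mul0r, mulr0, addr0).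
  pose c := v 0 o0; pose t := (n1 * v 0 o2 - n2 * v 0 o1) / c.
  have vE : v = c *: (g0 + t *: g1).
    have E1 : x * v 0 o1 + y * v 0 o2 = k * c by rewrite /c; lra.
    apply: row3_inj; rewrite !mxE /= /t.
    - by rewrite mulr0 addr0 mulr1.
    - have -> : c * (k * n1 + (n1 * v 0 o2 - n2 * v 0 o1) / c * - y) =
        n1 * (k * c) + (n2 * y) * v 0 o1 - n1 * y * v 0 o2 by field.
      by rewrite -E1; have -> : n2 * y = 1 - x * n1; [rewrite -bez|]; ring.
    - have -> : c * (k * n2 + (n1 * v 0 o2 - n2 * v 0 o1) / c * x) =
        n2 * (k * c) + (n1 * x) * v 0 o2 - n2 * x * v 0 o1 by field.
      by rewrite -E1; have -> : n1 * x = 1 - y * n2; [rewrite -bez|]; ring.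
  rewrite vE (homog_scale _ _ hp) -linep_ev -/(res p) r0 horner0 !mulr0. by [].
case/(linform_prime H0) => // /linform_ndvd_linform []; move=> c; apply/eqP => E.
have := congr1 (fun v : 'rV[R]_3 => v 0 o1) E; have := congr1 (fun v : 'rV[R]_3 => v 0 o2) E.
rewrite [RHS]mxE /H !row3E => e2; rewrite [RHS]mxE !row3E => e1.
have := congr1 (fun v : 'rV[R]_3 => v 0 o0) E; rewrite [RHS]mxE !row3E => e0.
have c0 : c = 0.
  have := bez; move/(congr1 (fun z => c * z)); rewrite mulr1 mulrDr !mulrA -e1 -e2 !mul0r addr0. by [].
by move: e0 => /eqP; rewrite c0 mul0r oner_eq0.
Qed.

(* The coefficient of [t^j] below has degree at most [j + 1] in the slope [s] and vanishes at the
   slopes of the [size r] lines of [r]. *)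
Let slope P Q (r : seq 'rV[R]_3) t0 : uniq r -> {subset r <= L} ->
  (forall lam, lam \in r -> Dh lam != 0 /\ posn lam = t0) ->
  (forall lam, lam \in r -> mdivides (linform lam) (ap lam P Q)) ->
  exists q, res (ap H P Q) = ('X - t0%:P) ^+ (size r).-1 * q.
Proof.
move=> ur rL rD rP; pose p0 := g0 + t0 *: g1.
(* Tilts the transversal direction so that every line of [r] has a finite slope with respect to
   it. *)
have [c cE] : exists c : R, forall lam, lam \in r -> An lam + c * Dh lam != 0.
  pose g : {poly R} := \prod_(lam <- r) ((An lam)%:P + Dh lam *: 'X).
  have gn0 : g != 0.
    rewrite prodf_seq_neq0; apply/allP => lam lr /=; apply/eqP => E; have [D0 _] := rD _ lr.
    have := congr1 (horner^~ 0) E; have := congr1 (horner^~ 1) E; rewrite !hornerD !hornerC !hornerZ !hornerX ?horner0 mulr1 mulr0 addr0 => e1 e0.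
    by case/eqP: D0; move: e1; rewrite e0 add0r.
  apply: boolp.contrapT => N; case/eqP: gn0; apply: poly_fun_eq0 => c; apply/eqP/negPn/negP => gc.
  apply: N; exists c => lam lr; apply: contraNneq gc => z.
  rewrite -[g.[c]]/(horner_eval c g) /g (rmorph_prod (horner_eval c)) /= (big_rem lam) //=.
  by rewrite horner_evalE !hornerE [_ * c]mulrC z mul0r.
pose w1 := gn + c *: g1.
pose u := ap H P Q; pose v := - (n2 + c * x) *: P + (n1 - c * y) *: Q.
pose sl lam := - Dh lam / (An lam + c * Dh lam).
pose E := Ev p0 g1 w1 u - ('X : {poly R})%:P * Ev p0 g1 w1 v.
have Esz j : (size (E`_j)%R <= j.+2)%N.
  rewrite /E coefB coefCM; apply: leq_trans (size_polyD _ _) _; rewrite size_polyN geq_max.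
  rewrite (leq_trans (Ev_coef _ _ _ _ _)) //= mulrC.
  have := Ev_coef p0 g1 w1 v j; have [->|z] := eqVneq (Ev p0 g1 w1 v)`_j 0; first by rewrite mul0r size_poly0.
  by rewrite size_mulX.
have Espec s : map_poly (horner_eval s) E = linep p0 (g1 + s *: w1) (u - s *: v).
  rewrite /E rmorphB rmorphM /= !Ev_spec map_polyC /= horner_evalE hornerX rmorphB /= linepZ.
  by rewrite mul_polyC.
have lamE lam : lam \in r -> ap lam P Q = (An lam + c * Dh lam) *: (u - sl lam *: v).
  move=> lr; rewrite scalerBr scalerA /sl mulrCA divff ?cE // mulr1 /u /v /ap /H !row3E.
  rewrite (coef1 lam) (coef2 lam) -!mul_mpolyC; move: (An lam) (Dh lam) => A D.
  by rewrite !mpolyCN !(mpolyCB, mpolyCD, mpolyCM, mpolyCN); ring.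
have root_ lam : lam \in r -> forall j, (E`_j).[sl lam] = 0.
  move=> lr j; have [D0 tE] := rD _ lr.
  have : map_poly (horner_eval (sl lam)) E = 0.
    rewrite Espec; have A0 := cE _ lr; apply: (@scalerI _ _ (An lam + c * Dh lam)); rewrite ?A0 //.
    rewrite scaler0 -linepZ -lamE //; have [q ->] := rP _ lr; rewrite rmorphM /= linep_linform.
    have -> : dotv lam p0 = 0.
      have -> : dotv lam p0 = lam 0 o0 + k * An lam + t0 * Dh lam.
        by rewrite /p0 dotvDr dotvZr !dot3 /g0 /g1 !row3E /An /Dh; ring.
      by rewrite -tE /posn divfK //; ring.
    have -> : dotv lam (g1 + sl lam *: w1) = 0.
      have -> : dotv lam (g1 + sl lam *: w1) = Dh lam + sl lam * (An lam + c * Dh lam).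
        by rewrite /w1 dotvDr dotvZr dotvDr dotvZr !dot3 /gn /g1 !row3E /An /Dh; ring.
      by rewrite /sl divfK // subrr.
    by rewrite polyC0 scale0r addr0 mul0r.
  by move/(congr1 (fun z : {poly R} => z`_j)); rewrite coef_map coef0 /= horner_evalE.
have sl_inj : {in r &, injective sl}.
  move=> l1 l2 r1 r2 e; apply/eqP/negPn/negP => l12.
  have [D1 t1] := rD _ r1; have [D2 t2] := rD _ r2.
  have A1 := cE _ r1; have A2 := cE _ r2.
  have e' : Dh l1 * (An l2 + c * Dh l2) = Dh l2 * (An l1 + c * Dh l1).
    move: e; rewrite /sl => /eqP; rewrite eqr_div // => /eqP; lra.
  have e2 : An l2 = Dh l2 / Dh l1 * An l1.
    apply: (mulfI D1); have -> : Dh l1 * (Dh l2 / Dh l1 * An l1) = Dh l2 * An l1 by field.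
    by lra.
  case/eqP: (npL (rL _ r1) (rL _ r2) l12 (Dh l2 / Dh l1)); apply: row3_inj; rewrite [RHS]mxE.
  - have p1 : l1 0 o0 = - (t0 * Dh l1) - k * An l1 by rewrite -t1 /posn divfK //; ring.
    have p2 : l2 0 o0 = - (t0 * Dh l2) - k * An l2 by rewrite -t2 /posn divfK //; ring.
    by rewrite p1 p2 e2; field.
  - by rewrite (coef1 l1) (coef1 l2) e2; field.
  - by rewrite (coef2 l1) (coef2 l2) e2; field.
have E0 j : (j < (size r).-1)%N -> E`_j = 0.
  move=> jr; apply/eqP/negPn/negP => Ej.
  have := @max_poly_roots _ E`_j (map sl r) Ej; rewrite size_map (map_inj_in_uniq sl_inj) ur.
  have -> : all (root E`_j) (map sl r).
    by apply/allP => z /mapP[lam lr ->]; apply/rootP; apply: root_.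
  by move=> /(_ isT isT); have := Esz j; move: (size _) => a; lia.
have [q qE] : exists q, linep p0 g1 u = 'X^((size r).-1) * q.
  exists (drop_poly (size r).-1 (linep p0 g1 u)).
  have := Espec 0; rewrite !scale0r addr0 subr0 => <-.
  rewrite -[LHS](poly_take_drop (size r).-1) mulrC.
  have -> : take_poly (size r).-1 (map_poly (horner_eval 0) E) = 0.
    by apply/polyP => j; rewrite coef_take_poly coef0; case: ifP => // jr; rewrite coef_map E0 //= horner_evalE horner0.
  by rewrite add0r.
exists (q \Po ('X - t0%:P)).
have : (res u \Po ('X + t0%:P)) = 'X^((size r).-1) * q.
  rewrite -qE; apply/eqP; rewrite -subr_eq0; apply/eqP/poly_fun_eq0 => s.
  rewrite hornerD hornerN horner_comp !hornerE /res !linep_ev /p0 -addrA -scalerDl [t0 + s]addrC subrr.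
  by [].
move/(congr1 (fun p => p \Po ('X - t0%:P))); rewrite -comp_polyA comp_polyD comp_polyX comp_polyC subrK comp_polyXr.
by rewrite comp_polyM rmorphXn /= comp_polyX.
Qed.

Let Lf := [seq lam <- L | Dh lam != 0].
Let Lp := [seq lam <- L | Dh lam == 0].
Definition Tpos := undup (map posn Lf).
Let B : {poly R} := \prod_(t <- Tpos) ('X - t%:P) ^+ (size [seq lam <- Lf | posn lam == t]).-1.

Let B0 : B != 0.
Proof. by rewrite prodf_seq_neq0; apply/allP => t _ /=; rewrite expf_neq0 // polyXsubC_eq0. Qed.

Let uL : uniq L. Proof. by case: nL => /andP[]. Qed.

Let size_LfLp : (size Lf + size Lp = size L)%N.
Proof.
rewrite /Lf /Lp !size_filter -(count_predC (fun lam => Dh lam != 0) L); congr (_ + _)%N.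
by apply: eq_count => lam /=; rewrite negbK.
Qed.

Let size_B : (size B + size Tpos = (size Lf).+1)%N.
Proof.
have -> : size B = (\sum_(t <- Tpos) (size [seq lam <- Lf | posn lam == t]).-1).+1.
  rewrite /B; elim: Tpos => [|t T IHT]; first by rewrite !big_nil size_poly1.
  rewrite !big_cons size_mul ?IHT ?size_exp_XsubC ?expf_neq0 ?polyXsubC_eq0 //; first by rewrite addnS.
  by rewrite prodf_seq_neq0; apply/allP => r _ /=; rewrite expf_neq0 // polyXsubC_eq0.
rewrite addSn; congr _.+1; rewrite -(sum_fibers posn Lf) -sum1_size -big_split /= big_seq [RHS]big_seq.
apply: eq_bigr => t; rewrite mem_undup => /mapP[lam lL tE].
have : lam \in [seq lam <- Lf | posn lam == t] by rewrite mem_filter -tE eqxx.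
by case: [seq _ <- _ | _] => //= a s _; rewrite addn1.
Qed.

Let apE lam P Q : ap lam P Q = An lam *: ap H P Q + Dh lam *: (- n2 *: P + n1 *: Q).
Proof.
rewrite /ap /H !row3E (coef1 lam) (coef2 lam) -!mul_mpolyC; move: (An lam) (Dh lam) => A D.
by rewrite !(mpolyCB, mpolyCD, mpolyCM, mpolyCN); ring.
Qed.

(** An intersection point on [k] lines contributes a zero of order [k - 1]. Lines parallel to [H]
    divide [ap H P Q] and are constant on [H], so they lower the degree of the restriction. *)
Let factor d P Q : P \is d.-homog -> Q \is d.-homog ->
  (forall lam, lam \in L -> mdivides (linform lam) (ap lam P Q)) ->
  exists2 s, res (ap H P Q) = B * s & s = 0 \/ (size s + size L <= d + 1 + size Tpos)%N.
Proof.
move=> hP hQ HL; set u := ap H P Q.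
have hu : u \is d.-homog by rewrite /u /ap rpredD // rpredZ.
have [->|u0] := eqVneq u 0; first by exists 0; [rewrite /res rmorph0 mulr0|left].
have [s sE] : exists s, res u = B * s.
  have : (B %| res u)%R.
    apply: prodXsub_dvd; first exact: undup_uniq.
    move=> t tT; pose r := [seq lam <- Lf | posn lam == t].
    have ur : uniq r by rewrite !filter_uniq.
    have rL : {subset r <= L} by move=> lam; rewrite !mem_filter => /and3P[].
    have rD lam : lam \in r -> Dh lam != 0 /\ posn lam = t.
      by rewrite !mem_filter => /and3P[/eqP pt D0 lL]; split.
    have [q ->] := slope ur rL rD (fun lam lr => HL lam (rL lam lr)).
    exact: dvdp_mulIl.
  by move=> /dvdpP[s sE]; exists s; rewrite sE mulrC.
exists s => //; have [->|s0] := eqVneq s 0; [by left|right].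
pose Pi : S := \prod_(lam <- Lp) linform lam ^+ 1.
have LpL lam : lam \in Lp -> lam \in L by rewrite mem_filter => /andP[].
have [G uE] : mdivides Pi u.
  apply: (linform_prod_dvd (e := fun=> 1%N)) => [|lam].
    split=> [||l1 l2 h1 h2]; first exact: filter_uniq.
      by apply/negP => /LpL /lam0; rewrite eqxx.
    by apply: npL; apply: LpL.
  rewrite mem_filter => /andP[/eqP D0 lL]; rewrite expr1.
  have [_ A0] := par_neq lL D0; have := HL _ lL; rewrite apE D0 scale0r addr0 -/u => d1'.
  by have := mdvdZ (An lam)^-1 d1'; rewrite scalerA mulVf // scale1r.
have G0 : G != 0 by apply: contraNneq u0 => G0; rewrite uE G0 mulr0.
have Pi0 : Pi != 0 by apply: contraNneq u0 => P0; rewrite uE P0 mul0r.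
have hPi : Pi \is (size Lp).-homog.
  rewrite /Pi; elim: (Lp) => [|lam r IHr]; first by rewrite big_nil dhomog1.
  by rewrite big_cons expr1; exact: dhomogM (dhomog_linform lam) IHr.
have hs n (r : S) : r \is n.-homog -> r != 0 -> msize r = n.+1.
  by move=> /dhomogP hr r0; rewrite -(mlead_deg r0) (hr _ (mlead_supp r0)).
have szG : (msize G + size Lp = d.+1)%N.
  have := hs _ _ hu u0; rewrite uE msizeM // (hs _ _ hPi Pi0).
  by move: (mmeasure _ G); clear; lia.
have [ka ka0 kaE] : exists2 ka : R, ka != 0 & res Pi = ka%:P.
  exists (\prod_(lam <- Lp) (lam 0 o0 + k * An lam)).
    rewrite prodf_seq_neq0; apply/allP => lam /=; rewrite mem_filter => /andP[/eqP D0 lL].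
    by have [] := par_neq lL D0.
  rewrite /res /Pi rmorph_prod (rmorph_prod (@polyC R)) big_seq [RHS]big_seq; apply: eq_bigr => lam.
  by rewrite mem_filter => /andP[/eqP D0 _]; rewrite expr1 -[LHS]/(res _) res_lam D0 scale0r addr0.
have : (size (res u) <= d.+1 - size Lp)%N.
  rewrite uE /res rmorphM /= -/(res Pi) kaE mul_polyC (leq_trans (size_scale_leq _ _)) //.
  by apply: leq_trans (size_linep _ _ _) _; rewrite -szG addnK.
rewrite sE size_mul //; have := size_B; have := size_LfLp; have : (0 < size s)%N by rewrite size_poly_gt0.
have : (0 < size B)%N by rewrite size_poly_gt0.
have := szG; move: (size B) (size s) (size Tpos) (size Lf) (size Lp) (size L) (mmeasure _ G); clear; lia.
Qed.

Let ext da db P1 Q1 P2 Q2 c : P1 \is da.-homog -> Q1 \is da.-homog -> P2 \is db.-homog -> Q2 \is db.-homog ->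
  (forall lam, lam \in L -> mdivides (linform lam) (ap lam P1 Q1) /\
                           mdivides (linform lam) (ap lam P2 Q2)) ->
  c != 0 -> P1 * Q2 - P2 * Q1 = c%:MP * \prod_(lam <- L) linform lam ->
  res (ap H P1 Q1) = 0 -> Free2 (H :: L) da db.+1.
Proof.
move=> hP1 hQ1 hP2 hQ2 HL c0 dE r0; exists P1, Q1, (linform H * P2), (linform H * Q2).
have apM lam : ap lam (linform H * P2) (linform H * Q2) = linform H * ap lam P2 Q2.
  by rewrite /ap mulrDr -!scalerAr.
split=> //.
- by split; [exact: dhomogM (dhomog_linform H) hP2|exact: dhomogM (dhomog_linform H) hQ2].
- move=> lam; rewrite inE => /orP[/eqP ->|/HL[d1' d2']]; rewrite apM.
    split; last by apply: mdvdMr; apply: mdvdr.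
    by apply: (@res0 da) => //; rewrite /ap rpredD // rpredZ.
  by split=> //; apply: mdvdMl.
- exists c => //; rewrite big_cons.
  have -> : P1 * (linform H * Q2) - linform H * P2 * Q1 = linform H * (P1 * Q2 - P2 * Q1) by ring.
  by rewrite dE; ring.
Qed.

(** Restricted to [H], the values of both basis elements at [H] share the factor [B]. The quotients
    [s1] and [s2], when nonzero, have sizes at most [1 + size Tpos - d2] and [1 + size Tpos - d1].
    Once one combination is made to vanish on [H], multiplying the other element by [linform H]
    gives the new basis. *)
Theorem add_line : Free2 L d1 d2 ->
  (size Tpos = d1 -> Free2 (H :: L) d1 d2.+1) /\ (size Tpos = d2 -> Free2 (H :: L) d1.+1 d2).
Proof.
move=> [P1 [Q1 [P2 [Q2 [[hP1 hQ1] [hP2 hQ2] HL [c c0 dE]]]]]].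
have [s1 u1E s1P] := factor hP1 hQ1 (fun lam lL => (HL lam lL).1).
have [s2 u2E s2P] := factor hP2 hQ2 (fun lam lL => (HL lam lL).2).
have ext1 : s1 = 0 -> Free2 (H :: L) d1 d2.+1.
  by move=> z; apply: (ext hP1 hQ1 hP2 hQ2 HL c0 dE); rewrite u1E z mulr0.
have sub2 (sig : S) : sig \is (d2 - d1).-homog -> res sig * s1 = s2 -> Free2 (H :: L) d2 d1.+1.
  move=> hs rs_; pose P3 := P2 - sig * P1; pose Q3 := Q2 - sig * Q1.
  have hP3 : P3 \is d2.-homog.
    by rewrite /P3 rpredB // -[d2](subnK d12); apply: dhomogM.
  have hQ3 : Q3 \is d2.-homog.
    by rewrite /Q3 rpredB // -[d2](subnK d12); apply: dhomogM.
  have ap3 lam : ap lam P3 Q3 = ap lam P2 Q2 - sig * ap lam P1 Q1.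
    by rewrite /ap /P3 /Q3 -!mul_mpolyC; ring.
  apply: (ext (c := - c) hP3 hQ3 hP1 hQ1); rewrite ?oppr_eq0 //.
  - by move=> lam lL; have [e1 e2] := HL _ lL; split=> //; rewrite ap3; apply: mdvdB => //; apply: mdvdMl.
  - rewrite mpolyCN mulNr -dE /P3 /Q3; ring.
  - rewrite ap3 /res rmorphB rmorphM /= -!/(res _) u1E u2E -rs_; ring.
have cst (s : {poly R}) : (size s <= 1)%N -> exists a, s = a%:P by move=> /size1_polyC ->; eexists.
split=> Td.
  have [/ext1 //|s10] := eqVneq s1 0.
  case: s1P => [z|]; first by rewrite z eqxx in s10.
  rewrite sL Td => sz1; have sp : (0 < size s1)%N by rewrite size_poly_gt0.
  have d21 : d1 = d2 by move: sz1 sp d12; move: (size s1); clear; lia.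
  have [|a1 a1E] := cst s1; first by move: sz1; rewrite -d21; move: (size s1); clear; lia.
  have [|a2 a2E] := cst s2.
    case: s2P => [->|]; first by rewrite size_poly0.
    by rewrite sL Td -d21; move: (size s2); clear; lia.
  have a10 : a1 != 0 by move: s10; rewrite a1E polyC_eq0.
  rewrite -d21 {1}d21; apply: (sub2 (a2 / a1)%:MP).
    by rewrite d21 subnn -alg_mpolyC; apply: rpredZ; apply: dhomog1.
  by rewrite /res linepC a1E a2E -polyCM divfK.
have [z1|s10] := eqVneq s1 0; last first.
  case: s1P => [z|]; first by rewrite z eqxx in s10.
  rewrite sL Td => sz1.
  have [|a1 a1E] := cst s1; first by move: sz1; move: (size s1); clear; lia.
  have a10 : a1 != 0 by move: s10; rewrite a1E polyC_eq0.
  pose e := (d2 - d1)%N.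
  have s2e : (size s2 <= e.+1)%N.
    case: s2P => [->|]; first by rewrite size_poly0.
    by rewrite sL Td /e; move: d12 (size s2); clear; lia.
  pose X0 := linform (row3 1 0 0); pose ps := linform (row3 0 (- n2) n1).
  (* The homogenization of [s2 / a1]: on [H] the form [X0] restricts to [1] and [ps] to the
     parameter. *)
  pose sig : S := \sum_(i < e.+1) (s2`_i / a1) *: (X0 ^+ (e - i) * ps ^+ i).
  apply: Free2C; apply: (sub2 sig).
    have hX (w : 'rV[R]_3) n : linform w ^+ n \is n.-homog.
      by have := dhomogMn n (dhomog_linform w); rewrite mul1n.
    apply: rpred_sum => i _; apply: rpredZ.
    have := dhomogM (hX (row3 1 0 0) (e - i)%N) (hX (row3 0 (- n2) n1) i).
    by rewrite subnK // -ltnS.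
  have rX0 : res X0 = 1.
    rewrite /X0 res_lam /An /Dh !row3E.
    have -> : 1 + k * (0 * n1 + 0 * n2) = 1 by ring.
    by rewrite mulr0 mul0r subrr scale0r addr0.
  have rps : res ps = 'X.
    rewrite /ps res_lam /An /Dh !row3E.
    have -> : 0 + k * (- n2 * n1 + n1 * n2) = 0 by ring.
    have -> : x * n1 - - n2 * y = 1 by rewrite -bez; ring.
    by rewrite scale1r add0r.
  have rE (i : nat) z : res (z *: (X0 ^+ (e - i) * ps ^+ i)) = z *: 'X^i.
    by rewrite /res linepZ rmorphM !rmorphXn /= -!/(res _) rX0 rps expr1n mul1r.
  rewrite /sig /res rmorph_sum a1E mulr_suml.
  transitivity (\poly_(i < e.+1) s2`_i); last first.
    by apply/polyP => i; rewrite coef_poly; case: ltnP => // ei; rewrite nth_default // (leq_trans s2e).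
  rewrite poly_def; apply: eq_bigr => i _; rewrite -[X in X * _]/(res _) rE.
  by rewrite mulrC mul_polyC scalerA mulrC divfK.
have [d21|nd] := eqVneq d1 d2; first by apply: Free2C; have := ext1 z1; rewrite -d21.
have lt12 : (d1 < d2)%N by rewrite ltn_neqAle nd.
have u10 : res (ap H P1 Q1) = 0 by rewrite u1E z1 mulr0.
pose v1 := - n2 *: P1 + n1 *: Q1.
have hv : v1 \is d1.-homog by rewrite /v1 rpredD // rpredZ.
(* If [s1 = 0] and [d1 < d2], the transversal component [v1] vanishes at the [d2] intersection
   points although its degree is [d1]. Then [H] would divide both components of the first element,
   hence the determinant, which is a product of forms not proportional to [H]. *)
have v10 : res v1 = 0.
  apply/eqP/negPn/negP => v0; have := @max_poly_roots _ (res v1) Tpos v0.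
  rewrite undup_uniq Td => /(_ _ isT) N.
  have : (d2 < size (res v1))%N.
    apply: N; apply/allP => t; rewrite mem_undup => /mapP[lam].
    rewrite mem_filter => /andP[D0 lL] tE; apply/rootP.
    have [q] := (HL _ lL).1; move/(congr1 res); rewrite /res rmorphM /= -!/(res _) res_lam.
    rewrite apE -/v1 /res rmorphD /= !linepZ -!/(res _) u10 scaler0 add0r.
    move/(congr1 (horner^~ t)); rewrite hornerZ hornerM !hornerE tE /posn mulrC.
    rewrite [Dh lam * _]mulrC divfK // addrC.
    have -> : lam 0 o0 + k * An lam + (- (k * An lam) - lam 0 o0) = 0 by ring.
    by rewrite mul0r => /eqP; rewrite mulf_eq0 (negPf D0) orbF => /eqP.
  by have := res_size hv; move: lt12; move: (size _); clear; lia.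
have hu1 : ap H P1 Q1 \is d1.-homog by rewrite /ap rpredD // rpredZ.
have du := res0 hu1 u10; have dv := res0 hv v10.
have P1E : P1 = n1 *: ap H P1 Q1 - y *: v1.
  rewrite /ap /H /v1 !row3E -!mul_mpolyC -[LHS]mul1r -mpolyC1 -bez !(mpolyCD, mpolyCM, mpolyCN); ring.
have Q1E : Q1 = n2 *: ap H P1 Q1 + x *: v1.
  rewrite /ap /H /v1 !row3E -!mul_mpolyC -[LHS]mul1r -mpolyC1 -bez !(mpolyCD, mpolyCM, mpolyCN); ring.
have dP : mdivides (linform H) P1 by rewrite P1E; apply: mdvdB; apply: mdvdZ.
have dQ : mdivides (linform H) Q1 by rewrite Q1E; apply: mdvdD; apply: mdvdZ.
have : mdivides (linform H) (c%:MP * \prod_(lam <- L) linform lam).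
  by rewrite -dE; apply: mdvdB; [apply: mdvdMr|apply: mdvdMl].
case/(linform_prime H0) => [[q /(congr1 (meval ((0 : 'rV[R]_3) 0)))]|].
  by rewrite mevalC mevalM ev_linform dotv0r mul0r => /eqP; rewrite (negPf c0).
move=> d3; exfalso; move: d3; apply: linform_ndvd_prod => // lam lL.
by apply: linform_ndvd_linform; apply: npH.
Qed.

End AffineLines.

(** * Arrangements of integer translates of the rank two roots *)

Section IntegerLines.
Local Notation line := ((nat * nat) * int)%type.
Implicit Types (r : nat * nat) (c : seq ((nat * nat) * (nat * nat))).

Definition vec (x : line) : 'rV[R]_3 := row3 (- x.2%:~R) x.1.1%:R x.1.2%:R.

(* The entry [(r, (a, b))] stands for the lines of direction [r] and heights [1 - m - a, ..., m + b]. *)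
Definition lines c (m : nat) : seq line :=
  flatten [seq [seq (e.1, 1 - m%:Z - e.2.1%:Z + i%:Z) | i <- iota 0 (2 * m + e.2.1 + e.2.2)%N] | e <- c].

Definition arr c m := map vec (lines c m).

Lemma mem_lines c m r k : ((r, k) \in lines c m) =
  has (fun e => [&& e.1 == r, 1 - m%:Z - e.2.1%:Z <= k & k <= m%:Z + e.2.2%:Z]) c.
Proof.
elim: c => //= e c IHc; rewrite /lines /= mem_cat -/(lines c m) IHc; congr (_ || _).
apply/mapP/and3P => [[j]|[/eqP <- h1 h2]].
  by rewrite mem_iota => hi [-> ->]; split; rewrite ?eqxx //; lia.
exists `|(k - (1 - m%:Z - e.2.1%:Z))%R|%N; first by rewrite mem_iota; lia.
by congr (_, _); lia.
Qed.

Lemma lines_uniq c m : uniq (map fst c) -> uniq (lines c m).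
Proof.
elim: c => //= e c IHc /andP[ec uc]; rewrite /lines /= cat_uniq -/(lines c m) IHc // andbT.
rewrite map_inj_uniq ?iota_uniq /= => [|i j [] /addrI[]//].
apply/hasPn => -[r k]; rewrite mem_lines => /hasP[e' e'c /and3P[/eqP e'r _ _]].
by apply/mapP => -[i _ [rE _]]; case/negP: ec; rewrite -rE -e'r map_f.
Qed.

Lemma size_lines c m : size (lines c m) = sumn [seq (2 * m + e.2.1 + e.2.2)%N | e <- c].
Proof. by elim: c => //= e c IHc; rewrite /lines /= size_cat size_map size_iota -/(lines c m) IHc. Qed.

Lemma perm_arr c c' m : perm_eq c c' -> perm_eq (arr c m) (arr c' m).
Proof. by move=> cc; apply/perm_map/perm_flatten/perm_map. Qed.

Definition dets (r r' : nat * nat) : int := r.1%:Z * r'.2%:Z - r'.1%:Z * r.2%:Z.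

(** Bounds the denominators of the intersection points on any line of the arrangement, so that their
    positions are integers after multiplication by six. *)
Lemma dets_dvd6 r r' : r \in rk2c 3 -> r' \in rk2c 3 -> r != r' -> exists2 q : int, q * dets r r' = 6 & q != 0.
Proof.
rewrite !inE => /or4P[||| /or3P[||]] /eqP -> /or4P[||| /or3P[||]] /eqP -> // _.
all: try by exists 6.
all: try by exists (- 6).
all: try by exists 3.
all: try by exists (- 3).
all: try by exists 2.
all: by exists (- 2).
Qed.

Lemma vec_nprop (A : seq line) : uniq A -> {subset map fst A <= rk2c 3} -> nprop (map vec A).
Proof.
move=> uA sA; have vE x : ((vec x 0 o0 = - x.2%:~R) * (vec x 0 o1 = x.1.1%:R) * (vec x 0 o2 = x.1.2%:R))%type.
  by rewrite /vec !row3E.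
have key x y (cc : R) : x \in A -> y \in A -> vec y = cc *: vec x -> x = y.
  move=> xA yA E; have := congr1 (fun v : 'rV[R]_3 => v 0 o0) E; have := congr1 (fun v : 'rV[R]_3 => v 0 o1) E.
  have := congr1 (fun v : 'rV[R]_3 => v 0 o2) E; rewrite [RHS]mxE !vE => e2; rewrite [RHS]mxE !vE => e1.
  rewrite [RHS]mxE !vE => e0; have xR := sA _ (map_f fst xA); have yR := sA _ (map_f fst yA).
  have xy : x.1 = y.1.
    apply/eqP/negPn/negP => xy; have [q qD _] := dets_dvd6 xR yR xy.
    have D0 : dets x.1 y.1 = 0.
      apply/eqP; rewrite -(intr_eq0 R) /dets rmorphB !rmorphM /= -!pmulrn e1 e2; apply/eqP; ring.
    by move: qD; rewrite D0 mulr0.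
  suff c1 : cc = 1.
    move: e0; rewrite c1 mul1r => /oppr_inj /eqP; rewrite eqr_int => /eqP k12.
    by case: x y xy k12 {E e1 e2 xA yA xR yR} => r1 k1 [r2 k2] /= -> ->.
  move: e1 e2 xR; rewrite -xy; case: (x.1) => -[|a1] a2 /= e1 e2 aR.
    by case: a2 aR e1 e2 => // a2 _ _ e2; apply: (@mulIf _ a2.+1%:R); rewrite ?mul1r ?pnatr_eq0.
  by apply: (@mulIf _ a1.+1%:R); rewrite ?mul1r ?pnatr_eq0.
split.
- rewrite map_inj_in_uniq // => x y xA yA E; apply: (key x y 1) => //; by rewrite scale1r.
- apply/mapP => -[x xA /esym x0]; have := sA _ (map_f fst xA).
  have := congr1 (fun v : 'rV[R]_3 => v 0 o1) x0; have := congr1 (fun v : 'rV[R]_3 => v 0 o2) x0.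
  rewrite !vE !mxE; case: (x.1) => -[|a1] a2 /= /eqP h2 /eqP h1 aR.
    by case: a2 aR h2 => // a2 _; rewrite pnatr_eq0.
  by rewrite pnatr_eq0 in h1.
- move=> _ _ /mapP[x xA ->] /mapP[y yA ->] xy cc; apply: contraNneq xy => E.
  by rewrite (key x y cc).
Qed.

Definition pieces (ps : seq (nat * (int * int) * (nat * nat))) (m : nat) : seq int :=
  flatten [seq [seq 6 * (p.1.2.1 * m%:Z + p.1.2.2 + i%:Z) + p.1.1%:Z | i <- iota 0 (p.2.1 * m + p.2.2)%N] | p <- ps].

Lemma mem_pieces ps m t : (t \in pieces ps m) = has (fun p =>
  [&& (6 %| t - p.1.1%:Z)%Z, 6 * (p.1.2.1 * m%:Z + p.1.2.2) + p.1.1%:Z <= t &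
      t < 6 * (p.1.2.1 * m%:Z + p.1.2.2 + (p.2.1 * m + p.2.2)%N%:Z) + p.1.1%:Z]) ps.
Proof.
elim: ps => //= p ps IHps; rewrite /pieces /= mem_cat -/(pieces ps m) IHps; congr (_ || _).
move: (p.1.2.1 * m%:Z + p.1.2.2) (p.2.1 * m + p.2.2)%N (p.1.1) => u n s.
apply/mapP/and3P => [[j]|[/dvdzP[q qE] h1 h2]].
  rewrite mem_iota => hi ->; split; [|lia|lia].
  by rewrite addrK dvdz_mulr.
by exists `|(q - u)%R|%N; [rewrite mem_iota; lia|lia].
Qed.

Lemma size_pieces ps m : size (pieces ps m) = sumn [seq (p.2.1 * m + p.2.2)%N | p <- ps].
Proof. by elim: ps => //= e c IHc; rewrite /pieces /= size_cat size_map size_iota -/(pieces c m) IHc. Qed.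

Lemma pieces_uniq ps m : uniq [seq p.1.1 | p <- ps] -> all (fun p => p.1.1 < 6)%N ps -> uniq (pieces ps m).
Proof.
elim: ps => //= p ps IHps /andP[pps ups] /andP[p6 ps6].
rewrite /pieces /= cat_uniq -/(pieces ps m) IHps // andbT.
rewrite map_inj_uniq ?iota_uniq /= => [|i j]; last by lia.
apply/hasPn => t; rewrite mem_pieces => /hasP[q qps /and3P[/dvdzP[z zE] _ _]].
apply/mapP => -[i _ tE]; case/negP: pps; have q6 := allP ps6 _ qps.
suff -> : p.1.1 = q.1.1 by apply: (map_f (fun p => p.1.1)).
by move: zE tE p6 q6; move: (_ + i%:Z) (p.1.1) (q.1.1) => u a b; lia.
Qed.

Section Step.
Variables (r0 : nat * nat) (k0 n1 n2 : int) (ab0 ab1 : nat * nat).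
Variables (c : seq ((nat * nat) * (nat * nat))) (ps : seq (nat * (int * int) * (nat * nat))) (m d1 d2 : nat).
Hypothesis bez : r0.1%:Z * n1 + r0.2%:Z * n2 = 1.
Hypotheses (sc : all (mem (rk2c 3)) (r0 :: map fst c)) (uc : uniq (r0 :: map fst c)).
Hypothesis pm : perm_eq (lines ((r0, ab1) :: c) m) ((r0, k0) :: lines ((r0, ab0) :: c) m).
Hypotheses (d12 : (d1 <= d2)%N) (sz : size (lines ((r0, ab0) :: c) m) = (d1 + d2)%N).
Hypotheses (ups : uniq [seq p.1.1 | p <- ps]) (aps : all (fun p => p.1.1 < 6)%N ps).
(* Positions on the new line are measured in sixths. *)
Hypothesis mps : forall t : int, (t \in pieces ps m) = has (fun e => let D := dets r0 e.1 in
   let z := k0 * (e.1.1%:Z * n1 + e.1.2%:Z * n2) in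
   [&& (6 %| t * D)%Z, 6 * (1 - m%:Z - e.2.1%:Z - z) <= t * D & t * D <= 6 * (m%:Z + e.2.2%:Z - z)]) c.

(** The integers listed in [pieces ps m] are six times the parameters of the intersection points, so
    their number is the one needed by [add_line]. *)
Lemma line_step : Free2 (arr ((r0, ab0) :: c) m) d1 d2 ->
  (size (pieces ps m) = d1 -> Free2 (arr ((r0, ab1) :: c) m) d1 d2.+1) /\
  (size (pieces ps m) = d2 -> Free2 (arr ((r0, ab1) :: c) m) d1.+1 d2).
Proof.
set A := lines ((r0, ab0) :: c) m; set x := r0.1%:R : R; set y := r0.2%:R : R.
have uA : uniq ((r0, k0) :: A) by rewrite -(perm_uniq pm); apply: lines_uniq.
have sA : {subset map fst ((r0, k0) :: A) <= rk2c 3}.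
  move=> r /mapP[[r' k']]; rewrite -(perm_mem pm) mem_lines => /hasP[e ec /and3P[/eqP er _ _]] ->.
  by rewrite /= -er; apply: (allP sc); rewrite -[r0 :: _]/(map fst ((r0, ab1) :: c)) map_f.
have nA := vec_nprop uA sA; have pmv := perm_map vec pm.
have bezR : x * n1%:~R + y * n2%:~R = 1.
  by have := congr1 (fun z : int => z%:~R : R) bez; rewrite rmorphD !rmorphM /= -!pmulrn.
have D0 r : r \in rk2c 3 -> (Dh x y (vec (r, k0)) == 0) = (r == r0).
  move=> rR; have r0R : r0 \in rk2c 3 by case/andP: sc.
  have -> : Dh x y (vec (r, k0)) = (dets r0 r)%:~R.
    by rewrite /Dh /vec !row3E /dets rmorphB !rmorphM /= -!pmulrn /x /y; ring.
  rewrite intr_eq0; apply/eqP/eqP => [z|->]; last by rewrite /dets; ring.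
  apply/eqP/negPn/negP => rr; have [|q] := @dets_dvd6 r0 r r0R rR; first by rewrite eq_sym.
  by rewrite z mulr0.
have Dk r k : Dh x y (vec (r, k)) = (dets r0 r)%:~R.
  by rewrite /Dh /vec !row3E /dets rmorphB !rmorphM /= -!pmulrn /x /y; ring.
have sT : size (Tpos (map vec A) x y k0%:~R n1%:~R n2%:~R) = size (pieces ps m).
  rewrite -(size_map (fun t : int => t%:~R / 6 : R)); apply: perm_size; apply: uniq_perm.
  - exact: undup_uniq.
  - rewrite map_inj_uniq ?pieces_uniq // => t t' /(mulIf _) E.
    by apply/eqP; rewrite -(eqr_int R); apply/eqP; apply: E; rewrite invr_eq0 pnatr_eq0.
  move=> s; rewrite mem_undup; apply/mapP/mapP => [[lam]|[t tP ->]].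
    rewrite mem_filter => /andP[lD /mapP[[r k] rk lE]] ->; rewrite {}lE in lD *.
    have rR : r \in rk2c 3 by apply: sA; apply/mapP; exists (r, k); rewrite // inE rk orbT.
    have rr0 : r0 != r by rewrite eq_sym; move: lD; rewrite Dk -(Dk r k0) D0.
    have r0R : r0 \in rk2c 3 by case/andP: sc.
    have [q qD q0] := dets_dvd6 r0R rR rr0.
    pose z := k0 * (r.1%:Z * n1 + r.2%:Z * n2).
    exists (q * (k - z)).
      rewrite mps; move: rk; rewrite mem_lines /= (negPf rr0) /=.
      apply: sub_has => e /and3P[/eqP -> h1 h2]; rewrite /= -/z.
      have -> : q * (k - z) * dets r0 r = 6 * (k - z) by rewrite -qD; ring.
      by rewrite dvdz_mulr //= !ler_pM2l // !lerD2r h1.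
    have D1 : (dets r0 r)%:~R != 0 :> R by move: lD; rewrite Dk.
    have qR : q%:~R = 6 / (dets r0 r)%:~R :> R.
      by apply: (mulIf D1); rewrite divfK // -intrM qD.
    have zR : (k - z)%:~R = k%:~R - k0%:~R * (r.1%:R * n1%:~R + r.2%:R * n2%:~R) :> R.
      by rewrite /z rmorphB rmorphM rmorphD !rmorphM /= -!pmulrn.
    rewrite /posn Dk [(q * _)%:~R]intrM qR zR /vec !row3E.
    by move: (dets _ _)%:~R D1 => D D1; field; rewrite D1.
  move: tP; rewrite mps => /hasP[e ec /and3P[/dvdzP[w wE]]].
  set z := k0 * _ => h1 h2.
  have er : e.1 != r0 by case/andP: uc => + _; apply: contraNneq => <-; apply: map_f.
  have D1 : (dets r0 e.1)%:~R != 0 :> R.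
    by rewrite -(Dk _ k0) D0 //; apply: (allP sc); rewrite inE map_f ?orbT.
  exists (vec (e.1, w + z)).
    rewrite mem_filter Dk D1 /=; apply: map_f; rewrite mem_lines /=; apply/orP; right.
    apply/hasP; exists e; rewrite // eqxx /=; move: h1 h2; rewrite wE [w * 6]mulrC !ler_pM2l //.
    by rewrite lerBlDr lerBrDr => -> ->.
  have tR : t%:~R = w%:~R * 6 / (dets r0 e.1)%:~R :> R.
    by apply: (mulIf D1); rewrite divfK // -[6]/(6%:~R) -!intrM wE.
  have zR : (w + z)%:~R = w%:~R + k0%:~R * (e.1.1%:R * n1%:~R + e.1.2%:R * n2%:~R) :> R.
    by rewrite /z rmorphD rmorphM rmorphD !rmorphM /= -!pmulrn.
  rewrite /posn Dk tR /vec !row3E /= zR.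
  by move: (dets _ _)%:~R D1 => D D1; field; rewrite D1.
move=> F; have aL (lam : 'rV[R]_3) : lam \in map vec A -> (lam 0 o1 != 0) || (lam 0 o2 != 0).
  move=> /mapP[u uA' ->]; have : u.1 \in rk2c 3.
    by apply: sA; apply/mapP; exists u; rewrite // inE uA' orbT.
  by rewrite /vec !row3E !pnatr_eq0; case: (u.1) => -[|?] [|?].
have sV : size (map vec A) = (d1 + d2)%N by rewrite size_map.
have := add_line bezR nA aL d12 sV F; rewrite sT => -[s1 s2].
by split=> [/s1|/s2]; apply: Free2_perm; rewrite perm_sym.
Qed.

End Step.

Lemma perm_lines_down r0 b c m :
  perm_eq (lines ((r0, (1%N, b)) :: c) m) ((r0, - m%:Z) :: lines ((r0, (0%N, b)) :: c) m).
Proof.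
rewrite /lines /= addn1 addn0 addSn /= -[1%N]addn0 iotaDl -map_comp.
have -> : 1 - m%:Z - (1 + 0)%N%:Z + 0%N%:Z = - m%:Z by lia.
by rewrite (eq_map (g := fun i : nat => (r0, 1 - m%:Z - 0%N%:Z + i%:Z))) // => i /=; congr (_, _); lia.
Qed.

Lemma perm_lines_up r0 a c m :
  perm_eq (lines ((r0, (a, 1%N)) :: c) m) ((r0, m%:Z + 1) :: lines ((r0, (a, 0%N)) :: c) m).
Proof.
rewrite /lines /= addn0 iotaD map_cat /= -catA perm_catCA /=.
set u := flatten _; have -> : (r0, m%:Z + 1) = (r0, 1 - m%:Z - a%:Z + (0 + (2 * m + a))%N%:Z) by congr (_, _); lia.
by [].
Qed.

End IntegerLines.

(** Writing a position as [6 q + s] with [s < 6] removes the divisibility conditions that involve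
    [q]; for each residue a linear statement in [q] and [m] remains. *)
Lemma chain_step r0 (k0 n1 n2 : int) ab0 ab1 c (ps : seq (nat * (int * int) * (nat * nat))) c0 c1 m (d1 d2 e1 e2 : nat) :
  Free2 (arr c0 m) d1 d2 ->
  perm_eq (lines ((r0, ab1) :: c) m) ((r0, k0) :: lines ((r0, ab0) :: c) m) ->
  [&& perm_eq c0 ((r0, ab0) :: c), perm_eq ((r0, ab1) :: c) c1,
      all (mem (rk2c 3)) (r0 :: map fst c), uniq (r0 :: map fst c),
      r0.1%:Z * n1 + r0.2%:Z * n2 == 1,
      uniq [seq p.1.1 | p <- ps] & all (fun p => p.1.1 < 6)%N ps] ->
  (forall (q : int) (s : 'I_6),
    has (fun p => [&& p.1.1 == s :> nat, p.1.2.1 * m%:Z + p.1.2.2 <= q &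
      q < p.1.2.1 * m%:Z + p.1.2.2 + (p.2.1 * m + p.2.2)%N%:Z]) ps =
    has (fun e => let D := dets r0 e.1 in
    let z := k0 * (e.1.1%:Z * n1 + e.1.2%:Z * n2) in
    [&& (6 %| s%:Z * D)%Z, 6 * (1 - m%:Z - e.2.1%:Z - z) <= (6 * q + s%:Z) * D &
        (6 * q + s%:Z) * D <= 6 * (m%:Z + e.2.2%:Z - z)]) c) ->
  let s := sumn [seq (p.2.1 * m + p.2.2)%N | p <- ps] in
  [/\ (d1 <= d2)%N, sumn [seq (2 * m + e.2.1 + e.2.2)%N | e <- (r0, ab0) :: c] = (d1 + d2)%N &
      s = d1 /\ (e1, e2) = (d1, d2.+1) \/ s = d2 /\ (e1, e2) = (d1.+1, d2)] ->
  Free2 (arr c1 m) e1 e2.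
Proof.
move=> F pl /and5P[pc0 pc1 sc uc /and3P[/eqP bez ups aps]] mps s [d12 sz ss].
have {}F := Free2_perm (perm_arr m pc0) F; rewrite -size_lines in sz.
have {}mps : forall t : int, (t \in pieces ps m) = has (fun e => let D := dets r0 e.1 in
   let z := k0 * (e.1.1%:Z * n1 + e.1.2%:Z * n2) in
   [&& (6 %| t * D)%Z, 6 * (1 - m%:Z - e.2.1%:Z - z) <= t * D & t * D <= 6 * (m%:Z + e.2.2%:Z - z)]) c.
  move=> t; have [q [i tE]] : exists (q : int) (i : 'I_6), t = 6 * q + i%:Z.
    have i6 : (`|(t %% 6)%Z| < 6)%N by have := ltz_mod t (isT : 6 != 0 :> int); have := modz_ge0 t (isT : 6 != 0 :> int); lia.
    by exists (t %/ 6)%Z, (Ordinal i6); rewrite /= gez0_abs ?modz_ge0 // mulrC -divz_eq.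
  rewrite mem_pieces tE; have := mps q i.
  rewrite (@eq_in_has _ _ (fun p => [&& (6 %| 6 * q + i%:Z - p.1.1%:Z)%Z,
     6 * (p.1.2.1 * m%:Z + p.1.2.2) + p.1.1%:Z <= 6 * q + i%:Z &
      6 * q + i%:Z < 6 * (p.1.2.1 * m%:Z + p.1.2.2 + (p.2.1 * m + p.2.2)%N%:Z) + p.1.1%:Z])); last first.
    move=> p /(allP aps) p6 /=; have := ltn_ord i; move: (p.1.2.1 * m%:Z + p.1.2.2) (p.2.1 * m + p.2.2)%N (p.1.1) p6 (nat_of_ord i) => u n b b6 j j6.
    have [->|bj] := eqVneq b j; first by rewrite addrK dvdz_mulr //=; lia.
    by rewrite /=; symmetry; apply/negP => /and3P[/dvdzP[w wE] _ _]; lia.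
  move=> ->; apply: eq_has => e /=; congr (_ && _).
  by rewrite mulrDl -mulrA; symmetry; apply: rpredDl; apply: dvdz_mulr.
have [s1 s2] := line_step bez sc uc pl d12 sz ups aps mps F.
apply: (Free2_perm (perm_arr m pc1)); case: ss => -[sE [-> ->]].
  by apply: s1; rewrite size_pieces.
by apply: s2; rewrite size_pieces.
Qed.

(* A step of the chain is given by the direction and height of the new line, a Bezout pair for its
   direction, and its intersection points: an entry [(s, (u, v), (w, z))] stands for the positions
   [q + s / 6] with [u m + v <= q < u m + v + w m + z]. *)
Ltac chain_tac r0 k0 n1 n2 ab0 ab1 c ps m pl := let F := fresh in move=> F;
  apply: (@chain_step r0 k0 n1 n2 ab0 ab1 c ps _ _ m _ _ _ _ F pl);
  [ by [] | by let q := fresh in move=> q [[|[|[|[|[|[|?]]]]]] // ?]; rewrite /= /dets /=; lia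
  | split; [ by lia | by rewrite /=; lia
           | first [ by left; split; [rewrite /=; lia|congr (_, _); lia]
                   | by right; split; [rewrite /=; lia|congr (_, _); lia] ] ] ].

(** * The chains of rank two ideal-Shi arrangements *)

(** In the names of the steps, [dn] adds the line of height [-m] and [up] that of height [m + 1],
    for the root with the given index in [rk2c]; [alt] is the step towards the ideal that consists
    of [b] alone. *)
Lemma chain0_alt m : Free2 (arr
    [:: ((1, 0), (0, 0)); ((0, 1), (0, 0))]%N m) (m * 2 + 0)%N (m * 2 + 0)%N ->
  Free2 (arr
    [:: ((1, 0), (0, 0)); ((0, 1), (1, 0))]%N m) (m * 2 + 0)%N (m * 2 + 1)%N.
Proof.
chain_tac (0, 1)%N (- m%:Z) (0)%Z (1)%Z (0, 0)%N (1, 0)%N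
  [:: ((1, 0), (0, 0))]%N
  [:: (0%N, (-1, 0)%Z, (2, 0)%N)] m
  (perm_lines_down (0, 1)%N 0 [:: ((1, 0), (0, 0))]%N m).
Qed.

Lemma chain0_dn0 m : Free2 (arr
    [:: ((1, 0), (0, 0)); ((0, 1), (0, 0))]%N m) (m * 2 + 0)%N (m * 2 + 0)%N ->
  Free2 (arr
    [:: ((1, 0), (1, 0)); ((0, 1), (0, 0))]%N m) (m * 2 + 0)%N (m * 2 + 1)%N.
Proof.
chain_tac (1, 0)%N (- m%:Z) (1)%Z (0)%Z (0, 0)%N (1, 0)%N
  [:: ((0, 1), (0, 0))]%N
  [:: (0%N, (-1, 1)%Z, (2, 0)%N)] m
  (perm_lines_down (1, 0)%N 0 [:: ((0, 1), (0, 0))]%N m).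
Qed.

Lemma chain0_dn1 m : Free2 (arr
    [:: ((1, 0), (1, 0)); ((0, 1), (0, 0))]%N m) (m * 2 + 0)%N (m * 2 + 1)%N ->
  Free2 (arr
    [:: ((1, 0), (1, 0)); ((0, 1), (1, 0))]%N m) (m * 2 + 1)%N (m * 2 + 1)%N.
Proof.
chain_tac (0, 1)%N (- m%:Z) (0)%Z (1)%Z (0, 0)%N (1, 0)%N
  [:: ((1, 0), (1, 0))]%N
  [:: (0%N, (-1, 0)%Z, (2, 1)%N)] m
  (perm_lines_down (0, 1)%N 0 [:: ((1, 0), (1, 0))]%N m).
Qed.

Lemma chain0_up0 m : Free2 (arr
    [:: ((1, 0), (1, 0)); ((0, 1), (1, 0))]%N m) (m * 2 + 1)%N (m * 2 + 1)%N ->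
  Free2 (arr
    [:: ((1, 0), (1, 1)); ((0, 1), (1, 0))]%N m) (m * 2 + 1)%N (m * 2 + 2)%N.
Proof.
chain_tac (1, 0)%N (m%:Z + 1) (1)%Z (0)%Z (1, 0)%N (1, 1)%N
  [:: ((0, 1), (1, 0))]%N
  [:: (0%N, (-1, 0)%Z, (2, 1)%N)] m
  (perm_lines_up (1, 0)%N 1 [:: ((0, 1), (1, 0))]%N m).
Qed.

Lemma chain0_up1 m : Free2 (arr
    [:: ((1, 0), (1, 1)); ((0, 1), (1, 0))]%N m) (m * 2 + 1)%N (m * 2 + 2)%N ->
  Free2 (arr
    [:: ((1, 0), (1, 1)); ((0, 1), (1, 1))]%N m) (m * 2 + 2)%N (m * 2 + 2)%N.
Proof.
chain_tac (0, 1)%N (m%:Z + 1) (0)%Z (1)%Z (1, 0)%N (1, 1)%N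
  [:: ((1, 0), (1, 1))]%N
  [:: (0%N, (-1, -1)%Z, (2, 2)%N)] m
  (perm_lines_up (0, 1)%N 1 [:: ((1, 0), (1, 1))]%N m).
Qed.

Lemma chain1_alt m : Free2 (arr
    [:: ((1, 0), (0, 0)); ((0, 1), (0, 0)); ((1, 1), (0, 0))]%N m) (m * 3 + 0)%N (m * 3 + 0)%N ->
  Free2 (arr
    [:: ((1, 0), (0, 0)); ((0, 1), (1, 0)); ((1, 1), (0, 0))]%N m) (m * 3 + 0)%N (m * 3 + 1)%N.
Proof.
chain_tac (0, 1)%N (- m%:Z) (0)%Z (1)%Z (0, 0)%N (1, 0)%N
  [:: ((1, 0), (0, 0)); ((1, 1), (0, 0))]%N
  [:: (0%N, (-2, 0)%Z, (3, 0)%N)] m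
  (perm_lines_down (0, 1)%N 0 [:: ((1, 0), (0, 0)); ((1, 1), (0, 0))]%N m).
Qed.

Lemma chain1_dn0 m : Free2 (arr
    [:: ((1, 0), (0, 0)); ((0, 1), (0, 0)); ((1, 1), (0, 0))]%N m) (m * 3 + 0)%N (m * 3 + 0)%N ->
  Free2 (arr
    [:: ((1, 0), (1, 0)); ((0, 1), (0, 0)); ((1, 1), (0, 0))]%N m) (m * 3 + 0)%N (m * 3 + 1)%N.
Proof.
chain_tac (1, 0)%N (- m%:Z) (1)%Z (0)%Z (0, 0)%N (1, 0)%N
  [:: ((0, 1), (0, 0)); ((1, 1), (0, 0))]%N
  [:: (0%N, (-1, 1)%Z, (3, 0)%N)] m
  (perm_lines_down (1, 0)%N 0 [:: ((0, 1), (0, 0)); ((1, 1), (0, 0))]%N m).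
Qed.

Lemma chain1_dn1 m : Free2 (arr
    [:: ((1, 0), (1, 0)); ((0, 1), (0, 0)); ((1, 1), (0, 0))]%N m) (m * 3 + 0)%N (m * 3 + 1)%N ->
  Free2 (arr
    [:: ((1, 0), (1, 0)); ((0, 1), (1, 0)); ((1, 1), (0, 0))]%N m) (m * 3 + 1)%N (m * 3 + 1)%N.
Proof.
chain_tac (0, 1)%N (- m%:Z) (0)%Z (1)%Z (0, 0)%N (1, 0)%N
  [:: ((1, 0), (1, 0)); ((1, 1), (0, 0))]%N
  [:: (0%N, (-2, 0)%Z, (3, 1)%N)] m
  (perm_lines_down (0, 1)%N 0 [:: ((1, 0), (1, 0)); ((1, 1), (0, 0))]%N m).
Qed.

Lemma chain1_dn2 m : Free2 (arr
    [:: ((1, 0), (1, 0)); ((0, 1), (1, 0)); ((1, 1), (0, 0))]%N m) (m * 3 + 1)%N (m * 3 + 1)%N ->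
  Free2 (arr
    [:: ((1, 0), (1, 0)); ((0, 1), (1, 0)); ((1, 1), (1, 0))]%N m) (m * 3 + 1)%N (m * 3 + 2)%N.
Proof.
chain_tac (1, 1)%N (- m%:Z) (1)%Z (0)%Z (0, 0)%N (1, 0)%N
  [:: ((1, 0), (1, 0)); ((0, 1), (1, 0))]%N
  [:: (0%N, (-2, 0)%Z, (3, 1)%N)] m
  (perm_lines_down (1, 1)%N 0 [:: ((1, 0), (1, 0)); ((0, 1), (1, 0))]%N m).
Qed.

Lemma chain1_up0 m : Free2 (arr
    [:: ((1, 0), (1, 0)); ((0, 1), (1, 0)); ((1, 1), (1, 0))]%N m) (m * 3 + 1)%N (m * 3 + 2)%N ->
  Free2 (arr
    [:: ((1, 0), (1, 1)); ((0, 1), (1, 0)); ((1, 1), (1, 0))]%N m) (m * 3 + 2)%N (m * 3 + 2)%N.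
Proof.
chain_tac (1, 0)%N (m%:Z + 1) (1)%Z (0)%Z (1, 0)%N (1, 1)%N
  [:: ((0, 1), (1, 0)); ((1, 1), (1, 0))]%N
  [:: (0%N, (-2, -1)%Z, (3, 2)%N)] m
  (perm_lines_up (1, 0)%N 1 [:: ((0, 1), (1, 0)); ((1, 1), (1, 0))]%N m).
Qed.

Lemma chain1_up2 m : Free2 (arr
    [:: ((1, 0), (1, 1)); ((0, 1), (1, 0)); ((1, 1), (1, 0))]%N m) (m * 3 + 2)%N (m * 3 + 2)%N ->
  Free2 (arr
    [:: ((1, 0), (1, 1)); ((0, 1), (1, 0)); ((1, 1), (1, 1))]%N m) (m * 3 + 2)%N (m * 3 + 3)%N.
Proof.
chain_tac (1, 1)%N (m%:Z + 1) (1)%Z (0)%Z (1, 0)%N (1, 1)%N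
  [:: ((1, 0), (1, 1)); ((0, 1), (1, 0))]%N
  [:: (0%N, (-1, 0)%Z, (3, 2)%N)] m
  (perm_lines_up (1, 1)%N 1 [:: ((1, 0), (1, 1)); ((0, 1), (1, 0))]%N m).
Qed.

Lemma chain1_up1 m : Free2 (arr
    [:: ((1, 0), (1, 1)); ((0, 1), (1, 0)); ((1, 1), (1, 1))]%N m) (m * 3 + 2)%N (m * 3 + 3)%N ->
  Free2 (arr
    [:: ((1, 0), (1, 1)); ((0, 1), (1, 1)); ((1, 1), (1, 1))]%N m) (m * 3 + 3)%N (m * 3 + 3)%N.
Proof.
chain_tac (0, 1)%N (m%:Z + 1) (0)%Z (1)%Z (1, 0)%N (1, 1)%N
  [:: ((1, 0), (1, 1)); ((1, 1), (1, 1))]%N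
  [:: (0%N, (-1, -1)%Z, (3, 3)%N)] m
  (perm_lines_up (0, 1)%N 1 [:: ((1, 0), (1, 1)); ((1, 1), (1, 1))]%N m).
Qed.

Lemma chain2_alt m : Free2 (arr
    [:: ((1, 0), (0, 0)); ((0, 1), (0, 0)); ((1, 1), (0, 0)); ((2, 1), (0, 0))]%N m) (m * 4 + 0)%N (m * 4 + 0)%N ->
  Free2 (arr
    [:: ((1, 0), (0, 0)); ((0, 1), (1, 0)); ((1, 1), (0, 0)); ((2, 1), (0, 0))]%N m) (m * 4 + 0)%N (m * 4 + 1)%N.
Proof.
chain_tac (0, 1)%N (- m%:Z) (0)%Z (1)%Z (0, 0)%N (1, 0)%N
  [:: ((1, 0), (0, 0)); ((1, 1), (0, 0)); ((2, 1), (0, 0))]%N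
  [:: (0%N, (-2, 0)%Z, (3, 0)%N); (3%N, (-1, 0)%Z, (1, 0)%N)] m
  (perm_lines_down (0, 1)%N 0 [:: ((1, 0), (0, 0)); ((1, 1), (0, 0)); ((2, 1), (0, 0))]%N m).
Qed.

Lemma chain2_dn0 m : Free2 (arr
    [:: ((1, 0), (0, 0)); ((0, 1), (0, 0)); ((1, 1), (0, 0)); ((2, 1), (0, 0))]%N m) (m * 4 + 0)%N (m * 4 + 0)%N ->
  Free2 (arr
    [:: ((1, 0), (1, 0)); ((0, 1), (0, 0)); ((1, 1), (0, 0)); ((2, 1), (0, 0))]%N m) (m * 4 + 0)%N (m * 4 + 1)%N.
Proof.
chain_tac (1, 0)%N (- m%:Z) (1)%Z (0)%Z (0, 0)%N (1, 0)%N
  [:: ((0, 1), (0, 0)); ((1, 1), (0, 0)); ((2, 1), (0, 0))]%N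
  [:: (0%N, (-1, 1)%Z, (4, 0)%N)] m
  (perm_lines_down (1, 0)%N 0 [:: ((0, 1), (0, 0)); ((1, 1), (0, 0)); ((2, 1), (0, 0))]%N m).
Qed.

Lemma chain2_dn1 m : Free2 (arr
    [:: ((1, 0), (1, 0)); ((0, 1), (0, 0)); ((1, 1), (0, 0)); ((2, 1), (0, 0))]%N m) (m * 4 + 0)%N (m * 4 + 1)%N ->
  Free2 (arr
    [:: ((1, 0), (1, 0)); ((0, 1), (1, 0)); ((1, 1), (0, 0)); ((2, 1), (0, 0))]%N m) (m * 4 + 1)%N (m * 4 + 1)%N.
Proof.
chain_tac (0, 1)%N (- m%:Z) (0)%Z (1)%Z (0, 0)%N (1, 0)%N
  [:: ((1, 0), (1, 0)); ((1, 1), (0, 0)); ((2, 1), (0, 0))]%N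
  [:: (0%N, (-2, 0)%Z, (3, 1)%N); (3%N, (-1, 0)%Z, (1, 0)%N)] m
  (perm_lines_down (0, 1)%N 0 [:: ((1, 0), (1, 0)); ((1, 1), (0, 0)); ((2, 1), (0, 0))]%N m).
Qed.

Lemma chain2_dn2 m : Free2 (arr
    [:: ((1, 0), (1, 0)); ((0, 1), (1, 0)); ((1, 1), (0, 0)); ((2, 1), (0, 0))]%N m) (m * 4 + 1)%N (m * 4 + 1)%N ->
  Free2 (arr
    [:: ((1, 0), (1, 0)); ((0, 1), (1, 0)); ((1, 1), (1, 0)); ((2, 1), (0, 0))]%N m) (m * 4 + 1)%N (m * 4 + 2)%N.
Proof.
chain_tac (1, 1)%N (- m%:Z) (1)%Z (0)%Z (0, 0)%N (1, 0)%N
  [:: ((1, 0), (1, 0)); ((0, 1), (1, 0)); ((2, 1), (0, 0))]%N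
  [:: (0%N, (-3, 0)%Z, (4, 1)%N)] m
  (perm_lines_down (1, 1)%N 0 [:: ((1, 0), (1, 0)); ((0, 1), (1, 0)); ((2, 1), (0, 0))]%N m).
Qed.

Lemma chain2_dn3 m : Free2 (arr
    [:: ((1, 0), (1, 0)); ((0, 1), (1, 0)); ((1, 1), (1, 0)); ((2, 1), (0, 0))]%N m) (m * 4 + 1)%N (m * 4 + 2)%N ->
  Free2 (arr
    [:: ((1, 0), (1, 0)); ((0, 1), (1, 0)); ((1, 1), (1, 0)); ((2, 1), (1, 0))]%N m) (m * 4 + 1)%N (m * 4 + 3)%N.
Proof.
chain_tac (2, 1)%N (- m%:Z) (0)%Z (1)%Z (0, 0)%N (1, 0)%N
  [:: ((1, 0), (1, 0)); ((0, 1), (1, 0)); ((1, 1), (1, 0))]%N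
  [:: (0%N, (-1, 0)%Z, (3, 1)%N); (3%N, (0, 0)%Z, (1, 0)%N)] m
  (perm_lines_down (2, 1)%N 0 [:: ((1, 0), (1, 0)); ((0, 1), (1, 0)); ((1, 1), (1, 0))]%N m).
Qed.

Lemma chain2_up0 m : Free2 (arr
    [:: ((1, 0), (1, 0)); ((0, 1), (1, 0)); ((1, 1), (1, 0)); ((2, 1), (1, 0))]%N m) (m * 4 + 1)%N (m * 4 + 3)%N ->
  Free2 (arr
    [:: ((1, 0), (1, 1)); ((0, 1), (1, 0)); ((1, 1), (1, 0)); ((2, 1), (1, 0))]%N m) (m * 4 + 2)%N (m * 4 + 3)%N.
Proof.
chain_tac (1, 0)%N (m%:Z + 1) (1)%Z (0)%Z (1, 0)%N (1, 1)%N
  [:: ((0, 1), (1, 0)); ((1, 1), (1, 0)); ((2, 1), (1, 0))]%N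
  [:: (0%N, (-3, -2)%Z, (4, 3)%N)] m
  (perm_lines_up (1, 0)%N 1 [:: ((0, 1), (1, 0)); ((1, 1), (1, 0)); ((2, 1), (1, 0))]%N m).
Qed.

Lemma chain2_up2 m : Free2 (arr
    [:: ((1, 0), (1, 1)); ((0, 1), (1, 0)); ((1, 1), (1, 0)); ((2, 1), (1, 0))]%N m) (m * 4 + 2)%N (m * 4 + 3)%N ->
  Free2 (arr
    [:: ((1, 0), (1, 1)); ((0, 1), (1, 0)); ((1, 1), (1, 1)); ((2, 1), (1, 0))]%N m) (m * 4 + 3)%N (m * 4 + 3)%N.
Proof.
chain_tac (1, 1)%N (m%:Z + 1) (1)%Z (0)%Z (1, 0)%N (1, 1)%N
  [:: ((1, 0), (1, 1)); ((0, 1), (1, 0)); ((2, 1), (1, 0))]%N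
  [:: (0%N, (-1, 0)%Z, (4, 3)%N)] m
  (perm_lines_up (1, 1)%N 1 [:: ((1, 0), (1, 1)); ((0, 1), (1, 0)); ((2, 1), (1, 0))]%N m).
Qed.

Lemma chain2_up3 m : Free2 (arr
    [:: ((1, 0), (1, 1)); ((0, 1), (1, 0)); ((1, 1), (1, 1)); ((2, 1), (1, 0))]%N m) (m * 4 + 3)%N (m * 4 + 3)%N ->
  Free2 (arr
    [:: ((1, 0), (1, 1)); ((0, 1), (1, 0)); ((1, 1), (1, 1)); ((2, 1), (1, 1))]%N m) (m * 4 + 3)%N (m * 4 + 4)%N.
Proof.
chain_tac (2, 1)%N (m%:Z + 1) (0)%Z (1)%Z (1, 0)%N (1, 1)%N
  [:: ((1, 0), (1, 1)); ((0, 1), (1, 0)); ((1, 1), (1, 1))]%N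
  [:: (0%N, (-2, -1)%Z, (3, 2)%N); (3%N, (-1, -1)%Z, (1, 1)%N)] m
  (perm_lines_up (2, 1)%N 1 [:: ((1, 0), (1, 1)); ((0, 1), (1, 0)); ((1, 1), (1, 1))]%N m).
Qed.

Lemma chain2_up1 m : Free2 (arr
    [:: ((1, 0), (1, 1)); ((0, 1), (1, 0)); ((1, 1), (1, 1)); ((2, 1), (1, 1))]%N m) (m * 4 + 3)%N (m * 4 + 4)%N ->
  Free2 (arr
    [:: ((1, 0), (1, 1)); ((0, 1), (1, 1)); ((1, 1), (1, 1)); ((2, 1), (1, 1))]%N m) (m * 4 + 4)%N (m * 4 + 4)%N.
Proof.
chain_tac (0, 1)%N (m%:Z + 1) (0)%Z (1)%Z (1, 0)%N (1, 1)%N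
  [:: ((1, 0), (1, 1)); ((1, 1), (1, 1)); ((2, 1), (1, 1))]%N
  [:: (0%N, (-1, -1)%Z, (3, 3)%N); (3%N, (0, 0)%Z, (1, 1)%N)] m
  (perm_lines_up (0, 1)%N 1 [:: ((1, 0), (1, 1)); ((1, 1), (1, 1)); ((2, 1), (1, 1))]%N m).
Qed.

Lemma chain3_alt m : Free2 (arr
    [:: ((1, 0), (0, 0)); ((0, 1), (0, 0)); ((1, 1), (0, 0)); ((2, 1), (0, 0)); ((3, 1), (0, 0)); ((3, 2), (0, 0))]%N m) (m * 6 + 0)%N (m * 6 + 0)%N ->
  Free2 (arr
    [:: ((1, 0), (0, 0)); ((0, 1), (1, 0)); ((1, 1), (0, 0)); ((2, 1), (0, 0)); ((3, 1), (0, 0)); ((3, 2), (0, 0))]%N m) (m * 6 + 0)%N (m * 6 + 1)%N.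
Proof.
chain_tac (0, 1)%N (- m%:Z) (0)%Z (1)%Z (0, 0)%N (1, 0)%N
  [:: ((1, 0), (0, 0)); ((1, 1), (0, 0)); ((2, 1), (0, 0)); ((3, 1), (0, 0)); ((3, 2), (0, 0))]%N
  [:: (0%N, (-2, 0)%Z, (3, 0)%N); (2%N, (-1, 0)%Z, (1, 0)%N); (3%N, (-1, 0)%Z, (1, 0)%N); (4%N, (-1, 0)%Z, (1, 0)%N)] m
  (perm_lines_down (0, 1)%N 0 [:: ((1, 0), (0, 0)); ((1, 1), (0, 0)); ((2, 1), (0, 0)); ((3, 1), (0, 0)); ((3, 2), (0, 0))]%N m).
Qed.

Lemma chain3_dn0 m : Free2 (arr
    [:: ((1, 0), (0, 0)); ((0, 1), (0, 0)); ((1, 1), (0, 0)); ((2, 1), (0, 0)); ((3, 1), (0, 0)); ((3, 2), (0, 0))]%N m) (m * 6 + 0)%N (m * 6 + 0)%N ->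
  Free2 (arr
    [:: ((1, 0), (1, 0)); ((0, 1), (0, 0)); ((1, 1), (0, 0)); ((2, 1), (0, 0)); ((3, 1), (0, 0)); ((3, 2), (0, 0))]%N m) (m * 6 + 0)%N (m * 6 + 1)%N.
Proof.
chain_tac (1, 0)%N (- m%:Z) (1)%Z (0)%Z (0, 0)%N (1, 0)%N
  [:: ((0, 1), (0, 0)); ((1, 1), (0, 0)); ((2, 1), (0, 0)); ((3, 1), (0, 0)); ((3, 2), (0, 0))]%N
  [:: (0%N, (-1, 1)%Z, (5, 0)%N); (3%N, (1, 0)%Z, (1, 0)%N)] m
  (perm_lines_down (1, 0)%N 0 [:: ((0, 1), (0, 0)); ((1, 1), (0, 0)); ((2, 1), (0, 0)); ((3, 1), (0, 0)); ((3, 2), (0, 0))]%N m).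
Qed.

Lemma chain3_dn1 m : Free2 (arr
    [:: ((1, 0), (1, 0)); ((0, 1), (0, 0)); ((1, 1), (0, 0)); ((2, 1), (0, 0)); ((3, 1), (0, 0)); ((3, 2), (0, 0))]%N m) (m * 6 + 0)%N (m * 6 + 1)%N ->
  Free2 (arr
    [:: ((1, 0), (1, 0)); ((0, 1), (1, 0)); ((1, 1), (0, 0)); ((2, 1), (0, 0)); ((3, 1), (0, 0)); ((3, 2), (0, 0))]%N m) (m * 6 + 1)%N (m * 6 + 1)%N.
Proof.
chain_tac (0, 1)%N (- m%:Z) (0)%Z (1)%Z (0, 0)%N (1, 0)%N
  [:: ((1, 0), (1, 0)); ((1, 1), (0, 0)); ((2, 1), (0, 0)); ((3, 1), (0, 0)); ((3, 2), (0, 0))]%N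
  [:: (0%N, (-2, 0)%Z, (3, 1)%N); (2%N, (-1, 0)%Z, (1, 0)%N); (3%N, (-1, 0)%Z, (1, 0)%N); (4%N, (-1, 0)%Z, (1, 0)%N)] m
  (perm_lines_down (0, 1)%N 0 [:: ((1, 0), (1, 0)); ((1, 1), (0, 0)); ((2, 1), (0, 0)); ((3, 1), (0, 0)); ((3, 2), (0, 0))]%N m).
Qed.

Lemma chain3_dn2 m : Free2 (arr
    [:: ((1, 0), (1, 0)); ((0, 1), (1, 0)); ((1, 1), (0, 0)); ((2, 1), (0, 0)); ((3, 1), (0, 0)); ((3, 2), (0, 0))]%N m) (m * 6 + 1)%N (m * 6 + 1)%N ->
  Free2 (arr
    [:: ((1, 0), (1, 0)); ((0, 1), (1, 0)); ((1, 1), (1, 0)); ((2, 1), (0, 0)); ((3, 1), (0, 0)); ((3, 2), (0, 0))]%N m) (m * 6 + 1)%N (m * 6 + 2)%N.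
Proof.
chain_tac (1, 1)%N (- m%:Z) (1)%Z (0)%Z (0, 0)%N (1, 0)%N
  [:: ((1, 0), (1, 0)); ((0, 1), (1, 0)); ((2, 1), (0, 0)); ((3, 1), (0, 0)); ((3, 2), (0, 0))]%N
  [:: (0%N, (-4, 0)%Z, (5, 1)%N); (3%N, (-2, 0)%Z, (1, 0)%N)] m
  (perm_lines_down (1, 1)%N 0 [:: ((1, 0), (1, 0)); ((0, 1), (1, 0)); ((2, 1), (0, 0)); ((3, 1), (0, 0)); ((3, 2), (0, 0))]%N m).
Qed.

Lemma chain3_dn3 m : Free2 (arr
    [:: ((1, 0), (1, 0)); ((0, 1), (1, 0)); ((1, 1), (1, 0)); ((2, 1), (0, 0)); ((3, 1), (0, 0)); ((3, 2), (0, 0))]%N m) (m * 6 + 1)%N (m * 6 + 2)%N ->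
  Free2 (arr
    [:: ((1, 0), (1, 0)); ((0, 1), (1, 0)); ((1, 1), (1, 0)); ((2, 1), (1, 0)); ((3, 1), (0, 0)); ((3, 2), (0, 0))]%N m) (m * 6 + 1)%N (m * 6 + 3)%N.
Proof.
chain_tac (2, 1)%N (- m%:Z) (0)%Z (1)%Z (0, 0)%N (1, 0)%N
  [:: ((1, 0), (1, 0)); ((0, 1), (1, 0)); ((1, 1), (1, 0)); ((3, 1), (0, 0)); ((3, 2), (0, 0))]%N
  [:: (0%N, (-2, 0)%Z, (5, 1)%N); (3%N, (0, 0)%Z, (1, 0)%N)] m
  (perm_lines_down (2, 1)%N 0 [:: ((1, 0), (1, 0)); ((0, 1), (1, 0)); ((1, 1), (1, 0)); ((3, 1), (0, 0)); ((3, 2), (0, 0))]%N m).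
Qed.

Lemma chain3_dn4 m : Free2 (arr
    [:: ((1, 0), (1, 0)); ((0, 1), (1, 0)); ((1, 1), (1, 0)); ((2, 1), (1, 0)); ((3, 1), (0, 0)); ((3, 2), (0, 0))]%N m) (m * 6 + 1)%N (m * 6 + 3)%N ->
  Free2 (arr
    [:: ((1, 0), (1, 0)); ((0, 1), (1, 0)); ((1, 1), (1, 0)); ((2, 1), (1, 0)); ((3, 1), (1, 0)); ((3, 2), (0, 0))]%N m) (m * 6 + 1)%N (m * 6 + 4)%N.
Proof.
chain_tac (3, 1)%N (- m%:Z) (0)%Z (1)%Z (0, 0)%N (1, 0)%N
  [:: ((1, 0), (1, 0)); ((0, 1), (1, 0)); ((1, 1), (1, 0)); ((2, 1), (1, 0)); ((3, 2), (0, 0))]%N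
  [:: (0%N, (-1, 0)%Z, (3, 1)%N); (2%N, (0, 0)%Z, (1, 0)%N); (3%N, (0, 0)%Z, (1, 0)%N); (4%N, (0, 0)%Z, (1, 0)%N)] m
  (perm_lines_down (3, 1)%N 0 [:: ((1, 0), (1, 0)); ((0, 1), (1, 0)); ((1, 1), (1, 0)); ((2, 1), (1, 0)); ((3, 2), (0, 0))]%N m).
Qed.

Lemma chain3_dn5 m : Free2 (arr
    [:: ((1, 0), (1, 0)); ((0, 1), (1, 0)); ((1, 1), (1, 0)); ((2, 1), (1, 0)); ((3, 1), (1, 0)); ((3, 2), (0, 0))]%N m) (m * 6 + 1)%N (m * 6 + 4)%N ->
  Free2 (arr
    [:: ((1, 0), (1, 0)); ((0, 1), (1, 0)); ((1, 1), (1, 0)); ((2, 1), (1, 0)); ((3, 1), (1, 0)); ((3, 2), (1, 0))]%N m) (m * 6 + 1)%N (m * 6 + 5)%N.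
Proof.
chain_tac (3, 2)%N (- m%:Z) (1)%Z (-1)%Z (0, 0)%N (1, 0)%N
  [:: ((1, 0), (1, 0)); ((0, 1), (1, 0)); ((1, 1), (1, 0)); ((2, 1), (1, 0)); ((3, 1), (1, 0))]%N
  [:: (0%N, (-2, 0)%Z, (3, 1)%N); (2%N, (-1, 0)%Z, (1, 0)%N); (3%N, (-1, 0)%Z, (1, 0)%N); (4%N, (-1, 0)%Z, (1, 0)%N)] m
  (perm_lines_down (3, 2)%N 0 [:: ((1, 0), (1, 0)); ((0, 1), (1, 0)); ((1, 1), (1, 0)); ((2, 1), (1, 0)); ((3, 1), (1, 0))]%N m).
Qed.

Lemma chain3_up0 m : Free2 (arr
    [:: ((1, 0), (1, 0)); ((0, 1), (1, 0)); ((1, 1), (1, 0)); ((2, 1), (1, 0)); ((3, 1), (1, 0)); ((3, 2), (1, 0))]%N m) (m * 6 + 1)%N (m * 6 + 5)%N ->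
  Free2 (arr
    [:: ((1, 0), (1, 1)); ((0, 1), (1, 0)); ((1, 1), (1, 0)); ((2, 1), (1, 0)); ((3, 1), (1, 0)); ((3, 2), (1, 0))]%N m) (m * 6 + 2)%N (m * 6 + 5)%N.
Proof.
chain_tac (1, 0)%N (m%:Z + 1) (1)%Z (0)%Z (1, 0)%N (1, 1)%N
  [:: ((0, 1), (1, 0)); ((1, 1), (1, 0)); ((2, 1), (1, 0)); ((3, 1), (1, 0)); ((3, 2), (1, 0))]%N
  [:: (0%N, (-4, -3)%Z, (5, 4)%N); (3%N, (-2, -2)%Z, (1, 1)%N)] m
  (perm_lines_up (1, 0)%N 1 [:: ((0, 1), (1, 0)); ((1, 1), (1, 0)); ((2, 1), (1, 0)); ((3, 1), (1, 0)); ((3, 2), (1, 0))]%N m).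
Qed.

Lemma chain3_up2 m : Free2 (arr
    [:: ((1, 0), (1, 1)); ((0, 1), (1, 0)); ((1, 1), (1, 0)); ((2, 1), (1, 0)); ((3, 1), (1, 0)); ((3, 2), (1, 0))]%N m) (m * 6 + 2)%N (m * 6 + 5)%N ->
  Free2 (arr
    [:: ((1, 0), (1, 1)); ((0, 1), (1, 0)); ((1, 1), (1, 1)); ((2, 1), (1, 0)); ((3, 1), (1, 0)); ((3, 2), (1, 0))]%N m) (m * 6 + 3)%N (m * 6 + 5)%N.
Proof.
chain_tac (1, 1)%N (m%:Z + 1) (1)%Z (0)%Z (1, 0)%N (1, 1)%N
  [:: ((1, 0), (1, 1)); ((0, 1), (1, 0)); ((2, 1), (1, 0)); ((3, 1), (1, 0)); ((3, 2), (1, 0))]%N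
  [:: (0%N, (-1, 0)%Z, (5, 4)%N); (3%N, (1, 1)%Z, (1, 1)%N)] m
  (perm_lines_up (1, 1)%N 1 [:: ((1, 0), (1, 1)); ((0, 1), (1, 0)); ((2, 1), (1, 0)); ((3, 1), (1, 0)); ((3, 2), (1, 0))]%N m).
Qed.

Lemma chain3_up3 m : Free2 (arr
    [:: ((1, 0), (1, 1)); ((0, 1), (1, 0)); ((1, 1), (1, 1)); ((2, 1), (1, 0)); ((3, 1), (1, 0)); ((3, 2), (1, 0))]%N m) (m * 6 + 3)%N (m * 6 + 5)%N ->
  Free2 (arr
    [:: ((1, 0), (1, 1)); ((0, 1), (1, 0)); ((1, 1), (1, 1)); ((2, 1), (1, 1)); ((3, 1), (1, 0)); ((3, 2), (1, 0))]%N m) (m * 6 + 4)%N (m * 6 + 5)%N.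
Proof.
chain_tac (2, 1)%N (m%:Z + 1) (0)%Z (1)%Z (1, 0)%N (1, 1)%N
  [:: ((1, 0), (1, 1)); ((0, 1), (1, 0)); ((1, 1), (1, 1)); ((3, 1), (1, 0)); ((3, 2), (1, 0))]%N
  [:: (0%N, (-3, -2)%Z, (5, 4)%N); (3%N, (-1, -1)%Z, (1, 1)%N)] m
  (perm_lines_up (2, 1)%N 1 [:: ((1, 0), (1, 1)); ((0, 1), (1, 0)); ((1, 1), (1, 1)); ((3, 1), (1, 0)); ((3, 2), (1, 0))]%N m).
Qed.

Lemma chain3_up4 m : Free2 (arr
    [:: ((1, 0), (1, 1)); ((0, 1), (1, 0)); ((1, 1), (1, 1)); ((2, 1), (1, 1)); ((3, 1), (1, 0)); ((3, 2), (1, 0))]%N m) (m * 6 + 4)%N (m * 6 + 5)%N ->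
  Free2 (arr
    [:: ((1, 0), (1, 1)); ((0, 1), (1, 0)); ((1, 1), (1, 1)); ((2, 1), (1, 1)); ((3, 1), (1, 1)); ((3, 2), (1, 0))]%N m) (m * 6 + 5)%N (m * 6 + 5)%N.
Proof.
chain_tac (3, 1)%N (m%:Z + 1) (0)%Z (1)%Z (1, 0)%N (1, 1)%N
  [:: ((1, 0), (1, 1)); ((0, 1), (1, 0)); ((1, 1), (1, 1)); ((2, 1), (1, 1)); ((3, 2), (1, 0))]%N
  [:: (0%N, (-2, -1)%Z, (3, 2)%N); (2%N, (-1, -1)%Z, (1, 1)%N); (3%N, (-1, -1)%Z, (1, 1)%N); (4%N, (-1, -1)%Z, (1, 1)%N)] m
  (perm_lines_up (3, 1)%N 1 [:: ((1, 0), (1, 1)); ((0, 1), (1, 0)); ((1, 1), (1, 1)); ((2, 1), (1, 1)); ((3, 2), (1, 0))]%N m).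
Qed.

Lemma chain3_up5 m : Free2 (arr
    [:: ((1, 0), (1, 1)); ((0, 1), (1, 0)); ((1, 1), (1, 1)); ((2, 1), (1, 1)); ((3, 1), (1, 1)); ((3, 2), (1, 0))]%N m) (m * 6 + 5)%N (m * 6 + 5)%N ->
  Free2 (arr
    [:: ((1, 0), (1, 1)); ((0, 1), (1, 0)); ((1, 1), (1, 1)); ((2, 1), (1, 1)); ((3, 1), (1, 1)); ((3, 2), (1, 1))]%N m) (m * 6 + 5)%N (m * 6 + 6)%N.
Proof.
chain_tac (3, 2)%N (m%:Z + 1) (1)%Z (-1)%Z (1, 0)%N (1, 1)%N
  [:: ((1, 0), (1, 1)); ((0, 1), (1, 0)); ((1, 1), (1, 1)); ((2, 1), (1, 1)); ((3, 1), (1, 1))]%N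
  [:: (0%N, (-1, 0)%Z, (3, 2)%N); (2%N, (0, 0)%Z, (1, 1)%N); (3%N, (0, 0)%Z, (1, 1)%N); (4%N, (0, 0)%Z, (1, 1)%N)] m
  (perm_lines_up (3, 2)%N 1 [:: ((1, 0), (1, 1)); ((0, 1), (1, 0)); ((1, 1), (1, 1)); ((2, 1), (1, 1)); ((3, 1), (1, 1))]%N m).
Qed.

Lemma chain3_up1 m : Free2 (arr
    [:: ((1, 0), (1, 1)); ((0, 1), (1, 0)); ((1, 1), (1, 1)); ((2, 1), (1, 1)); ((3, 1), (1, 1)); ((3, 2), (1, 1))]%N m) (m * 6 + 5)%N (m * 6 + 6)%N ->
  Free2 (arr
    [:: ((1, 0), (1, 1)); ((0, 1), (1, 1)); ((1, 1), (1, 1)); ((2, 1), (1, 1)); ((3, 1), (1, 1)); ((3, 2), (1, 1))]%N m) (m * 6 + 6)%N (m * 6 + 6)%N.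
Proof.
chain_tac (0, 1)%N (m%:Z + 1) (0)%Z (1)%Z (1, 0)%N (1, 1)%N
  [:: ((1, 0), (1, 1)); ((1, 1), (1, 1)); ((2, 1), (1, 1)); ((3, 1), (1, 1)); ((3, 2), (1, 1))]%N
  [:: (0%N, (-1, -1)%Z, (3, 3)%N); (2%N, (0, 0)%Z, (1, 1)%N); (3%N, (0, 0)%Z, (1, 1)%N); (4%N, (0, 0)%Z, (1, 1)%N)] m
  (perm_lines_up (0, 1)%N 1 [:: ((1, 0), (1, 1)); ((1, 1), (1, 1)); ((2, 1), (1, 1)); ((3, 1), (1, 1)); ((3, 2), (1, 1))]%N m).
Qed.

(** The heights from [-m] to [m + 1] are those of the next value of [m], which closes the induction
    on [m]. *)
Lemma arr_shift (rs : seq (nat * nat)) m :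
  arr [seq (r, (1, 1)%N) | r <- rs] m = arr [seq (r, (0, 0)%N) | r <- rs] m.+1.
Proof.
rewrite /arr; congr map; rewrite /lines -!map_comp; congr flatten; apply: eq_map => r /=.
have -> : (2 * m + 1 + 1 = 2 * m.+1 + 0 + 0)%N by lia.
by apply: eq_map => i; congr (_, _); lia.
Qed.

Lemma Free2_nil : Free2 [::] 0 0.
Proof.
exists 1, 0, 0, 1; split; rewrite ?rpred0 ?dhomog1 //; exists 1; rewrite ?oner_eq0 //.
by rewrite big_nil mpolyC1; ring.
Qed.

(** The lines are added in an order for which each new one meets the earlier ones in a number of
    points equal to an exponent. This order has [b] last among the upper lines. *)
Lemma shi0 m : Free2 (arr [seq (r, (0, 0)%N) | r <- rk2c 0] m) (m * 2 + 0)%N (m * 2 + 0)%N.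
Proof.
elim: m => [|m]; first exact: Free2_nil.
rewrite -arr_shift; have -> : (m.+1 * 2 + 0 = m * 2 + 2)%N by lia.
by move=> /chain0_dn0 /chain0_dn1 /chain0_up0 /chain0_up1.
Qed.

Lemma shi1 m : Free2 (arr [seq (r, (0, 0)%N) | r <- rk2c 1] m) (m * 3 + 0)%N (m * 3 + 0)%N.
Proof.
elim: m => [|m]; first exact: Free2_nil.
rewrite -arr_shift; have -> : (m.+1 * 3 + 0 = m * 3 + 3)%N by lia.
by move=> /chain1_dn0 /chain1_dn1 /chain1_dn2 /chain1_up0 /chain1_up2 /chain1_up1.
Qed.

Lemma shi2 m : Free2 (arr [seq (r, (0, 0)%N) | r <- rk2c 2] m) (m * 4 + 0)%N (m * 4 + 0)%N.
Proof.
elim: m => [|m]; first exact: Free2_nil.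
rewrite -arr_shift; have -> : (m.+1 * 4 + 0 = m * 4 + 4)%N by lia.
by move=> /chain2_dn0 /chain2_dn1 /chain2_dn2 /chain2_dn3 /chain2_up0 /chain2_up2 /chain2_up3 /chain2_up1.
Qed.

Lemma shi3 m : Free2 (arr [seq (r, (0, 0)%N) | r <- rk2c 3] m) (m * 6 + 0)%N (m * 6 + 0)%N.
Proof.
elim: m => [|m]; first exact: Free2_nil.
rewrite -arr_shift; have -> : (m.+1 * 6 + 0 = m * 6 + 6)%N by lia.
by move=> /chain3_dn0 /chain3_dn1 /chain3_dn2 /chain3_dn3 /chain3_dn4 /chain3_dn5 /chain3_up0 /chain3_up2 /chain3_up3 /chain3_up4 /chain3_up5 /chain3_up1.
Qed.

(** Apart from [b] alone, the order ideals are the initial segments of [rk2c p], each of which is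
    reached by a chain from the arrangement without ideal. *)
Theorem rank2_free p m (psi : pred (nat * nat)) : (p <= 3)%N ->
  (forall r r', r \in rk2c p -> r' \in rk2c p -> (r.1 <= r'.1)%N -> (r.2 <= r'.2)%N -> psi r' -> psi r) ->
  exists d1 d2, Free2 (arr [seq (r, (psi r : nat, 0%N)) | r <- rk2c p] m) d1 d2.
Proof.
move=> p3 I.
have I1 : (1 <= p)%N -> psi (1, 1)%N -> psi (1, 0)%N && psi (0, 1)%N.
  by case: p p3 I => [|[|[|[|//]]]] // _ I _ h; rewrite (I (1, 0)%N (1, 1)%N) // (I (0, 1)%N (1, 1)%N).
have I2 : (2 <= p)%N -> psi (2, 1)%N -> psi (1, 1)%N.
  by case: p p3 I {I1} => [|[|[|[|//]]]] // _ I _; apply: I.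
have I3 : (3 <= p)%N -> psi (3, 1)%N -> psi (2, 1)%N.
  by case: p p3 I {I1 I2} => [|[|[|[|//]]]] // _ I _; apply: I.
have I4 : (3 <= p)%N -> psi (3, 2)%N -> psi (3, 1)%N.
  by case: p p3 I {I1 I2 I3} => [|[|[|[|//]]]] // _ I _; apply: I.
(* As Boolean implications the conditions on the ideal compute, so the enumeration of all predicates
   discards those that are not ideals. *)
have {}I1 u : (1 <= p)%N = u -> u ==> psi (1, 1)%N ==> psi (1, 0)%N && psi (0, 1)%N.
  by move=> <-; apply/implyP => /I1 h; apply/implyP.
have {}I2 u : (2 <= p)%N = u -> u ==> psi (2, 1)%N ==> psi (1, 1)%N.
  by move=> <-; apply/implyP => /I2 h; apply/implyP.
have {}I3 u : (3 <= p)%N = u -> u ==> psi (3, 1)%N ==> psi (2, 1)%N.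
  by move=> <-; apply/implyP => /I3 h; apply/implyP.
have {}I4 u : (3 <= p)%N = u -> u ==> psi (3, 2)%N ==> psi (3, 1)%N.
  by move=> <-; apply/implyP => /I4 h; apply/implyP.
move: I1 I2 I3 I4 => /(_ _ erefl) I1 /(_ _ erefl) I2 /(_ _ erefl) I3 /(_ _ erefl) I4.
case: p p3 I I1 I2 I3 I4 => [|[|[|[|//]]]] _ _ /=.
- move: (psi (1, 0)%N) (psi (0, 1)%N) => [] [] //= *;
  first [ exact: (ex_intro _ _ (ex_intro _ _ (shi0 m)))
             | exact: (ex_intro _ _ (ex_intro _ _ (chain0_alt (shi0 m))))
             | exact: (ex_intro _ _ (ex_intro _ _ (chain0_dn0 (shi0 m))))
             | exact: (ex_intro _ _ (ex_intro _ _ (chain0_dn1 (chain0_dn0 (shi0 m))))) ].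
- move: (psi (1, 0)%N) (psi (0, 1)%N) (psi (1, 1)%N) => [] [] [] //= *;
  first [ exact: (ex_intro _ _ (ex_intro _ _ (shi1 m)))
             | exact: (ex_intro _ _ (ex_intro _ _ (chain1_alt (shi1 m))))
             | exact: (ex_intro _ _ (ex_intro _ _ (chain1_dn0 (shi1 m))))
             | exact: (ex_intro _ _ (ex_intro _ _ (chain1_dn1 (chain1_dn0 (shi1 m)))))
             | exact: (ex_intro _ _ (ex_intro _ _ (chain1_dn2 (chain1_dn1 (chain1_dn0 (shi1 m)))))) ].
- move: (psi (1, 0)%N) (psi (0, 1)%N) (psi (1, 1)%N) (psi (2, 1)%N) => [] [] [] [] //= *;
  first [ exact: (ex_intro _ _ (ex_intro _ _ (shi2 m)))
             | exact: (ex_intro _ _ (ex_intro _ _ (chain2_alt (shi2 m))))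
             | exact: (ex_intro _ _ (ex_intro _ _ (chain2_dn0 (shi2 m))))
             | exact: (ex_intro _ _ (ex_intro _ _ (chain2_dn1 (chain2_dn0 (shi2 m)))))
             | exact: (ex_intro _ _ (ex_intro _ _ (chain2_dn2 (chain2_dn1 (chain2_dn0 (shi2 m))))))
             | exact: (ex_intro _ _ (ex_intro _ _ (chain2_dn3 (chain2_dn2 (chain2_dn1 (chain2_dn0 (shi2 m))))))) ].
- move: (psi (1, 0)%N) (psi (0, 1)%N) (psi (1, 1)%N) (psi (2, 1)%N) (psi (3, 1)%N) (psi (3, 2)%N) => [] [] [] [] [] [] //= *;
  first [ exact: (ex_intro _ _ (ex_intro _ _ (shi3 m)))
             | exact: (ex_intro _ _ (ex_intro _ _ (chain3_alt (shi3 m))))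
             | exact: (ex_intro _ _ (ex_intro _ _ (chain3_dn0 (shi3 m))))
             | exact: (ex_intro _ _ (ex_intro _ _ (chain3_dn1 (chain3_dn0 (shi3 m)))))
             | exact: (ex_intro _ _ (ex_intro _ _ (chain3_dn2 (chain3_dn1 (chain3_dn0 (shi3 m))))))
             | exact: (ex_intro _ _ (ex_intro _ _ (chain3_dn3 (chain3_dn2 (chain3_dn1 (chain3_dn0 (shi3 m)))))))
             | exact: (ex_intro _ _ (ex_intro _ _ (chain3_dn4 (chain3_dn3 (chain3_dn2 (chain3_dn1 (chain3_dn0 (shi3 m))))))))
             | exact: (ex_intro _ _ (ex_intro _ _ (chain3_dn5 (chain3_dn4 (chain3_dn3 (chain3_dn2 (chain3_dn1 (chain3_dn0 (shi3 m))))))))) ].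
Qed.

(** * Lifting to the cone *)

Lemma dhomog_msub k n (A : 'M[R]_(k, n)) d (p : {mpoly R[n]}) : p \is d.-homog -> msub A p \is d.-homog.
Proof.
move=> /dhomogP hp; rewrite [p]mpolyE rmorph_sum big_seq; apply: rpred_sum => u up /=.
rewrite msubZ; apply: rpredZ; rewrite -(hp _ up) mpolyXE_id rmorph_prod /= mdegE.
elim: (index_enum _) => [|i r IHr]; first by rewrite !big_nil dhomog1.
rewrite !big_cons; apply: dhomogM => //; rewrite rmorphXn /= msubX.
by have := dhomogMn (u i) (dhomog_linform (row i A^T)); rewrite mul1n.
Qed.

Lemma pihomog_shift k1 k2 (F : {mpoly R[k1]} -> {mpoly R[k2]}) e :
  (forall p q, F (p + q) = F p + F q) -> F 0 = 0 ->
  (forall k p, p \is k.-homog -> F p \is (k + e).-homog) -> forall d p,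
  pihomog mdeg d (F p) = if (e <= d)%N then F (pihomog mdeg (d - e) p) else 0.
Proof.
move=> FD F0 Fh d p; set N := (msize p + d).+1.
have pE := @pihomog_partitionE _ _ mdeg N p (leq_trans (leq_addr _ _) (leqnSn _)).
have hk k : F (pihomog mdeg k p) \is (k + e).-homog by apply: Fh; apply: pihomogP.
rewrite {1}pE (big_morph F FD F0) raddf_sum /=; case: leqP => ed; last first.
  by apply: big1 => k _; apply: (pihomog_ne0 _ (hk k)); lia.
have dN : (d - e < N)%N by rewrite /N; lia.
rewrite (bigD1 (Ordinal dN)) //= pihomog_dE; last by have := hk (d - e)%N; rewrite subnK.
rewrite big1 ?addr0 // => k kd; apply: (pihomog_ne0 _ (hk k)); apply: contraNneq kd => kE.
by apply/eqP/val_inj; rewrite /= -kE addnK.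
Qed.

Lemma pihomogM_homog k e d (p q : {mpoly R[k]}) : q \is e.-homog ->
  pihomog mdeg d (q * p) = if (e <= d)%N then q * pihomog mdeg (d - e) p else 0.
Proof.
move=> hq; apply: (@pihomog_shift k k (fun p => q * p)) => [u v||n u hu].
- exact: mulrDr.
- exact: mulr0.
- by rewrite addnC; apply: dhomogM.
Qed.

Lemma pihomog_msub k n (A : 'M[R]_(k, n)) d (p : {mpoly R[n]}) :
  pihomog mdeg d (msub A p) = msub A (pihomog mdeg d p).
Proof.
rewrite (@pihomog_shift _ _ (msub A) 0) ?subn0 ?rmorph0 // => [u v|j u hu].
  exact: rmorphD.
by rewrite addn0; apply: dhomog_msub.
Qed.

Section ConeRing.
Variable l : nat.
Local Notation S0 := {mpoly R[l]}.
Local Notation S1 := {mpoly R[1 + l]}.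

(** Pullback along [iota_mx] includes the polynomials on [V] in those on the cone; pullback along
    [rho_mx] sets [x0] to zero. *)
Definition iota_mx : 'M[R]_(1 + l, l) := col_mx 0 1%:M.
Definition rho_mx : 'M[R]_(l, 1 + l) := row_mx 0 1%:M.
Local Notation iot := (msub iota_mx).
Local Notation rho := (msub rho_mx).
Definition x0 : S1 := linform (x0_form l).

Lemma mul_iota (v : 'rV[R]_(1 + l)) : v *m iota_mx = rsubmx v.
Proof. by rewrite -{1}[v]hsubmxK mul_row_col mulmx0 add0r mulmx1. Qed.

Lemma mul_rho (v : 'rV[R]_l) : v *m rho_mx = row_mx 0 v.
Proof. by rewrite mul_mx_row mulmx0 mulmx1. Qed.

Lemma rho_iot p : rho (iot p) = p.
Proof. by apply: mpoly_funP => v; rewrite !ev_msub mul_iota mul_rho row_mxKr. Qed.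

Lemma dotv_row_mx (c : 'rV[R]_1) (a : 'rV[R]_l) (v : 'rV[R]_(1 + l)) :
  dotv (row_mx c a) v = c 0 0 * v 0 (lshift l 0) + dotv a (rsubmx v).
Proof.
rewrite /dotv big_split_ord /= big_ord1 row_mxEl; congr (_ + _).
by apply: eq_bigr => i _; rewrite row_mxEr [in RHS]mxE.
Qed.

Lemma dotv_x0 (v : 'rV[R]_(1 + l)) : dotv (x0_form l) v = v 0 (lshift l 0).
Proof. by rewrite dotv_row_mx dotv0l addr0 mxE mul1r. Qed.

Lemma x0_form_neq0 : x0_form l != 0.
Proof.
apply/eqP => /(congr1 (fun v : 'rV[R]_(1 + l) => v 0 (lshift l 0))).
by rewrite /x0_form row_mxEl !mxE => /eqP; rewrite oner_eq0.
Qed.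

Lemma x0_neq0 : x0 != 0. Proof. by rewrite linform_eq0 x0_form_neq0. Qed.

Lemma rho_x0 : rho x0 = 0.
Proof.
apply: mpoly_fun_eq0 => v; rewrite ev_msub ev_linform dotv_x0 mul_rho row_mxEl. by rewrite mxE.
Qed.

Lemma x0_dvd p : rho p = 0 -> mdivides x0 p.
Proof.
move=> p0; apply: linform_dvd; first exact: x0_form_neq0.
move=> v; rewrite dotv_x0 => v0.
have -> : v = rsubmx v *m rho_mx.
  rewrite mul_rho -{1}[v]hsubmxK; congr row_mx; apply/rowP => i; rewrite ord1 !mxE //.
by rewrite -ev_msub p0 meval0.
Qed.

Lemma rho_eq_mod p q : rho p = rho q -> exists s, p = q + x0 * s.
Proof.
move=> E; have [|s sE] := x0_dvd (p := p - q); first by rewrite rmorphB /= E subrr.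
by exists s; rewrite -sE addrC subrK.
Qed.

Lemma cone_formE (a : 'rV[R]_l) (k : int) : linform (cone_form (a, k)) = iot (linform a) - k%:~R *: x0.
Proof.
apply: mpoly_funP => v; rewrite mevalB mevalZ ev_msub !ev_linform dotv_x0 mul_iota.
by rewrite /cone_form dotv_row_mx mxE /=; ring.
Qed.

Lemma rho_cone_form (a : 'rV[R]_l) (k : int) : rho (linform (cone_form (a, k))) = linform a.
Proof. by rewrite cone_formE rmorphB /= msubZ rho_x0 rho_iot scaler0 subr0. Qed.

(** [x0] is prime and does not divide [q], so its powers can be cancelled modulo [q]. *)
Lemma x0_cancel n q w t : rho q != 0 -> x0 ^+ n * w = q * t -> mdivides q w.
Proof.
move=> q0; elim: n t => [|n IHn] t; first by rewrite mul1r => ->; exists t.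
move=> E; have := congr1 (fun z => rho z) E; rewrite /= !rmorphM rmorphXn /= rho_x0 exprS !mul0r.
move/esym/eqP; rewrite mulf_eq0 (negPf q0) /= => /eqP/x0_dvd[t' tE].
apply: (IHn t'); apply: (mulfI x0_neq0); rewrite mulrA -exprS E tE; ring.
Qed.

Variables (m : nat) (Psi : seq 'rV[R]_l).
Local Notation mlt := (mlt m Psi).

(** The heights at which the arrangement has a hyperplane parallel to that of [a]; their number is
    the multiplicity of [a], which is why [La] restricts to [linform a ^+ mlt a]. *)
Definition Kset (a : 'rV[R]_l) : seq int :=
  [seq 1 - m%:Z - (a \in Psi)%:Z + i%:Z | i <- iota 0 (mlt a)].

Definition La (a : 'rV[R]_l) : S1 := \prod_(k <- Kset a) linform (cone_form (a, k)).

Lemma prod_const_seq (A : Type) (s : seq A) (c : S0) : \prod_(i <- s) c = c ^+ size s.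
Proof. by elim: s => [|i s IHs]; rewrite ?big_nil ?expr0 // big_cons IHs exprS. Qed.

Lemma rho_La a : rho (La a) = linform a ^+ mlt a.
Proof.
rewrite /La rmorph_prod (eq_bigr (fun=> linform a)) => [|k _]; last exact: rho_cone_form.
by rewrite prod_const_seq size_map size_iota.
Qed.

Lemma rho_La_neq0 a : a != 0 -> rho (La a) != 0.
Proof. by move=> a0; rewrite rho_La expf_neq0 // linform_eq0. Qed.

Lemma dhomog_La a : La a \is (mlt a).-homog.
Proof.
have -> : mlt a = size (Kset a) by rewrite size_map size_iota.
rewrite /La; elim: (Kset a) => [|k s IHs]; first by rewrite big_nil dhomog1.
by rewrite big_cons; exact: dhomogM (dhomog_linform _) IHs.
Qed.

Lemma cone_form_nprop a : a != 0 -> nprop [seq cone_form (a, k) | k <- Kset a].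
Proof.
move=> a0; have key (k k' : int) (c : R) : cone_form (a, k') = c *: cone_form (a, k) -> k' = k.
  rewrite /cone_form /= scale_row_mx => /eq_row_mx[e1 /eqP].
  rewrite -subr_eq0 -[X in X - _]scale1r -scalerBl scaler_eq0 (negPf a0) orbF subr_eq0 => /eqP c1.
  move/rowP: e1 => /(_ 0); rewrite !mxE -c1 mul1r => /oppr_inj /eqP.
  by rewrite eqr_int => /eqP.
split.
- rewrite map_inj_uniq ?map_inj_uniq ?iota_uniq // => [i j /addrI[]//|k k' E].
  by symmetry; apply: (key k k' 1); rewrite scale1r.
- apply/mapP => -[k _ /esym]; rewrite /cone_form -[0]row_mx0 => /eq_row_mx[_ /=].
  by move/eqP; rewrite (negPf a0).
- move=> _ _ /mapP[k _ ->] /mapP[k' _ ->] kk c; apply: contraNneq kk => /key ->. by [].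
Qed.

Lemma La_dvd a p : a != 0 -> (forall k, k \in Kset a -> mdivides (linform (cone_form (a, k))) p) ->
  mdivides (La a) p.
Proof.
move=> a0 H; have := @linform_prod_dvd _ _ (fun=> 1%N) p (cone_form_nprop a0).
rewrite big_map /La; under eq_bigr do rewrite expr1.
by apply=> w /mapP[k kK ->]; rewrite expr1; apply: H.
Qed.

Lemma dvd_La a k p : k \in Kset a -> mdivides (La a) p -> mdivides (linform (cone_form (a, k))) p.
Proof.
by move=> kK [q ->]; rewrite /La (big_rem k) //= -mulrA; exists (\prod_(y <- seq.rem k (Kset a)) linform (cone_form (a, y)) * q).
Qed.

(** With [n = 1 + l] this evaluates a derivation of the cone whose component along [x0] is zero. *)
Definition dap n (a : 'rV[R]_l) (Th : 'I_l -> {mpoly R[n]}) := \sum_j a 0 j *: Th j.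

Lemma dapD n a (f g : 'I_l -> {mpoly R[n]}) : dap a (fun j => f j + g j) = dap a f + dap a g.
Proof. by rewrite /dap -big_split; apply: eq_bigr => j _; rewrite scalerDr. Qed.

Lemma dapM n a (f : 'I_l -> {mpoly R[n]}) p : dap a (fun j => p * f j) = p * dap a f.
Proof. by rewrite /dap mulr_sumr; apply: eq_bigr => j _; rewrite scalerAr. Qed.

Lemma dapB n a (f g : 'I_l -> {mpoly R[n]}) : dap a (fun j => f j - g j) = dap a f - dap a g.
Proof. by rewrite /dap -sumrB; apply: eq_bigr => j _; rewrite scalerBr. Qed.

Lemma dap_sum n a (I : finType) (F : I -> 'I_l -> {mpoly R[n]}) :
  dap a (fun j => \sum_i F i j) = \sum_i dap a (F i).
Proof.
rewrite /dap; under eq_bigr => j _ do rewrite scaler_sumr.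
by rewrite exchange_big.
Qed.

Lemma dapl n a b x y (f : 'I_l -> {mpoly R[n]}) : dap (x *: a + y *: b) f = x *: dap a f + y *: dap b f.
Proof.
rewrite /dap !scaler_sumr -big_split; apply: eq_bigr => j _ /=.
by rewrite !mxE scalerDl !scalerA.
Qed.

Lemma rho_dap a f : rho (dap a f) = dap a (fun j => rho (f j)).
Proof. by rewrite /dap rmorph_sum; apply: eq_bigr => j _; rewrite /= msubZ. Qed.

Lemma iot_dap a f : iot (dap a f) = dap a (fun j => iot (f j)).
Proof. by rewrite /dap rmorph_sum; apply: eq_bigr => j _; rewrite /= msubZ. Qed.

Lemma pihomog_dap n d a (f : 'I_l -> {mpoly R[n]}) :
  pihomog mdeg d (dap a f) = dap a (fun j => pihomog mdeg d (f j)).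
Proof. by rewrite /dap raddf_sum; apply: eq_bigr => j _; rewrite /= linearZ. Qed.

Lemma La_dvd_pihomog a d p : mdivides (La a) p -> mdivides (La a) (pihomog mdeg d p).
Proof.
move=> [g ->]; rewrite (pihomogM_homog _ _ (dhomog_La a)); case: ifP => _; last exact: mdvd0.
exact: mdvdMr (mdvdr _).
Qed.

End ConeRing.

(** Modulo [D] both columns are orthogonal to the nonzero constant vector [(c1, c2)], so their
    determinant vanishes. *)
Lemma cramer_dvd n (c1 c2 : R) (D a b p q : {mpoly R[n]}) : (c1 != 0) || (c2 != 0) ->
  mdivides D (c1 *: a + c2 *: b) -> mdivides D (c1 *: p + c2 *: q) -> mdivides D (a * q - b * p).
Proof.
move=> c0 d1 d2; case/orP: c0 => c0.
  have -> : a * q - b * p = c1^-1 *: ((c1 *: a + c2 *: b) * q - b * (c1 *: p + c2 *: q)).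
    apply: (scalerI c0); rewrite scalerA divff // scale1r -!mul_mpolyC; ring.
  by apply: mdvdZ; apply: mdvdB; [apply: mdvdMr|apply: mdvdMl].
have -> : a * q - b * p = c2^-1 *: (a * (c1 *: p + c2 *: q) - (c1 *: a + c2 *: b) * p).
  apply: (scalerI c0); rewrite scalerA divff // scale1r -!mul_mpolyC; ring.
by apply: mdvdZ; apply: mdvdB; [apply: mdvdMl|apply: mdvdMr].
Qed.

(** * Lifting over a flat of codimension two *)

Section PairLift.
Variables (l : nat) (Phi : seq 'rV[R]_l) (Delta : 'M[R]_l).
Hypotheses (rs : root_system Phi) (ss : simple_system Phi Delta).
Local Notation Pos := (Pos Phi Delta).
Local Notation S1 := {mpoly R[1 + l]}.
Local Notation iot := (msub (iota_mx l)).
Local Notation rho := (msub (rho_mx l)).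
Local Notation x0 := (x0 l).
Variables (m : nat) (Psi : seq 'rV[R]_l).
Hypothesis ideal : forall a b, a \in Psi -> b \in Pos -> root_le Delta b a -> b \in Psi.
Local Notation La := (La m Psi).
Local Notation mlt := (mlt m Psi).
Variables (p : nat) (a b : 'rV[R]_l).
Hypothesis rk : rk2 Phi Delta p a b.
Let cb (c : nat * nat) : 'rV[R]_l := comb a b c.

Let cbP c : c \in rk2c p -> cb c \in Pos.
Proof. by move=> cp; case: rk => _ _ _ H; rewrite /cb /comb H; apply: (map_f (comb a b)). Qed.

Let cb0 c : c \in rk2c p -> cb c != 0.
Proof. by move=> /cbP/(Pos_neq0 rs). Qed.

Let aP : a \in Pos.
Proof.
have -> : a = cb (1, 0)%N by rewrite /cb /comb scale1r scale0r addr0.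
by apply: cbP; case: (p) => [|[|[|?]]].
Qed.

Let bP : b \in Pos.
Proof.
have -> : b = cb (0, 1)%N by rewrite /cb /comb scale1r scale0r add0r.
by apply: cbP; case: (p) => [|[|[|?]]].
Qed.

Let nc0 c : c \in rk2c p -> (c.1%:R != 0 :> R) || (c.2%:R != 0 :> R).
Proof. by rewrite !pnatr_eq0; case: (p) => [|[|[|?]]]; case: c => -[|?] [|?]. Qed.

Let cb_nprop : nprop (map cb (rk2c p)).
Proof.
have [_ ind _ _] := rk; have [_ P0 PN] := nprop_Pos rs ss.
have sub x : x \in map cb (rk2c p) -> x \in Pos by move=> /mapP[c cp ->]; apply: cbP.
split.
- rewrite map_inj_in_uniq => [|c c' _ _ E]; first by case: (p) => [|[|[|?]]].
  have [/eqP e1 /eqP e2] := indep2_inj ind E; move: e1 e2; rewrite !eqr_nat => /eqP e1 /eqP e2.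
  by case: c c' e1 e2 {E} => c1 c2 [d1 d2] /= -> ->.
- by apply/negP => /sub; apply/negP.
- by move=> x y /sub xP /sub yP; apply: PN.
Qed.

Let sg (q : {mpoly R[3]}) : S1 :=
  msub (\matrix_(i < 3) [:: x0_form l; row_mx 0 a; row_mx 0 b]`_i)^T q.

Let sg_vec c k : sg (linform (vec (c, k))) = linform (cone_form (cb c, k)).
Proof.
rewrite /sg msub_linform trmxK; congr linform; rewrite mulmx_sum_row !big_ord_recl big_ord0.
rewrite !rowK /= !mxE /= addr0 /x0_form /cone_form !scale_row_mx !add_row_mx !scaler0 !add0r addr0.
by congr row_mx; apply/rowP => i; rewrite !mxE mulr1.
Qed.

(** The three variables of the rank two result are replaced by [x0], [a] and [b]. The ideal
    restricts to an ideal of the plane because [a] and [b] have nonnegative simple coordinates. *)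
Lemma pair_basis : exists P1 Q1 P2 Q2 : S1,
  (forall c, c \in rk2c p -> mdivides (La (cb c)) (c.1%:R *: P1 + c.2%:R *: Q1) /\
                           mdivides (La (cb c)) (c.1%:R *: P2 + c.2%:R *: Q2)) /\
  exists2 k : R, k != 0 & P1 * Q2 - P2 * Q1 = k%:MP * \prod_(c <- rk2c p) La (cb c).
Proof.
have [p3 ind _ _] := rk.
have [|d1 [d2 [P1 [Q1 [P2 [Q2 [_ _ H [k k0 E]]]]]]]] := @rank2_free p m (fun c => cb c \in Psi) p3.
  move=> r r' rp r'p h1 h2 r'Psi; apply: ideal r'Psi (cbP rp) _.
  rewrite /root_le; have -> : cb r' - cb r = (r'.1 - r.1)%N%:R *: a + (r'.2 - r.2)%N%:R *: b.
    by rewrite /cb /comb !natrB // !scalerBl opprD addrACA.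
  apply/nonnegP => i; rewrite coordsD !coordsZ [X in 0 <= X]mxE; apply: addr_ge0; rewrite mxE.
    by apply: mulr_ge0; [apply: ler0n|exact: (Pos_nonneg _ aP)].
  by apply: mulr_ge0; [apply: ler0n|exact: (Pos_nonneg _ bP)].
have KL c k' : c \in rk2c p -> k' \in Kset m Psi (cb c) -> vec (c, k') \in
    arr [seq (r, (cb r \in Psi : nat, 0%N)) | r <- rk2c p] m.
  move=> cp /mapP[i iK ->]; apply/map_f/flatten_mapP; exists (c, (cb c \in Psi : nat, 0%N)).
    exact: (map_f (fun r => (r, (cb r \in Psi : nat, 0%N)))).
  by apply/mapP; exists i; rewrite // addn0.
exists (sg P1), (sg Q1), (sg P2), (sg Q2); split.
  move=> c cp; have H' k' : k' \in Kset m Psi (cb c) ->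
      mdivides (linform (cone_form (cb c, k'))) (c.1%:R *: sg P1 + c.2%:R *: sg Q1) /\
      mdivides (linform (cone_form (cb c, k'))) (c.1%:R *: sg P2 + c.2%:R *: sg Q2).
    move=> /(KL _ _ cp)/H[[q1 e1] [q2 e2]]; rewrite -sg_vec; split.
      by exists (sg q1); rewrite /sg -rmorphM /= -e1 rmorphD /= !msubZ /vec !row3E.
    by exists (sg q2); rewrite /sg -rmorphM /= -e2 rmorphD /= !msubZ /vec !row3E.
  by split; apply: La_dvd => [|k' /H'[]//]; apply: cb0.
exists k => //; have := congr1 sg E; rewrite /sg rmorphB !rmorphM /= msubC => ->; congr (_ * _).
rewrite rmorph_prod big_map /lines big_flatten big_map /= big_map; apply: eq_bigr => c _.
rewrite big_map /La /Kset big_map /= /mlt addn0; apply: eq_bigr => i _. exact: sg_vec.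
Qed.

(** On [x0 = 0] the basis has determinant a nonzero multiple of the product of the prescribed
    powers, so Cramer's rule expresses the restriction of [A] and [B] by it; the same combination on
    the cone is an exact solution. Higher powers of [x0] are treated by applying this to the
    quotient. *)
Lemma pair_split n : forall A B : S1,
  (forall c, c \in rk2c p -> exists g s, c.1%:R *: A + c.2%:R *: B = La (cb c) * g + x0 ^+ n * s) ->
  exists A' B' A0 B0, [/\ A = A' + x0 ^+ n * A0, B = B' + x0 ^+ n * B0 &
    forall c, c \in rk2c p -> mdivides (La (cb c)) (c.1%:R *: A' + c.2%:R *: B')].
Proof.
have [P1 [Q1 [P2 [Q2 [HL [k k0 dE]]]]]] := pair_basis.
have core (A B : S1) :
  (forall c, c \in rk2c p -> exists g s, c.1%:R *: A + c.2%:R *: B = La (cb c) * g + x0 * s) ->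
  exists A' B' A0 B0, [/\ A = A' + x0 * A0, B = B' + x0 * B0 &
    forall c, c \in rk2c p -> mdivides (La (cb c)) (c.1%:R *: A' + c.2%:R *: B')].
  move=> H; pose w c := linform (cb c) ^+ mlt (cb c).
  have rhoL c X Y : mdivides (La (cb c)) (c.1%:R *: X + c.2%:R *: Y) ->
      mdivides (w c) (c.1%:R *: rho X + c.2%:R *: rho Y).
    by move=> [q E]; exists (rho q); rewrite /w -rho_La -rmorphM -E rmorphD /= !msubZ.
  have dA c : c \in rk2c p -> mdivides (w c) (c.1%:R *: rho A + c.2%:R *: rho B).
    move=> /H[g [s E]]; exists (rho g); rewrite /w -rho_La -!msubZ -rmorphD E rmorphD !rmorphM /=.
    by rewrite rho_x0 mul0r addr0.
  set D := \prod_(c <- rk2c p) w c.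
  have dD X : (forall c, c \in rk2c p -> mdivides (w c) X) -> mdivides D X.
    move=> HX; have := @linform_prod_dvd _ _ mlt X cb_nprop; rewrite big_map; apply.
    by move=> u /mapP[c cp ->]; apply: HX.
  have [f1 f1E] : mdivides D (rho A * rho Q2 - rho B * rho P2).
    by apply: dD => c cp; apply: (cramer_dvd (nc0 cp)); [apply: dA|apply: rhoL; case: (HL c cp)].
  have [f2 f2E] : mdivides D (rho P1 * rho B - rho Q1 * rho A).
    by apply: dD => c cp; apply: (cramer_dvd (nc0 cp)); [apply: rhoL; case: (HL c cp)|apply: dA].
  have D0 : D != 0.
    rewrite prodf_seq_neq0; apply/allP => c cp /=; rewrite expf_neq0 // linform_eq0; exact: cb0.
  have dE0 : rho P1 * rho Q2 - rho P2 * rho Q1 = k%:MP * D.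
    rewrite -!rmorphM -rmorphB dE rmorphM /= msubC; congr (_ * _); rewrite rmorph_prod.
    by apply: eq_bigr => c _; exact: rho_La.
  have kD : k%:MP * D != 0 by rewrite mulf_neq0 // mpolyC_eq0.
  pose A' := k^-1 *: (iot f1 * P1 + iot f2 * P2); pose B' := k^-1 *: (iot f1 * Q1 + iot f2 * Q2).
  have EA : rho A = rho A'.
    rewrite /A' msubZ rmorphD !rmorphM /= !rho_iot; apply: (mulfI kD).
    have -> : k%:MP * D * (k^-1 *: (f1 * rho P1 + f2 * rho P2)) = (D * f1) * rho P1 + (D * f2) * rho P2.
      rewrite -mul_mpolyC; have kk : k%:MP * k^-1%:MP = 1 :> {mpoly R[l]} by rewrite -mpolyCM divff // mpolyC1.
      by transitivity (k%:MP * k^-1%:MP * (D * f1 * rho P1 + D * f2 * rho P2)); [ring|rewrite kk mul1r].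
    by rewrite -f1E -f2E -dE0; ring.
  have EB : rho B = rho B'.
    rewrite /B' msubZ rmorphD !rmorphM /= !rho_iot; apply: (mulfI kD).
    have -> : k%:MP * D * (k^-1 *: (f1 * rho Q1 + f2 * rho Q2)) = (D * f1) * rho Q1 + (D * f2) * rho Q2.
      rewrite -mul_mpolyC; have kk : k%:MP * k^-1%:MP = 1 :> {mpoly R[l]} by rewrite -mpolyCM divff // mpolyC1.
      by transitivity (k%:MP * k^-1%:MP * (D * f1 * rho Q1 + D * f2 * rho Q2)); [ring|rewrite kk mul1r].
    by rewrite -f1E -f2E -dE0; ring.
  have [A0 A0E] := rho_eq_mod EA; have [B0 B0E] := rho_eq_mod EB.
  exists A', B', A0, B0; split=> // c cp; have [h1 h2] := HL c cp.
  have -> : c.1%:R *: A' + c.2%:R *: B' =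
      k^-1 *: (iot f1 * (c.1%:R *: P1 + c.2%:R *: Q1) + iot f2 * (c.1%:R *: P2 + c.2%:R *: Q2)).
    rewrite /A' /B' -!mul_mpolyC; ring.
  by apply: mdvdZ; apply: mdvdD; apply: mdvdMl.
elim: n => [|n IHn] A B H.
  exists 0, 0, A, B; split; rewrite ?mul1r ?add0r // => c _; rewrite !scaler0 addr0; exact: mdvd0.
have [|A' [B' [A0 [B0 [AE BE H']]]]] := IHn A B.
  by move=> c /H[g [s ->]]; exists g, (x0 * s); rewrite mulrA -exprSr.
have [|A2 [B2 [A3 [B3 [A0E B0E H2]]]]] := core A0 B0.
  move=> c cp; have [g [s E]] := H c cp; have [g' E'] := H' c cp.
  have [||t tE] := @x0_cancel l n (La (cb c)) (c.1%:R *: A0 + c.2%:R *: B0 - x0 * s) (g - g').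
  - exact: rho_La_neq0 (cb0 cp).
  - move: E; rewrite AE BE.
    have -> : c.1%:R *: (A' + x0 ^+ n * A0) + c.2%:R *: (B' + x0 ^+ n * B0) =
      (c.1%:R *: A' + c.2%:R *: B') + x0 ^+ n * (c.1%:R *: A0 + c.2%:R *: B0).
      rewrite -!mul_mpolyC; ring.
    rewrite E' exprSr => E; rewrite !mulrBr; move: E.
    move: (_ *: A0 + _) (La _) (x0 ^+ n) => u v z E.
    by rewrite mulrA; move: (z * x0 * s) (z * u) E => y1 y2 E; rewrite -[v * g](addrK y1) -E; ring.
  - by exists t, s; rewrite -tE subrK.
exists (A' + x0 ^+ n * A2), (B' + x0 ^+ n * B2), A3, B3; split.
- by rewrite AE A0E exprSr; ring.
- by rewrite BE B0E exprSr; ring.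
- move=> c cp; have -> : c.1%:R *: (A' + x0 ^+ n * A2) + c.2%:R *: (B' + x0 ^+ n * B2) =
      (c.1%:R *: A' + c.2%:R *: B') + x0 ^+ n * (c.1%:R *: A2 + c.2%:R *: B2).
    by rewrite -!mul_mpolyC; ring.
  by apply: mdvdD; [exact: H'|apply: mdvdMl; exact: H2].
Qed.

Lemma pair_lift n (Th : 'I_l -> S1) (r : 'rV[R]_l -> S1) :
  (forall c, c \in Pos -> exists g, dap c Th = La c * g + x0 ^+ n * r c) ->
  exists eta : 'I_l -> {mpoly R[l]}, forall c x y, c \in Pos -> c = x *: a + y *: b ->
    mdivides (linform c ^+ mlt c) (dap c eta - rho (r c)).
Proof.
move=> H; have [_ ind _ rkP] := rk.
have dcb c : dap (cb c) Th = c.1%:R *: dap a Th + c.2%:R *: dap b Th by rewrite /cb /comb dapl.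
have [|A' [B' [A0 [B0 [AE BE H']]]]] := @pair_split n (dap a Th) (dap b Th).
  by move=> c cp; have [g E] := H _ (cbP cp); exists g, (r (cb c)); rewrite -dcb E.
have aN : a != 0 := Pos_neq0 rs aP.
pose v := b *m projm a; have av : dotv a v = 0 by rewrite dotv_projm.
have bv : dotv b v != 0.
  have vE : v = b - (dotv b a / dotv a a) *: a by exact: mul_projm.
  have -> : dotv b v = dotv v v by rewrite [X in _ = dotv X _]vE dotvBl dotvZl av mulr0 subr0.
  rewrite dotv_eq0 /v mul_projm; apply/eqP => E.
  have [|_ /eqP] := ind (- (dotv b a / dotv a a)) 1; last by rewrite oner_eq0.
  by rewrite scale1r scaleNr addrC.
have [v' [av' bv']] : exists v', dotv a v' = 0 /\ dotv b v' = 1.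
  by exists ((dotv b v)^-1 *: v); rewrite !dotvZr av mulr0 mulVf.
pose u := (dotv a a)^-1 *: (a - dotv b a *: v').
have [au bu] : dotv a u = 1 /\ dotv b u = 0.
  by rewrite /u !dotvZr !dotvBr !dotvZr av' bv' mulr0 subr0 mulVf ?dotv_eq0 // mulr1 subrr mulr0.
(* [u] and [v'] are dual to [a] and [b], so this field takes the values [rho A0] at [a] and [rho B0]
   at [b]. *)
exists (fun j => u 0 j *: rho A0 + v' 0 j *: rho B0) => c x y cP cE.
have : c \in map (comb a b) (rk2c p) by rewrite cE -rkP -cE.
move=> /mapP[d dp dE]; rewrite -/(cb d) in dE.
have dapc z : dap z (fun j => u 0 j *: rho A0 + v' 0 j *: rho B0) = dotv z u *: rho A0 + dotv z v' *: rho B0.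
  rewrite dapD /dap /dotv !scaler_suml; congr (_ + _); apply: eq_bigr => j _; by rewrite scalerA.
have [q qE] : mdivides (La c) (d.1%:R *: A0 + d.2%:R *: B0 - r c).
  have [g E] := H _ cP; have [g' E'] := H' d dp; rewrite -dE in E'.
  apply: (@x0_cancel l n (La c) _ (g - g')); first exact: rho_La_neq0 (Pos_neq0 rs cP).
  move: E; rewrite dE dcb AE BE -dE.
  have -> : d.1%:R *: (A' + x0 ^+ n * A0) + d.2%:R *: (B' + x0 ^+ n * B0) =
      (d.1%:R *: A' + d.2%:R *: B') + x0 ^+ n * (d.1%:R *: A0 + d.2%:R *: B0).
    by rewrite -!mul_mpolyC; ring.
  rewrite E' => E; rewrite !mulrBr; move: E; move: (x0 ^+ n * r c) (_ * (_ *: A0 + _)) => y1 y2 E.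
  by rewrite -[La c * g](addrK y1) -E; ring.
exists (rho q); rewrite -rho_La -rmorphM -qE rmorphB rmorphD /= !msubZ; congr (_ - _).
by rewrite dapc {1 2}dE /cb /comb !dotvDl !dotvZl au bu av' bv' !mulr0 !mulr1 addr0 add0r.
Qed.

End PairLift.

Lemma vanish_ideal2 n (w1 w2 : 'rV[R]_n) (p : {mpoly R[n]}) : w1 != 0 -> w2 *m projm w1 != 0 ->
  (forall v, dotv w1 v = 0 -> dotv w2 v = 0 -> p.@[v 0] = 0) ->
  exists u v, p = linform w1 * u + linform w2 * v.
Proof.
move=> w10; set w := w2 *m projm w1 => w0 H.
have wE : w = w2 - (dotv w2 w1 / dotv w1 w1) *: w1 by exact: mul_projm.
have ww1 : dotv w1 w = 0 by exact: dotv_projm.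
have [q1 E1] := msub_projm_congr w1 p; set p1 := msub _ p in E1.
have [q2 E2] := msub_projm_congr w p1.
have p20 : msub (projm w) p1 = 0.
  apply: mpoly_fun_eq0 => v; rewrite !ev_msub; set z := v *m projm w; apply: H; first exact: dotv_projm.
  have -> : dotv w2 (z *m projm w1) = dotv w (z *m projm w1).
    by rewrite wE dotvBl dotvZl dotv_projm // mulr0 subr0.
  by rewrite mul_projm dotvBr dotvZr [dotv w w1]dotvC ww1 mulr0 subr0 dotv_projm.
exists (q1 - (dotv w2 w1 / dotv w1 w1) *: q2), q2.
rewrite p20 subr0 wE linformD linformN linformZ in E2.
by rewrite -[LHS](subrK p1) E1 E2 -!mul_mpolyC; ring.
Qed.

Lemma seq_argmin (T : eqType) (f : T -> R) (s : seq T) x : x \in s ->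
  exists2 y, y \in s & forall z, z \in s -> f y <= f z.
Proof.
elim: s x => // y s IHs x _; case: s IHs => [|z s] IHs.
  by exists y; rewrite ?mem_head // => z; rewrite inE => /eqP ->.
have [u us uP] := IHs z (mem_head _ _).
have [yu|uy] := lerP (f y) (f u).
  exists y; rewrite ?mem_head // => v; rewrite inE => /orP[/eqP -> //|/uP]; exact: le_trans.
exists u; first by rewrite inE us orbT.
by move=> v; rewrite inE => /orP[/eqP ->|/uP //]; apply: ltW.
Qed.

(** * Vanishing of the obstruction to lifting *)

Section Lifting.
Variables (l : nat) (Phi : seq 'rV[R]_l) (Delta : 'M[R]_l).
Hypotheses (rs : root_system Phi) (ss : simple_system Phi Delta).
Local Notation Pos := (Pos Phi Delta).
Local Notation S0 := {mpoly R[l]}.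
Local Notation S1 := {mpoly R[1 + l]}.
Local Notation iot := (msub (iota_mx l)).
Local Notation rho := (msub (rho_mx l)).
Local Notation x0 := (x0 l).

(* The extreme rays of the cone spanned by the positive roots of a plane: they minimize and
   maximize the quotient of a linear form by the height. *)
Lemma base2_exists b1 b2 : b1 \in Pos -> b2 \in Pos -> b1 != b2 ->
  exists a b, base2 Phi Delta a b /\ forall x y, exists x' y', x *: b1 + y *: b2 = x' *: a + y' *: b.
Proof.
move=> b1P b2P b12; have ind := Pos_indep2 rs ss b1P b2P b12; have b10 := Pos_neq0 rs b1P.
pose v := b2 *m projm b1; have vE : v = b2 - (dotv b2 b1 / dotv b1 b1) *: b1 by exact: mul_projm.
have b1v : dotv b1 v = 0 by exact: dotv_projm.
have b2v : 0 < dotv b2 v.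
  have -> : dotv b2 v = dotv v v by rewrite [X in _ = dotv X _]vE dotvBl dotvZl b1v mulr0 subr0.
  apply: dotv_gt0; rewrite vE; apply/eqP => E.
  have [|_ /eqP] := ind (- (dotv b2 b1 / dotv b1 b1)) 1; last by rewrite oner_eq0.
  by rewrite scale1r scaleNr addrC.
pose X := [seq c <- Pos | boolp.asbool (exists x y, c = x *: b1 + y *: b2)].
have XP c : c \in X -> c \in Pos /\ exists x y, c = x *: b1 + y *: b2.
  by rewrite mem_filter => /andP[/boolp.asboolP h cP].
have memX c : c \in Pos -> (exists x y, c = x *: b1 + y *: b2) -> c \in X.
  by move=> cP h; rewrite mem_filter cP andbT; apply/boolp.asboolP.
have b1X : b1 \in X by apply: memX => //; exists 1, 0; rewrite scale1r scale0r addr0.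
have b2X : b2 \in X by apply: memX => //; exists 0, 1; rewrite scale1r scale0r add0r.
have htl x y c d : ht Delta (x *: c + y *: d) = x * ht Delta c + y * ht Delta d.
  rewrite /ht !mulr_sumr -big_split; apply: eq_bigr => i _; rewrite coordsD !coordsZ.
  by rewrite [LHS]mxE; congr (_ + _); rewrite mxE.
have hp c : c \in Pos -> 0 < ht Delta c by exact: ht_Pos.
have [a aX aM] := seq_argmin (fun c => dotv c v / ht Delta c) b1X.
have [b bX bM] := seq_argmin (fun c => - (dotv c v / ht Delta c)) b1X.
have [aP [x1 [y1 aE]]] := XP _ aX; have [bP [x2 [y2 bE]]] := XP _ bX.
have ha := hp _ aP; have hb := hp _ bP.
have br : 0 < dotv b v * ht Delta a - dotv a v * ht Delta b.
  have := aM _ b1X; rewrite /= b1v mul0r ler_pdivrMr // mul0r => av.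
  have := bM _ b2X; rewrite /= lerN2 => bv.
  have : 0 < dotv b v / ht Delta b by apply: lt_le_trans bv; rewrite divr_gt0 ?hp.
  rewrite ltr_pdivlMr // mul0r => bv'.
  have : 0 < dotv b v * ht Delta a by rewrite mulr_gt0.
  have : dotv a v * ht Delta b <= 0 by rewrite mulr_le0_ge0 // ltW.
  by lra.
have ab : a != b by apply/eqP => E; move: br; rewrite E subrr ltxx.
have iab := Pos_indep2 rs ss aP bP ab.
exists a, b; split.
  split=> // x y cP; have cX : x *: a + y *: b \in X.
    apply: memX => //; exists (x * x1 + y * x2), (x * y1 + y * y2).
    by rewrite aE bE !scalerDr !scalerA !scalerDl addrACA.
  have hc := hp _ cP; have := aM _ cX; have := bM _ cX; rewrite /= lerN2.
  rewrite ler_pdivrMr // mulrAC ler_pdivlMr // => h1.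
  rewrite ler_pdivrMr // mulrAC ler_pdivlMr // => h2.
  move: h1 h2 br; rewrite htl dotvDl !dotvZl.
  move: (dotv a v) (dotv b v) (ht Delta a) (ht Delta b) => fa fb ta tb h1 h2 br.
  by split; rewrite -(pmulr_lge0 _ br); lra.
have D0 : x1 * y2 - x2 * y1 != 0.
  apply/eqP => D0.
  have [|y20 y10] := iab y2 (- y1).
    rewrite aE bE !scalerDr !scalerA addrACA -!scalerDl.
    have -> : y2 * x1 + - y1 * x2 = 0 by rewrite -D0; ring.
    have -> : y2 * y1 + - y1 * y2 = 0 by ring.
    by rewrite !scale0r addr0.
  have [|x20 x10] := iab x2 (- x1).
    rewrite aE bE !scalerDr !scalerA addrACA -!scalerDl.
    have -> : x2 * x1 + - x1 * x2 = 0 by ring.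
    have -> : x2 * y1 + - x1 * y2 = - (x1 * y2 - x2 * y1) by ring.
    by rewrite D0 oppr0 !scale0r addr0.
  case/eqP: (Pos_neq0 rs aP); rewrite aE -[x1]opprK x10 -[y1]opprK y10 oppr0 !scale0r. by rewrite addr0.
move=> x y; pose D := x1 * y2 - x2 * y1.
exists ((x * y2 - y * x2) / D), ((y * x1 - x * y1) / D).
rewrite aE bE !scalerDr !scalerA addrACA -!scalerDl; congr (_ *: _ + _ *: _).
  by rewrite /D; field.
by rewrite /D; field.
Qed.

Variables (m : nat) (Psi : seq 'rV[R]_l).
Hypothesis ideal : forall a b, a \in Psi -> b \in Pos -> root_le Delta b a -> b \in Psi.
Local Notation La := (La m Psi).
Local Notation mlt := (mlt m Psi).

Lemma plane_lift b1 b2 n (Th : 'I_l -> S1) (r : 'rV[R]_l -> S1) : b1 \in Pos -> b2 \in Pos -> b1 != b2 ->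
  (forall c, c \in Pos -> exists g, dap c Th = La c * g + x0 ^+ n * r c) ->
  exists eta : 'I_l -> S0, forall c x y, c \in Pos -> c = x *: b1 + y *: b2 ->
    mdivides (linform c ^+ mlt c) (dap c eta - rho (r c)).
Proof.
move=> b1P b2P b12 H; have [a [b [bs sp]]] := base2_exists b1P b2P b12.
have [p p3 [rk|rk]] := base2_rk2 rs ss bs; have [eta E] := pair_lift rs ss ideal rk H.
  by exists eta => c x y cP cE; have [x' [y' E']] := sp x y; apply: (E c x' y'); rewrite // cE E'.
by exists eta => c x y cP cE; have [x' [y' E']] := sp x y; apply: (E c y' x'); rewrite // cE E' addrC.
Qed.

(** Obstructions live in the cokernel of the evaluation at the positive roots modulo
    [linform c ^+ mlt c], whose kernel is the module [D(mu)]; the predicate says that the class of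
    [r] is zero. *)
Definition solv (r : 'rV[R]_l -> S0) := exists eta : 'I_l -> S0,
  forall c, c \in Pos -> mdivides (linform c ^+ mlt c) (dap c eta - r c).

Lemma solvM f r : solv r -> solv (fun c => f * r c).
Proof.
by move=> [eta H]; exists (fun j => f * eta j) => c cP; rewrite dapM -mulrBr; apply: mdvdMl; apply: H.
Qed.

Lemma solvD r s : solv r -> solv s -> solv (fun c => r c + s c).
Proof.
move=> [eta H] [eta' H']; exists (fun j => eta j + eta' j) => c cP.
by rewrite dapD opprD addrACA; apply: mdvdD; [apply: H|apply: H'].
Qed.

Lemma solv_ext r s : (forall c, r c = s c) -> solv r -> solv s.
Proof. by move=> rs_ [eta H]; exists eta => c cP; rewrite -rs_; apply: H. Qed.

(** Each root is proportional to at most one vector of this form, so a value of [s] larger than all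
    those excluded will do. *)
Lemma avoid_roots b1 b2 : indep2 b1 b2 -> exists s : R, forall c, c \in Pos -> forall t, c != t *: (b1 + s *: b2).
Proof.
move=> ind; pose bad c (s : R) := exists t : R, c = t *: (b1 + s *: b2).
pose f c : R := if boolp.pselect (exists s, bad c s) is left e then sval (boolp.cid e) else 0.
exists (1 + \sum_(c <- Pos) `|f c|) => c cP t; apply/eqP => cE; set s := 1 + _ in cE.
have [t' cE'] : bad c (f c).
  rewrite /f; case: boolp.pselect => [e|N]; first exact: (svalP (boolp.cid e)).
  by case: N; exists s, t.
move: (cE'); rewrite {1}cE !scalerDr !scalerA => /(indep2_inj ind)[tt].
rewrite tt => E; have t0 : t' != 0.
  by apply: contraNneq (Pos_neq0 rs cP) => z; rewrite cE' z scale0r.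
have := mulfI t0 E => sE.
have : `|f c| <= \sum_(c <- Pos) `|f c|.
  by rewrite (big_rem c) //= lerDl sumr_ge0.
by rewrite -sE /s; have := ler_norm (1 + \sum_(c <- Pos) `|f c|); lra.
Qed.

Variable T : 'I_l -> 'I_l -> S0.
Hypothesis Tspan : forall th : 'I_l -> S0,
  (forall a, a \in Pos -> mdivides (linform a ^+ mlt a) (deriv_apply th a)) ->
  exists g : 'I_l -> S0, forall j, th j = \sum_i g i * T i j.
Hypothesis Tdvd : forall i a, a \in Pos -> mdivides (linform a ^+ mlt a) (deriv_apply (T i) a).
Hypothesis Tfree : forall g : 'I_l -> S0, (forall j, \sum_i g i * T i j = 0) -> forall i, g i = 0.

(* As the multiderivations form a free module, an obstruction killed by three independent
   linear forms is zero. *)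
Lemma solv_depth b1 b2 b3 r : b1 \in Pos -> b2 \in Pos -> b1 != b2 ->
  (forall x y, b3 != x *: b1 + y *: b2) ->
  solv (fun c => linform b1 * r c) -> solv (fun c => linform b2 * r c) ->
  solv (fun c => linform b3 * r c) -> solv r.
Proof.
move=> b1P b2P b12 b3N s1 [e2 H2] [e3 H3]; have ind := Pos_indep2 rs ss b1P b2P b12.
(* The form [f] is prime to all roots, so it can be cancelled modulo their powers; it takes the
   place of [b1]. *)
have [s sN] := avoid_roots ind; set w := b1 + s *: b2 in sN; set f := linform w.
have [ef Hf] : solv (fun c => f * r c).
  have s2 : solv (fun c => s%:MP * (linform b2 * r c)) by apply: solvM; exists e2.
  apply: solv_ext (solvD s1 s2) => c; rewrite /f /w linformD linformZ -mul_mpolyC; ring.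
have w0 : w != 0.
  apply/eqP => E; have [|/eqP] := ind 1 s; first by rewrite scale1r.
  by rewrite oner_eq0.
have f0 : f != 0 by rewrite linform_eq0.
have wN c : c \in Pos -> ~ mdivides f (linform c) by move=> cP; apply: linform_ndvd_linform; apply: sN.
have wN' c : c \in Pos -> ~ mdivides (linform c) f.
  move=> cP; apply: linform_ndvd_linform => t; apply/eqP => wE.
  have t0 : t != 0 by apply: contraNneq w0 => z; rewrite wE z scale0r.
  by case/eqP: (sN c cP t^-1); rewrite wE scalerA mulVf // scale1r.
have span3 (x y : S0) (ex ey : 'I_l -> S0) :
    (forall c, c \in Pos -> mdivides (linform c ^+ mlt c) (dap c ex - x * r c)) ->
    (forall c, c \in Pos -> mdivides (linform c ^+ mlt c) (dap c ey - y * r c)) ->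
    exists g : 'I_l -> S0, forall j, y * ex j - x * ey j = \sum_i g i * T i j.
  move=> Hx Hy; apply: (Tspan (th := fun j => y * ex j - x * ey j)) => c cP.
  rewrite -[deriv_apply _ _]/(dap c _) dapB !dapM.
  have -> : y * dap c ex - x * dap c ey = y * (dap c ex - x * r c) - x * (dap c ey - y * r c) by ring.
  by apply: mdvdB; apply: mdvdMl; [apply: Hx|apply: Hy].
have [cc ccE] := span3 _ _ _ _ Hf H2.
have [dd ddE] := span3 _ _ _ _ Hf H3.
have [ee eeE] := span3 _ _ _ _ H2 H3.
(* Solutions for two multiples of [r] differ by a multiderivation; freeness turns the identity among
   the three differences into one for each coefficient. As [b3] is regular modulo [f] and the form
   of [b2], each [cc i] lies in the ideal they generate. *)
have rel i : linform b3 * cc i = linform b2 * dd i - f * ee i.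
  apply/eqP; rewrite -subr_eq0; apply/eqP; move: i; apply: Tfree => j.
  have -> : \sum_i (linform b3 * cc i - (linform b2 * dd i - f * ee i)) * T i j =
     linform b3 * (\sum_i cc i * T i j) - (linform b2 * (\sum_i dd i * T i j) - f * (\sum_i ee i * T i j)).
    by rewrite !mulr_sumr -!sumrB; apply: eq_bigr => i _; ring.
  by rewrite -ccE -ddE -eeE; ring.
have b10 := Pos_neq0 rs b1P.
pose w2 := b2 *m projm b1; have w2E : w2 = b2 - (dotv b2 b1 / dotv b1 b1) *: b1 by exact: mul_projm.
have w20 : w2 != 0.
  rewrite w2E; apply/eqP => E.
  have [|_ /eqP] := ind (- (dotv b2 b1 / dotv b1 b1)) 1; last by rewrite oner_eq0.
  by rewrite scale1r scaleNr addrC.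
have b1w2 : dotv b1 w2 = 0 by exact: dotv_projm.
pose z := b3 *m projm b1 *m projm w2.
have zE : z = b3 - (dotv b3 b1 / dotv b1 b1) *: b1 - (dotv (b3 *m projm b1) w2 / dotv w2 w2) *: w2.
  by rewrite /z mul_projm {1}mul_projm.
have zw2 : dotv w2 z = 0 by exact: dotv_projm.
have zb1 : dotv b1 z = 0 by rewrite /z mul_projm dotvBr dotvZr dotv_projm // b1w2 mulr0 subr0.
have zb2 : dotv b2 z = 0.
  by have := zw2; rewrite w2E dotvBl dotvZl zb1 mulr0 subr0.
have zb3 : dotv b3 z != 0.
  have -> : dotv b3 z = dotv z z.
    by rewrite [X in _ = dotv X _]zE !dotvBl !dotvZl zb1 zw2 !mulr0 !subr0.
  rewrite dotv_eq0; apply/eqP => z0.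
  set k1 := dotv b3 b1 / _ in zE; set k2 := _ / dotv w2 w2 in zE; set k3 := dotv b2 b1 / _ in w2E.
  case/eqP: (b3N (k1 - k2 * k3) k2); apply/eqP; rewrite -subr_eq0 -z0 zE w2E.
  by apply/eqP/rowP => j; rewrite !mxE; ring.
have vanish i v : dotv b1 v = 0 -> dotv b2 v = 0 -> (cc i).@[v 0] = 0.
  move=> v1 v2; have : linep v z (linform b3 * cc i) = 0.
    apply: poly_fun_eq0 => t; rewrite linep_ev rel mevalB !mevalM !ev_linform /w dotvDl dotvZl.
    have vz1 : dotv b1 (v + t *: z) = 0 by rewrite dotvDr dotvZr v1 zb1 mulr0 addr0.
    have vz2 : dotv b2 (v + t *: z) = 0 by rewrite dotvDr dotvZr v2 zb2 mulr0 addr0.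
    by rewrite vz1 vz2 mulr0 addr0 !mul0r subrr.
  rewrite rmorphM /= linep_linform => /eqP; rewrite mulf_eq0 => /orP[/eqP E|/eqP E].
    have := congr1 (fun q : {poly R} => q`_1) E; rewrite coefD coefC coefZ coefX coef0 /= add0r mulr1.
    by move/eqP; rewrite (negPf zb3).
  by have := linep_ev v z (cc i) 0; rewrite E horner0 scale0r addr0.
have Ex i : exists uv : S0 * S0, cc i = f * uv.1 + linform b2 * uv.2.
  have [u [v E]] := vanish_ideal2 b10 w20 (vanish i).
  by exists (u, v - s *: u); rewrite E /f /w linformD linformZ -!mul_mpolyC /=; ring.
have [uv uvE] := boolp.choice Ex.
(* With [cc] split in this way, the multiderivation can be divided between the two solutions, and
   [f] divides the corrected solution for [f * r]; the quotient solves for [r]. *)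
have step j : linform b2 * (ef j - \sum_i (uv i).2 * T i j) = f * (e2 j + \sum_i (uv i).1 * T i j).
  have := ccE j; under eq_bigr => i _ do rewrite uvE mulrDl -!mulrA.
  rewrite big_split /= -!mulr_sumr; move: (\sum_i _) (\sum_i _) => X Y E.
  by rewrite mulrBr mulrDr -[linform b2 * ef j](subrK (f * e2 j)) E; ring.
have dz j : exists q : S0, ef j - \sum_i (uv i).2 * T i j = f * q.
  have : mdivides f (linform b2 * (ef j - \sum_i (uv i).2 * T i j)) by rewrite step; apply: mdvdMr; apply: mdvdr.
  by case/(linform_prime w0) => // /(wN _ b2P).
have [zeta zetaE] := boolp.choice dz.
exists zeta => c cP; apply: (linform_dvdX_coprime (Pos_neq0 rs cP) (wN' _ cP)).
have -> : f * (dap c zeta - r c) = (dap c ef - f * r c) - \sum_i (uv i).2 * dap c (T i).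
  have -> : f * (dap c zeta - r c) = dap c (fun j => f * zeta j) - f * r c by rewrite dapM; ring.
  have -> : dap c (fun j => f * zeta j) = dap c (fun j => ef j - \sum_i (uv i).2 * T i j).
    by apply: eq_bigr => j _; rewrite zetaE.
  rewrite dapB dap_sum addrAC; congr (_ - _); apply: eq_bigr => i _; exact: dapM.
by apply: mdvdB; [exact: Hf|apply: mdvd_sum => i _; apply: mdvdMl; exact: Tdvd].
Qed.

(** The class is multiplied by products of roots and these are removed again, by induction on the
    total missing exponent [k]. Roots whose full power is already present impose no condition. If
    the others lie in a plane, the rank two lifting solves for all of them; otherwise three of them
    are independent and the depth argument applies. *)
Lemma solv_residue n (Th : 'I_l -> S1) (r : 'rV[R]_l -> S1) :
  (forall c, c \in Pos -> exists g, dap c Th = La c * g + x0 ^+ n * r c) -> solv (fun c => rho (r c)).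
Proof.
move=> H; pose g (nn : 'rV[R]_l -> nat) : S0 := \prod_(b <- Pos) linform b ^+ nn b.
have uP : uniq Pos by exact: undup_uniq.
have sum1 b : b \in Pos -> (\sum_(c <- Pos) (c == b) = 1)%N.
  move=> bP; rewrite (bigD1_seq b) //= eqxx big1 ?addn0 // => c cb; by rewrite (negPf cb).
have prod1 b : b \in Pos -> \prod_(c <- Pos) linform c ^+ (c == b) = linform b.
  move=> bP; rewrite (bigD1_seq b) //= eqxx expr1 big1 ?mulr1 // => c cb; by rewrite (negPf cb) expr0.
suff main k nn : (forall b, b \in Pos -> (nn b <= mlt b)%N) ->
    (\sum_(b <- Pos) (mlt b - nn b) <= k)%N -> solv (fun c => g nn * rho (r c)).
  apply: solv_ext (main _ (fun=> 0%N) _ (leqnn _)) => // c.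
  by rewrite /g big1 ?mul1r // => b _; rewrite expr0.
elim: k nn => [|k IHk] nn nle sz.
(* The roots whose power in [g nn] is not yet full; [enough] says that only these have to be solved
   for. *)
all: pose B := [seq b <- Pos | (nn b < mlt b)%N].
all: have enough (eta : 'I_l -> S0) : (forall c, c \in B -> mdivides (linform c ^+ mlt c) (dap c eta - rho (r c))) ->
    solv (fun c => g nn * rho (r c)).
1,3: move=> HB; exists (fun j => g nn * eta j) => c cP; rewrite dapM -mulrBr.
1,2: have [cB|] := boolP (c \in B); first by apply: mdvdMl; apply: HB.
1,2: rewrite mem_filter cP andbT -leqNgt => cn; apply: mdvdMr; rewrite /g (big_rem c) //=.
1,2: by apply: mdvdMr; apply: mdvd_exp.
- apply: (enough (fun=> 0)) => c; rewrite mem_filter => /andP[cn cP]; exfalso.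
  by move: sz; rewrite (big_rem c) //= => sz; move: cn sz; clear; lia.
have upd b : b \in B -> solv (fun c => linform b * (g nn * rho (r c))).
  rewrite mem_filter => /andP[bn bP].
  apply: (solv_ext (r := fun c => g (fun b' => nn b' + (b' == b))%N * rho (r c))).
    move=> c; rewrite mulrA; congr (_ * _); rewrite /g; under eq_bigr => b' _ do rewrite exprD.
    by rewrite big_split /= prod1 // mulrC.
  apply: IHk => [b' b'P|].
    by have [->|_] := eqVneq b' b; rewrite ?addn1 // addn0 nle.
  have E : (\sum_(b0 <- Pos) (mlt b0 - nn b0) =
      (\sum_(b0 <- Pos) (mlt b0 - (nn b0 + (b0 == b)))) + 1)%N.
    rewrite -[X in _ = (_ + X)%N](sum1 b bP) -big_split /=; apply: eq_bigr => b' _.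
    by have [->|_] := eqVneq b' b; move: bn; clear; lia.
  by move: sz; rewrite E addn1 ltnS.
have BP b : b \in B -> b \in Pos by rewrite mem_filter => /andP[].
have [b1B|nB] := boolp.pselect (exists b1, b1 \in B); last first.
  by apply: (enough (fun=> 0)) => c cB; case: nB; exists c.
case: b1B => b1 b1B; have b1P := BP _ b1B; have b10 := Pos_neq0 rs b1P.
have [b2B|nB] := boolp.pselect (exists2 b2, b2 \in B & b1 != b2); last first.
  apply: (enough (fun j => (b1 0 j / dotv b1 b1) *: rho (r b1))) => c cB.
  have -> : c = b1 by apply/eqP/negPn/negP => cb; apply: nB; exists c; rewrite // eq_sym.
  have -> : dap b1 (fun j => (b1 0 j / dotv b1 b1) *: rho (r b1)) = rho (r b1).
    rewrite /dap; under eq_bigr => j _ do rewrite scalerA mulrA.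
    by rewrite -scaler_suml -mulr_suml -[X in X / _]/(dotv b1 b1) divff ?dotv_eq0 // scale1r.
  by rewrite subrr; exact: mdvd0.
case: b2B => b2 b2B b12; have b2P := BP _ b2B.
have [b3B|nB] := boolp.pselect (exists2 b3, b3 \in B & forall x y, b3 != x *: b1 + y *: b2); last first.
  have [eta E] := plane_lift b1P b2P b12 H; apply: (enough eta) => c cB.
  have [x [y cE]] : exists x y, c = x *: b1 + y *: b2.
    apply: boolp.contrapT => N; apply: nB; exists c => // x y; apply/eqP => cE; apply: N; by exists x, y.
  by apply: (E c x y) => //; apply: BP.
case: b3B => b3 b3B b3N; exact: (solv_depth b1P b2P b12 b3N (upd _ b1B) (upd _ b2B) (upd _ b3B)).
Qed.

Definition approx n (Th : 'I_l -> S1) :=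
  forall c, c \in Pos -> exists g s, dap c Th = La c * g + x0 ^+ n * s.

Lemma approx_lift (T0 : 'I_l -> S0) n :
  (forall c, c \in Pos -> mdivides (linform c ^+ mlt c) (dap c T0)) ->
  exists2 Th : 'I_l -> S1, forall j, rho (Th j) = T0 j & approx n.+1 Th.
Proof.
move=> H; elim: n => [|n [Th ThE A]].
  exists (fun j => iot (T0 j)) => [j|c cP]; first exact: rho_iot.
  have [q qE] := H _ cP; exists (iot q); apply: rho_eq_mod.
  by rewrite -iot_dap rho_iot rmorphM /= rho_La rho_iot.
have Ex c : exists s : S1, c \in Pos -> exists g, dap c Th = La c * g + x0 ^+ n.+1 * s.
  have [cP|_] := boolP (c \in Pos); last by exists 0.
  by have [g [s E]] := A c cP; exists s => _; exists g.
have [r rE] := boolp.choice Ex; have [eta Heta] := solv_residue rE.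
(* Subtracting a solution of the obstruction, with coefficient [x0^(n+1)], leaves a remainder
   divisible by one more power of [x0]. *)
exists (fun j => Th j - x0 ^+ n.+1 * iot (eta j)) => [j|c cP].
  by rewrite rmorphB rmorphM rmorphXn /= rho_x0 expr0n mul0r subr0 ThE.
have [g gE] := rE c cP; have [q qE] := Heta c cP.
have [|s sE] := @rho_eq_mod l (r c - iot (dap c eta)) (- (La c * iot q)).
  rewrite rmorphN rmorphB rmorphM /= rho_La !rho_iot -qE opprB. by [].
exists (g - x0 ^+ n.+1 * iot q), s; rewrite dapB dapM gE -iot_dap.
have -> : r c = - (La c * iot q) + x0 * s + iot (dap c eta) by rewrite -sE subrK.
by rewrite [x0 ^+ n.+2]exprSr; ring.
Qed.

(** Approximation beyond the degree is exact: a multiple of [x0^(d+1)] has no component of degree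
    [d]. *)
Theorem homog_lift (T0 : 'I_l -> S0) d : (forall j, T0 j \is d.-homog) ->
  (forall c, c \in Pos -> mdivides (linform c ^+ mlt c) (dap c T0)) ->
  exists Th : 'I_l -> S1, [/\ forall j, Th j \is d.-homog, forall j, rho (Th j) = T0 j &
    forall c, c \in Pos -> mdivides (La c) (dap c Th)].
Proof.
move=> hT H; have [Th ThE A] := approx_lift d H.
exists (fun j => pihomog mdeg d (Th j)); split=> [j|j|c cP].
- exact: pihomogP.
- by rewrite -pihomog_msub ThE pihomog_dE.
- have [g [s E]] := A c cP; rewrite -pihomog_dap E pihomogD.
  apply: mdvdD; first by apply: La_dvd_pihomog; apply: mdvdMr; apply: mdvdr.
  have hx : x0 ^+ d.+1 \is d.+1.-homog by have := dhomogMn d.+1 (dhomog_linform (x0_form l)); rewrite mul1n.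
  by rewrite (pihomogM_homog _ _ hx) ltnn; exact: mdvd0.
Qed.

End Lifting.

Lemma mpolyXU_neq0 n (k : 'I_n) : 'X_k != 0 :> {mpoly R[n]}.
Proof. by rewrite -msize_poly_eq0 msizeX. Qed.

(** * The basis of the derivations of the cone *)

Section ConeBasis.
Variables (l : nat) (Phi : seq 'rV[R]_l) (Delta : 'M[R]_l).
Hypotheses (rs : root_system Phi) (ss : simple_system Phi Delta).
Local Notation Pos := (Pos Phi Delta).
Local Notation S0 := {mpoly R[l]}.
Local Notation S1 := {mpoly R[1 + l]}.
Local Notation iot := (msub (iota_mx l)).
Local Notation rho := (msub (rho_mx l)).
Local Notation x0 := (x0 l).
Variables (m : nat) (Psi : seq 'rV[R]_l) (d : 'I_l -> nat).
Hypothesis sPsi : {subset Psi <= Pos}.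
Local Notation La := (La m Psi).
Local Notation mlt := (mlt m Psi).
Variables (T : 'I_l -> 'I_l -> S0) (Th : 'I_l -> 'I_l -> S1).
Hypothesis Tspan : forall th : 'I_l -> S0,
  (forall a, a \in Pos -> mdivides (linform a ^+ mlt a) (deriv_apply th a)) ->
  exists g : 'I_l -> S0, forall j, th j = \sum_i g i * T i j.
Hypothesis Tfree : forall g : 'I_l -> S0, (forall j, \sum_i g i * T i j = 0) -> forall i, g i = 0.
Hypothesis Thom : forall i j, T i j \is (d i).-homog.
Hypothesis Hhom : forall i j, Th i j \is (d i).-homog.
Hypothesis Hrho : forall i j, rho (Th i j) = T i j.
Hypothesis Hdvd : forall i c, c \in Pos -> mdivides (La c) (dap c (Th i)).

(** The restriction to [x0 = 0] is a multiderivation; subtracting the same combination of the lifts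
    leaves a multiple of [x0], and [x0] cancels modulo [La c]. In degree zero the value of [n.-1] is
    meaningless, hence the separate clause. *)
Lemma homog_descent n (X : 'I_l -> S1) : (forall j, X j \is n.-homog) ->
  (forall c, c \in Pos -> mdivides (La c) (dap c X)) ->
  exists (f : 'I_l -> S1) (Y : 'I_l -> S1),
  [/\ forall j, X j = \sum_i f i * Th i j + x0 * Y j,
      forall j, Y j \is n.-1.-homog, n = 0%N -> forall j, Y j = 0 &
      forall c, c \in Pos -> mdivides (La c) (dap c Y)].
Proof.
move=> hX HX; have [|f fE] := Tspan (th := fun j => rho (X j)).
  move=> c cP; have [q qE] := HX c cP; exists (rho q).
  by rewrite -[deriv_apply _ _]/(dap c _) -rho_dap qE rmorphM /= rho_La.
(* Homogeneous components of the coefficients keep the quotient by [x0] homogeneous, so that the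
   induction is on the degree. *)
pose f' i : S0 := if (d i <= n)%N then pihomog mdeg (n - d i) (f i) else 0.
have fE' j : rho (X j) = \sum_i f' i * T i j.
  have <- : pihomog mdeg n (rho (X j)) = rho (X j) by rewrite pihomog_msub pihomog_dE.
  rewrite fE raddf_sum; apply: eq_bigr => i _ /=.
  rewrite mulrC (pihomogM_homog _ _ (Thom i j)) /f'; case: ifP => _; last by rewrite mul0r.
  by rewrite mulrC.
have Ex j : exists y : S1, X j - \sum_i iot (f' i) * Th i j = x0 * y.
  have [|y yE] := @x0_dvd l (X j - \sum_i iot (f' i) * Th i j); last by exists y.
  rewrite rmorphB /= fE' rmorph_sum; apply/eqP; rewrite subr_eq0; apply/eqP; apply: eq_bigr => i _.
  by rewrite /= rmorphM /= rho_iot Hrho.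
have [Y YE] := boolp.choice Ex.
have hE j : x0 * Y j \is n.-homog.
  rewrite -YE; apply: rpredB => //; apply: rpred_sum => i _; rewrite /f'.
  case: leqP => [di|_]; last by rewrite rmorph0 mul0r rpred0.
  have := dhomogM (dhomog_msub (iota_mx l) (pihomogP mdeg (n - d i) (f i))) (Hhom i j).
  by rewrite subnK.
have xh : x0 \is 1.-homog := dhomog_linform (x0_form l).
have E j : x0 * Y j = if (0 < n)%N then x0 * pihomog mdeg n.-1 (Y j) else 0.
  by rewrite -[LHS](pihomog_dE (hE j)) (pihomogM_homog _ _ xh) subn1.
pose Y' j := if (0 < n)%N then pihomog mdeg n.-1 (Y j) else 0.
have E' j : x0 * Y j = x0 * Y' j by rewrite E /Y'; case: ifP; rewrite ?mulr0.
exists (fun i => iot (f' i)), Y'; split=> [j|j|n0 j|c cP].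
- by rewrite -E' -YE addrC subrK.
- by rewrite /Y'; case: ifP => _; [exact: pihomogP|exact: rpred0].
- by rewrite /Y' n0.
- have [q qE] : mdivides (La c) (x0 * dap c Y').
    have -> : x0 * dap c Y' = dap c X - \sum_i iot (f' i) * dap c (Th i).
      have -> : x0 * dap c Y' = dap c (fun j => X j - \sum_i iot (f' i) * Th i j).
        by rewrite -dapM; apply: eq_bigr => j _; rewrite YE E'.
      by rewrite dapB dap_sum; congr (_ - _); apply: eq_bigr => i _; rewrite dapM.
    by apply: mdvdB; [exact: HX|apply: mdvd_sum => i _; apply: mdvdMl; exact: Hdvd].
  apply: (@x0_cancel l 1 (La c) _ q); last by rewrite expr1.
  exact: rho_La_neq0 (Pos_neq0 rs cP).
Qed.

Lemma homog_span n (X : 'I_l -> S1) : (forall j, X j \is n.-homog) ->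
  (forall c, c \in Pos -> mdivides (La c) (dap c X)) ->
  exists g : 'I_l -> S1, forall j, X j = \sum_i g i * Th i j.
Proof.
elim: n X => [|n IHn] X hX HX; have [f [Y [XE hY Y0 HY]]] := homog_descent hX HX.
  by exists f => j; rewrite XE Y0 // mulr0 addr0.
have [g gE] := IHn Y hY HY; exists (fun i => f i + x0 * g i) => j.
rewrite XE gE mulr_sumr -big_split; apply: eq_bigr => i _ /=; ring.
Qed.

Lemma cone_span (X : 'I_l -> S1) : (forall c, c \in Pos -> mdivides (La c) (dap c X)) ->
  exists g : 'I_l -> S1, forall j, X j = \sum_i g i * Th i j.
Proof.
move=> HX; pose N := (\max_j msize (X j))%N.
have XE j : X j = \sum_(k < N) pihomog mdeg k (X j).
  by apply: pihomog_partitionE; exact: (leq_bigmax (F := fun j => msize (X j)) j).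
have Ex (k : 'I_N) : exists g : 'I_l -> S1, forall j, pihomog mdeg k (X j) = \sum_i g i * Th i j.
  apply: (@homog_span k) => [j|c cP]; first exact: pihomogP.
  by rewrite -pihomog_dap; apply: La_dvd_pihomog; apply: HX.
have [g gE] := boolp.choice Ex; exists (fun i => \sum_k g k i) => j.
rewrite XE; under eq_bigr => k _ do rewrite gE.
by rewrite exchange_big; apply: eq_bigr => i _; rewrite mulr_suml.
Qed.

(** Restricting a relation to [x0 = 0] shows that [x0] divides all coefficients; dividing it out
    lowers their degrees. *)
Lemma cone_indep (g : 'I_l -> S1) : (forall j, \sum_i g i * Th i j = 0) -> forall i, g i = 0.
Proof.
have H n : forall g : 'I_l -> S1, (forall i, msize (g i) <= n)%N ->
    (forall j, \sum_i g i * Th i j = 0) -> forall i, g i = 0.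
  elim: n => [|n IHn] {}g sz g0 i.
    by apply/eqP; rewrite -msize_poly_eq0 -leqn0.
  have r0 k : rho (g k) = 0.
    apply: (Tfree (g := fun k => rho (g k))) => j; transitivity (rho (\sum_i g i * Th i j)); last first.
      by rewrite g0 rmorph0.
    by rewrite rmorph_sum; apply: eq_bigr => k' _; rewrite /= rmorphM /= Hrho.
  have Ex k : exists q : S1, g k = x0 * q by have [q qE] := x0_dvd (r0 k); exists q.
  have [q qE] := boolp.choice Ex; rewrite qE (IHn q) ?mulr0 // => [k|j].
    have [->|q0] := eqVneq (q k) 0; first by rewrite msize0.
    have := sz k; rewrite qE msizeM ?x0_neq0 //.
    have -> : msize x0 = 2%N.
      have /dhomogP hx := dhomog_linform (x0_form l).
      by rewrite -(mlead_deg (x0_neq0 l)) (hx _ (mlead_supp (x0_neq0 l))).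
    by move: (mmeasure _ (q k)); clear; lia.
  apply: (mulfI (x0_neq0 l)); rewrite mulr0 mulr_sumr -[RHS](g0 j); apply: eq_bigr => k _.
  by rewrite qE mulrA.
move=> g0; apply: (H (\max_i msize (g i))%N) => // i.
exact: (leq_bigmax (F := fun i => msize (g i)) i).
Qed.

Lemma mem_cone_roots a k :
  ((a, k) \in A_Phi_Psi_m (positive_roots Phi Delta) Psi m) = (a \in Pos) && (k \in Kset m Psi a).
Proof.
rewrite mem_cat; apply/orP/andP => [[|]|[aP /mapP[i ]]].
- move=> /allpairsP[[b i] /= [bP]]; rewrite mem_iota => hi [-> ->].
  split; first by rewrite mem_undup.
  apply/mapP; exists (i + (b \in Psi))%N; last by case: (b \in Psi); clear; lia.
  by rewrite mem_iota /mlt; move: hi; clear; case: (b \in Psi); lia.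
- move=> /mapP[b bP [-> ->]]; split; first exact: sPsi.
  by apply/mapP; exists 0%N; rewrite ?mem_iota /mlt bP; lia.
rewrite mem_iota /mlt => hi kE.
have [/andP[aPsi /eqP i0]|ai] := boolP ((a \in Psi) && (i == 0%N)).
  by right; apply/mapP; exists a => //; congr (_, _); rewrite kE aPsi i0; lia.
left; apply/allpairsP; exists (a, (i - (a \in Psi))%N); split.
- by move: aP; rewrite mem_undup.
- by rewrite mem_iota /=; move: hi ai; case: (a \in Psi) => /=; clear; lia.
- by congr (_, _); rewrite kE /=; move: hi ai; case: (a \in Psi) => /=; clear; lia.
Qed.

Definition cone_basis (j : 'I_(1 + l)) : 'I_(1 + l) -> S1 :=
  match split j with
  | inl _ => fun k => 'X_k
  | inr i => fun k => match split k with inl _ => 0 | inr k' => Th i k' end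
  end.

Lemma cone_basisl i k : cone_basis (lshift l i) k = 'X_k.
Proof. by rewrite /cone_basis -[lshift _ _]/(unsplit (inl _)) unsplitK. Qed.

Lemma cone_basisr i : (cone_basis (rshift 1 i) (lshift l 0) = 0) *
  (forall k, cone_basis (rshift 1 i) (rshift 1 k) = Th i k).
Proof.
rewrite /cone_basis -[rshift 1 i]/(unsplit (inr i)) unsplitK; split=> [|k].
  by rewrite -[lshift _ _]/(unsplit (inl _)) unsplitK.
by rewrite -[rshift 1 k]/(unsplit (inr k)) unsplitK.
Qed.

Lemma deriv_cone_form (th : 'I_(1 + l) -> S1) a k :
  deriv_apply th (cone_form (a, k)) = (- k%:~R) *: th (lshift l 0) + dap a (fun j => th (rshift 1 j)).
Proof.
rewrite /deriv_apply big_split_ord /= big_ord1 /cone_form row_mxEl mxE; congr (_ + _).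
by apply: eq_bigr => i _; rewrite row_mxEr.
Qed.

Lemma deriv_x0_form (th : 'I_(1 + l) -> S1) : deriv_apply th (x0_form l) = th (lshift l 0).
Proof.
rewrite /deriv_apply big_split_ord /= big_ord1 /x0_form row_mxEl mxE scale1r big1 ?addr0 // => i _.
by rewrite row_mxEr mxE scale0r.
Qed.

Theorem cone_free h (e : 'I_l -> nat) : (forall i, d i = (e i + m * h)%N) ->
  free_with_exponents (cone (A_Phi_Psi_m (positive_roots Phi Delta) Psi m)) (cone_exponents e m h).
Proof.
move=> dE; exists cone_basis.
have memC w : w \in cone (A_Phi_Psi_m (positive_roots Phi Delta) Psi m) ->
    w = x0_form l \/ exists a k, [/\ w = cone_form (a, k), a \in Pos & k \in Kset m Psi a].
  rewrite inE => /orP[/eqP|/mapP[[a k]]]; first by left.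
  by rewrite mem_cone_roots => /andP[aP kK] ->; right; exists a, k.
have memK a k : a \in Pos -> k \in Kset m Psi a ->
    cone_form (a, k) \in cone (A_Phi_Psi_m (positive_roots Phi Delta) Psi m).
  by move=> aP kK; rewrite inE; apply/orP; right; apply: map_f; rewrite mem_cone_roots aP.
split.
- move=> j w wC; case: (split_ordP j) => i ->.
    rewrite (_ : deriv_apply _ _ = linform w); first exact: mdvdr.
    by apply: eq_bigr => k _; rewrite cone_basisl.
  case: (memC w wC) => [->|[a [k [-> aP kK]]]]; first by rewrite deriv_x0_form cone_basisr; exact: mdvd0.
  rewrite deriv_cone_form cone_basisr scaler0 add0r; apply: (dvd_La kK).
  rewrite (_ : dap _ _ = dap a (Th i)); first exact: Hdvd.
  by apply: eq_bigr => j' _; rewrite cone_basisr.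
- move=> j; rewrite /cone_exponents; case: (split_ordP j) => i ->.
    split.
      by exists (lshift l 0); rewrite cone_basisl mpolyXU_neq0.
    by move=> k; apply/mhomogE; rewrite cone_basisl dhomogX /= mdeg1.
  split.
    apply: boolp.contrapT => N; have z k : Th i k = 0.
      by apply/eqP/negPn/negP => nz; apply: N; exists (rshift 1 k); rewrite cone_basisr.
    have := cone_indep (g := fun i' => (i' == i)%:R) _ i; rewrite eqxx => /(_ _) H.
    have /eqP : (1 : S1) = 0; last by rewrite oner_eq0.
    apply: H => j'; rewrite big1 // => i' _; case: eqP => [->|_]; by rewrite ?z ?mulr0 ?mul0r.
  move=> k; apply/mhomogE; case: (split_ordP k) => k' ->; last by rewrite cone_basisr -dE.
  by rewrite ord1 cone_basisr rpred0.
- move=> th Hth.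
  have [q qE] : mdivides x0 (th (lshift l 0)).
    by rewrite -deriv_x0_form; apply: Hth; rewrite mem_head.
  (* The multiple of the Euler derivation with the same component along [x0] is removed; what
     remains kills [x0] and falls under [cone_span]. *)
  pose X j := th (rshift 1 j) - q * 'X_(rshift 1 j).
  have xE : x0 = 'X_(lshift l 0).
    rewrite [LHS]/linform big_split_ord /= big_ord1 /x0_form row_mxEl mxE scale1r big1 ?addr0 // => i _.
    by rewrite row_mxEr mxE scale0r.
  have [|g gE] := cone_span (X := X).
    move=> c cP; apply: (La_dvd (Pos_neq0 rs cP)) => k kK.
    have -> : dap c X = deriv_apply th (cone_form (c, k)) - q * linform (cone_form (c, k)).
      rewrite deriv_cone_form -[linform _]/(deriv_apply (fun j => 'X_j) (cone_form (c, k))).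
      rewrite deriv_cone_form dapB dapM qE -xE -!mul_mpolyC; ring.
    by apply: mdvdB; [apply: Hth; exact: memK|apply: mdvdMl; exact: mdvdr].
  pose G (j : 'I_(1 + l)) := match split j with inl _ => q | inr i => g i end.
  have Gl i : G (lshift l i) = q by rewrite /G -[lshift _ _]/(unsplit (inl _)) unsplitK.
  have Gr i : G (rshift 1 i) = g i by rewrite /G -[rshift _ _]/(unsplit (inr _)) unsplitK.
  exists G => i; rewrite big_split_ord /= big_ord1 Gl cone_basisl.
  under eq_bigr => j _ do rewrite Gr; case: (split_ordP i) => k ->.
    rewrite ord1 qE xE big1 ?addr0; first by rewrite mulrC.
    by move=> j _; rewrite cone_basisr mulr0.
  under eq_bigr => j _ do rewrite cone_basisr.
  by rewrite -gE /X addrC subrK.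
- move=> g g0 j; have gl : g (lshift l 0) = 0.
    have := g0 (lshift l 0); rewrite big_split_ord /= big_ord1 cone_basisl big1 ?addr0 => [/eqP|i _].
      by rewrite mulf_eq0 (negPf (mpolyXU_neq0 _)) orbF => /eqP.
    by rewrite cone_basisr mulr0.
  case: (split_ordP j) => i ->; first by rewrite ord1.
  move: i; apply: cone_indep => k; have := g0 (rshift 1 k); rewrite big_split_ord /= big_ord1 gl mul0r add0r.
  by under eq_bigr => i _ do rewrite cone_basisr.
Qed.

End ConeBasis.

Theorem mainTheorem12 (l : nat) (Phi : seq 'rV[R]_l) (Delta : 'M[R]_l) (h : nat)
  (Psi : seq 'rV[R]_l) (e : 'I_l -> nat) :
  root_system Phi -> irreducible_rs Phi -> simple_system Phi Delta ->
  is_coxeter_number Delta h ->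
  order_ideal (positive_roots Phi Delta) Delta Psi ->
  free_with_exponents Psi e ->
  forall m : nat,
    free_with_exponents (cone (A_Phi_Psi_m (positive_roots Phi Delta) Psi m))
      (cone_exponents e m h).
Proof.
move=> rs irr ss hc [sub idl] fr m.
(* In rank zero the only vector is zero, which is not a root, whereas irreducibility provides a
   root. *)
have l0 : (0 < l)%N.
  rewrite lt0n; apply/eqP => l0; case: irr => + _; case: (Phi) rs => // a s [_ + _ _ _] _.
  rewrite inE negb_or => /andP[/eqP a0 _]; apply: a0; apply/rowP => -[j jl].
  by exfalso; rewrite l0 in jl.
have PosE a : (a \in Pos Phi Delta) = (a \in positive_roots Phi Delta) by rewrite mem_undup.
have sPsi : {subset Psi <= Pos Phi Delta} by move=> a /sub; rewrite PosE.
have ideal a b : a \in Psi -> b \in Pos Phi Delta -> root_le Delta b a -> b \in Psi.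
  by rewrite PosE; exact: idl.
have count : (h * l = 2 * size (Pos Phi Delta))%N.
  by apply/eqP; rewrite eqn_leq (coxeter_number_le rs ss irr l0 hc) (coxeter_number_ge rs ss hc).
have [T [Tdvd Thom Tspan Tfree]] := multi_basis rs ss m (coxeter_Casimir rs ss irr l0 hc) count sPsi fr.
have Ex i := homog_lift rs ss ideal Tspan Tdvd Tfree (Thom i) (Tdvd i).
have [X XP] := boolp.choice Ex.
refine (cone_free rs sPsi Tspan Tfree Thom (Th := X) _ _ _ _) => //.
- by move=> i j; case: (XP i).
- by move=> i j; case: (XP i).
- by move=> i; case: (XP i).
Qed.
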